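(* Let $\beta\ge 0$, $T>0$, and let $x: I\times[0,T]\to\mathbb{R}^2$ be a solution of the continuous problem $$x_{tt}+\beta x_t=\frac{1}{|x_\rho|}\Bigl(\frac{x_\rho}{|x_\rho|}\Bigr)_\rho-(x_t\cdot\tau_t)\,\tau \ \text{ in } I\times(0,T],\qquad x(\cdot,0)=x_0,\quad x_t(\cdot,0)=\mathcal{V}_0\,\nu(\cdot,0)\ \text{ in } I,$$ such that $\partial_t^i\partial_\rho^j x$ exist and are continuous on $I\times[0,T]$ for all integers $i,j\ge 0$ with $2i+j\le 4$, and $|x_\rho|>0$ in $I\times[0,T]$. Then there exist $h_0>0$ and a constant $C>0$, independent of $h$, such that for all $h=\frac1J$ with $0<h\le h_0$ the semidiscrete problem of finding $x^h:\mathcal{G}^h\times[0,T]\to\mathbb{R}^2$ with $$\ddot x^h_j+\beta\dot x^h_j=\frac{2}{q^h_j+q^h_{j+1}}\,\frac{\tau^h_{j+1}-\tau^h_j}{h}-(\dot x^h_j\cdot\dot\theta^h_j)\,\theta^h_j\quad\text{in }[0,T],\quad j=1,\ldots,J,$$ $$x^h_j(0)=x_0(\rho_j),\qquad \dot x^h_j(0)=\mathcal{V}_0(\rho_j)\,\bigl(\theta^h_j(0)\bigr)^{\perp},\qquad j=1,\ldots,J,$$ has a unique solution $x^h:\mathcal{G}^h\times[0,T]\to\mathbb{R}^2$, and $$\max_{0\le t\le T}\bigl(\|x(t)-x^h(t)\|_{1,h}+\|\dot x(t)-\dot x^h(t)\|_{0,h}\bigr)\le C h^2 .$$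
   Context: $I=\mathbb{R}/\mathbb{Z}$ is the periodic unit interval. Subscripts $t,\rho$ denote partial derivatives. For $y\in\mathbb{R}^2$, $y^\perp$ is the anti-clockwise rotation of $y$ by $\frac{\pi}{2}$. For $x:I\times[0,T]\to\mathbb{R}^2$ with $|x_\rho|>0$, set $\tau=x_\rho/|x_\rho|$ and $\nu=\tau^\perp$. The initial data $x_0:I\to\mathbb{R}^2$ and $\mathcal{V}_0:I\to\mathbb{R}$ are given. Grid: for an integer $J\ge2$ let $h=\frac1J$, $\rho_j=jh$, $\mathcal{G}^h=\{\rho_1,\ldots,\rho_J\}\subset I$, with $\rho_0$ identified with $\rho_J$. For a grid function $v:\mathcal{G}^h\to\mathbb{R}^2$ write $v_j=v(\rho_j)$; all indices are understood periodically modulo $J$ (e.g. $v_0=v_J$, $v_{J+1}=v_1$). The backward difference quotient is $\delta v_j=\frac{v_j-v_{j-1}}{h}$. The discrete norms are $$\|v\|_{0,h}=\Bigl(h\sum_{j=1}^J|v_j|^2\Bigr)^{1/2},\qquad \|v\|_{1,h}=\Bigl(h\sum_{j=1}^J\bigl(|v_j|^2+|\delta v_j|^2\bigr)\Bigr)^{1/2}.$$ In the norms, $x(t)$ and $\dot x(t)$ denote the grid functions $\rho_j\mapsto x(\rho_j,t)$ and $\rho_j\mapsto x_t(\rho_j,t)$. A dot denotes the time derivative. For a discrete parameterization $x^h$: $q^h_j=|\delta x^h_j|$, $\tau^h_j=\frac{1}{q^h_j}\delta x^h_j$, and $\theta^h_j=\frac{\tau^h_j+\tau^h_{j+1}}{|\tau^h_j+\tau^h_{j+1}|}$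 provided $\tau^h_j+\tau^h_{j+1}\ne0$. Being a solution of the semidiscrete problem includes that these quantities are well defined (i.e. $q^h_j>0$ and $\tau^h_j+\tau^h_{j+1}\neq 0$ for all $j$) on the time interval considered. *)

(* Defs.v *)
From Stdlib Require Import Reals ZArith.
From Coquelicot Require Import Coquelicot.

Open Scope R_scope.

Definition dot (u v : R * R) : R := fst u * fst v + snd u * snd v.

Definition perp (u : R * R) : R * R := (- snd u, fst u).

(** Coquelicot's product norm on [R * R] is the Euclidean one,
    [sqrt (|y1|^2 + |y2|^2)], so [norm] is used for the length of vectors. *)
Definition normalize (u : R * R) : R * R := scal (/ norm u) u.

Definition Icc (a b : R) : R -> Prop := fun s => a <= s <= b.

(** Same as [is_derive], except that only points of [D] are used in the limit;
    with [D = Icc 0 T] this is the one-sided derivative at [0] and at [T]. *)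
Definition is_derive_on (D : R -> Prop) (f : R -> R * R) (t : R) (l : R * R)
  : Prop :=
  filterdiff f (within D (locally t)) (fun y => scal y l).

(** Functions on [R/Z] are represented by 1-periodic functions on [R]. *)
Definition periodic {U : Type} (f : R -> U) : Prop :=
  forall rho, f (rho + 1) = f rho.

(** [dx i j] is the partial derivative of order [i] in [t] of the partial
    derivative of order [j] in [rho] of [x]; only the indices with
    [2 * i + j <= m] and the times in [0, T] are constrained. *)
Record parabolic_partials (m : nat) (T : R) (x : R -> R -> R * R)
  (dx : nat -> nat -> R -> R -> R * R) : Prop := {
  partials_00 : forall rho t, Icc 0 T t -> dx 0%nat 0%nat rho t = x rho t;
  partials_rho : forall j rho t, (S j <= m)%nat -> Icc 0 T t ->
    is_derive (fun r => dx 0%nat j r t) rho (dx 0%nat (S j) rho t);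
  partials_t : forall i j rho t, (2 * S i + j <= m)%nat -> Icc 0 T t ->
    is_derive_on (Icc 0 T) (fun s => dx i j rho s) t (dx (S i) j rho t);
  partials_continuous : forall i j, (2 * i + j <= m)%nat ->
    continuous_on (fun p : R * R => Icc 0 T (snd p))
                  (fun p : R * R => dx i j (fst p) (snd p))
}.

(** [x_rho], [x_t], [x_tt] are meant to be the corresponding partial
    derivatives of [x]. *)
Record continuous_solution (beta T : R) (x0 : R -> R * R) (V0 : R -> R)
  (x x_rho x_t x_tt : R -> R -> R * R) : Prop := {
  cont_periodic : forall t, Icc 0 T t -> periodic (fun rho => x rho t);
  cont_equation : forall rho t, 0 < t <= T ->
    let tau r s := normalize (x_rho r s) in
    exists tau_rho tau_t : R * R,
      is_derive (fun r => tau r t) rho tau_rho /\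
      is_derive_on (Icc 0 T) (fun s => tau rho s) t tau_t /\
      plus (x_tt rho t) (scal beta (x_t rho t)) =
      minus (scal (/ norm (x_rho rho t)) tau_rho)
            (scal (dot (x_t rho t) tau_t) (tau rho t));
  cont_init_pos : forall rho, x rho 0 = x0 rho;
  cont_init_vel : forall rho,
    x_t rho 0 = scal (V0 rho) (perp (normalize (x_rho rho 0)))
}.

(** Grid functions on the grid with [J] points are represented by [J]-periodic
    functions on [Z], the value at [j] being the one at [rho_j = j * h]. *)
Definition grid_periodic (J : nat) (v : Z -> R * R) : Prop :=
  forall j, v (j + Z.of_nat J)%Z = v j.

Definition mesh (J : nat) : R := / INR J.

Definition node (J : nat) (j : Z) : R := IZR j * mesh J.

Definition delta (J : nat) (v : Z -> R * R) (j : Z) : R * R :=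
  scal (/ mesh J) (minus (v j) (v (j - 1)%Z)).

Definition norm_0h (J : nat) (v : Z -> R * R) : R :=
  sqrt (mesh J * sum_n_m (fun j => norm (v (Z.of_nat j)) ^ 2) 1 J).

Definition norm_1h (J : nat) (v : Z -> R * R) : R :=
  sqrt (mesh J * sum_n_m (fun j => norm (v (Z.of_nat j)) ^ 2 +
                                   norm (delta J v (Z.of_nat j)) ^ 2) 1 J).

Definition qh (J : nat) (v : Z -> R * R) (j : Z) : R := norm (delta J v j).

Definition tauh (J : nat) (v : Z -> R * R) (j : Z) : R * R :=
  scal (/ qh J v j) (delta J v j).

Definition thetah (J : nat) (v : Z -> R * R) (j : Z) : R * R :=
  normalize (plus (tauh J v j) (tauh J v (j + 1)%Z)).

Definition at_time (y : Z -> R -> R * R) (t : R) : Z -> R * R :=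
  fun j => y j t.

(** [vh] is the time derivative of [xh]. *)
Record semidiscrete_solution (beta T : R) (x0 : R -> R * R) (V0 : R -> R)
  (J : nat) (xh vh : Z -> R -> R * R) : Prop := {
  semi_periodic : forall t, Icc 0 T t -> grid_periodic J (at_time xh t);
  semi_velocity : forall j t, Icc 0 T t ->
    is_derive_on (Icc 0 T) (xh j) t (vh j t);
  semi_q_pos : forall j t, Icc 0 T t -> 0 < qh J (at_time xh t) j;
  semi_theta_def : forall j t, Icc 0 T t ->
    plus (tauh J (at_time xh t) j) (tauh J (at_time xh t) (j + 1)%Z) <> zero;
  semi_equation : forall j t, Icc 0 T t ->
    let q := qh J (at_time xh t) in
    let tau := tauh J (at_time xh t) in
    let theta s := thetah J (at_time xh s) j in
    exists acc theta_dot : R * R,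
      is_derive_on (Icc 0 T) (vh j) t acc /\
      is_derive_on (Icc 0 T) theta t theta_dot /\
      plus acc (scal beta (vh j t)) =
      minus (scal (2 / (q j + q (j + 1)%Z))
               (scal (/ mesh J) (minus (tau (j + 1)%Z) (tau j))))
            (scal (dot (vh j t) theta_dot) (theta t));
  semi_init_pos : forall j, xh j 0 = x0 (node J j);
  semi_init_vel : forall j,
    vh j 0 = scal (V0 (node J j)) (perp (thetah J (at_time xh 0) j))
}.

Definition nodal_error (J : nat) (y : R -> R -> R * R) (yh : Z -> R -> R * R)
  (t : R) : Z -> R * R :=
  fun j => minus (y (node J j) t) (yh j t).

(* Main.v *)
Require Import Defs.
From Stdlib Require Import Reals ZArith Lra Lia Classical.
From Coquelicot Require Import Coquelicot.

Open Scope R_scope.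

(** The last term of both equations of motion keeps the velocity normal to the
    curve: the tangential velocity satisfies a linear homogeneous differential
    equation and vanishes initially. The vertices of the discrete curve therefore
    move with velocities [V_j perp(theta_j)], and the second order equation
    becomes a first order system for the [V_j] and the edge vectors of the
    polygon, the latter written in polar form with lengths [q_j] and directions.
    If [a_j] is half the turning angle at the vertex [j], this system is
[[
      V_j' = - beta V_j + 4 / (q_j + q_(j+1)) * sin a_j / h
      q_j' = - (V_j sin a_j + V_(j-1) sin a_(j-1)) / h
      q_j * (angle of edge j)' = (V_j cos a_j - V_(j-1) cos a_(j-1)) / h
]]
    The direction of an edge of the discrete curve is recorded by the angle
    [psi_j] from it to the corresponding edge of the exact polygon, whose vertices
    are the values of [x] at the nodes. This avoids lifting angles, and makes the
    errors the unknowns from the beginning. See [psi_rate], [vel_rate] and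
    [len_rate] for the resulting equations.

    Consistency. With the reference values of [exact_reference] the exact solution
    satisfies the system up to [O(h^2)] ([exact_estimates]). The Taylor expansions
    are organized around one fact: two vectors symmetric about a third up to
    [O(h^2)], and at a distance [O(h)] from it, have the mean length of the third
    up to [O(h^2)] ([pair_length_sum]). It applies to the secants at a node and to
    the tangents at the ends of a cell.

    Stability. The errors [W] of the velocities and [psi] of the directions form a
    discrete wave equation. In the energy [q W^2 + q psi^2] their coupling cancels
    after summation by parts, because the derivative of the sine is the cosine.
    The error of the lengths is different: its rate contains a difference quotient
    of [psi], which the energy does not control. But by the velocity equation
    this difference quotient is, up to harmless terms, the time derivative of [W],
    so that a multiple of [W] added to the length error removes it
    ([corrected_len]). The energy completed by the square of this corrected error
    satisfies a Gronwall inequality ([energy_rate], [energy_growth]) as long as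
    the state remains near the reference. Since the sum of the squared errors is
    then [O(h^3)], all of them are too small, for small [h], to leave that
    neighbourhood ([stability]).

    Existence and uniqueness. Truncated outside the neighbourhood, the system has a
    bounded and globally Lipschitz continuous right-hand side and thus exactly one
    solution on [0, T] ([state_path_exists], [state_path_unique]), which by
    stability never meets the truncation. Integrating the velocities turns it into
    a solution of the semidiscrete problem ([built_curve_solution]). Conversely
    the polar variables of any solution of that problem solve the system while
    they are near the reference ([polar_state_path]), remain there by stability,
    and hence are the ones already found.

    The error bound follows by translating the bound on the sum of the squares of
    [W], [psi] and the length errors back to velocities, edges and positions
    ([velocity_error], [secant_error], [position_error]); multiplied by [h] it is
    [O(h^4)], the square of the rate claimed. *)

(** * Calculus on a time interval *)

Lemma continuous_eps (f : R -> R) t :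
  continuous f t <->
  forall eps, 0 < eps -> exists d, 0 < d /\
    forall s, Rabs (s - t) < d -> Rabs (f s - f t) < eps.
Proof.
  split.
  - intros H eps He.
    destruct (proj1 (filterlim_locally f (f t)) H (mkposreal eps He)) as [d Hd].
    exists d; split; [apply cond_pos|].
    intros s Hs; apply (Hd s Hs).
  - intros H; apply filterlim_locally; intros eps.
    destruct (H eps (cond_pos eps)) as [d [Hd0 Hd]].
    exists (mkposreal d Hd0); intros s Hs; apply (Hd s Hs).
Qed.

Lemma is_derive_eps (f : R -> R) t l :
  is_derive f t l <->
  forall eps, 0 < eps -> exists d, 0 < d /\
    forall s, Rabs (s - t) < d ->
      Rabs (f s - f t - l * (s - t)) <= eps * Rabs (s - t).
Proof.
  split.
  - intros [_ H] eps He.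
    assert (Hl : is_filter_lim (locally t) t) by (intros P HP; exact HP).
    destruct (H t Hl (mkposreal eps He)) as [d Hd].
    exists d; split; [apply cond_pos|].
    intros s Hs; specialize (Hd s Hs).
    unfold norm, minus, plus, opp, scal, mult in Hd; simpl in Hd;
      unfold abs, plus, opp, scal, mult in Hd; simpl in Hd.
    unfold mult in Hd; simpl in Hd.
    replace (f s - f t - l * (s - t)) with (f s + - f t + - ((s + - t) * l))
      by ring.
    exact Hd.
  - intros H; split; [apply is_linear_scal_l|].
    intros y Hy eps.
    replace y with t in *
      by (apply (is_filter_lim_locally_unique t y); exact Hy).
    destruct (H eps (cond_pos eps)) as [d [Hd0 Hd]].
    exists (mkposreal d Hd0); intros s Hs; specialize (Hd s Hs).
    unfold norm, minus, plus, opp, scal, mult; simpl;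
      unfold abs, plus, opp, scal, mult; simpl.
    unfold mult; simpl.
    replace (f s + - f t + - ((s + - t) * l)) with (f s - f t - l * (s - t))
      by ring.
    exact Hd.
Qed.

Lemma is_derive_eq (f : R -> R) t (l l' : R) :
  is_derive f t l -> l = l' -> is_derive f t l'.
Proof. now intros H <-. Qed.

Lemma is_derive_Rext (f g : R -> R) (t l : R) :
  (forall s : R, f s = g s) -> is_derive f t l -> is_derive g t l.
Proof. intros; now apply is_derive_ext with f. Qed.

Lemma is_derive_near (f g : R -> R) a b t l :
  a < t < b -> (forall s, a < s < b -> f s = g s) ->
  is_derive f t l -> is_derive g t l.
Proof.
  intros Ht He; apply is_derive_ext_loc.
  assert (Hd : 0 < Rmin (t - a) (b - t)) by (apply Rmin_case; lra).
  exists (mkposreal _ Hd); intros s Hs.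
  unfold ball in Hs; simpl in Hs; unfold AbsRing_ball, abs, minus, plus, opp in Hs;
    simpl in Hs.
  apply He.
  generalize (Rmin_l (t - a) (b - t)) (Rmin_r (t - a) (b - t)).
  apply Rabs_lt_between in Hs; lra.
Qed.

(** The rules of calculus with the operations of [R] in place of those of an
    abstract normed module, so that [ring] applies to the derivatives. *)
Lemma is_derive_Rplus (f g : R -> R) t a b :
  is_derive f t a -> is_derive g t b ->
  is_derive (fun s => f s + g s) t (a + b).
Proof. intros; now apply (is_derive_plus f g). Qed.

Lemma is_derive_Rminus (f g : R -> R) t a b :
  is_derive f t a -> is_derive g t b ->
  is_derive (fun s => f s - g s) t (a - b).
Proof. intros; now apply (is_derive_minus f g). Qed.

Lemma is_derive_Ropp (f : R -> R) t a :
  is_derive f t a -> is_derive (fun s => - f s) t (- a).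
Proof. intros; now apply (is_derive_opp f). Qed.

Lemma is_derive_Rmult (f g : R -> R) t a b :
  is_derive f t a -> is_derive g t b ->
  is_derive (fun s => f s * g s) t (a * g t + f t * b).
Proof. intros; apply (is_derive_mult f g); auto; intros; apply Rmult_comm. Qed.

Lemma is_derive_Rconst (c t : R) : is_derive (fun _ => c) t 0.
Proof. apply (is_derive_const (V := R_NormedModule)). Qed.

Lemma is_derive_Rdiv (f g : R -> R) t a b :
  is_derive f t a -> is_derive g t b -> g t <> 0 ->
  is_derive (fun s => f s / g s) t ((a * g t - f t * b) / (g t) ^ 2).
Proof. intros; now apply is_derive_div. Qed.

Lemma is_derive_Rcomp (F f : R -> R) t a b :
  is_derive F (f t) b -> is_derive f t a ->
  is_derive (fun s => F (f s)) t (a * b).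
Proof. intros; now apply (is_derive_comp F f). Qed.

Lemma is_derive_Rsqrt (f : R -> R) t a :
  is_derive f t a -> 0 < f t ->
  is_derive (fun s => sqrt (f s)) t (a / (2 * sqrt (f t))).
Proof.
  intros Hf Hp; eapply is_derive_eq.
  - apply (is_derive_Rcomp sqrt f t a (/ (2 * sqrt (f t)))); trivial.
    now apply is_derive_sqrt_pt || (apply is_derive_Reals; now apply derivable_pt_lim_sqrt).
  - reflexivity.
Qed.

Lemma is_derive_Rcos (f : R -> R) t a :
  is_derive f t a -> is_derive (fun s => cos (f s)) t (a * - sin (f t)).
Proof.
  intros; apply (is_derive_Rcomp cos f); trivial.
  apply is_derive_Reals, derivable_pt_lim_cos.
Qed.

Lemma is_derive_Rsin (f : R -> R) t a :
  is_derive f t a -> is_derive (fun s => sin (f s)) t (a * cos (f t)).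
Proof.
  intros; apply (is_derive_Rcomp sin f); trivial.
  apply is_derive_Reals, derivable_pt_lim_sin.
Qed.

Lemma is_derive_cont (f : R -> R) t l : is_derive f t l -> continuous f t.
Proof. intros H; apply (ex_derive_continuous (V := R_NormedModule)); now exists l. Qed.

Lemma is_derive_Rid (t : R) : is_derive (fun s => s) t 1.
Proof. apply (is_derive_id (K := R_AbsRing)). Qed.

Ltac derive_step :=
  first [ eassumption |
  lazymatch goal with
  | |- is_derive (fun s => s) _ _ => apply is_derive_Rid
  | |- is_derive sin _ _ => apply is_derive_Reals, derivable_pt_lim_sin
  | |- is_derive cos _ _ => apply is_derive_Reals, derivable_pt_lim_cos
  | |- is_derive (fun _ => ?c) _ _ => apply is_derive_Rconst
  | |- is_derive (fun s => _ + _) _ _ => apply is_derive_Rplus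
  | |- is_derive (fun s => _ - _) _ _ => apply is_derive_Rminus
  | |- is_derive (fun s => - _) _ _ => apply is_derive_Ropp
  | |- is_derive (fun s => _ * _) _ _ => apply is_derive_Rmult
  | |- is_derive (fun s => cos _) _ _ => apply is_derive_Rcos
  | |- is_derive (fun s => sin _) _ _ => apply is_derive_Rsin
  | |- is_derive (fun s => _ / _) _ _ => apply is_derive_Rdiv
  | |- is_derive (fun s => sqrt _) _ _ => apply is_derive_Rsqrt
  end ].

Lemma continuous_Rplus (f g : R -> R) t :
  continuous f t -> continuous g t -> continuous (fun s => f s + g s) t.
Proof. intros; now apply (continuous_plus f g). Qed.

Lemma continuous_Rminus (f g : R -> R) t :
  continuous f t -> continuous g t -> continuous (fun s => f s - g s) t.
Proof. intros; now apply (continuous_minus f g). Qed.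

Lemma continuous_Ropp (f : R -> R) t :
  continuous f t -> continuous (fun s => - f s) t.
Proof. intros; now apply (continuous_opp f). Qed.

Lemma continuous_Rmult (f g : R -> R) t :
  continuous f t -> continuous g t -> continuous (fun s => f s * g s) t.
Proof. intros; now apply (continuous_mult f g). Qed.

Lemma continuous_Rcomp (F f : R -> R) t :
  continuous F (f t) -> continuous f t -> continuous (fun s => F (f s)) t.
Proof. intros; now apply (continuous_comp f F). Qed.

Lemma continuous_Rinv_comp (f : R -> R) t :
  continuous f t -> f t <> 0 -> continuous (fun s => / f s) t.
Proof. intros; apply (continuous_Rcomp Rinv f); trivial; now apply continuous_Rinv. Qed.

Lemma continuous_Rdiv (f g : R -> R) t :
  continuous f t -> continuous g t -> g t <> 0 ->
  continuous (fun s => f s / g s) t.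
Proof. intros; apply continuous_Rmult; trivial; now apply continuous_Rinv_comp. Qed.

Lemma continuous_Rpow (f : R -> R) n t :
  continuous f t -> continuous (fun s => f s ^ n) t.
Proof.
  intros H; induction n as [|n IH]; simpl; [apply continuous_const|].
  now apply continuous_Rmult.
Qed.

Lemma continuous_Rcos (f : R -> R) t :
  continuous f t -> continuous (fun s => cos (f s)) t.
Proof. intros; apply (continuous_Rcomp cos f); trivial; apply continuous_cos. Qed.

Lemma continuous_Rsin (f : R -> R) t :
  continuous f t -> continuous (fun s => sin (f s)) t.
Proof. intros; apply (continuous_Rcomp sin f); trivial; apply continuous_sin. Qed.

Lemma continuous_Rsqrt (f : R -> R) t :
  continuous f t -> continuous (fun s => sqrt (f s)) t.
Proof. intros; apply (continuous_Rcomp sqrt f); trivial; apply continuous_sqrt. Qed.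

Lemma continuous_Rabs_comp (f : R -> R) t :
  continuous f t -> continuous (fun s => Rabs (f s)) t.
Proof. intros; apply (continuous_Rcomp Rabs f); trivial; apply continuous_Rabs. Qed.

Lemma continuous_Rconst (c t : R) : continuous (fun _ => c) t.
Proof. apply continuous_const. Qed.

Ltac cont_step :=
  first [ eassumption |
  lazymatch goal with
  | |- continuous (fun s => s) _ => apply continuous_id
  | |- continuous sin _ => apply continuous_sin
  | |- continuous cos _ => apply continuous_cos
  | |- continuous (fun _ => ?c) _ => apply continuous_Rconst
  | |- continuous (fun s => _ + _) _ => apply continuous_Rplus
  | |- continuous (fun s => _ - _) _ => apply continuous_Rminus
  | |- continuous (fun s => - _) _ => apply continuous_Ropp
  | |- continuous (fun s => _ * _) _ => apply continuous_Rmult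
  | |- continuous (fun s => cos _) _ => apply continuous_Rcos
  | |- continuous (fun s => sin _) _ => apply continuous_Rsin
  | |- continuous (fun s => _ / _) _ => apply continuous_Rdiv
  | |- continuous (fun s => / _) _ => apply continuous_Rinv_comp
  | |- continuous (fun s => _ ^ _) _ => apply continuous_Rpow
  | |- continuous (fun s => sqrt _) _ => apply continuous_Rsqrt
  | |- continuous (fun s => Rabs _) _ => apply continuous_Rabs_comp
  end ].

(** A function known on [0, T] only is composed with this projection to become
    continuous on the whole line, so that continuity up to the end points needs no
    one-sided notion. *)
Definition clamp (T t : R) : R := Rmax 0 (Rmin t T).

Lemma clamp_id T t : 0 <= t <= T -> clamp T t = t.
Proof.
  intros; unfold clamp; rewrite Rmin_left by lra; now apply Rmax_right.
Qed.

Lemma clamp_Icc T t : 0 <= T -> 0 <= clamp T t <= T.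
Proof.
  intros; unfold clamp; split; [apply Rmax_l|].
  apply Rmax_lub; [lra|apply Rmin_r].
Qed.

Lemma clamp_lip T s t : Rabs (clamp T s - clamp T t) <= Rabs (s - t).
Proof.
  unfold clamp; apply Rabs_le_between; revert s t.
  assert (H : forall s t,
    Rmax 0 (Rmin s T) - Rmax 0 (Rmin t T) <= Rabs (s - t)).
  { intros s t; generalize (Rle_abs (s - t)) (Rabs_pos (s - t)); intros.
    unfold Rmax, Rmin; destruct (Rle_dec s T), (Rle_dec t T);
    repeat (match goal with |- context [Rle_dec 0 ?b] => destruct (Rle_dec 0 b) end);
    lra. }
  intros s t; generalize (H s t) (H t s); rewrite (Rabs_minus_sym t s); lra.
Qed.

Lemma continuous_clamp T t : continuous (clamp T) t.
Proof.
  apply continuous_eps; intros e He; exists e; split; trivial.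
  intros s Hs; apply Rle_lt_trans with (2 := Hs), clamp_lip.
Qed.

Lemma mvt_open (f df : R -> R) a b :
  a < b -> (forall t, a <= t <= b -> continuous f t) ->
  (forall t, a < t < b -> is_derive f t (df t)) ->
  exists c, a < c < b /\ f b - f a = df c * (b - a).
Proof.
  intros Hab Hc Hd.
  assert (pr1 : forall c, a < c < b -> derivable_pt f c).
  { intros c H; exists (df c); apply is_derive_Reals; auto. }
  assert (pr2 : forall c, a < c < b -> derivable_pt id c).
  { intros; apply derivable_pt_id. }
  destruct (MVT f id a b pr1 pr2 Hab) as [c [P E]].
  - intros c H; apply continuity_pt_filterlim; now apply Hc.
  - intros c _; apply derivable_continuous_pt, derivable_pt_id.
  - exists c; split; trivial.
    assert (E1 : derive_pt f c (pr1 c P) = df c).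
    { apply derive_pt_eq_0, is_derive_Reals; auto. }
    assert (E2 : derive_pt id c (pr2 c P) = 1).
    { apply derive_pt_eq_0, derivable_pt_lim_id. }
    rewrite E1, E2 in E; unfold id in E; lra.
Qed.

Lemma decreasing_of_derive (f df : R -> R) a b :
  a <= b -> (forall t, a <= t <= b -> continuous f t) ->
  (forall t, a < t < b -> is_derive f t (df t)) ->
  (forall t, a < t < b -> df t <= 0) -> f b <= f a.
Proof.
  intros [Hab| <-] Hc Hd Hn; [|lra].
  destruct (mvt_open f df a b Hab Hc Hd) as [c [Hcc E]].
  specialize (Hn c Hcc); nra.
Qed.

Lemma lipschitz_of_derive (f df : R -> R) K a b :
  a <= b -> (forall t, a <= t <= b -> continuous f t) ->
  (forall t, a < t < b -> is_derive f t (df t)) ->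
  (forall t, a < t < b -> Rabs (df t) <= K) -> Rabs (f b - f a) <= K * (b - a).
Proof.
  intros [Hab| <-] Hc Hd Hn.
  - destruct (mvt_open f df a b Hab Hc Hd) as [c [Hcc E]].
    rewrite E, Rabs_mult, (Rabs_right (b - a)) by lra.
    apply Rmult_le_compat_r; [lra|auto].
  - replace (f a - f a) with 0 by ring; rewrite Rabs_R0; lra.
Qed.

Lemma constant_of_derive (f : R -> R) a b :
  a <= b -> (forall t, a <= t <= b -> continuous f t) ->
  (forall t, a < t < b -> is_derive f t 0) -> f b = f a.
Proof.
  intros Hab Hc Hd.
  generalize (lipschitz_of_derive f (fun _ => 0) 0 a b Hab Hc Hd).
  rewrite Rmult_0_l; intros H.
  assert (H0 : Rabs (f b - f a) <= 0) by (apply H; intros; rewrite Rabs_R0; lra).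
  generalize (Rabs_pos (f b - f a)); intros.
  destruct (Req_dec (f b - f a) 0); [lra|].
  generalize (Rabs_pos_lt _ H2); lra.
Qed.

Lemma is_derive_exp_scal (k t : R) :
  is_derive (fun s => exp (k * s)) t (k * exp (k * t)).
Proof.
  eapply is_derive_eq.
  - apply (is_derive_Rcomp exp (fun s => k * s)).
    + apply is_derive_Reals, derivable_pt_lim_exp.
    + apply is_derive_Rmult; [apply is_derive_Rconst|apply is_derive_Rid].
  - cbv beta; ring.
Qed.

Lemma gronwall (f df : R -> R) K B T :
  0 <= K -> 0 <= B -> 0 <= T ->
  (forall t, 0 <= t <= T -> continuous f t) ->
  (forall t, 0 < t < T -> is_derive f t (df t)) ->
  (forall t, 0 < t < T -> df t <= K * f t + B) ->
  f T <= (f 0 + B * T) * exp (K * T).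
Proof.
  intros HK HB HT Hc Hd Hle.
  (* [exp (- K t) * f t - B * t] decreases, because [exp (- K t) <= 1] *)
  assert (H : exp (- K * T) * f T - B * T <= exp (- K * 0) * f 0 - B * 0).
  { apply (decreasing_of_derive (fun t => exp (- K * t) * f t - B * t)
      (fun t => (- K * exp (- K * t)) * f t + exp (- K * t) * df t - B) 0 T HT).
    - intros t Ht.
      apply continuous_Rminus; apply continuous_Rmult; auto.
      + eapply is_derive_cont, is_derive_exp_scal.
      + apply continuous_const.
      + apply continuous_id.
    - intros t Ht; eapply is_derive_eq.
      + apply is_derive_Rminus; apply is_derive_Rmult; auto.
        * apply is_derive_exp_scal.
        * apply is_derive_Rconst.
        * apply is_derive_Rid.
      + cbv beta; ring.
    - intros t Ht; specialize (Hle t Ht).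
      assert (He : 0 < exp (- K * t)) by apply exp_pos.
      assert (He1 : exp (- K * t) <= 1).
      { rewrite <- exp_0; destruct (Req_dec (K * t) 0) as [E|E].
        - replace (- K * t) with 0 by lra; lra.
        - left; apply exp_increasing; nra. }
      nra. }
  rewrite Rmult_0_r, exp_0 in H.
  replace (- K * T) with (- (K * T)) in H by ring.
  rewrite exp_Ropp in H.
  assert (He : 0 < exp (K * T)) by apply exp_pos.
  apply (Rmult_le_reg_l (/ exp (K * T))); [now apply Rinv_0_lt_compat|].
  replace (/ exp (K * T) * ((f 0 + B * T) * exp (K * T))) with (f 0 + B * T)
    by (field; lra).
  lra.
Qed.

(** Continuation principle. The strict inequality extends by continuity a little
    beyond any time up to which the bound holds; hence the supremum of these
    times is the end of the interval. *)
Lemma no_first_exit (g : R -> R) b T :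
  0 <= T -> (forall t, continuous g t) -> g 0 <= b ->
  (forall t, 0 <= t <= T -> (forall s, 0 <= s <= t -> g s <= b) -> g t < b) ->
  forall t, 0 <= t <= T -> g t <= b.
Proof.
  intros HT Hc H0 Hstep t1 Ht1.
  apply Rnot_lt_le; intros Hlt.
  set (A := fun t => 0 <= t <= t1 /\ forall s, 0 <= s <= t -> g s <= b).
  assert (HA0 : A 0).
  { split; [lra|]; intros s Hs; now replace s with 0 by lra. }
  destruct (completeness A) as [m [Hub Hlub]].
  { exists t1; intros t [Ht _]; lra. }
  { now exists 0. }
  assert (Hm : 0 <= m <= t1).
  { split; [now apply Hub|]. apply Hlub; intros t [Ht _]; lra. }
  assert (Hbelow : forall s, 0 <= s < m -> g s <= b).
  { intros s Hs.
    destruct (classic (exists t, A t /\ s < t)) as [[t [[_ Ht] Hst]]|Hn].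
    - apply Ht; lra.
    - exfalso; assert (m <= s); [|lra].
      apply Hlub; intros t Ht; apply Rnot_lt_le; intros Hst.
      apply Hn; now exists t. }
  assert (Hgm : g m <= b).
  { apply Rnot_lt_le; intros Hgt.
    destruct (proj1 (continuous_eps g m) (Hc m) (g m - b)) as [d [Hd Hcl]]; [lra|].
    destruct (Req_dec m 0) as [E|E]; [subst m; lra|].
    set (s := Rmax 0 (m - d / 2)).
    assert (Hs : 0 <= s < m /\ m - d / 2 <= s).
    { unfold s; repeat split; [apply Rmax_l| apply Rmax_lub_lt; lra|apply Rmax_r]. }
    specialize (Hcl s); rewrite Rabs_left in Hcl by lra.
    specialize (Hcl ltac:(lra)); apply Rabs_lt_between in Hcl.
    specialize (Hbelow s (proj1 Hs)); lra. }
  assert (Hall : forall s, 0 <= s <= m -> g s <= b).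
  { intros s Hs; destruct (Req_dec s m) as [->|]; trivial; apply Hbelow; lra. }
  assert (Hgs : g m < b) by (apply Hstep; trivial; lra).
  destruct (proj1 (continuous_eps g m) (Hc m) (b - g m)) as [d [Hd Hcl]]; [lra|].
  assert (Hmt : m < t1).
  { destruct (Req_dec m t1) as [E|]; [subst m|]; lra. }
  set (r := Rmin t1 (m + d / 2)).
  assert (Hr : m < r /\ r <= t1 /\ r <= m + d / 2).
  { unfold r; repeat split; [apply Rmin_glb_lt; lra|apply Rmin_l|apply Rmin_r]. }
  assert (Ar : A r).
  { split; [lra|]; intros s Hs.
    destruct (Rle_dec s m); [apply Hall; lra|].
    specialize (Hcl s); rewrite Rabs_right in Hcl by lra.
    specialize (Hcl ltac:(lra)); apply Rabs_lt_between in Hcl; lra. }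
  generalize (Hub r Ar); lra.
Qed.

(** * Ordinary differential equations with a globally Lipschitz right-hand side *)

(** In the norm weighted by [exp (2 L t)] an integration in time gains the factor
    [1 / 2], so that the Picard map is a contraction on the whole interval. *)
Lemma growth_bound (w dw : R -> R) L K T :
  0 <= K -> (forall t, continuous w t) -> w 0 = 0 ->
  (forall t, 0 < t < T -> is_derive w t (dw t)) ->
  (forall t, 0 < t < T -> Rabs (dw t) <= L * K * exp (2 * L * t)) ->
  forall t, 0 <= t <= T -> Rabs (w t) <= K / 2 * exp (2 * L * t).
Proof.
  intros HK Hc H0 Hd Hb t Ht.
  assert (He : forall s, is_derive (fun r => K / 2 * exp (2 * L * r)) s
                           (L * K * exp (2 * L * s))).
  { intros s; eapply is_derive_eq.
    - apply is_derive_Rmult; [apply is_derive_Rconst|apply is_derive_exp_scal].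
    - cbv beta; field. }
  assert (Hup : w t - K / 2 * exp (2 * L * t) <= w 0 - K / 2 * exp (2 * L * 0)).
  { apply (decreasing_of_derive (fun t => w t - K / 2 * exp (2 * L * t))
             (fun t => dw t - L * K * exp (2 * L * t)) 0 t); [lra| | |].
    - intros s _; apply continuous_Rminus; auto; eapply is_derive_cont, He.
    - intros s Hs; apply is_derive_Rminus; auto; apply Hd; lra.
    - intros s Hs; specialize (Hb s ltac:(lra)); apply Rabs_le_between in Hb; lra. }
  assert (Hlo : - w t - K / 2 * exp (2 * L * t) <= - w 0 - K / 2 * exp (2 * L * 0)).
  { apply (decreasing_of_derive (fun t => - w t - K / 2 * exp (2 * L * t))
             (fun t => - dw t - L * K * exp (2 * L * t)) 0 t); [lra| | |].
    - intros s _; apply continuous_Rminus; [now apply continuous_Ropp|].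
      eapply is_derive_cont, He.
    - intros s Hs; apply is_derive_Rminus; auto; apply is_derive_Ropp, Hd; lra.
    - intros s Hs; specialize (Hb s ltac:(lra)); apply Rabs_le_between in Hb; lra. }
  rewrite Rmult_0_r, exp_0, H0 in *.
  apply Rabs_le_between; lra.
Qed.

Lemma Rle_of_halves x y K : (forall n, x <= y + K * (/ 2) ^ n) -> x <= y.
Proof.
  intros H; apply Rnot_lt_le; intros Hlt.
  destruct (Rle_dec K 0) as [HK|HK].
  - specialize (H O); simpl in H; lra.
  - destruct (pow_lt_1_zero (/ 2) ltac:(rewrite Rabs_right; lra) ((x - y) / K))
      as [n Hn]; [apply Rdiv_lt_0_compat; lra|].
    specialize (Hn n (le_n n)); specialize (H n).
    rewrite Rabs_right in Hn by (apply Rle_ge, pow_le; lra).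
    apply (Rmult_lt_compat_l K) in Hn; [|lra].
    replace (K * ((x - y) / K)) with (x - y) in Hn by (field; lra); lra.
Qed.

Lemma exp_ge_1 x : 0 <= x -> 1 <= exp x.
Proof.
  intros [H| <-]; [|rewrite exp_0; lra].
  rewrite <- exp_0; left; now apply exp_increasing.
Qed.

(** The unknowns are indexed by an arbitrary type and compared in the sup
    norm; an index type with a shift then provides periodic grid functions. *)
Definition sup_lipschitz {A : Type} (L : R) (f : R -> (A -> R) -> A -> R) : Prop :=
  forall t u v d, (forall a, Rabs (u a - v a) <= d) ->
    forall a, Rabs (f t u a - f t v a) <= L * d.

Definition solves {A : Type} (T : R) (f : R -> (A -> R) -> A -> R)
  (u : A -> R -> R) : Prop :=
  forall a t, 0 < t < T -> is_derive (u a) t (f t (fun b => u b t) a).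

(** The distance of two solutions is halved, in the weighted norm, each time it
    is inserted in the equation. The a priori bound [D] starts the iteration: for
    infinitely many unknowns the distance could be infinite. *)
Lemma ode_unique {A : Type} (f : R -> (A -> R) -> A -> R) L D T u v :
  0 <= D -> 0 <= L -> sup_lipschitz L f ->
  (forall a t, continuous (u a) t) -> (forall a t, continuous (v a) t) ->
  (forall a, u a 0 = v a 0) -> solves T f u -> solves T f v ->
  (forall a t, 0 <= t <= T -> Rabs (u a t - v a t) <= D) ->
  forall a t, 0 <= t <= T -> u a t = v a t.
Proof.
  intros HD HL Hlip Hcu Hcv H0 Hu Hv HB a t Ht.
  assert (H : forall n a t, 0 <= t <= T ->
             Rabs (u a t - v a t) <= D * (/ 2) ^ n * exp (2 * L * t)).
  { induction n as [|n IH]; intros b s Hs.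
    - simpl; rewrite Rmult_1_r.
      apply Rle_trans with (1 := HB b s Hs).
      rewrite <- (Rmult_1_r D) at 1; apply Rmult_le_compat_l; trivial.
      apply exp_ge_1; nra.
    - replace (D * (/ 2) ^ S n) with ((D * (/ 2) ^ n) / 2) by (simpl; field).
      apply (growth_bound (fun t => u b t - v b t)
        (fun t => f t (fun b => u b t) b - f t (fun b => v b t) b) L _ T);
        trivial.
      + apply Rmult_le_pos; trivial; apply pow_le; lra.
      + intros r; now apply continuous_Rminus.
      + rewrite H0; ring.
      + intros r Hr; apply is_derive_Rminus; auto.
      + intros r Hr; rewrite Rmult_assoc.
        apply Hlip; intros c; apply IH; lra. }
  apply Rminus_diag_uniq.
  assert (Hz : Rabs (u a t - v a t) <= 0).
  { apply (Rle_of_halves _ _ (D * exp (2 * L * t))); intros n.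
    specialize (H n a t Ht); lra. }
  generalize (Rabs_pos (u a t - v a t)); intros.
  destruct (Req_dec (u a t - v a t) 0) as [|Hne]; trivial.
  generalize (Rabs_pos_lt _ Hne); lra.
Qed.

Lemma ex_RInt_cont (g : R -> R) a b : (forall t, continuous g t) -> ex_RInt g a b.
Proof. intros H; apply (ex_RInt_continuous (V := R_CompleteNormedModule)); auto. Qed.

Lemma is_derive_primitive (g : R -> R) c t :
  (forall s, continuous g s) -> is_derive (fun r => c + RInt g 0 r) t (g t).
Proof.
  intros H; eapply is_derive_eq.
  - apply is_derive_Rplus; [apply is_derive_Rconst|].
    apply (is_derive_RInt g (fun r => RInt g 0 r) 0); trivial.
    apply filter_forall; intros r.
    apply (RInt_correct (V := R_CompleteNormedModule)), ex_RInt_cont; trivial.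
  - ring.
Qed.

Fixpoint picard_iterate {A : Type} (T : R) (f : R -> (A -> R) -> A -> R)
  (u0 : A -> R) (n : nat) : A -> R -> R :=
  match n with
  | O => fun a _ => u0 a
  | S m => fun a t =>
      u0 a + RInt (fun s => f s (fun b => picard_iterate T f u0 m b s) a) 0 (clamp T t)
  end.

(** Picard iteration. The iterates are frozen outside [0, T], which makes all the
    estimates hold at all times. *)
Lemma ode_exists {A : Type} (f : R -> (A -> R) -> A -> R) (u0 : A -> R) L M T :
  0 <= T -> 0 <= L -> 0 <= M -> sup_lipschitz L f ->
  (forall t u a, Rabs (f t u a) <= M) ->
  (forall u : A -> R -> R, (forall a t, continuous (u a) t) ->
     forall a t, continuous (fun s => f s (fun b => u b s) a) t) ->
  exists u : A -> R -> R,
    (forall a, u a 0 = u0 a) /\ (forall a t, continuous (u a) t) /\ solves T f u.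
Proof.
  intros HT HL HM Hlip Hbd Hcont.
  set (U := picard_iterate T f u0).
  assert (Hcd : forall t, clamp T (clamp T t) = clamp T t).
  { intros t; apply clamp_id, clamp_Icc; trivial. }
  assert (HUc : forall n a t, continuous (U n a) t).
  { induction n as [|n IH]; intros a t; [apply continuous_Rconst|].
    unfold U; simpl; fold (U n).
    apply (continuous_Rcomp (fun r => u0 a + RInt _ 0 r) (clamp T));
      [|apply continuous_clamp].
    eapply is_derive_cont, is_derive_primitive.
    intros s; now apply Hcont. }
  assert (HU0 : forall n a, U n a 0 = u0 a).
  { destruct n; intros a; trivial.
    unfold U; simpl; rewrite clamp_id by lra.
    rewrite (RInt_point (V := R_CompleteNormedModule)); unfold zero; simpl; ring. }
  assert (HUd : forall n a t, 0 < t < T ->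
            is_derive (U (S n) a) t (f t (fun b => U n b t) a)).
  { intros n a t Ht; unfold U; simpl; fold (U n).
    apply (is_derive_near (fun r => u0 a + RInt (fun s => f s (fun b => U n b s) a) 0 r)
             _ 0 T); trivial.
    - intros s Hs; now rewrite clamp_id by lra.
    - apply (is_derive_primitive (fun s => f s (fun b => U n b s) a)).
      intros s; now apply Hcont. }
  assert (HUclamp : forall n a t, U n a (clamp T t) = U n a t).
  { destruct n; intros; unfold U; simpl; trivial; now rewrite Hcd. }
  set (K := M * T).
  assert (HK : 0 <= K) by (now apply Rmult_le_pos).
  assert (Hstep : forall n a t, 0 <= t <= T ->
            Rabs (U (S n) a t - U n a t) <= K * (/ 2) ^ n * exp (2 * L * t)).
  { induction n as [|n IH]; intros a t Ht.
    - simpl pow; rewrite Rmult_1_r.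
      apply Rle_trans with K.
      + replace (U 0%nat a t) with (U 1%nat a 0) by apply HU0.
        apply Rle_trans with (M * (t - 0)).
        * apply (lipschitz_of_derive (U 1%nat a) (fun s => f s (fun b => U 0%nat b s) a));
            [lra|auto| |auto].
          intros s Hs; apply HUd; lra.
        * unfold K; apply Rmult_le_compat_l; lra.
      + rewrite <- (Rmult_1_r K) at 1; apply Rmult_le_compat_l; trivial.
        apply exp_ge_1; nra.
    - replace (K * (/ 2) ^ S n) with ((K * (/ 2) ^ n) / 2) by (simpl; field).
      apply (growth_bound (fun t => U (S (S n)) a t - U (S n) a t)
        (fun t => f t (fun b => U (S n) b t) a - f t (fun b => U n b t) a) L _ T);
        trivial.
      + apply Rmult_le_pos; trivial; apply pow_le; lra.
      + intros r; now apply continuous_Rminus.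
      + rewrite !HU0; ring.
      + intros r Hr; apply is_derive_Rminus; auto.
      + intros r Hr; rewrite Rmult_assoc.
        apply Hlip; intros c; apply IH; lra. }
  set (K' := K * exp (2 * L * T)).
  assert (HK' : 0 <= K').
  { apply Rmult_le_pos; trivial; left; apply exp_pos. }
  assert (Hstep' : forall n a t, Rabs (U (S n) a t - U n a t) <= K' * (/ 2) ^ n).
  { intros n a t; rewrite <- (HUclamp (S n)), <- (HUclamp n).
    apply Rle_trans with (1 := Hstep n a _ (clamp_Icc T t HT)).
    unfold K'; rewrite (Rmult_assoc K (exp _)), (Rmult_comm (exp _)), <- Rmult_assoc.
    apply Rmult_le_compat_l.
    - apply Rmult_le_pos; trivial; apply pow_le; lra.
    - generalize (clamp_Icc T t HT); intros.
      destruct (Req_dec (L * clamp T t) (L * T)) as [E|E].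
      + replace (2 * L * clamp T t) with (2 * L * T) by lra; lra.
      + left; apply exp_increasing; nra. }
  clearbody K'.
  assert (Htail : forall n k a t, Rabs (U (n + k)%nat a t - U n a t)
                    <= 2 * K' * ((/ 2) ^ n - (/ 2) ^ (n + k))).
  { intros n k a t; induction k as [|k IH].
    - rewrite Nat.add_0_r, !Rminus_diag, Rabs_R0; lra.
    - rewrite Nat.add_succ_r.
      replace (U (S (n + k)) a t - U n a t) with
        ((U (S (n + k)) a t - U (n + k)%nat a t) + (U (n + k)%nat a t - U n a t)) by ring.
      eapply Rle_trans; [apply Rabs_triang|].
      specialize (Hstep' (n + k)%nat a t); simpl pow; lra. }
  assert (Htail' : forall n m a t, (n <= m)%nat ->
            Rabs (U m a t - U n a t) <= 2 * K' * (/ 2) ^ n).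
  { intros n m a t Hnm; replace m with (n + (m - n))%nat by lia.
    apply Rle_trans with (1 := Htail n (m - n)%nat a t).
    assert (0 <= (/ 2) ^ (n + (m - n))) by (apply pow_le; lra); nra. }
  assert (Hlim : forall a t, { l | is_lim_seq (fun n => U n a t) l /\ is_finite l }).
  { intros a t; exists (Lim_seq (fun n => U n a t)).
    assert (Hex : ex_finite_lim_seq (fun n => U n a t)).
    { apply ex_lim_seq_cauchy_corr; intros eps.
      destruct (pow_lt_1_zero (/ 2) ltac:(rewrite Rabs_right; lra)
                  (eps / (4 * K' + 1))) as [N HN].
      { apply Rdiv_lt_0_compat; [apply cond_pos|lra]. }
      specialize (HN N (le_n N)).
      rewrite Rabs_right in HN by (apply Rle_ge, pow_le; lra).
      apply (Rmult_lt_compat_l (4 * K' + 1)) in HN; [|lra].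
      replace ((4 * K' + 1) * (eps / (4 * K' + 1))) with (pos eps) in HN by (field; lra).
      exists N; intros n m Hn Hm.
      replace (U n a t - U m a t) with
        ((U n a t - U N a t) - (U m a t - U N a t)) by ring.
      eapply Rle_lt_trans; [apply Rabs_triang|]; rewrite Rabs_Ropp.
      generalize (Htail' N n a t Hn) (Htail' N m a t Hm); intros.
      assert (0 < (/ 2) ^ N) by (apply pow_lt; lra); lra. }
    destruct Hex as [l Hl].
    rewrite (is_lim_seq_unique _ _ Hl); split; trivial; reflexivity. }
  set (u := fun a t => real (proj1_sig (Hlim a t))).
  assert (Hu : forall n a t, Rabs (u a t - U n a t) <= 2 * K' * (/ 2) ^ n).
  { intros n a t; unfold u; destruct (Hlim a t) as [l [Hl Hf]]; simpl.
    apply Rnot_lt_le; intros Hlt.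
    rewrite <- Hf in Hl; apply is_lim_seq_spec in Hl.
    destruct (Hl (mkposreal _ (proj2 (Rlt_0_minus _ _) Hlt))) as [N HN]; simpl in HN.
    specialize (HN (max n N) (Nat.le_max_r _ _)).
    generalize (Htail' n (max n N) a t (Nat.le_max_l _ _)); intros H.
    generalize (Rabs_triang (real l - U (max n N) a t) (U (max n N) a t - U n a t)).
    rewrite (Rabs_minus_sym (real l)).
    replace (real l - U (Init.Nat.max n N) a t + (U (Init.Nat.max n N) a t - U n a t))
      with (real l - U n a t) by ring.
    lra. }
  assert (Huc : forall a t, continuous (u a) t).
  { intros a t; apply continuous_eps; intros eps He.
    destruct (pow_lt_1_zero (/ 2) ltac:(rewrite Rabs_right; lra)
                (eps / (4 * (2 * K' + 1)))) as [n Hn].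
    { apply Rdiv_lt_0_compat; lra. }
    specialize (Hn n (le_n n)).
    rewrite Rabs_right in Hn by (apply Rle_ge, pow_le; lra).
    apply (Rmult_lt_compat_l (2 * K' + 1)) in Hn; [|lra].
    replace ((2 * K' + 1) * (eps / (4 * (2 * K' + 1)))) with (eps / 4) in Hn
      by (field; lra).
    assert (0 < (/ 2) ^ n) by (apply pow_lt; lra).
    destruct (proj1 (continuous_eps _ _) (HUc n a t) (eps / 4)) as [d [Hd Hcl]]; [lra|].
    exists d; split; trivial; intros s Hs; specialize (Hcl s Hs).
    replace (u a s - u a t) with
      ((u a s - U n a s) + (U n a s - U n a t) - (u a t - U n a t)) by ring.
    generalize (Hu n a s) (Hu n a t); intros H1 H2.
    apply Rabs_le_between in H1, H2; apply Rabs_lt_between in Hcl.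
    apply Rabs_lt_between; nra. }
  (* the limit satisfies the integral equation, by uniform convergence *)
  assert (Hint : forall a t, u a t = u0 a +
             RInt (fun s => f s (fun b => u b s) a) 0 (clamp T t)).
  { intros a t.
    apply Rminus_diag_uniq.
    match goal with |- ?x = 0 => assert (Hz : Rabs x <= 0) end.
    { apply (Rle_of_halves _ _ (K' + T * (L * (2 * K')))); intros n.
      generalize (Hu (S n) a t); intros H1.
      assert (H2 : Rabs (RInt (fun s => f s (fun b => U n b s) a) 0 (clamp T t) -
                         RInt (fun s => f s (fun b => u b s) a) 0 (clamp T t))
                   <= T * (L * (2 * K' * (/ 2) ^ n))).
      { generalize (clamp_Icc T t HT); intros Hct.
        change (Rabs (minus (RInt (fun s => f s (fun b => U n b s) a) 0 (clamp T t))
                         (RInt (fun s => f s (fun b => u b s) a) 0 (clamp T t)))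
                   <= T * (L * (2 * K' * (/ 2) ^ n))).
        rewrite <- (RInt_minus (V := R_CompleteNormedModule)) by
          (apply ex_RInt_cont; intros; now apply Hcont).
        apply Rle_trans with ((clamp T t - 0) * (L * (2 * K' * (/ 2) ^ n))).
        - apply abs_RInt_le_const; [lra| |].
          + apply ex_RInt_cont; intros; apply continuous_Rminus; now apply Hcont.
          + intros s Hs; apply Hlip; intros b; rewrite Rabs_minus_sym; apply Hu.
        - apply Rmult_le_compat_r; [|lra].
          assert (Hp : 0 <= (/ 2) ^ n) by (apply pow_le; lra).
          apply Rmult_le_pos; trivial; apply Rmult_le_pos; lra. }
      revert H1; unfold U at 1; simpl; fold (U n); intros H1.
      apply Rabs_le_between in H1, H2; apply Rabs_le_between.
      replace (2 * K' * (/ 2 * (/ 2) ^ n)) with (K' * (/ 2) ^ n) in H1 by field.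
      lra. }
    match goal with |- ?x = 0 => destruct (Req_dec x 0) as [|Hne]; trivial;
      generalize (Rabs_pos_lt _ Hne); lra end. }
  exists u; split; [|split]; trivial.
  - intros a; rewrite Hint, clamp_id by lra.
    rewrite (RInt_point (V := R_CompleteNormedModule)); unfold zero; simpl; ring.
  - intros a t Ht.
    apply (is_derive_near (fun r => u0 a + RInt (fun s => f s (fun b => u b s) a) 0 r)
             _ 0 T); trivial.
    + intros s Hs; now rewrite Hint, clamp_id by lra.
    + apply (is_derive_primitive (fun s => f s (fun b => u b s) a)).
      intros s; now apply Hcont.
Qed.

(** * Sums over one period of a grid function *)

Definition gsum (J : nat) (f : Z -> R) : R :=
  sum_n_m (fun k => f (Z.of_nat k)) 1 J.

Definition zperiodic {U : Type} (J : nat) (f : Z -> U) : Prop :=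
  forall j, f (j + Z.of_nat J)%Z = f j.

Lemma gsum_S J f : gsum (S J) f = gsum J f + f (Z.of_nat (S J)).
Proof. unfold gsum; rewrite sum_n_Sm by lia; reflexivity. Qed.

Lemma gsum_0 f : gsum 0 f = 0.
Proof. unfold gsum; now rewrite sum_n_m_zero by lia. Qed.

Lemma gsum_ext J f g : (forall j, f j = g j) -> gsum J f = gsum J g.
Proof.
  intros H; induction J as [|J IH]; [now rewrite !gsum_0|].
  now rewrite !gsum_S, IH, H.
Qed.

Lemma gsum_plus J f g : gsum J (fun j => f j + g j) = gsum J f + gsum J g.
Proof.
  induction J as [|J IH]; [rewrite !gsum_0; ring|].
  rewrite !gsum_S, IH; ring.
Qed.

Lemma gsum_scal J k f : gsum J (fun j => k * f j) = k * gsum J f.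
Proof.
  induction J as [|J IH]; [rewrite !gsum_0; ring|].
  rewrite !gsum_S, IH; ring.
Qed.

Lemma gsum_const J k : gsum J (fun _ => k) = INR J * k.
Proof.
  induction J as [|J IH]; [rewrite gsum_0; simpl; ring|].
  rewrite gsum_S, IH, S_INR; ring.
Qed.

Lemma gsum_le J f g : (forall j, f j <= g j) -> gsum J f <= gsum J g.
Proof.
  intros H; induction J as [|J IH]; [rewrite !gsum_0; lra|].
  rewrite !gsum_S; specialize (H (Z.of_nat (S J))); lra.
Qed.

Lemma gsum_nonneg J f : (forall j, 0 <= f j) -> 0 <= gsum J f.
Proof.
  intros H; replace 0 with (gsum J (fun _ => 0)) by (rewrite gsum_const; ring).
  now apply gsum_le.
Qed.

Lemma gsum_shift J f : zperiodic J f -> gsum J (fun j => f (j + 1)%Z) = gsum J f.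
Proof.
  intros Hp.
  assert (H : forall n, gsum n (fun j => f (j + 1)%Z) + f 1%Z
                        = gsum n f + f (Z.of_nat n + 1)%Z).
  { induction n as [|n IH]; [rewrite !gsum_0; simpl; ring|].
    rewrite !gsum_S.
    replace (Z.of_nat (S n)) with (Z.of_nat n + 1)%Z in * by lia.
    cbv beta; lra. }
  specialize (H J).
  rewrite Z.add_comm, Hp in H; lra.
Qed.

Lemma gsum_shift_back J f :
  zperiodic J f -> gsum J (fun j => f (j - 1)%Z) = gsum J f.
Proof.
  intros Hp; rewrite <- (gsum_shift J (fun j => f (j - 1)%Z)).
  - apply gsum_ext; intros j; f_equal; lia.
  - intros j; rewrite <- (Hp (j - 1)%Z); f_equal; lia.
Qed.

Lemma zperiodic_mult {U} J (f : Z -> U) k j :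
  zperiodic J f -> f (j + k * Z.of_nat J)%Z = f j.
Proof.
  intros Hp; revert j; induction k using Z.peano_ind; intros j.
  - f_equal; lia.
  - replace (j + Z.succ k * Z.of_nat J)%Z with (j + k * Z.of_nat J + Z.of_nat J)%Z
      by lia.
    now rewrite Hp.
  - replace (j + Z.pred k * Z.of_nat J)%Z
      with (j - Z.of_nat J + k * Z.of_nat J)%Z by lia.
    rewrite IHk, <- Hp; f_equal; lia.
Qed.

Lemma gsum_elt J f j :
  (0 < J)%nat -> zperiodic J f -> (forall j, 0 <= f j) -> f j <= gsum J f.
Proof.
  intros HJ Hp Hf.
  assert (H : forall n k, (1 <= k <= n)%nat -> f (Z.of_nat k) <= gsum n f).
  { induction n as [|n IH]; intros k Hk; [lia|].
    rewrite gsum_S.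
    destruct (Nat.eq_dec k (S n)) as [->|].
    - generalize (gsum_nonneg n f Hf); lra.
    - specialize (IH k ltac:(lia)); specialize (Hf (Z.of_nat (S n))); lra. }
  (* [r] is the index congruent to [j] among those of the sum *)
  set (r := ((j - 1) mod Z.of_nat J + 1)%Z).
  assert (Hr : (1 <= r <= Z.of_nat J)%Z).
  { unfold r; generalize (Z.mod_pos_bound (j - 1) (Z.of_nat J) ltac:(lia)); lia. }
  assert (E : f j = f r).
  { rewrite <- (zperiodic_mult J f ((j - 1) / Z.of_nat J) r Hp); f_equal.
    unfold r; generalize (Z.div_mod (j - 1) (Z.of_nat J) ltac:(lia)); lia. }
  rewrite E; replace r with (Z.of_nat (Z.to_nat r)) by lia.
  apply H; lia.
Qed.

Lemma gsum_derive J (f df : Z -> R -> R) t :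
  (forall j, is_derive (f j) t (df j t)) ->
  is_derive (fun s => gsum J (fun j => f j s)) t (gsum J (fun j => df j t)).
Proof.
  intros H; induction J as [|J IH].
  - rewrite gsum_0; apply is_derive_ext with (fun _ => 0);
      [intros; now rewrite gsum_0|apply is_derive_Rconst].
  - rewrite gsum_S.
    apply is_derive_ext with
      (fun s => gsum J (fun j => f j s) + f (Z.of_nat (S J)) s);
      [intros; now rewrite gsum_S|].
    now apply is_derive_Rplus.
Qed.

Lemma gsum_continuous J (f : Z -> R -> R) t :
  (forall j, continuous (f j) t) -> continuous (fun s => gsum J (fun j => f j s)) t.
Proof.
  intros H; induction J as [|J IH].
  - apply continuous_ext with (fun _ => 0);
      [intros; now rewrite gsum_0|apply continuous_Rconst].
  - apply continuous_ext with
      (fun s => gsum J (fun j => f j s) + f (Z.of_nat (S J)) s);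
      [intros; now rewrite gsum_S|].
    now apply continuous_Rplus.
Qed.

(** * Orders of magnitude *)

(** The Landau symbol [f = O(w)] with the uniformity made explicit: one constant
    serves all the grids and data selected by [P]. *)
Definition dom {A : Type} (P : A -> Prop) (w f : A -> Z -> R) : Prop :=
  exists C, 0 <= C /\ forall a j, P a -> Rabs (f a j) <= C * w a j.

Section Domination.
Context {A : Type} (P : A -> Prop).
Implicit Types w f g : A -> Z -> R.

Lemma dom_le C w f :
  0 <= C -> (forall a j, P a -> Rabs (f a j) <= C * w a j) -> dom P w f.
Proof. intros; now exists C. Qed.

Lemma dom_ext w f g :
  dom P w f -> (forall a j, P a -> g a j = f a j) -> dom P w g.
Proof. intros [C [HC H]] E; exists C; split; trivial; intros; rewrite E; auto. Qed.

Lemma dom_plus w f g : dom P w f -> dom P w g -> dom P w (fun a j => f a j + g a j).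
Proof.
  intros [C [HC H]] [D [HD H']]; exists (C + D); split; [lra|]; intros a j Ha.
  eapply Rle_trans; [apply Rabs_triang|].
  specialize (H a j Ha); specialize (H' a j Ha); lra.
Qed.

Lemma dom_opp w f : dom P w f -> dom P w (fun a j => - f a j).
Proof. intros [C [HC H]]; exists C; split; trivial; intros; rewrite Rabs_Ropp; auto. Qed.

Lemma dom_minus w f g : dom P w f -> dom P w g -> dom P w (fun a j => f a j - g a j).
Proof. intros; apply dom_plus; trivial; now apply dom_opp. Qed.

Lemma dom_mult w1 w2 w f g :
  dom P w1 f -> dom P w2 g -> (forall a j, P a -> w1 a j * w2 a j <= w a j) ->
  dom P w (fun a j => f a j * g a j).
Proof.
  intros [C [HC H]] [D [HD H']] Hw; exists (C * D).
  split; [now apply Rmult_le_pos|]; intros a j Ha.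
  rewrite Rabs_mult.
  apply Rle_trans with ((C * w1 a j) * (D * w2 a j)).
  - apply Rmult_le_compat; auto using Rabs_pos.
  - replace (C * w1 a j * (D * w2 a j)) with (C * D * (w1 a j * w2 a j)) by ring.
    apply Rmult_le_compat_l; [now apply Rmult_le_pos|auto].
Qed.

Lemma dom_weaken w w' f :
  dom P w f -> (forall a j, P a -> w a j <= w' a j) -> dom P w' f.
Proof.
  intros [C [HC H]] Hw; exists C; split; trivial; intros a j Ha.
  apply Rle_trans with (1 := H a j Ha); apply Rmult_le_compat_l; auto.
Qed.

Lemma dom_const k : dom P (fun _ _ => 1) (fun _ _ => k).
Proof. exists (Rabs k); split; [apply Rabs_pos|]; intros; lra. Qed.

Lemma dom_scal k w f : dom P w f -> dom P w (fun a j => k * f a j).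
Proof.
  intros [C [HC H]]; exists (Rabs k * C).
  split; [apply Rmult_le_pos; trivial; apply Rabs_pos|]; intros a j Ha.
  rewrite Rabs_mult, Rmult_assoc; apply Rmult_le_compat_l; auto using Rabs_pos.
Qed.

Lemma dom_mult1 w f g :
  dom P (fun _ _ => 1) f -> dom P w g -> dom P w (fun a j => f a j * g a j).
Proof. intros; apply dom_mult with (fun _ _ => 1) w; trivial; intros; lra. Qed.

Lemma dom_inv c f :
  0 < c -> (forall a j, P a -> c <= f a j) -> dom P (fun _ _ => 1) (fun a j => / f a j).
Proof.
  intros Hc H; exists (/ c); split; [left; now apply Rinv_0_lt_compat|].
  intros a j Ha; specialize (H a j Ha).
  rewrite Rabs_inv, Rabs_right, Rmult_1_r by lra; apply Rinv_le_contravar; lra.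
Qed.

Lemma dom_div c w f g :
  0 < c -> (forall a j, P a -> c <= g a j) -> dom P w f ->
  dom P w (fun a j => f a j / g a j).
Proof.
  intros Hc Hg Hf; apply dom_ext with (fun a j => / g a j * f a j);
    [|intros; unfold Rdiv; ring].
  apply dom_mult1; trivial; now apply dom_inv with c.
Qed.

Lemma dom_shift k w f :
  dom P w f -> dom P (fun a j => w a (j + k)%Z) (fun a j => f a (j + k)%Z).
Proof. intros [C [HC H]]; exists C; split; trivial; intros; auto. Qed.

End Domination.

Arguments semi_periodic {beta T x0 V0 J xh vh}.
Arguments semi_velocity {beta T x0 V0 J xh vh}.
Arguments semi_q_pos {beta T x0 V0 J xh vh}.
Arguments semi_theta_def {beta T x0 V0 J xh vh}.
Arguments semi_equation {beta T x0 V0 J xh vh}.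
Arguments semi_init_pos {beta T x0 V0 J xh vh}.
Arguments semi_init_vel {beta T x0 V0 J xh vh}.

Arguments cont_periodic {beta T x0 V0 x x_rho x_t x_tt}.
Arguments cont_equation {beta T x0 V0 x x_rho x_t x_tt}.
Arguments cont_init_pos {beta T x0 V0 x x_rho x_t x_tt}.
Arguments cont_init_vel {beta T x0 V0 x x_rho x_t x_tt}.

Arguments partials_00 {m T x dx}.
Arguments partials_rho {m T x dx}.
Arguments partials_t {m T x dx}.
Arguments partials_continuous {m T x dx}.

(** * Plane vectors *)

Lemma plus_pair (u v : R * R) : plus u v = (fst u + fst v, snd u + snd v).
Proof. reflexivity. Qed.

Lemma minus_pair (u v : R * R) : minus u v = (fst u - fst v, snd u - snd v).
Proof. reflexivity. Qed.

Lemma scal_pair (a : R) (u : R * R) : scal a u = (a * fst u, a * snd u).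
Proof. reflexivity. Qed.

Lemma norm_pair (u : R * R) : norm u = sqrt (fst u * fst u + snd u * snd u).
Proof.
  change (norm u) with (sqrt (Rabs (fst u) ^ 2 + Rabs (snd u) ^ 2)).
  rewrite !pow2_abs; f_equal; ring.
Qed.

Lemma norm_sqr (u : R * R) : norm u ^ 2 = dot u u.
Proof.
  rewrite norm_pair, pow2_sqrt; [reflexivity|]; nra.
Qed.

Lemma norm_nonneg (u : R * R) : 0 <= norm u.
Proof. rewrite norm_pair; apply sqrt_pos. Qed.

Lemma fst_le_norm (u : R * R) : Rabs (fst u) <= norm u.
Proof.
  rewrite norm_pair, <- sqrt_Rsqr_abs; apply sqrt_le_1_alt; unfold Rsqr; nra.
Qed.

Lemma snd_le_norm (u : R * R) : Rabs (snd u) <= norm u.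
Proof.
  rewrite norm_pair, <- sqrt_Rsqr_abs; apply sqrt_le_1_alt; unfold Rsqr; nra.
Qed.

Lemma norm_le_sum (u : R * R) : norm u <= Rabs (fst u) + Rabs (snd u).
Proof.
  generalize (Rabs_pos (fst u)) (Rabs_pos (snd u)); intros.
  apply Rsqr_incr_0_var; [|lra]; unfold Rsqr.
  replace (norm u * norm u) with (norm u ^ 2) by ring; rewrite norm_sqr; unfold dot.
  assert (E1 : fst u * fst u = Rabs (fst u) * Rabs (fst u)).
  { rewrite <- Rabs_mult, Rabs_right; nra. }
  assert (E2 : snd u * snd u = Rabs (snd u) * Rabs (snd u)).
  { rewrite <- Rabs_mult, Rabs_right; nra. }
  rewrite E1, E2; nra.
Qed.

Definition cross (u v : R * R) : R := fst u * snd v - snd u * fst v.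

Lemma normalize_unit (u : R * R) : 0 < norm u -> dot (normalize u) (normalize u) = 1.
Proof.
  intros H; unfold normalize; rewrite scal_pair; unfold dot; cbn [fst snd].
  generalize (norm_sqr u); unfold dot; intros E.
  transitivity ((fst u * fst u + snd u * snd u) / norm u ^ 2); [field; lra|].
  rewrite <- E; field; lra.
Qed.

Lemma norm_zero_iff (u : R * R) : norm u = 0 -> u = (0, 0).
Proof. exact (norm_eq_zero u). Qed.

Lemma norm_pos_of_neq (u : R * R) : u <> (0, 0) -> 0 < norm u.
Proof.
  intros H; destruct (norm_nonneg u) as [|E]; trivial.
  now contradiction H; apply norm_zero_iff.
Qed.

Lemma frame_decomposition t u :
  dot t t = 1 -> u = (dot u t * fst t - dot u (perp t) * snd t,
                      dot u t * snd t + dot u (perp t) * fst t).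
Proof.
  destruct t as [t1 t2], u as [u1 u2]; unfold dot, perp; cbn [fst snd]; intros H.
  f_equal.
  - transitivity (u1 * (t1 * t1 + t2 * t2)); [rewrite H|]; ring.
  - transitivity (u2 * (t1 * t1 + t2 * t2)); [rewrite H|]; ring.
Qed.

(** Two unit vectors seen from the direction bisecting them: they make with it
    opposite angles, of cosine [half_cos] and sine [half_sin]. *)
Definition half_cos (u v : R * R) : R := norm (plus u v) / 2.
Definition half_sin (u v : R * R) : R := cross u v / norm (plus u v).

Section Bisector.
Variables (u v : R * R).
Hypotheses (Hu : dot u u = 1) (Hv : dot v v = 1) (Huv : 0 < norm (plus u v)).

Let norm_sum : norm (plus u v) ^ 2 = 2 + 2 * dot u v.
Proof.
  rewrite norm_sqr, plus_pair; unfold dot in *; cbn [fst snd].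
  lra.
Qed.

Let theta := normalize (plus u v).

Lemma bisector_left :
  dot u theta = half_cos u v /\ dot u (perp theta) = - half_sin u v.
Proof.
  unfold theta, half_cos, half_sin, normalize, cross.
  rewrite scal_pair; unfold dot, perp in *; cbn [fst snd].
  set (n := norm (plus u v)) in *; clearbody n.
  rewrite plus_pair; cbn [fst snd]; split; [|field; lra].
  apply Rmult_eq_reg_l with (2 * n); [|lra].
  transitivity (n ^ 2); [|field].
  rewrite norm_sum; unfold dot.
  transitivity (2 * (fst u * fst u + snd u * snd u) +
                2 * (fst u * fst v + snd u * snd v)); [field; lra|].
  rewrite Hu; ring.
Qed.

Lemma bisector_right :
  dot v theta = half_cos u v /\ dot v (perp theta) = half_sin u v.
Proof.
  unfold theta, half_cos, half_sin, normalize, cross.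
  rewrite scal_pair; unfold dot, perp in *; cbn [fst snd].
  set (n := norm (plus u v)) in *; clearbody n.
  rewrite plus_pair; cbn [fst snd]; split; [|field; lra].
  apply Rmult_eq_reg_l with (2 * n); [|lra].
  transitivity (n ^ 2); [|field].
  rewrite norm_sum; unfold dot.
  transitivity (2 * (fst v * fst v + snd v * snd v) +
                2 * (fst u * fst v + snd u * snd v)); [field; lra|].
  rewrite Hv; ring.
Qed.

End Bisector.

(** * One-sided derivatives of plane curves *)

Lemma derive_on_increment (F : (R -> Prop) -> Prop) {FF : Filter F}
  (f : R -> R * R) (t : R) (l : R * R) :
  is_filter_lim F t -> filterdiff f F (fun y => scal y l) ->
  forall eps : posreal, F (fun s =>
    Rabs (fst (f s) - fst (f t) - fst l * (s - t)) <= eps * Rabs (s - t) /\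
    Rabs (snd (f s) - snd (f t) - snd l * (s - t)) <= eps * Rabs (s - t)).
Proof.
  intros Hlim [_ H] eps.
  specialize (H t Hlim eps); revert H; apply filter_imp; intros s Hs.
  change (norm (minus (minus (f s) (f t)) (scal (s - t) l)) <= eps * Rabs (s - t)) in Hs.
  generalize (fst_le_norm (minus (minus (f s) (f t)) (scal (s - t) l)))
    (snd_le_norm (minus (minus (f s) (f t)) (scal (s - t) l))).
  rewrite scal_pair, !minus_pair; simpl; intros H1 H2.
  replace (fst l * (s - t)) with ((s - t) * fst l) by ring.
  replace (snd l * (s - t)) with ((s - t) * snd l) by ring.
  rewrite scal_pair, !minus_pair in Hs; split; eapply Rle_trans; eauto.
Qed.

Lemma is_derive_components (f : R -> R * R) t l :
  is_derive f t l ->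
  is_derive (fun s => fst (f s)) t (fst l) /\ is_derive (fun s => snd (f s)) t (snd l).
Proof.
  intros H.
  assert (Hlim : is_filter_lim (locally t) t) by (intros P HP; exact HP).
  split; apply is_derive_eps; intros eps He;
  destruct (derive_on_increment (locally t) f t l Hlim H (mkposreal eps He)) as [d Hd];
    exists d; (split; [apply cond_pos|]); intros s Hs; apply (Hd s Hs).
Qed.

Lemma is_derive_on_eps T (f : R -> R * R) t l :
  is_derive_on (Icc 0 T) f t l -> forall eps, 0 < eps ->
  exists d, 0 < d /\ forall s, 0 <= s <= T -> Rabs (s - t) < d ->
    Rabs (fst (f s) - fst (f t) - fst l * (s - t)) <= eps * Rabs (s - t) /\
    Rabs (snd (f s) - snd (f t) - snd l * (s - t)) <= eps * Rabs (s - t).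
Proof.
  intros H eps He.
  assert (Hlim : is_filter_lim (within (Icc 0 T) (locally t)) t).
  { intros P HP; unfold within; revert HP; apply filter_imp; auto. }
  destruct (derive_on_increment _ f t l Hlim H (mkposreal eps He)) as [d Hd].
  exists d; split; [apply cond_pos|]; intros s Hs Hst; apply (Hd s Hst Hs).
Qed.

Lemma is_derive_on_interior T (f : R -> R * R) t l :
  0 < t < T -> is_derive_on (Icc 0 T) f t l ->
  is_derive (fun s => fst (f s)) t (fst l) /\ is_derive (fun s => snd (f s)) t (snd l).
Proof.
  intros Ht H; split; apply is_derive_eps; intros eps He;
  destruct (is_derive_on_eps T f t l H eps He) as [d [Hd Hs]];
  exists (Rmin d (Rmin t (T - t)));
  (split; [repeat apply Rmin_case; lra|]); intros s Hst;
  generalize (Rmin_l d (Rmin t (T - t))) (Rmin_r d (Rmin t (T - t)))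
    (Rmin_l t (T - t)) (Rmin_r t (T - t)); intros;
  generalize Hst; intros Hst'; apply Rabs_lt_between in Hst';
  apply Hs; lra.
Qed.

Lemma is_derive_on_continuous T (f : R -> R * R) :
  0 <= T -> (forall t, 0 <= t <= T -> exists l, is_derive_on (Icc 0 T) f t l) ->
  (forall t, continuous (fun s => fst (f (clamp T s))) t) /\
  (forall t, continuous (fun s => snd (f (clamp T s))) t).
Proof.
  intros HT H.
  assert (Hc : forall t eps, 0 < eps -> exists d, 0 < d /\
    forall s, Rabs (s - t) < d ->
      Rabs (fst (f (clamp T s)) - fst (f (clamp T t))) < eps /\
      Rabs (snd (f (clamp T s)) - snd (f (clamp T t))) < eps).
  { intros t eps He.
    generalize (clamp_Icc T t HT); intros Ht.
    destruct (H _ Ht) as [l Hl].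
    destruct (is_derive_on_eps T f _ _ Hl 1 Rlt_0_1) as [d [Hd Hs]].
    set (t' := clamp T t) in *.
    set (K := 2 + Rabs (fst l) + Rabs (snd l)).
    assert (HK : 0 < K) by (unfold K; generalize (Rabs_pos (fst l))
                     (Rabs_pos (snd l)); lra).
    exists (Rmin d (eps / K)); split.
    { apply Rmin_case; trivial; now apply Rdiv_lt_0_compat. }
    intros s Hst.
    generalize (clamp_Icc T s HT); intros Hs'.
    assert (Hle : Rabs (clamp T s - t') < d /\ Rabs (clamp T s - t') < eps / K).
    { generalize (clamp_lip T s t) (Rmin_l d (eps / K)) (Rmin_r d (eps / K)).
      fold t'; lra. }
    destruct (Hs _ Hs' (proj1 Hle)) as [H1 H2].
    destruct Hle as [_ Hle].
    apply (Rmult_lt_compat_l K) in Hle; trivial.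
    replace (K * (eps / K)) with eps in Hle by (field; lra).
    set (x := clamp T s - t') in *.
    generalize (Rabs_pos x) (Rabs_pos (fst l)) (Rabs_pos (snd l)); intros.
    split.
    - replace (fst (f (clamp T s)) - fst (f t')) with
        ((fst (f (clamp T s)) - fst (f t') - fst (l) * x) + fst (l) * x) by ring.
      eapply Rle_lt_trans; [apply Rabs_triang|]; rewrite Rabs_mult.
      unfold K in Hle; nra.
    - replace (snd (f (clamp T s)) - snd (f t')) with
        ((snd (f (clamp T s)) - snd (f t') - snd (l) * x) + snd (l) * x) by ring.
      eapply Rle_lt_trans; [apply Rabs_triang|]; rewrite Rabs_mult.
      unfold K in Hle; nra. }
  split; intros t; apply continuous_eps; intros eps He;
    destruct (Hc t eps He) as [d [Hd Hs]]; exists d; split; trivial;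
    intros s Hst; now apply Hs.
Qed.

(** Extending [f] beyond [0, T] by a differentiable [g] replaces one-sided
    derivatives by ordinary ones. *)
Lemma is_derive_on_of_components T (f g : R -> R * R) t (a b : R) :
  0 <= t <= T -> (forall s, 0 <= s <= T -> f s = g s) ->
  is_derive (fun s => fst (g s)) t a -> is_derive (fun s => snd (g s)) t b ->
  is_derive_on (Icc 0 T) f t (a, b).
Proof.
  intros Ht E Ha Hb; split.
  { apply (is_linear_scal_l
      (V := prod_NormedModule R_AbsRing R_NormedModule R_NormedModule)). }
  intros y Hy eps.
  assert (Ey : y = t).
  { apply NNPP; intros Hne.
    assert (Hd : 0 < Rabs (y - t) / 2).
    { generalize (Rabs_pos_lt (y - t)); intros Hp; apply Rdiv_lt_0_compat; [|lra].
      apply Hp; lra. }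
    assert (H1 : within (Icc 0 T) (locally t) (ball y (mkposreal _ Hd))).
    { apply Hy; now exists (mkposreal _ Hd). }
    destruct H1 as [d Hd1].
    assert (Hb0 : ball y (mkposreal _ Hd) t) by (apply Hd1; trivial; apply ball_center).
    change (Rabs (t - y) < Rabs (y - t) / 2) in Hb0.
    rewrite Rabs_minus_sym in Hb0; lra. }
  subst y.
  destruct (proj1 (is_derive_eps _ _ _) Ha (eps / 2)) as [d1 [Hd1 H1]];
    [generalize (cond_pos eps); lra|].
  destruct (proj1 (is_derive_eps _ _ _) Hb (eps / 2)) as [d2 [Hd2 H2]];
    [generalize (cond_pos eps); lra|].
  exists (mkposreal (Rmin d1 d2) (Rmin_pos _ _ Hd1 Hd2)).
  intros s Hs Hsi; change (Rabs (s - t) < Rmin d1 d2) in Hs.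
  change (norm (minus (minus (f s) (f t)) (scal (s - t) (a, b))) <= eps * Rabs (s - t)).
  eapply Rle_trans; [apply norm_le_sum|].
  rewrite scal_pair, !minus_pair, !E by (trivial); simpl.
  specialize (H1 s (Rlt_le_trans _ _ _ Hs (Rmin_l _ _))).
  specialize (H2 s (Rlt_le_trans _ _ _ Hs (Rmin_r _ _))).
  rewrite (Rmult_comm (s - t) a), (Rmult_comm (s - t) b); lra.
Qed.

(** The equations are differentiated at interior times only; continuity carries
    the conclusions to the end points. *)
Lemma closed_extension (f : R -> R) T :
  0 < T -> (forall t, continuous f t) -> (forall t, 0 < t < T -> f t <= 0) ->
  forall t, 0 <= t <= T -> f t <= 0.
Proof.
  intros HT Hc H t Ht; apply Rnot_lt_le; intros Hlt.
  destruct (proj1 (continuous_eps f t) (Hc t) (f t) Hlt) as [d [Hd Hs]].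
  assert (Hex : exists s, 0 < s < T /\ Rabs (s - t) < d).
  { set (m := Rmin (d / 2) (T / 4)).
    assert (Hm : 0 < m /\ m <= d / 2 /\ m <= T / 4).
    { unfold m; repeat split; [apply Rmin_case; lra|apply Rmin_l|apply Rmin_r]. }
    destruct (Rle_dec t (T / 2)).
    - exists (t + m); split; [lra|].
      apply Rabs_lt_between; lra.
    - exists (t - m); split; [lra|].
      apply Rabs_lt_between; lra. }
  destruct Hex as [s [Hs1 Hs2]]; specialize (Hs s Hs2); specialize (H s Hs1).
  apply Rabs_lt_between in Hs; lra.
Qed.

Lemma closed_extension_eq (f g : R -> R) T :
  0 < T -> (forall t, continuous f t) -> (forall t, continuous g t) ->
  (forall t, 0 < t < T -> f t = g t) ->
  forall t, 0 <= t <= T -> f t = g t.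
Proof.
  intros HT Hf Hg H t Ht.
  assert (H1 : f t - g t <= 0).
  { apply (closed_extension (fun t => f t - g t) T); trivial.
    - intros; now apply continuous_Rminus.
    - intros s Hs; rewrite (H s Hs); lra. }
  assert (H2 : g t - f t <= 0).
  { apply (closed_extension (fun t => g t - f t) T); trivial.
    - intros; now apply continuous_Rminus.
    - intros s Hs; rewrite (H s Hs); lra. }
  lra.
Qed.

(** * Elementary bounds on the sine and the cosine *)

Lemma bounded_sine (x : R) : Rabs (sin x) <= Rabs x.
Proof.
  assert (H : forall x, 0 <= x -> Rabs (sin x) <= x).
  { intros y Hy.
    replace (sin y) with (sin y - sin 0) by (rewrite sin_0; ring).
    rewrite <- (Rmult_1_l y) at 2; replace (1 * y) with (1 * (y - 0)) by ring.
    apply (lipschitz_of_derive sin cos); trivial.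
    - intros; apply continuous_sin.
    - intros; apply is_derive_Reals, derivable_pt_lim_sin.
    - intros; apply Rabs_le_between, COS_bound. }
  destruct (Rle_dec 0 x) as [Hx|Hx].
  - rewrite (Rabs_right x) by lra; auto.
  - rewrite (Rabs_left x), <- Rabs_Ropp, <- sin_neg by lra; apply H; lra.
Qed.

Lemma cos_defect (x : R) : Rabs (cos x - 1) <= x ^ 2 / 2.
Proof.
  replace x with (2 * (x / 2)) at 1 by field; rewrite cos_2a_sin.
  generalize (bounded_sine (x / 2)); intros H.
  replace (1 - 2 * sin (x / 2) * sin (x / 2) - 1) with (- (2 * sin (x / 2) ^ 2)) by ring.
  rewrite Rabs_Ropp, Rabs_right by nra.
  apply Rsqr_le_abs_1 in H; unfold Rsqr in H; nra.
Qed.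

Lemma sin_defect (x : R) : Rabs x <= 1 -> Rabs (sin x - x) <= x ^ 2 / 2.
Proof.
  assert (H : forall x, 0 <= x <= 1 -> Rabs (sin x - x) <= x ^ 2 / 2).
  { intros y Hy; rewrite Rabs_left1.
    - assert (H : (y - sin y - y ^ 2 / 2) <= (0 - sin 0 - 0 ^ 2 / 2)).
      { apply (decreasing_of_derive (fun y => y - sin y - y ^ 2 / 2)
                 (fun y => 1 - cos y - y)); [lra| | |].
        - intros t _; repeat cont_step; lra.
        - intros t _; eapply is_derive_eq.
          + apply is_derive_Rminus; [repeat derive_step|].
            apply is_derive_ext with (fun y => y * y / 2); [intros; simpl; field|].
            repeat derive_step; lra.
          + cbv beta; field.
        - intros t Ht; generalize (cos_defect t); intros H.
          apply Rabs_le_between in H; nra. }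
      rewrite sin_0 in H; lra.
    - generalize (bounded_sine y); rewrite (Rabs_right y) by lra; intros H.
      apply Rabs_le_between in H; lra. }
  intros Hx; destruct (Rle_dec 0 x) as [Hp|Hp].
  - rewrite Rabs_right in Hx by lra; apply H; lra.
  - rewrite Rabs_left in Hx by lra; specialize (H (- x) ltac:(lra)).
    rewrite sin_neg in H; rewrite <- Rabs_Ropp.
    replace (- (sin x - x)) with (- sin x - - x) by ring.
    replace (x ^ 2) with ((- x) ^ 2) by ring; trivial.
Qed.

(** * The scheme in polar variables *)

(** Grid data read off the exact solution at one time: the normal velocity at
    the nodes, a length element and an angular velocity on the cells, and the
    cosine and sine of half the turning angle at the nodes. *)
Record reference := Reference {
  ref_vel : Z -> R; ref_len : Z -> R; ref_om : Z -> R;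
  ref_cos : Z -> R; ref_sin : Z -> R
}.

(** The discrete solution at one time. Its tangents are obtained from the exact
    discrete ones by the rotations of angle [- psi j]; no angle function has to
    be lifted for the exact solution. *)
Record state := State { psi : Z -> R; vel : Z -> R; len : Z -> R }.

Definition half_jump (u : state) (j : Z) : R := (psi u (j + 1)%Z - psi u j) / 2.

(** Sine and cosine of half the turning angle of the discrete curve at a node.
    They come from those of the exact polygon by the addition formulas. *)
Definition turn_sin (r : reference) (u : state) (j : Z) : R :=
  ref_sin r j * cos (half_jump u j) - ref_cos r j * sin (half_jump u j).

Definition turn_cos (r : reference) (u : state) (j : Z) : R :=
  ref_cos r j * cos (half_jump u j) + ref_sin r j * sin (half_jump u j).

(** The edges of a polygon whose vertices move along their normals rotate and
    change their lengths according to the differences of the vertex velocities,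
    resolved across and along the edge; the vertices are accelerated by the
    discrete curvature. *)
Definition psi_rate (h : R) (r : reference) (u : state) (j : Z) : R :=
  ref_om r j - (vel u j * turn_cos r u j -
                vel u (j - 1)%Z * turn_cos r u (j - 1)%Z) / (h * len u j).

Definition vel_rate (beta h : R) (r : reference) (u : state) (j : Z) : R :=
  - beta * vel u j + 4 / (len u j + len u (j + 1)%Z) * (turn_sin r u j / h).

Definition len_rate (h : R) (r : reference) (u : state) (j : Z) : R :=
  - (vel u j * turn_sin r u j + vel u (j - 1)%Z * turn_sin r u (j - 1)%Z) / h.

(** The region where the nonlinear terms are under control. The angles [psi] are
    compared with [h] because this is the size of the turning angles. *)
Set Implicit Arguments.
Record near_reference (c0 h : R) (r : reference) (u : state) : Prop := {
  close_psi : forall j, Rabs (psi u j) <= h;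
  close_vel : forall j, Rabs (ref_vel r j - vel u j) <= 1;
  close_len : forall j, Rabs (ref_len r j - len u j) <= c0 / 2
}.
Unset Implicit Arguments.

Set Implicit Arguments.
Record bounded_reference (M c0 h : R) (r : reference) : Prop := {
  bounded_vel : forall j, Rabs (ref_vel r j) <= M;
  bounded_len : forall j, c0 <= ref_len r j <= M;
  bounded_om : forall j, Rabs (ref_om r j) <= M;
  bounded_sin : forall j, Rabs (ref_sin r j) <= M * h;
  unit_turn : forall j, ref_cos r j ^ 2 + ref_sin r j ^ 2 = 1
}.
Unset Implicit Arguments.

(** The exact data satisfy the scheme up to [O(h^2)]; [dV] and [dQ] stand for
    the time derivatives of the velocities and of the length elements. *)
Record consistent (beta M h : R) (r : reference) (dV dQ : Z -> R) : Prop := {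
  consistent_psi : forall j, Rabs (ref_len r j * ref_om r j -
     (ref_vel r j * ref_cos r j - ref_vel r (j - 1)%Z * ref_cos r (j - 1)%Z) / h)
     <= M * h ^ 2;
  consistent_vel : forall j, Rabs (dV j + beta * ref_vel r j -
     4 / (ref_len r j + ref_len r (j + 1)%Z) * (ref_sin r j / h)) <= M * h ^ 2;
  consistent_len : forall j, Rabs (dQ j +
     (ref_vel r j * ref_sin r j + ref_vel r (j - 1)%Z * ref_sin r (j - 1)%Z) / h)
     <= M * h ^ 2
}.

(** * The energy of the error *)

Section Energy.
Variables (beta M c0 : R).
Hypotheses (HM : 0 <= M) (Hc0 : 0 < c0).

(** All the data at one time, so that [dom] can range over them. *)
Record snapshot := Snapshot {
  mesh_of : R; ref_of : reference; dV_of : Z -> R; dQ_of : Z -> R; state_of : state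
}.

Definition admissible (g : snapshot) : Prop :=
  0 < mesh_of g <= 1 /\ bounded_reference M c0 (mesh_of g) (ref_of g) /\
  consistent beta M (mesh_of g) (ref_of g) (dV_of g) (dQ_of g) /\
  near_reference c0 (mesh_of g) (ref_of g) (state_of g).

Definition vel_error (r : reference) (u : state) (j : Z) : R := ref_vel r j - vel u j.
Definition len_error (r : reference) (u : state) (j : Z) : R := ref_len r j - len u j.
Definition mean_len (u : state) (j : Z) : R := (len u j + len u (j + 1)%Z) / 2.
Definition momentum (u : state) (j : Z) : R := vel u j * mean_len u j.

(** The tangential part of the scheme loses a derivative: the rate of
    [len_error] contains a difference quotient of [psi]. By the equation for the
    velocity this difference quotient is the time derivative of [vel_error] up
    to harmless terms, so that it disappears from the rate of this corrected
    quantity. *)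
Definition corrected_len (r : reference) (u : state) (j : Z) : R :=
  len_error r u j + (momentum u j * vel_error r u j +
                     momentum u (j - 1)%Z * vel_error r u (j - 1)%Z) / 2.

(** The weights make the coupling terms of size [psi vel_error / h] cancel. *)
Definition energy_density (r : reference) (u : state) (j : Z) : R :=
  (mean_len u j * vel_error r u j ^ 2 + len u j * psi u j ^ 2 +
   corrected_len r u j ^ 2) / 2.

Definition error_size (h : R) (r : reference) (u : state) (j : Z) : R :=
  Rabs (vel_error r u j) + Rabs (psi u j) + Rabs (corrected_len r u j) + h ^ 2.

Definition spread (w : Z -> R) (j : Z) : R := w (j - 1)%Z + w j + w (j + 1)%Z.

Let h (g : snapshot) (j : Z) : R := mesh_of g.
Let one (g : snapshot) (j : Z) : R := 1.
Let V g := ref_vel (ref_of g).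
Let Q g := ref_len (ref_of g).
Let om g := ref_om (ref_of g).
Let c g := ref_cos (ref_of g).
Let s g := ref_sin (ref_of g).
Let ps g := psi (state_of g).
Let v g := vel (state_of g).
Let q g := len (state_of g).
Let chi g := half_jump (state_of g).
Let S g := turn_sin (ref_of g) (state_of g).
Let C g := turn_cos (ref_of g) (state_of g).
Let W g := vel_error (ref_of g) (state_of g).
Let p g := len_error (ref_of g) (state_of g).
Let mq g := mean_len (state_of g).
Let mQ g (j : Z) : R := (Q g j + Q g (j + 1)%Z) / 2.
Let mo g := momentum (state_of g).
Let F g := corrected_len (ref_of g) (state_of g).
Let dps g := psi_rate (mesh_of g) (ref_of g) (state_of g).
Let dv g := vel_rate beta (mesh_of g) (ref_of g) (state_of g).
Let dq g := len_rate (mesh_of g) (ref_of g) (state_of g).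
Let w0 g := error_size (mesh_of g) (ref_of g) (state_of g).
(* Estimates lose a [spread] with each step to a neighbouring index. *)
Let w1 g := spread (w0 g).
Let w2 g := spread (w1 g).
Let w3 g := spread (w2 g).

(** Time derivatives of the quantities above along the scheme. *)
Definition dmean_len g (j : Z) : R := (dq g j + dq g (j + 1)%Z) / 2.
Definition dmomentum g (j : Z) : R := dv g j * mq g j + v g j * dmean_len g j.
Definition dvel_error g (j : Z) : R := dV_of g j - dv g j.
Definition dcorrected_len g (j : Z) : R :=
  (dQ_of g j - dq g j) +
  ((dmomentum g j * W g j + mo g j * dvel_error g j) +
   (dmomentum g (j - 1)%Z * W g (j - 1)%Z +
    mo g (j - 1)%Z * dvel_error g (j - 1)%Z)) / 2.
Definition denergy g (j : Z) : R :=
  (dmean_len g j * W g j ^ 2 + mq g j * (2 * W g j * dvel_error g j) +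
   (dq g j * ps g j ^ 2 + q g j * (2 * ps g j * dps g j)) +
   2 * F g j * dcorrected_len g j) / 2.

Definition energy_flux g (j : Z) : R :=
  ps g j * (V g (j - 1)%Z * c g (j - 1)%Z - v g (j - 1)%Z * C g (j - 1)%Z).

Notation "f << w" := (dom admissible w f) (at level 70).

Let h_pos g : admissible g -> 0 < mesh_of g <= 1.
Proof. now intros [H _]. Qed.

Let w0_pos g j : admissible g -> 0 <= w0 g j.
Proof.
  intros H; unfold w0, error_size.
  generalize (Rabs_pos (vel_error (ref_of g) (state_of g) j))
    (Rabs_pos (psi (state_of g) j)) (Rabs_pos (corrected_len (ref_of g) (state_of g) j))
    (pow2_ge_0 (mesh_of g)); lra.
Qed.

Let w1_pos g j : admissible g -> 0 <= w1 g j.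
Proof.
  intros H; unfold w1, spread.
  generalize (w0_pos g (j - 1)%Z H) (w0_pos g j H) (w0_pos g (j + 1)%Z H); lra.
Qed.

Let w2_pos g j : admissible g -> 0 <= w2 g j.
Proof.
  intros H; unfold w2, spread.
  generalize (w1_pos g (j - 1)%Z H) (w1_pos g j H) (w1_pos g (j + 1)%Z H); lra.
Qed.

Let dom_spread (f w : snapshot -> Z -> R) k :
  (forall g j, admissible g -> 0 <= w g j) -> (-1 <= k <= 1)%Z -> f << w ->
  (fun g j => f g (j + k)%Z) << (fun g => spread (w g)).
Proof.
  intros Hw Hk H; apply (dom_weaken _ (fun g j => w g (j + k)%Z)).
  - now apply dom_shift.
  - intros g j Hg; unfold spread.
    generalize (Hw g (j - 1)%Z Hg) (Hw g j Hg) (Hw g (j + 1)%Z Hg).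
    assert (E : (k = -1 \/ k = 0 \/ k = 1)%Z) by lia.
    destruct E as [-> |[-> | ->]];
      [replace (j + -1)%Z with (j - 1)%Z by lia | rewrite Z.add_0_r | ]; lra.
Qed.

Let dom_spread0 (f w : snapshot -> Z -> R) :
  (forall g j, admissible g -> 0 <= w g j) -> f << w ->
  f << (fun g => spread (w g)).
Proof.
  intros Hw H; apply dom_ext with (fun g j => f g (j + 0)%Z);
    [apply dom_spread; trivial; lia|]; intros; now rewrite Z.add_0_r.
Qed.

Let dom_shift1 (f : snapshot -> Z -> R) k :
  f << one -> (fun g j => f g (j + k)%Z) << one.
Proof. intros H; exact (dom_shift _ k _ _ H). Qed.

Let dom_div_h (f w : snapshot -> Z -> R) :
  f << (fun g j => mesh_of g * w g j) -> (fun g j => f g j / mesh_of g) << w.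
Proof.
  intros [K [HK H]]; exists K; split; trivial; intros g j Hg.
  generalize (h_pos g Hg); intros Hh; specialize (H g j Hg).
  unfold Rdiv; rewrite Rabs_mult, Rabs_inv, (Rabs_right (mesh_of g)) by lra.
  apply Rmult_le_reg_r with (mesh_of g); [lra|].
  rewrite Rmult_assoc, Rinv_l by lra; lra.
Qed.

Let V1 : V << one.
Proof. apply dom_le with M; trivial; unfold one; intros g j [_ [H _]].
  rewrite Rmult_1_r; apply H. Qed.

Let v1 : v << one.
Proof.
  apply dom_ext with (fun g j => V g j - W g j); [apply dom_minus; [exact V1|]|].
  - apply dom_le with 1; [lra|]; unfold one; intros g j [_ [_ [_ H]]].
    rewrite Rmult_1_r; apply H.
  - intros; unfold V, W, v, vel_error; ring.
Qed.

Let q_low g j : admissible g -> c0 / 2 <= q g j.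
Proof.
  intros [_ [Hb [_ Hc]]].
  generalize (close_len Hc j) (bounded_len Hb j); intros H1 H2.
  apply Rabs_le_between in H1; unfold q; lra.
Qed.

Let q1 : q << one.
Proof.
  apply dom_le with (M + c0 / 2); [lra|]; intros g j Hg; unfold one.
  generalize (q_low g j Hg); destruct Hg as [_ [Hb [_ Hc]]].
  generalize (close_len Hc j) (bounded_len Hb j); intros H1 H2 H3.
  apply Rabs_le_between in H1; unfold q in *; rewrite Rabs_right; lra.
Qed.

Let mq_low g j : admissible g -> c0 / 2 <= mq g j.
Proof.
  intros H; unfold mq, mean_len.
  generalize (q_low g j H) (q_low g (j + 1)%Z H); unfold q; lra.
Qed.

Let mq1 : mq << one.
Proof.
  apply dom_ext with (fun g j => / 2 * (q g j + q g (j + 1)%Z)).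
  - apply dom_scal, dom_plus; [exact q1|exact (dom_shift1 _ 1 q1)].
  - intros; unfold mq, mean_len, q; field.
Qed.

Let mQ_low g j : admissible g -> c0 <= mQ g j.
Proof.
  intros [_ [Hb _]]; unfold mQ, Q.
  generalize (bounded_len Hb j) (bounded_len Hb (j + 1)%Z); lra.
Qed.

Let om1 : om << one.
Proof. apply dom_le with M; trivial; unfold one; intros g j [_ [H _]].
  rewrite Rmult_1_r; apply H. Qed.

Let s_h : s << h.
Proof. apply dom_le with M; trivial; intros g j [_ [H _]]; apply H. Qed.

Let h_one (f : snapshot -> Z -> R) : f << h -> f << one.
Proof.
  intros H; apply dom_weaken with (1 := H); intros g j Hg.
  generalize (h_pos g Hg); unfold h, one; lra.
Qed.

Let h2_w0 (f : snapshot -> Z -> R) : f << (fun g j => mesh_of g ^ 2) -> f << w0.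
Proof.
  intros H; apply dom_weaken with (1 := H); intros g j Hg; unfold w0, error_size.
  generalize (Rabs_pos (vel_error (ref_of g) (state_of g) j))
    (Rabs_pos (psi (state_of g) j)) (Rabs_pos (corrected_len (ref_of g) (state_of g) j));
  lra.
Qed.

Let c1 : c << one.
Proof.
  apply dom_le with 1; [lra|]; unfold one, c; intros g j [_ [H _]].
  generalize (unit_turn H j); intros E.
  rewrite Rmult_1_r; apply Rabs_le_between.
  generalize (pow2_ge_0 (ref_sin (ref_of g) j)); split; nra.
Qed.

Let chi_h : chi << h.
Proof.
  apply dom_le with 1; [lra|]; intros g j [_ [_ [_ H]]]; unfold chi, half_jump, h.
  generalize (close_psi H j) (close_psi H (j + 1)%Z); intros H1 H2.
  apply Rabs_le_between in H1, H2; apply Rabs_le_between; lra.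
Qed.

Let psi_w0 : ps << w0.
Proof.
  apply dom_le with 1; [lra|]; intros g j Hg; unfold w0, error_size, ps.
  generalize (Rabs_pos (vel_error (ref_of g) (state_of g) j))
    (Rabs_pos (corrected_len (ref_of g) (state_of g) j)) (pow2_ge_0 (mesh_of g)); lra.
Qed.

Let W_w0 : W << w0.
Proof.
  apply dom_le with 1; [lra|]; intros g j Hg; unfold w0, error_size, W.
  generalize (Rabs_pos (psi (state_of g) j))
    (Rabs_pos (corrected_len (ref_of g) (state_of g) j)) (pow2_ge_0 (mesh_of g)); lra.
Qed.

Let F_w0 : F << w0.
Proof.
  apply dom_le with 1; [lra|]; intros g j Hg; unfold w0, error_size, F.
  generalize (Rabs_pos (psi (state_of g) j))
    (Rabs_pos (vel_error (ref_of g) (state_of g) j)) (pow2_ge_0 (mesh_of g)); lra.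
Qed.

Let up1 (f : snapshot -> Z -> R) : f << w0 -> f << w1.
Proof. exact (dom_spread0 f w0 w0_pos). Qed.

Let up2 (f : snapshot -> Z -> R) : f << w1 -> f << w2.
Proof. exact (dom_spread0 f w1 w1_pos). Qed.

Let up3 (f : snapshot -> Z -> R) : f << w2 -> f << w3.
Proof. exact (dom_spread0 f w2 w2_pos). Qed.

Let chi_w1 : chi << w1.
Proof.
  apply dom_ext with (fun g j => / 2 * (ps g (j + 1)%Z - ps g j)).
  - apply dom_scal, dom_minus; [apply (dom_spread ps w0 1 w0_pos); [lia|exact psi_w0]|].
    apply up1, psi_w0.
  - intros; unfold chi, half_jump, ps; field.
Qed.

(* [chi] is of order [h] and is also controlled by the errors, so that its square
   is [h] times an error: second order terms survive a division by [h]. *)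
Let chi_hw1 : (fun g j => chi g j ^ 2 / 2) << (fun g j => mesh_of g * w1 g j).
Proof.
  apply dom_ext with (fun g j => / 2 * (chi g j * chi g j)); [|intros; field].
  apply dom_scal, dom_mult with h w1; [exact chi_h|exact chi_w1|].
  intros; unfold h; lra.
Qed.

Let cosm_hw1 : (fun g j => cos (chi g j) - 1) << (fun g j => mesh_of g * w1 g j).
Proof.
  destruct chi_hw1 as [K [HK H]]; exists K; split; trivial; intros g j Hg.
  eapply Rle_trans; [apply cos_defect|]; eapply Rle_trans; [apply Rle_abs|].
  now apply H.
Qed.

Let chi_le1 g j : admissible g -> Rabs (chi g j) <= 1.
Proof.
  intros Hg; generalize (h_pos g Hg); intros Hh; destruct Hg as [_ [_ [_ H]]].
  unfold chi, half_jump.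
  generalize (close_psi H j) (close_psi H (j + 1)%Z); intros H1 H2.
  apply Rabs_le_between in H1, H2; apply Rabs_le_between; lra.
Qed.

Let sinm_hw1 : (fun g j => sin (chi g j) - chi g j) << (fun g j => mesh_of g * w1 g j).
Proof.
  destruct chi_hw1 as [K [HK H]]; exists K; split; trivial; intros g j Hg.
  eapply Rle_trans; [apply sin_defect; auto|]; eapply Rle_trans; [apply Rle_abs|].
  now apply H.
Qed.

Let sin_chi_of (w : snapshot -> Z -> R) : chi << w -> (fun g j => sin (chi g j)) << w.
Proof.
  intros [K [HK H]]; exists K; split; trivial; intros g j Hg.
  eapply Rle_trans; [apply bounded_sine|now apply H].
Qed.

Let cos_chi : (fun g j => cos (chi g j)) << one.
Proof.
  apply dom_le with 1; [lra|]; intros; unfold one.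
  rewrite Rmult_1_r; apply Rabs_le_between, COS_bound.
Qed.

Let S_h : S << h.
Proof.
  unfold S, turn_sin; apply dom_minus.
  - apply dom_mult with h one; [exact s_h|exact cos_chi|]; intros; unfold one; lra.
  - apply dom_mult1; [exact c1|]; apply sin_chi_of, chi_h.
Qed.

Let C1 : C << one.
Proof.
  unfold C, turn_cos; apply dom_plus.
  - apply dom_mult1; [exact c1|exact cos_chi].
  - apply dom_mult1; [apply h_one, s_h|]; apply h_one, sin_chi_of, chi_h.
Qed.

(** Rotating the discrete turning angle by [chi] gives back the exact one. *)
Let s_decomp g j : s g j = S g j * cos (chi g j) + C g j * sin (chi g j).
Proof.
  unfold S, C, turn_sin, turn_cos, s, chi.
  generalize (sin2_cos2 (half_jump (state_of g) j)); unfold Rsqr; intros E.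
  match goal with |- ?a = _ => transitivity (a * 1); [ring|rewrite <- E; ring] end.
Qed.

Let c_decomp g j : c g j = C g j * cos (chi g j) - S g j * sin (chi g j).
Proof.
  unfold S, C, turn_sin, turn_cos, c, chi.
  generalize (sin2_cos2 (half_jump (state_of g) j)); unfold Rsqr; intros E.
  match goal with |- ?a = _ => transitivity (a * 1); [ring|rewrite <- E; ring] end.
Qed.

Let sin_remainder :
  (fun g j => s g j - S g j - chi g j * C g j) << (fun g j => mesh_of g * w1 g j).
Proof.
  apply dom_ext with (fun g j => S g j * (cos (chi g j) - 1) +
                                 C g j * (sin (chi g j) - chi g j)).
  - apply dom_plus; apply dom_mult1.
    + apply h_one, S_h.
    + exact cosm_hw1.
    + exact C1.
    + exact sinm_hw1.
  - intros; rewrite s_decomp; ring.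
Qed.

Let cos_remainder :
  (fun g j => c g j - C g j) << (fun g j => mesh_of g * w1 g j).
Proof.
  apply dom_ext with (fun g j => C g j * (cos (chi g j) - 1) - S g j * sin (chi g j)).
  - apply dom_minus.
    + apply dom_mult1; [exact C1|exact cosm_hw1].
    + apply dom_mult with h w1; [exact S_h|apply sin_chi_of, chi_w1|].
      intros; unfold h; lra.
  - intros; rewrite c_decomp; ring.
Qed.

Let dq1 : dq << one.
Proof.
  assert (H : (fun g j => v g j * S g j / mesh_of g) << one).
  { apply dom_div_h; apply dom_weaken with h.
    - apply dom_mult1; [exact v1|exact S_h].
    - intros; unfold h, one; lra. }
  apply dom_ext with (fun g j => - (v g j * S g j / mesh_of g +
                        v g (j + -1)%Z * S g (j + -1)%Z / mesh_of g)).
  - apply dom_opp, dom_plus; [exact H|exact (dom_shift1 _ (-1) H)].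
  - intros g j Hg; generalize (h_pos g Hg); intros.
    unfold dq, len_rate, v, S, Z.sub; simpl; field; lra.
Qed.

Let dmq1 : dmean_len << one.
Proof.
  apply dom_ext with (fun g j => / 2 * (dq g j + dq g (j + 1)%Z)).
  - apply dom_scal, dom_plus; [exact dq1|exact (dom_shift1 _ 1 dq1)].
  - intros; unfold dmean_len; field.
Qed.

Let S_over_h : (fun g j => S g j / mesh_of g) << one.
Proof.
  apply dom_div_h; apply dom_weaken with (1 := S_h); intros; unfold h, one; lra.
Qed.

Let s_over_h : (fun g j => s g j / mesh_of g) << one.
Proof.
  apply dom_div_h; apply dom_weaken with (1 := s_h); intros; unfold h, one; lra.
Qed.

Let dv1 : dv << one.
Proof.
  apply dom_ext with (fun g j => - beta * v g j + 2 * (S g j / mesh_of g) / mq g j).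
  - apply dom_plus; [apply dom_scal; exact v1|].
    apply dom_div with (c0 / 2); [lra|exact mq_low|].
    apply dom_scal; exact S_over_h.
  - intros g j Hg; generalize (h_pos g Hg) (mq_low g j Hg); intros.
    unfold dv, vel_rate, v, S, mq, mean_len in *; field; lra.
Qed.

Let dmo1 : dmomentum << one.
Proof.
  unfold dmomentum; apply dom_plus; apply dom_mult1.
  - exact dv1.
  - exact mq1.
  - exact v1.
  - exact dmq1.
Qed.

Let mo1 : mo << one.
Proof. unfold mo, momentum; apply dom_mult1; [exact v1|exact mq1]. Qed.

Let p_w1 : p << w1.
Proof.
  assert (H : (fun g j => mo g j * W g j) << w0) by (apply dom_mult1; [exact mo1|exact W_w0]).
  apply dom_ext with (fun g j => F g j - / 2 * (mo g j * W g j +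
             mo g (j + -1)%Z * W g (j + -1)%Z)).
  - apply dom_minus; [apply up1, F_w0|]; apply dom_scal, dom_plus; [apply up1, H|].
    exact (dom_spread _ w0 (-1) w0_pos ltac:(lia) H).
  - intros; unfold F, corrected_len, p, mo, W, Z.sub; simpl; field.
Qed.

Let tr1 g j := dV_of g j + beta * V g j -
     4 / (Q g j + Q g (j + 1)%Z) * (s g j / mesh_of g).
Let tr2 g j := Q g j * om g j -
     (V g j * c g j - V g (j - 1)%Z * c g (j - 1)%Z) / mesh_of g.
Let tr3 g j := dQ_of g j +
     (V g j * s g j + V g (j - 1)%Z * s g (j - 1)%Z) / mesh_of g.

Let tr1_w0 : tr1 << w0.
Proof. apply h2_w0; exists M; split; trivial; intros g j [_ [_ [H _]]]; apply H. Qed.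
Let tr2_w0 : tr2 << w0.
Proof. apply h2_w0; exists M; split; trivial; intros g j [_ [_ [H _]]]; apply H. Qed.
Let tr3_w0 : tr3 << w0.
Proof. apply h2_w0; exists M; split; trivial; intros g j [_ [_ [H _]]]; apply H. Qed.

Let R1 g j := 2 * (s g j / mesh_of g) * ((mq g j - mQ g j) / mQ g j) + mq g j * tr1 g j.

Let R1_w2 : R1 << w2.
Proof.
  unfold R1; apply dom_plus; apply dom_mult1.
  - apply dom_scal; exact s_over_h.
  - apply dom_div with c0; [trivial|exact mQ_low|].
    apply dom_ext with (fun g j => - / 2 * (p g j + p g (j + 1)%Z)).
    + apply dom_scal, dom_plus; [apply up2, p_w1|].
      exact (dom_spread _ w1 1 w1_pos ltac:(lia) p_w1).
    + intros; unfold mq, mQ, mean_len, p, len_error, Q; field.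
  - exact mq1.
  - apply up2, up1, tr1_w0.
Qed.

Let W_equation g j : admissible g ->
  mq g j * dvel_error g j =
  - beta * (mq g j * W g j) + 2 * (s g j - S g j) / mesh_of g + R1 g j.
Proof.
  intros Hg; generalize (h_pos g Hg) (mq_low g j Hg) (mQ_low g j Hg); intros.
  unfold R1, tr1, dvel_error, dv, vel_rate, W, vel_error, V, S, s, mQ, mq, mean_len in *.
  fold (Q g) in *.
  field; repeat split; lra.
Qed.

Let psi_equation g j : admissible g ->
  q g j * dps g j = - p g j * om g j + tr2 g j +
  ((V g j * c g j - v g j * C g j) -
   (V g (j - 1)%Z * c g (j - 1)%Z - v g (j - 1)%Z * C g (j - 1)%Z)) / mesh_of g.
Proof.
  intros Hg; generalize (h_pos g Hg) (q_low g j Hg); intros.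
  unfold dps, psi_rate, tr2, p, len_error, q, Q, om, v, V, C, c in *.
  field; lra.
Qed.

(* The contribution of one node to the rate of [corrected_len]: by [W_equation] the
   singular part [(s - S) / h] of the length equation is cancelled by that of the
   correction. *)
Let G g j := - (W g j * (s g j / mesh_of g)) + / 2 * (dmomentum g j * W g j)
  - / 2 * beta * (v g j * (mq g j * W g j)) + / 2 * (v g j * R1 g j).

Let G_w2 : G << w2.
Proof.
  assert (HW : W << w2) by apply up2, up1, W_w0.
  unfold G; apply dom_plus; [apply dom_minus; [apply dom_plus|]|].
  - apply dom_opp, dom_ext with (fun g j => s g j / mesh_of g * W g j);
      [|intros; ring].
    apply dom_mult1; [exact s_over_h|exact HW].
  - apply dom_scal, dom_mult1; [exact dmo1|exact HW].
  - apply dom_scal, dom_mult1; [exact v1|apply dom_mult1; [exact mq1|exact HW]].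
  - apply dom_scal, dom_mult1; [exact v1|exact R1_w2].
Qed.

Let G_def g j : admissible g ->
  - (V g j * s g j - v g j * S g j) / mesh_of g +
  (dmomentum g j * W g j + mo g j * dvel_error g j) / 2 = G g j.
Proof.
  intros Hg; generalize (h_pos g Hg); intros.
  replace (mo g j * dvel_error g j) with (v g j * (mq g j * dvel_error g j))
    by (unfold mo, momentum, v, mq; ring).
  rewrite W_equation by trivial; unfold G.
  replace (V g j) with (W g j + v g j) by (unfold W, vel_error, v, V; ring).
  field; lra.
Qed.

Let dF_w3 : dcorrected_len << w3.
Proof.
  apply dom_ext with (fun g j => tr3 g j + (G g j + G g (j + -1)%Z)).
  - apply dom_plus; [apply up3, up2, up1, tr3_w0|].
    apply dom_plus; [apply up3, G_w2|].
    exact (dom_spread _ w2 (-1) w2_pos ltac:(lia) G_w2).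
  - intros g j Hg; generalize (h_pos g Hg); intros.
    change (j + -1)%Z with (j - 1)%Z.
    rewrite <- !G_def by trivial.
    unfold dcorrected_len, tr3, dq, len_rate, V, v, s, S; field; lra.
Qed.

(** The critical terms are those of size [psi vel_error / h]. The curvature term
    of the velocity equation is [2 W (s - S) / h], which is [2 W chi C / h] to
    first order; summation by parts, the source of the flux, turns the velocity
    difference of the angle equation into [- 2 W chi C / h]. They cancel because
    the derivative of the sine is the cosine; all the other terms are quadratic
    in the errors. *)
Lemma energy_rate :
  (fun g j => denergy g j - (energy_flux g (j + 1)%Z - energy_flux g j) / mesh_of g)
  << (fun g j => w3 g j ^ 2).
Proof.
  assert (Hsq : forall f f', f << w3 -> f' << w3 ->
            (fun g j => f g j * f' g j) << (fun g j => w3 g j ^ 2)).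
  { intros f f' Hf Hf'; apply dom_mult with w3 w3; trivial; intros; lra. }
  assert (HW : W << w3) by apply up3, up2, up1, W_w0.
  assert (Hp : ps << w3) by apply up3, up2, up1, psi_w0.
  assert (HF : F << w3) by apply up3, up2, up1, F_w0.
  assert (Hb : forall f f' f'', f << one -> f' << w3 -> f'' << w3 ->
            (fun g j => f g j * f' g j * f'' g j) << (fun g j => w3 g j ^ 2)).
  { intros f f' f'' Hf Hf' Hf''; apply Hsq; trivial; now apply dom_mult1. }
  apply dom_ext with (fun g j =>
    / 2 * (dmean_len g j * W g j * W g j) + / 2 * (dq g j * ps g j * ps g j)
    - beta * (mq g j * W g j * W g j) + W g j * R1 g j - om g j * p g j * ps g j
    + ps g j * tr2 g j + F g j * dcorrected_len g j
    + 2 * (W g j * ((s g j - S g j - chi g j * C g j) / mesh_of g)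
           - V g j * chi g j * ((c g j - C g j) / mesh_of g))).
  - repeat first [apply dom_plus | apply dom_opp | apply dom_scal].
    + apply Hb; [exact dmq1|exact HW|exact HW].
    + apply Hb; [exact dq1|exact Hp|exact Hp].
    + apply Hb; [exact mq1|exact HW|exact HW].
    + apply Hsq; [exact HW|apply up3, R1_w2].
    + apply Hb; [exact om1|apply up3, up2, p_w1|exact Hp].
    + apply Hsq; [exact Hp|apply up3, up2, up1, tr2_w0].
    + apply Hsq; [exact HF|exact dF_w3].
    + apply Hsq; [exact HW|apply up3, up2, dom_div_h, sin_remainder].
    + apply Hb; [exact V1|apply up3, up2, chi_w1|].
      apply up3, up2, dom_div_h, cos_remainder.
  - intros g j Hg; generalize (h_pos g Hg); intros Hh.
    unfold denergy, energy_flux.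
    replace (mq g j * (2 * W g j * dvel_error g j))
      with (2 * W g j * (mq g j * dvel_error g j)) by ring.
    replace (q g j * (2 * ps g j * dps g j)) with (2 * ps g j * (q g j * dps g j)) by ring.
    rewrite W_equation, psi_equation by trivial.
    replace (j + 1 - 1)%Z with j by lia.
    replace (ps g (j + 1)%Z) with (ps g j + 2 * chi g j)
      by (unfold chi, half_jump, ps; field).
    replace (v g j) with (V g j - W g j) by (unfold W, vel_error, v, V; ring).
    field; lra.
Qed.

End Energy.

(** * Stability of the scheme *)

Definition periodic_reference (J : nat) (r : reference) : Prop :=
  zperiodic J (ref_vel r) /\ zperiodic J (ref_len r) /\ zperiodic J (ref_om r) /\
  zperiodic J (ref_cos r) /\ zperiodic J (ref_sin r).

Definition periodic_state (J : nat) (u : state) : Prop :=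
  zperiodic J (psi u) /\ zperiodic J (vel u) /\ zperiodic J (len u).

Set Implicit Arguments.
Record reference_path (beta M c0 T : R) (J : nat) (r : R -> reference)
  (dV dQ : R -> Z -> R) : Prop := {
  path_bounded : forall t, bounded_reference M c0 (mesh J) (r t);
  path_consistent : forall t, 0 < t < T ->
    consistent beta M (mesh J) (r t) (dV t) (dQ t);
  path_dV : forall j t, 0 < t < T ->
    is_derive (fun s => ref_vel (r s) j) t (dV t j);
  path_dQ : forall j t, 0 < t < T ->
    is_derive (fun s => ref_len (r s) j) t (dQ t j);
  path_vel_cont : forall j t, continuous (fun s => ref_vel (r s) j) t;
  path_len_cont : forall j t, continuous (fun s => ref_len (r s) j) t;
  path_om_cont : forall j t, continuous (fun s => ref_om (r s) j) t;
  path_cos_cont : forall j t, continuous (fun s => ref_cos (r s) j) t;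
  path_sin_cont : forall j t, continuous (fun s => ref_sin (r s) j) t;
  path_periodic : forall t, periodic_reference J (r t)
}.
Unset Implicit Arguments.

Definition evolves (beta h : R) (r : R -> reference) (u : R -> state) (t : R) : Prop :=
  forall j,
    is_derive (fun s => psi (u s) j) t (psi_rate h (r t) (u t) j) /\
    is_derive (fun s => vel (u s) j) t (vel_rate beta h (r t) (u t) j) /\
    is_derive (fun s => len (u s) j) t (len_rate h (r t) (u t) j).

Set Implicit Arguments.
(** The equations are only required while the state is close to the reference;
    outside of that region the turning angle of the discrete curve may differ
    from the one computed from [psi], and a truncated equation may be solved. *)
Record state_path (beta M c0 T : R) (J : nat) (r : R -> reference)
  (u : R -> state) : Prop := {
  state_psi_cont : forall j t, continuous (fun s => psi (u s) j) t;
  state_vel_cont : forall j t, continuous (fun s => vel (u s) j) t;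
  state_len_cont : forall j t, continuous (fun s => len (u s) j) t;
  state_periodic : forall t, periodic_state J (u t);
  state_psi_init : forall j, psi (u 0) j = 0;
  state_vel_init : forall j, vel (u 0) j = ref_vel (r 0) j;
  state_len_init : forall j, Rabs (ref_len (r 0) j - len (u 0) j) <= M * mesh J ^ 2;
  state_evolves : forall t, 0 < t < T -> near_reference c0 (mesh J) (r t) (u t) ->
    evolves beta (mesh J) r u t
}.
Unset Implicit Arguments.

Definition square_error (r : reference) (u : state) (j : Z) : R :=
  vel_error r u j ^ 2 + psi u j ^ 2 + len_error r u j ^ 2.

Lemma square_spread_le (w : Z -> R) j :
  spread w j ^ 2 <= 3 * w (j - 1)%Z ^ 2 + 3 * w j ^ 2 + 3 * w (j + 1)%Z ^ 2.
Proof.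
  unfold spread.
  generalize (pow2_ge_0 (w (j - 1)%Z - w j)) (pow2_ge_0 (w (j - 1)%Z - w (j + 1)%Z))
    (pow2_ge_0 (w j - w (j + 1)%Z)); nra.
Qed.

Lemma zperiodic_spread J (w : Z -> R) : zperiodic J w -> zperiodic J (spread w).
Proof.
  intros H j; unfold spread.
  replace (j + Z.of_nat J - 1)%Z with (j - 1 + Z.of_nat J)%Z by lia.
  replace (j + Z.of_nat J + 1)%Z with (j + 1 + Z.of_nat J)%Z by lia.
  now rewrite !H.
Qed.

Lemma gsum_spread J (w : Z -> R) :
  zperiodic J w -> gsum J (fun j => spread w j ^ 2) <= 9 * gsum J (fun j => w j ^ 2).
Proof.
  intros H.
  apply Rle_trans with (gsum J (fun j => 3 * w (j - 1)%Z ^ 2 + 3 * w j ^ 2 +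
                                         3 * w (j + 1)%Z ^ 2)).
  - apply gsum_le; intros j; apply square_spread_le.
  - rewrite !gsum_plus, !gsum_scal.
    assert (Hp : zperiodic J (fun j => w j ^ 2)) by (intros j; now rewrite H).
    rewrite (gsum_shift_back J (fun j => w j ^ 2) Hp), (gsum_shift J (fun j => w j ^ 2) Hp).
    lra.
Qed.

Lemma zperiodic_shift {U} J (f : Z -> U) k j :
  zperiodic J f -> f (j + Z.of_nat J + k)%Z = f (j + k)%Z.
Proof. intros H; rewrite <- (H (j + k)%Z); f_equal; lia. Qed.

Section Periodicity.
Variables (J : nat) (r : reference) (u : state).
Hypotheses (Hr : periodic_reference J r) (Hu : periodic_state J u).

Lemma zperiodic_vel_error : zperiodic J (vel_error r u).
Proof.
  destruct Hr as [H1 _], Hu as [_ [H2 _]]; intros j; unfold vel_error.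
  now rewrite H1, H2.
Qed.

Lemma zperiodic_len_error : zperiodic J (len_error r u).
Proof.
  destruct Hr as [_ [H1 _]], Hu as [_ [_ H2]]; intros j; unfold len_error.
  now rewrite H1, H2.
Qed.

Lemma zperiodic_momentum : zperiodic J (momentum u).
Proof.
  destruct Hu as [_ [H1 H2]]; intros j; unfold momentum, mean_len.
  now rewrite H1, (zperiodic_shift J _ 1 j H2), H2.
Qed.

Lemma zperiodic_corrected_len : zperiodic J (corrected_len r u).
Proof.
  intros j; unfold corrected_len, Z.sub.
  rewrite !(zperiodic_shift J _ _ j zperiodic_momentum),
    !(zperiodic_shift J _ _ j zperiodic_vel_error).
  now rewrite zperiodic_len_error, zperiodic_momentum, zperiodic_vel_error.
Qed.

Lemma zperiodic_energy_flux h dV dQ :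
  zperiodic J (energy_flux (Snapshot h r dV dQ u)).
Proof.
  destruct Hr as [HV [_ [_ [Hc Hs]]]], Hu as [Hp [Hv _]].
  intros j; unfold energy_flux; simpl.
  replace (j + Z.of_nat J - 1)%Z with (j - 1 + Z.of_nat J)%Z by lia.
  unfold turn_cos, half_jump.
  replace (j - 1 + Z.of_nat J + 1)%Z with (j - 1 + 1 + Z.of_nat J)%Z by lia.
  now rewrite HV, Hc, Hs, Hv, !Hp.
Qed.

Lemma zperiodic_error_size h : zperiodic J (error_size h r u).
Proof.
  destruct Hu as [Hp _]; intros j; unfold error_size.
  now rewrite Hp, zperiodic_vel_error, zperiodic_corrected_len.
Qed.

End Periodicity.

Lemma energy_derive beta h r dV dQ u t j :
  (forall j, is_derive (fun s => ref_vel (r s) j) t (dV t j)) ->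
  (forall j, is_derive (fun s => ref_len (r s) j) t (dQ t j)) ->
  evolves beta h r u t ->
  is_derive (fun s => energy_density (r s) (u s) j) t
    (denergy beta (Snapshot h (r t) (dV t) (dQ t) (u t)) j).
Proof.
  intros HV HQ Hu.
  set (g := Snapshot h (r t) (dV t) (dQ t) (u t)).
  assert (Hmq : forall j, is_derive (fun s => mean_len (u s) j) t (dmean_len g j)).
  { intros i; destruct (Hu i) as [_ [_ H1]], (Hu (i + 1)%Z) as [_ [_ H2]].
    unfold mean_len; eapply is_derive_eq; [repeat derive_step; lra|].
    unfold dmean_len; simpl; field. }
  assert (Hmo : forall j, is_derive (fun s => momentum (u s) j) t (dmomentum beta g j)).
  { intros i; destruct (Hu i) as [_ [H1 _]]; specialize (Hmq i).
    unfold momentum; eapply is_derive_eq; [repeat derive_step|].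
    unfold dmomentum; simpl; ring. }
  assert (HW : forall j, is_derive (fun s => vel_error (r s) (u s) j) t
                           (dvel_error beta g j)).
  { intros i; destruct (Hu i) as [_ [H1 _]]; specialize (HV i).
    unfold vel_error; eapply is_derive_eq; [repeat derive_step|].
    unfold dvel_error; simpl; ring. }
  assert (HF : is_derive (fun s => corrected_len (r s) (u s) j) t
                 (dcorrected_len beta g j)).
  { destruct (Hu j) as [_ [_ H1]]; specialize (HQ j).
    generalize (Hmo j) (Hmo (j - 1)%Z) (HW j) (HW (j - 1)%Z); intros M1 M2 W1 W2.
    unfold corrected_len, len_error; eapply is_derive_eq; [repeat derive_step; lra|].
    unfold dcorrected_len; simpl; field. }
  destruct (Hu j) as [H1 [_ H2]]; specialize (Hmq j); specialize (HW j).
  apply is_derive_ext with (fun s =>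
     (mean_len (u s) j * (vel_error (r s) (u s) j * vel_error (r s) (u s) j) +
      len (u s) j * (psi (u s) j * psi (u s) j) +
      corrected_len (r s) (u s) j * corrected_len (r s) (u s) j) / 2).
  { intros s; unfold energy_density; simpl; field. }
  eapply is_derive_eq; [repeat derive_step; lra|].
  unfold denergy; simpl; field.
Qed.

Lemma square_sum4 a b c d : (a + b + c + d) ^ 2 <= 4 * (a ^ 2 + b ^ 2 + c ^ 2 + d ^ 2).
Proof.
  generalize (pow2_ge_0 (a - b)) (pow2_ge_0 (a - c)) (pow2_ge_0 (a - d))
    (pow2_ge_0 (b - c)) (pow2_ge_0 (b - d)) (pow2_ge_0 (c - d)); nra.
Qed.

Lemma Rabs_sqr x : Rabs x ^ 2 = x ^ 2.
Proof. now rewrite pow2_abs. Qed.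

Lemma mesh_pos J : (0 < J)%nat -> 0 < mesh J.
Proof. intros; apply Rinv_0_lt_compat, lt_0_INR; lia. Qed.

Lemma INR_mesh J : (0 < J)%nat -> INR J * mesh J = 1.
Proof. intros; unfold mesh; apply Rinv_r, not_0_INR; lia. Qed.

Ltac path_cont Hr Hu :=
  repeat first [
    lazymatch goal with
    | |- continuous (fun s => ref_vel _ _) _ => apply (path_vel_cont Hr)
    | |- continuous (fun s => ref_len _ _) _ => apply (path_len_cont Hr)
    | |- continuous (fun s => ref_om _ _) _ => apply (path_om_cont Hr)
    | |- continuous (fun s => ref_cos _ _) _ => apply (path_cos_cont Hr)
    | |- continuous (fun s => ref_sin _ _) _ => apply (path_sin_cont Hr)
    | |- continuous (fun s => psi _ _) _ => apply (state_psi_cont Hu)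
    | |- continuous (fun s => vel _ _) _ => apply (state_vel_cont Hu)
    | |- continuous (fun s => len _ _) _ => apply (state_len_cont Hu)
    end
  | cont_step ].

Section Stability.
Variables (beta M c0 T : R).
Hypotheses (HM : 0 <= M) (Hc0 : 0 < c0) (HT : 0 < T).

Let coer := Rmin (c0 / 2) 1 / 2.

Let coer_pos : 0 < coer.
Proof. unfold coer; apply Rmin_case; lra. Qed.

Lemma len_bounds h r u j :
  bounded_reference M c0 h r -> near_reference c0 h r u -> c0 / 2 <= len u j <= M + c0 / 2.
Proof.
  intros Hb Hc; generalize (bounded_len Hb j) (close_len Hc j).
  intros H1 H2; apply Rabs_le_between in H2; lra.
Qed.

Lemma vel_bound h r u j :
  bounded_reference M c0 h r -> near_reference c0 h r u -> Rabs (vel u j) <= M + 1.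
Proof.
  intros Hb Hc; generalize (bounded_vel Hb j) (close_vel Hc j).
  intros H1 H2; apply Rabs_le_between in H1, H2; apply Rabs_le_between; lra.
Qed.

Lemma energy_coercive h r u j :
  bounded_reference M c0 h r -> near_reference c0 h r u ->
  coer * (vel_error r u j ^ 2 + psi u j ^ 2 + corrected_len r u j ^ 2)
  <= energy_density r u j.
Proof.
  intros Hb Hc; unfold energy_density, mean_len.
  generalize (len_bounds _ _ _ j Hb Hc) (len_bounds _ _ _ (j + 1)%Z Hb Hc); intros H1 H2.
  assert (Hm : Rmin (c0 / 2) 1 <= c0 / 2 /\ Rmin (c0 / 2) 1 <= 1)
    by (split; [apply Rmin_l|apply Rmin_r]).
  unfold coer; set (m := Rmin (c0 / 2) 1) in *.
  generalize (pow2_ge_0 (vel_error r u j)) (pow2_ge_0 (psi u j))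
    (pow2_ge_0 (corrected_len r u j)); intros; nra.
Qed.

Lemma error_size_square h r u j :
  bounded_reference M c0 h r -> near_reference c0 h r u ->
  error_size h r u j ^ 2 <= 4 / coer * energy_density r u j + 4 * h ^ 4.
Proof.
  intros Hb Hc; unfold error_size.
  eapply Rle_trans; [apply square_sum4|]; rewrite !Rabs_sqr.
  generalize (energy_coercive h r u j Hb Hc); intros H.
  replace ((h ^ 2) ^ 2) with (h ^ 4) by ring.
  rewrite (Rmult_plus_distr_l 4 (_ + _ + _)).
  apply Rplus_le_compat_r.
  apply (Rmult_le_reg_l (coer / 4)); [lra|].
  replace (coer / 4 * (4 / coer * energy_density r u j)) with (energy_density r u j)
    by (field; lra).
  lra.
Qed.

(** The correction of the length error is a bounded multiple of velocity errors,
    which the energy controls. *)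
Lemma square_error_le_energy :
  exists K, 0 <= K /\ forall J h r u,
    bounded_reference M c0 h r -> near_reference c0 h r u ->
    periodic_reference J r -> periodic_state J u ->
    gsum J (square_error r u) <= K * gsum J (energy_density r u).
Proof.
  set (m := (M + 1) * (M + c0 / 2)).
  exists ((3 + 3 * m ^ 2) / coer); split.
  { left; apply Rdiv_lt_0_compat; trivial; generalize (pow2_ge_0 m); lra. }
  intros J h r u Hb Hc Hr Hu.
  assert (Hmo : forall j, Rabs (momentum u j) <= m).
  { intros j; unfold momentum, m; rewrite Rabs_mult.
    apply Rmult_le_compat; try apply Rabs_pos; [eapply vel_bound; eauto|].
    unfold mean_len.
    generalize (len_bounds _ _ _ j Hb Hc) (len_bounds _ _ _ (j + 1)%Z Hb Hc); intros.
    rewrite Rabs_right; lra. }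
  set (S j := vel_error r u j ^ 2 + psi u j ^ 2 + corrected_len r u j ^ 2).
  assert (HS : gsum J S <= / coer * gsum J (energy_density r u)).
  { rewrite <- gsum_scal; apply gsum_le; intros j.
    generalize (energy_coercive h r u j Hb Hc); intros H.
    apply (Rmult_le_reg_l coer); [trivial|].
    replace (coer * (/ coer * energy_density r u j)) with (energy_density r u j)
      by (field; lra).
    exact H. }
  apply Rle_trans with ((3 + 3 * m ^ 2) * gsum J S).
  - assert (HWp : zperiodic J (fun j => vel_error r u j ^ 2)).
    { intros j; now rewrite (zperiodic_vel_error J r u Hr Hu). }
    apply Rle_trans with
      (gsum J (fun j => (3 + 2 * m ^ 2) * S j + m ^ 2 * vel_error r u (j - 1)%Z ^ 2)).
    + apply gsum_le; intros j; unfold square_error, S.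
      replace (len_error r u j) with (corrected_len r u j -
        (momentum u j * vel_error r u j +
                     momentum u (j - 1)%Z * vel_error r u (j - 1)%Z) / 2)
        by (unfold corrected_len; ring).
      assert (Hsq : forall i, (momentum u i * vel_error r u i) ^ 2
                              <= m ^ 2 * vel_error r u i ^ 2).
      { intros i; rewrite Rpow_mult_distr; apply Rmult_le_compat_r; [apply pow2_ge_0|].
        rewrite <- Rabs_sqr; apply pow_incr; split; [apply Rabs_pos|trivial]. }
      generalize (Hsq j) (Hsq (j - 1)%Z).
      set (a := momentum u j * vel_error r u j).
      set (b := momentum u (j - 1)%Z * vel_error r u (j - 1)%Z).
      set (F := corrected_len r u j); intros H1 H2.
      generalize (pow2_ge_0 m) (pow2_ge_0 (psi u j)) (pow2_ge_0 F)
        (pow2_ge_0 (vel_error r u j)); intros.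
      assert (Hn4 : (F - (a + b) / 2) ^ 2 <= 2 * F ^ 2 + a ^ 2 + b ^ 2).
      { generalize (pow2_ge_0 (F + (a + b) / 2)) (pow2_ge_0 (a - b)); nra. }
      assert (Hn5 : 0 <= m ^ 2 * psi u j ^ 2) by nra.
      assert (Hn6 : 0 <= m ^ 2 * F ^ 2) by nra.
      assert (Hn7 : 0 <= m ^ 2 * vel_error r u j ^ 2) by nra.
      lra.
    + rewrite gsum_plus, !gsum_scal, (gsum_shift_back J (fun j => vel_error r u j ^ 2))
        by trivial.
      assert (H : gsum J (fun j => vel_error r u j ^ 2) <= gsum J S).
      { apply gsum_le; intros j; unfold S.
        generalize (pow2_ge_0 (psi u j)) (pow2_ge_0 (corrected_len r u j)); lra. }
      generalize (pow2_ge_0 m); intros; nra.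
  - unfold Rdiv; rewrite Rmult_assoc; apply Rmult_le_compat_l; trivial.
    generalize (pow2_ge_0 m); lra.
Qed.

(** Gronwall's inequality for the summed energy: the flux telescopes over a
    period, and the [J] squared consistency errors, of size [h ^ 4] each, add up
    to [O(h ^ 3)]. *)
Lemma energy_growth :
  exists K, 0 <= K /\ forall J r dV dQ u t,
    (0 < J)%nat -> mesh J <= 1 ->
    reference_path beta M c0 T J r dV dQ -> state_path beta M c0 T J r u ->
    0 <= t <= T -> (forall s, 0 <= s <= t -> near_reference c0 (mesh J) (r s) (u s)) ->
    gsum J (energy_density (r t) (u t)) <= K * mesh J ^ 3.
Proof.
  destruct (energy_rate beta M c0 HM Hc0) as [K0 [HK0 Hrate]].
  (* [729] is [9 ^ 3]: each of the three spreads costs a factor [9] *)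
  set (A := K0 * 729 * (4 / coer)).
  set (B := K0 * 729 * 4).
  assert (HA : 0 <= A).
  { unfold A; apply Rmult_le_pos; [lra|]; left; apply Rdiv_lt_0_compat; lra. }
  assert (HB : 0 <= B) by (unfold B; lra).
  exists ((M ^ 2 + B * T) * exp (A * T)).
  assert (Hexp : forall s, 0 < exp s) by (intros; apply exp_pos).
  assert (HBT : 0 <= M ^ 2 + B * T).
  { generalize (pow2_ge_0 M) (Rmult_le_pos B T HB); lra. }
  split; [apply Rmult_le_pos; trivial; left; trivial|].
  intros J r dV dQ u t HJ Hh1 Hr Hu Ht Hc.
  set (h := mesh J) in *.
  assert (Hh : 0 < h) by now apply mesh_pos.
  assert (Hh3 : 0 < h ^ 3) by (apply pow_lt; lra).
  set (E := fun s => gsum J (energy_density (r s) (u s))).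
  set (g := fun s => Snapshot h (r s) (dV s) (dQ s) (u s)).
  assert (HE : E t <= (E 0 + B * h ^ 3 * t) * exp (A * t)).
  { apply (gronwall E (fun s => gsum J (denergy beta (g s)))); try lra.
    - apply Rmult_le_pos; lra.
    - intros s _; unfold E, energy_density; apply gsum_continuous; intros j.
      unfold corrected_len, momentum, mean_len, vel_error, len_error.
      path_cont Hr Hu; lra.
    - intros s Hs; apply (gsum_derive J (fun j s => energy_density (r s) (u s) j)
                            (fun j s => denergy beta (g s) j)).
      intros j; apply energy_derive.
      + intros i; apply (path_dV Hr); lra.
      + intros i; apply (path_dQ Hr); lra.
      + apply (state_evolves Hu); [lra|apply Hc; lra].
    - intros s Hs.
      assert (Had : admissible beta M c0 (g s)).
      { split; [simpl; lra|split; [|split]]; simpl.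
        - apply (path_bounded Hr).
        - apply (path_consistent Hr); lra.
        - apply Hc; lra. }
      generalize (path_periodic Hr s)
        (state_periodic Hu s); intros Pr Pu.
      set (w0 := error_size h (r s) (u s)).
      assert (P0 : zperiodic J w0) by now apply zperiodic_error_size.
      generalize (zperiodic_spread J _ P0); intros P1.
      generalize (zperiodic_spread J _ P1); intros P2.
      apply Rle_trans with
        (gsum J (fun j => / h * energy_flux (g s) (j + 1)%Z +
                  - / h * energy_flux (g s) j +
                  K0 * (spread (spread (spread w0)) j) ^ 2)).
      { apply gsum_le; intros j; specialize (Hrate (g s) j Had); simpl in Hrate.
        apply Rabs_le_between, proj2 in Hrate.
        unfold Rdiv in Hrate; change (mesh_of (g s)) with h in *.
        unfold w0; simpl; lra. }
      rewrite !gsum_plus, !gsum_scal.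
      rewrite (gsum_shift J (energy_flux (g s))) by now apply zperiodic_energy_flux.
      assert (H0 : gsum J (fun j => w0 j ^ 2) <= 4 / coer * E s + 4 * h ^ 3).
      { apply Rle_trans with (gsum J (fun j => 4 / coer * energy_density (r s) (u s) j
                                               + 4 * h ^ 4)).
        - apply gsum_le; intros j; apply error_size_square.
          + apply (path_bounded Hr).
          + apply Hc; lra.
        - rewrite gsum_plus, gsum_scal, gsum_const; fold (E s).
          replace (INR J * (4 * h ^ 4)) with (4 * (INR J * h) * h ^ 3) by ring.
          unfold h at 1; rewrite INR_mesh by trivial; lra. }
      generalize (gsum_spread J _ P0) (gsum_spread J _ P1) (gsum_spread J _ P2).
      intros G0 G1 G2.
      assert (G : gsum J (fun j => spread (spread (spread w0)) j ^ 2)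
                  <= 729 * (4 / coer * E s + 4 * h ^ 3)) by lra.
      apply (Rmult_le_compat_l K0) in G; trivial.
      change (gsum J (fun j => energy_flux (g s) j)) with (gsum J (energy_flux (g s))).
      unfold A, B; lra. }
  assert (HE0 : E 0 <= M ^ 2 * h ^ 3).
  { apply Rle_trans with (gsum J (fun _ => M ^ 2 * h ^ 4)).
    - apply gsum_le; intros j; unfold energy_density, corrected_len, vel_error.
      rewrite !(state_vel_init Hu), (state_psi_init Hu).
      rewrite !Rminus_diag, !Rmult_0_r.
      assert (H : len_error (r 0) (u 0) j ^ 2 <= M ^ 2 * h ^ 4).
      { replace (M ^ 2 * h ^ 4) with ((M * h ^ 2) ^ 2) by ring.
        rewrite <- Rabs_sqr; apply pow_incr; split; [apply Rabs_pos|].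
        apply (state_len_init Hu). }
      generalize (pow2_ge_0 (len_error (r 0) (u 0) j)); intros.
      replace (len_error (r 0) (u 0) j + (0 + 0) / 2) with (len_error (r 0) (u 0) j)
        by field.
      simpl in *; lra.
    - rewrite gsum_const.
      replace (INR J * (M ^ 2 * h ^ 4)) with (M ^ 2 * (INR J * h) * h ^ 3) by ring.
      unfold h at 1; rewrite INR_mesh by trivial; lra. }
  apply Rle_trans with (1 := HE).
  replace ((M ^ 2 + B * T) * exp (A * T) * h ^ 3)
    with ((M ^ 2 * h ^ 3 + B * h ^ 3 * T) * exp (A * T)) by ring.
  assert (Hx : exp (A * t) <= exp (A * T)).
  { destruct (Req_dec (A * t) (A * T)) as [->|]; [lra|].
    left; apply exp_increasing; nra. }
  assert (Hy : E 0 + B * h ^ 3 * t <= M ^ 2 * h ^ 3 + B * h ^ 3 * T).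
  { assert (B * h ^ 3 * t <= B * h ^ 3 * T); [|lra].
    apply Rmult_le_compat_l; [apply Rmult_le_pos; lra|lra]. }
  assert (Hz : 0 <= M ^ 2 * h ^ 3 + B * h ^ 3 * T).
  { replace (M ^ 2 * h ^ 3 + B * h ^ 3 * T) with ((M ^ 2 + B * T) * h ^ 3) by ring.
    apply Rmult_le_pos; lra. }
  apply Rle_trans with ((M ^ 2 * h ^ 3 + B * h ^ 3 * T) * exp (A * t)).
  - apply Rmult_le_compat_r; [left; trivial|trivial].
  - apply Rmult_le_compat_l; trivial.
Qed.

(** The energy is [O(h ^ 3)] as long as the state is near the reference, and then
    so are the squares of all the errors at every node. For small [h] this is
    well inside the region defining nearness, even for [psi], which is compared
    with [h]. Hence the region is never left. *)
Lemma stability :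
  exists K h1, 0 <= K /\ 0 < h1 <= 1 /\ forall J r dV dQ u,
    (0 < J)%nat -> mesh J <= h1 ->
    reference_path beta M c0 T J r dV dQ -> state_path beta M c0 T J r u ->
    forall t, 0 <= t <= T ->
      near_reference c0 (mesh J) (r t) (u t) /\
      gsum J (square_error (r t) (u t)) <= K * mesh J ^ 3.
Proof.
  destruct energy_growth as [K1 [HK1 Hgrow]].
  destruct square_error_le_energy as [K2 [HK2 Hsq]].
  set (b := Rmin 1 (c0 / 2) ^ 2).
  assert (Hb : 0 < b) by (unfold b; apply pow_lt; apply Rmin_case; lra).
  assert (Hb1 : b <= 1 ^ 2).
  { unfold b; apply pow_incr; split; [apply Rmin_case; lra|apply Rmin_l]. }
  assert (Hb2 : b <= (c0 / 2) ^ 2).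
  { unfold b; apply pow_incr; split; [apply Rmin_case; lra|apply Rmin_r]. }
  set (D := K2 * K1 + M ^ 2 + 1).
  assert (HD : 1 <= D).
  { unfold D; generalize (pow2_ge_0 M) (Rmult_le_pos K2 K1 HK2 HK1); lra. }
  set (h1 := Rmin 1 (b / (2 * D))).
  exists (K2 * K1), h1.
  assert (Hbd : 0 < b / (2 * D)) by (apply Rdiv_lt_0_compat; lra).
  split; [now apply Rmult_le_pos|].
  split; [unfold h1; split; [apply Rmin_case; lra|apply Rmin_l]|].
  intros J r dV dQ u HJ Hh1 Hr Hu.
  set (h := mesh J) in *.
  assert (Hh : 0 < h) by now apply mesh_pos.
  assert (Hh1' : h <= 1) by (apply Rle_trans with (1 := Hh1), Rmin_l).
  assert (HDh : D * h < b).
  { apply Rle_lt_trans with (D * (b / (2 * D))).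
    - apply Rmult_le_compat_l; [lra|]; apply Rle_trans with (1 := Hh1), Rmin_r.
    - replace (D * (b / (2 * D))) with (b / 2) by (field; lra); lra. }
  set (g := fun t => gsum J (fun j => vel_error (r t) (u t) j ^ 2 +
               psi (u t) j ^ 2 / h ^ 2 + len_error (r t) (u t) j ^ 2)).
  assert (Hclose : forall t, g t <= b -> near_reference c0 h (r t) (u t)).
  { intros t Hg.
    generalize (path_periodic Hr t)
        (state_periodic Hu t); intros Pr Pu.
    assert (Hj : forall j, vel_error (r t) (u t) j ^ 2 +
               psi (u t) j ^ 2 / h ^ 2 + len_error (r t) (u t) j ^ 2 <= b).
    { intros j; apply Rle_trans with (2 := Hg).
      apply (gsum_elt J (fun j => vel_error (r t) (u t) j ^ 2 +
               psi (u t) j ^ 2 / h ^ 2 + len_error (r t) (u t) j ^ 2)); trivial.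
      - intros i; rewrite (zperiodic_vel_error J _ _ Pr Pu),
          (zperiodic_len_error J _ _ Pr Pu), (proj1 Pu); reflexivity.
      - intros i; generalize (pow2_ge_0 (vel_error (r t) (u t) i))
          (pow2_ge_0 (len_error (r t) (u t) i)); intros.
        assert (0 <= psi (u t) i ^ 2 / h ^ 2).
        { apply Rdiv_le_0_compat; [apply pow2_ge_0|apply pow_lt; lra]. }
        lra. }
    assert (Hroot : forall x y, 0 <= y -> x ^ 2 <= y ^ 2 -> Rabs x <= y).
    { intros x y Hy H; rewrite <- (Rabs_right y) by lra.
      apply Rsqr_le_abs_0; unfold Rsqr; lra. }
    assert (Hpos : forall i, 0 <= psi (u t) i ^ 2 / h ^ 2).
    { intros i; apply Rdiv_le_0_compat; [apply pow2_ge_0|apply pow_lt; lra]. }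
    split; intros j; specialize (Hj j); specialize (Hpos j);
      generalize (pow2_ge_0 (vel_error (r t) (u t) j))
          (pow2_ge_0 (len_error (r t) (u t) j)); intros.
    - apply Hroot; [lra|].
      assert (Hq : psi (u t) j ^ 2 / h ^ 2 <= 1) by lra.
      apply (Rmult_le_compat_r (h ^ 2)) in Hq; [|apply pow2_ge_0].
      replace (psi (u t) j ^ 2 / h ^ 2 * h ^ 2) with (psi (u t) j ^ 2) in Hq
        by (field; lra).
      lra.
    - apply Hroot; [lra|]; unfold vel_error in *; lra.
    - apply Hroot; [lra|]; unfold len_error in *; lra. }
  assert (Hest : forall t, 0 <= t <= T ->
            (forall s, 0 <= s <= t -> near_reference c0 h (r s) (u s)) ->
            gsum J (square_error (r t) (u t)) <= K2 * K1 * h ^ 3).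
  { intros t Ht Hc.
    apply Rle_trans with (K2 * gsum J (energy_density (r t) (u t))).
    - apply (Hsq J h).
      + apply (path_bounded Hr).
      + apply Hc; lra.
      + apply (path_periodic Hr).
      + apply (state_periodic Hu).
    - rewrite Rmult_assoc; apply Rmult_le_compat_l; trivial.
      now apply (Hgrow J r dV dQ). }
  assert (Hg : forall t, 0 <= t <= T -> g t <= b).
  { apply (no_first_exit g b T); [lra| | |].
    - intros t; apply gsum_continuous; intros j; unfold vel_error, len_error.
      path_cont Hr Hu.
      apply pow_nonzero; lra.
    - apply Rle_trans with (gsum J (fun _ => M ^ 2 * h ^ 4)).
      + apply gsum_le; intros j; unfold vel_error.
        rewrite (state_vel_init Hu), (state_psi_init Hu).
        rewrite Rminus_diag.
        assert (H : len_error (r 0) (u 0) j ^ 2 <= M ^ 2 * h ^ 4).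
        { replace (M ^ 2 * h ^ 4) with ((M * h ^ 2) ^ 2) by ring.
          rewrite <- Rabs_sqr; apply pow_incr; split; [apply Rabs_pos|].
          apply (state_len_init Hu). }
        replace (0 ^ 2 / h ^ 2) with 0 by (field; lra).
        replace (0 ^ 2) with 0 by ring; lra.
      + rewrite gsum_const.
        replace (INR J * (M ^ 2 * h ^ 4)) with (M ^ 2 * (INR J * h) * h ^ 3) by ring.
        unfold h at 1; rewrite INR_mesh by trivial.
        apply Rle_trans with (D * h); [|lra].
        assert (Hh2 : h ^ 3 <= h) by (simpl; nra).
        rewrite Rmult_1_r; apply Rmult_le_compat; try lra.
        * apply pow2_ge_0.
        * apply pow_le; lra.
        * unfold D; generalize (Rmult_le_pos K2 K1 HK2 HK1); lra.
    - intros t Ht Hs.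
      assert (Hc : forall s, 0 <= s <= t -> near_reference c0 h (r s) (u s)) by auto.
      apply Rle_lt_trans with (D * h); trivial.
      apply Rle_trans with (/ h ^ 2 * gsum J (square_error (r t) (u t))).
      + rewrite <- gsum_scal; apply gsum_le; intros j; unfold square_error.
        assert (Hi : 1 <= / h ^ 2).
        { rewrite <- Rinv_1; apply Rinv_le_contravar; [apply pow_lt; lra|].
          simpl; nra. }
        generalize (pow2_ge_0 (vel_error (r t) (u t) j))
          (pow2_ge_0 (len_error (r t) (u t) j)); intros.
        unfold Rdiv; nra.
      + apply Rle_trans with (/ h ^ 2 * (K2 * K1 * h ^ 3)).
        * apply Rmult_le_compat_l; [left; apply Rinv_0_lt_compat, pow_lt; lra|].
          now apply Hest.
        * replace (/ h ^ 2 * (K2 * K1 * h ^ 3)) with (K2 * K1 * h) by (field; lra).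
          apply Rmult_le_compat_r; [lra|].
          unfold D; generalize (pow2_ge_0 M); lra. }
  intros t Ht; split; [auto|].
  apply Hest; trivial; intros s Hs; apply Hclose, Hg; lra.
Qed.

End Stability.

(** * Solvability of the scheme in polar variables *)

Definition clip (d m x : R) : R := m + Rmax (- d) (Rmin d (x - m)).

Lemma clip_near d m x : 0 <= d -> Rabs (m - clip d m x) <= d.
Proof.
  intros Hd; unfold clip; apply Rabs_le_between.
  generalize (Rmax_l (- d) (Rmin d (x - m))); intros.
  assert (Rmax (- d) (Rmin d (x - m)) <= d) by (apply Rmax_lub; [lra|apply Rmin_l]).
  lra.
Qed.

Lemma clip_id d m x : Rabs (m - x) <= d -> clip d m x = x.
Proof.
  intros H; apply Rabs_le_between in H; unfold clip.
  rewrite Rmin_right, Rmax_right by (try apply Rmin_glb; lra); ring.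
Qed.

Lemma cut_lip d x y :
  Rabs (Rmax (- d) (Rmin d x) - Rmax (- d) (Rmin d y)) <= Rabs (x - y).
Proof.
  assert (H : forall s t,
    Rmax (- d) (Rmin d s) - Rmax (- d) (Rmin d t) <= Rabs (s - t)).
  { intros s t; generalize (Rle_abs (s - t)) (Rabs_pos (s - t)); intros.
    unfold Rmax, Rmin; destruct (Rle_dec d s), (Rle_dec d t);
    repeat (match goal with |- context [Rle_dec (- d) ?b] => destruct (Rle_dec (- d) b) end);
    lra. }
  apply Rabs_le_between; generalize (H x y) (H y x); rewrite (Rabs_minus_sym y x); lra.
Qed.

Lemma clip_lip d m x y : Rabs (clip d m x - clip d m y) <= Rabs (x - y).
Proof.
  unfold clip; generalize (cut_lip d (x - m) (y - m)).
  replace (x - m - (y - m)) with (x - y) by ring; intros H.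
  match goal with |- Rabs ?a <= _ =>
    replace a with (Rmax (- d) (Rmin d (x - m)) - Rmax (- d) (Rmin d (y - m))) by ring end.
  exact H.
Qed.

Lemma continuous_clip d (m x : R -> R) t :
  continuous m t -> continuous x t -> continuous (fun s => clip d (m s) (x s)) t.
Proof.
  intros Hm Hx; unfold clip; apply continuous_Rplus; trivial.
  apply (continuous_Rcomp (fun y => Rmax (- d) (Rmin d y)) (fun s => x s - m s));
    [|now apply continuous_Rminus].
  apply continuous_eps; intros e He; exists e; split; trivial; intros s Hs.
  apply Rle_lt_trans with (2 := Hs), cut_lip.
Qed.

Lemma half_jump_ext u u' j :
  (forall j, psi u j = psi u' j) -> half_jump u j = half_jump u' j.
Proof. intros H; unfold half_jump; now rewrite !H. Qed.

Lemma rates_ext beta h r u u' :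
  (forall j, psi u j = psi u' j) -> (forall j, vel u j = vel u' j) ->
  (forall j, len u j = len u' j) -> forall j,
  psi_rate h r u j = psi_rate h r u' j /\ vel_rate beta h r u j = vel_rate beta h r u' j /\
  len_rate h r u j = len_rate h r u' j.
Proof.
  intros Hp Hv Hl j; unfold psi_rate, vel_rate, len_rate, turn_sin, turn_cos.
  now rewrite !(half_jump_ext u u'), !Hv, !Hl by trivial.
Qed.

Inductive component := Angle | Velocity | Length.

Section Truncated.
Variables (beta M c0 h : R).
Hypotheses (HM : 0 <= M) (Hc0 : 0 < c0) (Hh : 0 < h).

(** Truncation makes the vector field bounded and globally Lipschitz continuous
    without changing it near the reference. *)
Definition truncate (r : reference) (u : component * Z -> R) : state :=
  State (fun j => clip h 0 (u (Angle, j)))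
        (fun j => clip 1 (ref_vel r j) (u (Velocity, j)))
        (fun j => clip (c0 / 2) (ref_len r j) (u (Length, j))).

Definition rate (r : reference) (u : state) (a : component * Z) : R :=
  match fst a with
  | Angle => psi_rate h r u (snd a)
  | Velocity => vel_rate beta h r u (snd a)
  | Length => len_rate h r u (snd a)
  end.

Lemma truncate_near r u : near_reference c0 h r (truncate r u).
Proof.
  split; intros j; simpl.
  - rewrite <- (Rabs_Ropp), <- (Rplus_0_l (- _)); apply clip_near; lra.
  - apply clip_near; lra.
  - apply clip_near; lra.
Qed.

Let near (a : reference * state) : Prop :=
  bounded_reference M c0 h (fst a) /\ near_reference c0 h (fst a) (snd a).

Let near_pair (a : reference * (state * state * R)) : Prop :=
  let '(r, (u, v, d)) := a in
  near (r, u) /\ near (r, v) /\ forall j, Rabs (psi u j - psi v j) <= d /\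
    Rabs (vel u j - vel v j) <= d /\ Rabs (len u j - len v j) <= d.

Let on_pair (f : reference -> state -> Z -> R) (a : reference * (state * state * R))
  (j : Z) : R := let '(r, (u, v, d)) := a in f r u j - f r v j.

(** A class of functions closed under the operations that build the rates. *)
Let regular (f : reference -> state -> Z -> R) : Prop :=
  dom near (fun _ _ => 1) (fun a j => f (fst a) (snd a) j) /\
  dom near_pair (fun a _ => snd (snd a)) (on_pair f).

Let regular_bounded f :
  regular f -> exists K, 0 <= K /\ forall r u j, near (r, u) -> Rabs (f r u j) <= K.
Proof.
  intros [[K [HK H]] _]; exists K; split; trivial; intros r u j Hn.
  specialize (H (r, u) j Hn); simpl in H; lra.
Qed.

Let regular_plus f g : regular f -> regular g -> regular (fun r u j => f r u j + g r u j).
Proof.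
  intros [Hf Lf] [Hg Lg]; split; [now apply dom_plus|].
  apply dom_ext with (fun a j => on_pair f a j + on_pair g a j); [now apply dom_plus|].
  intros [r [[u v] d]] j _; simpl; ring.
Qed.

Let regular_mult f g : regular f -> regular g -> regular (fun r u j => f r u j * g r u j).
Proof.
  intros [Hf Lf] [Hg Lg]; split; [now apply dom_mult1|].
  set (fl := fun (a : reference * (state * state * R)) j => f (fst a) (fst (fst (snd a))) j).
  set (gr := fun (a : reference * (state * state * R)) j => g (fst a) (snd (fst (snd a))) j).
  assert (Hfl : dom near_pair (fun _ _ => 1) fl).
  { destruct Hf as [K [HK H]]; exists K; split; trivial.
    intros [r [[u v] d]] j [Hn _]; apply (H (r, u) j Hn). }
  assert (Hgr : dom near_pair (fun _ _ => 1) gr).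
  { destruct Hg as [K [HK H]]; exists K; split; trivial.
    intros [r [[u v] d]] j [_ [Hn _]]; apply (H (r, v) j Hn). }
  apply dom_ext with (fun a j => fl a j * on_pair g a j + gr a j * on_pair f a j).
  - apply dom_plus; now apply dom_mult1.
  - intros [r [[u v] d]] j _; unfold fl, gr; simpl; ring.
Qed.

Let regular_ext f g :
  regular f -> (forall r u j, near (r, u) -> g r u j = f r u j) -> regular g.
Proof.
  intros [Hf Lf] E; split.
  - apply dom_ext with (1 := Hf); intros [r u] j Hn; simpl; now apply E.
  - apply dom_ext with (1 := Lf); intros [r [[u v] d]] j [H1 [H2 _]]; simpl.
    now rewrite !E.
Qed.

Let regular_const k : regular (fun _ _ _ => k).
Proof.
  split; [apply dom_const|].
  apply dom_le with 0; [lra|]; intros [r [[u v] d]] j _; simpl.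
  rewrite Rminus_diag, Rabs_R0; lra.
Qed.

Let regular_shift f k : regular f -> regular (fun r u j => f r u (j + k)%Z).
Proof.
  intros [[K [HK H]] [L [HL H']]]; split.
  - exists K; split; trivial; intros a j Hn; now apply H.
  - exists L; split; trivial; intros [r [[u v] d]] j Hn; exact (H' (r, (u, v, d)) _ Hn).
Qed.

Let regular_ref (f : reference -> Z -> R) K :
  0 <= K -> (forall r j, bounded_reference M c0 h r -> Rabs (f r j) <= K) ->
  regular (fun r _ => f r).
Proof.
  intros HK H; split.
  - apply dom_le with K; trivial; intros [r u] j [Hb _]; simpl.
    rewrite Rmult_1_r; auto.
  - apply dom_le with 0; [lra|]; intros [r [[u v] d]] j _; simpl.
    rewrite Rminus_diag, Rabs_R0; lra.
Qed.

Let regular_psi : regular (fun _ u => psi u).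
Proof.
  split.
  - apply dom_le with h; [lra|]; intros [r u] j [_ Hn]; simpl.
    rewrite Rmult_1_r; apply (close_psi Hn).
  - apply dom_le with 1; [lra|]; intros [r [[u v] d]] j [_ [_ H]]; simpl.
    rewrite Rmult_1_l; apply H.
Qed.

Let regular_vel : regular (fun _ u => vel u).
Proof.
  split.
  - apply dom_le with (M + 1); [lra|]; intros [r u] j [Hb Hn]; simpl in *.
    rewrite Rmult_1_r; eapply vel_bound; eauto.
  - apply dom_le with 1; [lra|]; intros [r [[u v] d]] j [_ [_ H]]; simpl.
    rewrite Rmult_1_l; apply H.
Qed.

Let regular_len : regular (fun _ u => len u).
Proof.
  split.
  - apply dom_le with (M + c0 / 2); [lra|]; intros [r u] j [Hb Hn]; simpl in *.
    generalize (len_bounds _ _ _ _ _ j Hb Hn); intros; rewrite Rabs_right; lra.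
  - apply dom_le with 1; [lra|]; intros [r [[u v] d]] j [_ [_ H]]; simpl.
    rewrite Rmult_1_l; apply H.
Qed.

Let regular_inv f c :
  0 < c -> (forall r u j, near (r, u) -> c <= f r u j) -> regular f ->
  regular (fun r u j => / f r u j).
Proof.
  intros Hc Hl [Hf Lf]; split.
  - apply dom_inv with c; trivial; intros [r u] j Hn; now apply Hl.
  - apply dom_ext with (fun a j =>
      / (fun a j => f (fst a) (fst (fst (snd a))) j) a j *
      (/ (fun a j => f (fst a) (snd (fst (snd a))) j) a j * - on_pair f a j)).
    + apply dom_mult1; [|apply dom_mult1; [|now apply dom_opp]];
        apply dom_inv with c; trivial; intros [r [[u v] d]] j [H1 [H2 _]]; simpl; auto.
    + intros [r [[u v] d]] j [H1 [H2 _]]; simpl.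
      generalize (Hl _ _ j H1) (Hl _ _ j H2); intros; field; lra.
Qed.

Let regular_half_jump : regular (fun _ u => half_jump u).
Proof.
  apply regular_ext with (fun r u j => / 2 * (psi u (j + 1)%Z + -1 * psi u j)).
  - apply regular_mult; [apply regular_const|]; apply regular_plus.
    + exact (regular_shift _ 1 regular_psi).
    + apply regular_mult; [apply regular_const|exact regular_psi].
  - intros; unfold half_jump; field.
Qed.

Let regular_trig (F dF : R -> R) f :
  (forall t, is_derive F t (dF t)) -> (forall t, -1 <= F t <= 1) ->
  (forall t, -1 <= dF t <= 1) -> regular f -> regular (fun r u j => F (f r u j)).
Proof.
  intros HF H1 H2 [_ Lf]; split.
  - apply dom_le with 1; [lra|]; intros [r u] j _; simpl.
    rewrite Rmult_1_r; apply Rabs_le_between, H1.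
  - destruct Lf as [L [HL H]]; exists L; split; trivial.
    intros [r [[u v] d]] j Hn; specialize (H (r, (u, v, d)) j Hn); simpl in *.
    apply Rle_trans with (2 := H).
    assert (Hlip : forall x y, x <= y -> Rabs (F y - F x) <= y - x).
    { intros x y Hxy; rewrite <- (Rmult_1_l (y - x)).
      apply (lipschitz_of_derive F dF); trivial.
      - intros; eapply is_derive_cont, HF.
      - intros; apply Rabs_le_between, H2. }
    destruct (Rle_dec (f r u j) (f r v j)) as [Hle|Hle].
    + rewrite Rabs_minus_sym, (Rabs_left1 (f r u j - f r v j)) by lra.
      specialize (Hlip _ _ Hle); lra.
    + rewrite (Rabs_right (f r u j - f r v j)) by lra.
      apply Hlip; lra.
Qed.

Let regular_cos_jump : regular (fun _ u j => cos (half_jump u j)).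
Proof.
  apply (regular_trig cos (fun x => - sin x) (fun _ u j => half_jump u j)).
  - intros; apply is_derive_Reals, derivable_pt_lim_cos.
  - intros; apply COS_bound.
  - intros t; generalize (SIN_bound t); lra.
  - exact regular_half_jump.
Qed.

Let regular_sin_jump : regular (fun _ u j => sin (half_jump u j)).
Proof.
  apply (regular_trig sin cos (fun _ u j => half_jump u j)).
  - intros; apply is_derive_Reals, derivable_pt_lim_sin.
  - intros; apply SIN_bound.
  - intros; apply COS_bound.
  - exact regular_half_jump.
Qed.

Let regular_ref_cos : regular (fun r _ => ref_cos r).
Proof.
  apply regular_ref with 1; [lra|]; intros r j Hb.
  generalize (unit_turn Hb j) (pow2_ge_0 (ref_sin r j)); intros.
  apply Rabs_le_between; split; nra.
Qed.

Let regular_ref_sin : regular (fun r _ => ref_sin r).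
Proof.
  apply regular_ref with (M * h); [apply Rmult_le_pos; lra|]; intros r j Hb.
  apply (bounded_sin Hb).
Qed.

Let regular_turn_sin : regular turn_sin.
Proof.
  apply regular_ext with (fun r u j => ref_sin r j * cos (half_jump u j) +
             -1 * (ref_cos r j * sin (half_jump u j))).
  - apply regular_plus; [|apply regular_mult; [apply regular_const|]];
      apply regular_mult; trivial.
  - intros; unfold turn_sin; ring.
Qed.

Let regular_turn_cos : regular turn_cos.
Proof.
  unfold turn_cos; apply regular_plus; apply regular_mult; trivial.
Qed.

Let regular_rate k : regular (fun r u j => rate r u (k, j)).
Proof.
  assert (Hvs : regular (fun r u j => vel u j * turn_sin r u j))
    by (apply regular_mult; trivial).
  assert (Hvc : regular (fun r u j => vel u j * turn_cos r u j))
    by (apply regular_mult; trivial).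
  assert (Hlow : forall r u j, near (r, u) -> c0 / 2 <= len u j).
  { intros r u j [Hb Hn]; simpl in *; eapply len_bounds; eauto. }
  destruct k.
  - apply regular_ext with (fun r u j => ref_om r j + - / h *
      ((vel u j * turn_cos r u j + -1 *
        (vel u (j + -1)%Z * turn_cos r u (j + -1)%Z)) * / len u j)).
    + apply regular_plus.
      * apply regular_ref with M; trivial; intros r j Hb; apply Hb.
      * apply regular_mult; [apply regular_const|]; apply regular_mult.
        -- apply regular_plus; [exact Hvc|]; apply regular_mult; [apply regular_const|].
           exact (regular_shift _ (-1) Hvc).
        -- apply regular_inv with (c0 / 2); trivial; lra.
    + intros r u j Hn; specialize (Hlow r u j Hn).
      unfold rate, psi_rate; simpl; unfold Z.sub; simpl; field; lra.
  - apply regular_ext with (fun r u j => - beta * vel u j + 4 / h *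
      (/ (len u j + len u (j + 1)%Z) * turn_sin r u j)).
    + apply regular_plus; [apply regular_mult; [apply regular_const|exact regular_vel]|].
      apply regular_mult; [apply regular_const|]; apply regular_mult; trivial.
      apply regular_inv with c0; trivial.
      * intros r u j Hn; generalize (Hlow r u j Hn) (Hlow r u (j + 1)%Z Hn); lra.
      * apply regular_plus; [exact regular_len|exact (regular_shift _ 1 regular_len)].
    + intros r u j Hn; generalize (Hlow r u j Hn) (Hlow r u (j + 1)%Z Hn); intros.
      unfold rate, vel_rate; simpl; field; lra.
  - apply regular_ext with (fun r u j => - / h * (vel u j * turn_sin r u j +
          vel u (j + -1)%Z * turn_sin r u (j + -1)%Z)).
    + apply regular_mult; [apply regular_const|].
      apply regular_plus; [exact Hvs|exact (regular_shift _ (-1) Hvs)].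
    + intros; unfold rate, len_rate; simpl; unfold Z.sub; simpl; field; lra.
Qed.

Lemma rate_bounded :
  exists K, 0 <= K /\ forall r u a, bounded_reference M c0 h r ->
    near_reference c0 h r u -> Rabs (rate r u a) <= K.
Proof.
  destruct (regular_bounded _ (regular_rate Angle)) as [K1 [P1 H1]].
  destruct (regular_bounded _ (regular_rate Velocity)) as [K2 [P2 H2]].
  destruct (regular_bounded _ (regular_rate Length)) as [K3 [P3 H3]].
  exists (K1 + K2 + K3); split; [lra|]; intros r u [k j] Hb Hn.
  assert (N : near (r, u)) by (split; trivial).
  specialize (H1 r u j N); specialize (H2 r u j N); specialize (H3 r u j N).
  destruct k; lra.
Qed.

Lemma truncate_lip r u v d :
  (forall a, Rabs (u a - v a) <= d) -> forall j,
  Rabs (psi (truncate r u) j - psi (truncate r v) j) <= d /\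
  Rabs (vel (truncate r u) j - vel (truncate r v) j) <= d /\
  Rabs (len (truncate r u) j - len (truncate r v) j) <= d.
Proof.
  intros H j; simpl; repeat split;
    (eapply Rle_trans; [apply clip_lip|apply H]).
Qed.

Lemma rate_lipschitz (r : R -> reference) :
  (forall t, bounded_reference M c0 h (r t)) ->
  exists L, 0 <= L /\ sup_lipschitz L (fun t u => rate (r t) (truncate (r t) u)).
Proof.
  intros Hb.
  destruct (regular_rate Angle) as [_ [L1 [P1 H1]]].
  destruct (regular_rate Velocity) as [_ [L2 [P2 H2]]].
  destruct (regular_rate Length) as [_ [L3 [P3 H3]]].
  exists (L1 + L2 + L3); split; [lra|].
  intros t u v d Huv [k j].
  assert (Hd : 0 <= d) by (eapply Rle_trans; [apply Rabs_pos|apply (Huv (Angle, 0%Z))]).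
  set (a := (r t, (truncate (r t) u, truncate (r t) v, d))).
  assert (Ha : near_pair a).
  { split; [|split]; [split; [apply Hb|apply truncate_near]..|now apply truncate_lip]. }
  specialize (H1 a j Ha); specialize (H2 a j Ha); specialize (H3 a j Ha); simpl in *.
  assert (0 <= L1 * d) by now apply Rmult_le_pos.
  assert (0 <= L2 * d) by now apply Rmult_le_pos.
  assert (0 <= L3 * d) by now apply Rmult_le_pos.
  destruct k; lra.
Qed.

End Truncated.

Section Solvability.
Variables (beta M c0 T : R) (J : nat) (r : R -> reference) (dV dQ : R -> Z -> R).
Hypotheses (HM : 0 <= M) (Hc0 : 0 < c0) (HT : 0 < T) (HJ : (0 < J)%nat).
Hypothesis Hr : reference_path beta M c0 T J r dV dQ.

Let h := mesh J.
Let Hh : 0 < h.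
Proof. now apply mesh_pos. Qed.

Let field t (u : component * Z -> R) := rate beta h (r t) (truncate c0 h (r t) u).

Let field_cont (u : component * Z -> R -> R) :
  (forall a t, continuous (u a) t) ->
  forall a t, continuous (fun s => field s (fun b => u b s) a) t.
Proof.
  intros Hu.
  assert (Hp : forall j t, continuous
    (fun s => psi (truncate c0 h (r s) (fun b => u b s)) j) t).
  { intros; simpl; apply continuous_clip; [apply continuous_Rconst|apply Hu]. }
  assert (Hv : forall j t, continuous
    (fun s => vel (truncate c0 h (r s) (fun b => u b s)) j) t).
  { intros; simpl; apply continuous_clip; [apply (path_vel_cont Hr)|].
    apply Hu. }
  assert (Hl : forall j t, continuous
    (fun s => len (truncate c0 h (r s) (fun b => u b s)) j) t).
  { intros; simpl; apply continuous_clip; [apply (path_len_cont Hr)|].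
    apply Hu. }
  assert (Hlow : forall j s, c0 / 2 <= len (truncate c0 h (r s) (fun b => u b s)) j).
  { intros; eapply len_bounds; trivial.
    - apply (path_bounded Hr).
    - now apply truncate_near. }
  set (st := fun s => truncate c0 h (r s) (fun b => u b s)) in *.
  assert (Hj : forall j t, continuous (fun s => half_jump (st s) j) t).
  { intros; unfold half_jump; apply continuous_Rdiv;
      [apply continuous_Rminus; apply Hp|apply continuous_Rconst|lra]. }
  assert (Hs : forall j t, continuous (fun s => turn_sin (r s) (st s) j) t).
  { intros; unfold turn_sin; apply continuous_Rminus; apply continuous_Rmult.
    - apply (path_sin_cont Hr).
    - apply continuous_Rcos, Hj.
    - apply (path_cos_cont Hr).
    - apply continuous_Rsin, Hj. }
  assert (Hc : forall j t, continuous (fun s => turn_cos (r s) (st s) j) t).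
  { intros; unfold turn_cos; apply continuous_Rplus; apply continuous_Rmult.
    - apply (path_cos_cont Hr).
    - apply continuous_Rcos, Hj.
    - apply (path_sin_cont Hr).
    - apply continuous_Rsin, Hj. }
  intros [k j] t; destruct k; unfold field, rate; simpl; fold (st t).
  - change (continuous (fun s => psi_rate h (r s) (st s) j) t); unfold psi_rate.
    apply continuous_Rminus; [apply (path_om_cont Hr)|].
    apply continuous_Rdiv.
    + apply continuous_Rminus; apply continuous_Rmult; trivial; apply Hv.
    + apply continuous_Rmult; [apply continuous_Rconst|apply Hl].
    + specialize (Hlow j t); fold (st t) in Hlow.
      apply Rgt_not_eq, Rmult_lt_0_compat; lra.
  - change (continuous (fun s => vel_rate beta h (r s) (st s) j) t); unfold vel_rate.
    apply continuous_Rplus; apply continuous_Rmult.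
    + apply continuous_Rconst.
    + apply Hv.
    + generalize (Hlow j t) (Hlow (j + 1)%Z t); fold (st t); intros.
      apply continuous_Rdiv; [apply continuous_Rconst| |lra].
      apply continuous_Rplus; apply Hl.
    + apply continuous_Rdiv; [apply Hs|apply continuous_Rconst|lra].
  - change (continuous (fun s => len_rate h (r s) (st s) j) t); unfold len_rate.
    apply continuous_Rdiv; [|apply continuous_Rconst|lra].
    apply continuous_Ropp, continuous_Rplus; apply continuous_Rmult; trivial; apply Hv.
Qed.

Let components (u : R -> state) (a : component * Z) (t : R) : R :=
  match fst a with
  | Angle => psi (u t) (snd a)
  | Velocity => vel (u t) (snd a)
  | Length => len (u t) (snd a)
  end.

Let truncate_components (u : R -> state) t :
  near_reference c0 h (r t) (u t) -> forall a,
  rate beta h (r t) (u t) a = field t (fun b => components u b t) a.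
Proof.
  intros Hn [k j].
  destruct (rates_ext beta h (r t) (u t)
    (truncate c0 h (r t) (fun b => components u b t))) with (j := j)
    as [H1 [H2 H3]]; [..|destruct k; unfold field, rate; simpl; trivial];
    intros i; simpl; unfold components; simpl; symmetry; apply clip_id.
  - rewrite Rminus_0_l, Rabs_Ropp; apply Hn.
  - apply Hn.
  - apply Hn.
Qed.

(** A state that remains near the reference solves the truncated equation, which
    has only one solution. *)
Lemma state_path_unique u v :
  state_path beta M c0 T J r u -> state_path beta M c0 T J r v ->
  (forall t, 0 <= t <= T -> near_reference c0 h (r t) (u t)) ->
  (forall t, 0 <= t <= T -> near_reference c0 h (r t) (v t)) ->
  (forall j, len (u 0) j = len (v 0) j) ->
  forall j t, 0 <= t <= T ->
    psi (u t) j = psi (v t) j /\ vel (u t) j = vel (v t) j /\ len (u t) j = len (v t) j.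
Proof.
  intros Hu Hv Nu Nv H0.
  destruct (rate_lipschitz beta M c0 h HM Hc0 Hh r) as [L [HL Hlip]].
  { intros t; apply (path_bounded Hr). }
  assert (Hsol : forall w, state_path beta M c0 T J r w ->
            (forall t, 0 <= t <= T -> near_reference c0 h (r t) (w t)) ->
            solves T field (components w)).
  { intros w Hw Nw [k j] t Ht.
    rewrite <- truncate_components by (apply Nw; lra).
    destruct (state_evolves Hw Ht (Nw t ltac:(lra)) j) as [E1 [E2 E3]].
    destruct k; unfold components, rate; simpl; trivial. }
  assert (Hcont : forall w, state_path beta M c0 T J r w ->
            forall a t, continuous (components w a) t).
  { intros w Hw [k j] t; destruct k; unfold components; simpl.
    - apply (state_psi_cont Hw).
    - apply (state_vel_cont Hw).
    - apply (state_len_cont Hw). }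
  assert (Heq : forall a t, 0 <= t <= T -> components u a t = components v a t).
  { apply (ode_unique field L (2 * h + 2 + c0)); auto; try lra.
    - intros [k j]; destruct k; unfold components; simpl.
      + now rewrite (state_psi_init Hu), (state_psi_init Hv).
      + now rewrite (state_vel_init Hu), (state_vel_init Hv).
      + apply H0.
    - intros [k j] t Ht.
      destruct (Nu t Ht) as [P1 P2 P3], (Nv t Ht) as [Q1 Q2 Q3].
      specialize (P1 j); specialize (P2 j); specialize (P3 j);
      specialize (Q1 j); specialize (Q2 j); specialize (Q3 j).
      apply Rabs_le_between in P1, P2, P3, Q1, Q2, Q3.
      destruct k; unfold components; simpl; apply Rabs_le_between; lra. }
  intros j t Ht; repeat split.
  - exact (Heq (Angle, j) t Ht).
  - exact (Heq (Velocity, j) t Ht).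
  - exact (Heq (Length, j) t Ht).
Qed.

(** The truncated equation is solved for all integers at once. Periodicity then
    follows from uniqueness, the vector field being invariant under shifts by
    [J]. *)
Lemma state_path_exists (l0 : Z -> R) :
  zperiodic J l0 -> (forall j, Rabs (ref_len (r 0) j - l0 j) <= M * h ^ 2) ->
  exists u, state_path beta M c0 T J r u /\ forall j, len (u 0) j = l0 j.
Proof.
  intros Hl0 Hinit.
  assert (Hb : forall t, bounded_reference M c0 h (r t)).
  { intros t; apply (path_bounded Hr). }
  destruct (rate_lipschitz beta M c0 h HM Hc0 Hh r Hb) as [L [HL Hlip]].
  destruct (rate_bounded beta M c0 h HM Hc0 Hh) as [K [HK Hbd]].
  set (u0 := fun a : component * Z => match fst a with
     | Angle => 0 | Velocity => ref_vel (r 0) (snd a) | Length => l0 (snd a) end).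
  destruct (ode_exists field u0 L K T) as [y [Hy0 [Hyc Hys]]]; trivial; try lra.
  { intros t u a; apply Hbd; trivial; now apply truncate_near. }
  set (shift := fun a : component * Z => (fst a, (snd a + Z.of_nat J)%Z)).
  assert (Hper : forall a t, 0 <= t <= T -> y (shift a) t = y a t).
  { assert (Hincr : forall a t, 0 <= t <= T -> Rabs (y a t - u0 a) <= K * T).
    { intros a t Ht; rewrite <- Hy0.
      apply Rle_trans with (K * (t - 0)).
      - apply (lipschitz_of_derive (y a) (fun s => field s (fun b => y b s) a));
          [lra|auto| |].
        + intros s Hs; apply Hys; lra.
        + intros s Hs; apply Hbd; trivial; now apply truncate_near.
      - apply Rmult_le_compat_l; lra. }
    assert (Hu0 : forall a, u0 (shift a) = u0 a).
    { intros [k j]; destruct k; unfold u0, shift; simpl; trivial.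
      apply (path_periodic Hr 0). }
    apply (ode_unique field L (2 * (K * T)) T (fun a => y (shift a)) y); trivial.
    - apply Rmult_le_pos; [lra|apply Rmult_le_pos; lra].
    - intros a; now rewrite !Hy0.
    - intros a t Ht.
      replace (field t (fun b => y (shift b) t) a) with
        (field t (fun b => y b t) (shift a)); [now apply Hys|].
      (* the reference is periodic, hence the vector field commutes with the shift *)
      destruct a as [k j]; unfold field, rate, shift; simpl fst; simpl snd.
      generalize (path_periodic Hr t); intros [PV [PQ [Po [Pc Ps]]]].
      set (S := truncate c0 h (r t) (fun b => y b t)).
      set (S' := truncate c0 h (r t) (fun b => y (fst b, (snd b + Z.of_nat J)%Z) t)).
      assert (E1 : forall i, psi S (i + Z.of_nat J)%Z = psi S' i) by reflexivity.
      assert (E2 : forall i, vel S (i + Z.of_nat J)%Z = vel S' i).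
      { intros; unfold S, S'; simpl; now rewrite PV. }
      assert (E3 : forall i, len S (i + Z.of_nat J)%Z = len S' i).
      { intros; unfold S, S'; simpl; now rewrite PQ. }
      assert (E0 : forall i, half_jump S (i + Z.of_nat J)%Z = half_jump S' i).
      { intros i; unfold half_jump; rewrite <- !E1.
        now replace (i + 1 + Z.of_nat J)%Z with (i + Z.of_nat J + 1)%Z by lia. }
      assert (E4 : forall i, turn_sin (r t) S (i + Z.of_nat J)%Z = turn_sin (r t) S' i).
      { intros i; unfold turn_sin; now rewrite E0, Pc, Ps. }
      assert (E5 : forall i, turn_cos (r t) S (i + Z.of_nat J)%Z = turn_cos (r t) S' i).
      { intros i; unfold turn_cos; now rewrite E0, Pc, Ps. }
      unfold psi_rate, vel_rate, len_rate.
      replace (j + Z.of_nat J - 1)%Z with (j - 1 + Z.of_nat J)%Z by lia.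
      replace (j + Z.of_nat J + 1)%Z with (j + 1 + Z.of_nat J)%Z by lia.
      now rewrite !E2, !E3, !E4, !E5, Po.
    - intros a t Ht.
      generalize (Hincr a t Ht) (Hincr (shift a) t Ht); rewrite Hu0; intros B1 B2.
      apply Rabs_le_between in B1, B2; apply Rabs_le_between; lra. }
  assert (Hcl : forall t, 0 <= clamp T t <= T) by (intros; apply clamp_Icc; lra).
  exists (fun t => State (fun j => y (Angle, j) (clamp T t))
                         (fun j => y (Velocity, j) (clamp T t))
                         (fun j => y (Length, j) (clamp T t))).
  assert (Hc : forall a t, continuous (fun s => y a (clamp T s)) t).
  { intros; apply (continuous_Rcomp (y a) (clamp T)); [apply Hyc|apply continuous_clamp]. }
  assert (Hz : clamp T 0 = 0) by (apply clamp_id; lra).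
  split; [split; simpl|]; auto; simpl.
  - intros t; repeat split; intros j; simpl.
    + exact (Hper (Angle, j) _ (Hcl t)).
    + exact (Hper (Velocity, j) _ (Hcl t)).
    + exact (Hper (Length, j) _ (Hcl t)).
  - intros j; now rewrite Hz, Hy0.
  - intros j; now rewrite Hz, Hy0.
  - intros j; rewrite Hz, Hy0; apply Hinit.
  - intros t Ht Hn.
    set (u := fun t => State (fun j => y (Angle, j) (clamp T t))
                         (fun j => y (Velocity, j) (clamp T t))
                         (fun j => y (Length, j) (clamp T t))) in *.
    change (State (fun j => y (Angle, j) (clamp T t))
                         (fun j => y (Velocity, j) (clamp T t))
                         (fun j => y (Length, j) (clamp T t))) with (u t) in *.
    assert (Hd : forall a, is_derive (fun s => y a (clamp T s)) t
                             (rate beta h (r t) (u t) a)).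
    { intros a; rewrite truncate_components by trivial.
      apply (is_derive_near (y a) _ 0 T); trivial.
      - intros s Hs; now rewrite clamp_id by lra.
      - eapply is_derive_eq; [now apply Hys|].
        destruct (rates_ext beta h (r t) (truncate c0 h (r t) (fun b => y b t))
           (truncate c0 h (r t) (fun b => components u b t))) with (j := snd a)
          as [H1 [H2 H3]];
        [..|destruct a as [[] j]; unfold field, rate; simpl; trivial];
        intros i; simpl; unfold components; simpl; now rewrite clamp_id by lra. }
    intros j; split; [|split].
    + exact (Hd (Angle, j)).
    + exact (Hd (Velocity, j)).
    + exact (Hd (Length, j)).
  - intros j; now rewrite Hz, Hy0.
Qed.

End Solvability.

(** * The exact solution *)

Lemma lipschitz_between (f df : R -> R) K a b :
  (forall t, Rabs (t - a) <= Rabs (b - a) -> is_derive f t (df t)) ->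
  (forall t, Rabs (t - a) <= Rabs (b - a) -> Rabs (df t) <= K) ->
  Rabs (f b - f a) <= K * Rabs (b - a).
Proof.
  intros Hd HK.
  destruct (Rle_dec a b) as [H|H].
  - rewrite (Rabs_right (b - a)) in * by lra.
    apply (lipschitz_of_derive f df); trivial.
    + intros t Ht; eapply is_derive_cont, Hd; rewrite Rabs_right; lra.
    + intros t Ht; apply Hd; rewrite Rabs_right; lra.
    + intros t Ht; apply HK; rewrite Rabs_right; lra.
  - assert (E : Rabs (b - a) = a - b) by (rewrite Rabs_left; lra).
    rewrite E in *; rewrite Rabs_minus_sym.
    apply (lipschitz_of_derive f df); [lra| | |].
    + intros t Ht; eapply is_derive_cont, Hd; rewrite Rabs_left1; lra.
    + intros t Ht; apply Hd; rewrite Rabs_left1; lra.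
    + intros t Ht; apply HK; rewrite Rabs_left1; lra.
Qed.

(** Passing to the limit in a bound on increments. *)
Lemma derive_close (w : R -> R) t l c K d :
  0 < d -> is_derive w t l ->
  (forall s, Rabs (s - t) < d -> Rabs (w s - w t - c * (s - t)) <= K * Rabs (s - t)) ->
  Rabs (l - c) <= K.
Proof.
  intros Hd Hw Hc.
  apply Rnot_lt_le; intros Hlt.
  set (e := (Rabs (l - c) - K) / 2).
  destruct (proj1 (is_derive_eps _ _ _) Hw e) as [d' [Hd' Hs]]; [unfold e; lra|].
  set (s := t + Rmin d d' / 2).
  assert (Hm : 0 < Rmin d d') by (apply Rmin_case; lra).
  assert (Hst : s - t = Rmin d d' / 2) by (unfold s; ring).
  assert (Hab : Rabs (s - t) = Rmin d d' / 2) by (rewrite Hst, Rabs_right; lra).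
  generalize (Rmin_l d d') (Rmin_r d d'); intros L1 L2.
  specialize (Hc s ltac:(lra)); specialize (Hs s ltac:(lra)).
  assert (Hle : Rabs (l - c) * Rabs (s - t) <= (K + e) * Rabs (s - t)).
  { rewrite <- Rabs_mult.
    replace ((l - c) * (s - t)) with
      ((w s - w t - c * (s - t)) - (w s - w t - l * (s - t))) by ring.
    eapply Rle_trans; [apply Rabs_triang|]; rewrite Rabs_Ropp; lra. }
  apply Rmult_le_reg_r in Hle; [|lra]; unfold e in Hle; lra.
Qed.

(** The interval is crossed in [n] steps of length [d / 2]. *)
Lemma bounded_oscillation (g : R -> R) a d n x :
  0 < d -> (forall y z, a <= y <= x -> a <= z <= x -> Rabs (y - z) < d ->
              Rabs (g y - g z) < 1) ->
  a <= x -> x <= a + INR n * (d / 2) -> Rabs (g x - g a) <= INR n.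
Proof.
  intros Hd; revert x; induction n as [|n IH]; intros x Hg Hax Hx.
  - simpl in *; replace x with a by lra; rewrite Rminus_diag, Rabs_R0; lra.
  - rewrite S_INR in *.
    destruct (Rle_dec x (a + INR n * (d / 2))) as [Hle|Hle].
    + specialize (IH x Hg Hax Hle); lra.
    + set (y := a + INR n * (d / 2)) in *.
      assert (Hy : a <= y) by (unfold y; generalize (pos_INR n); nra).
      assert (H1 : Rabs (g y - g a) <= INR n).
      { apply IH; trivial; [|unfold y; lra].
        intros u v Hu Hv; apply Hg; lra. }
      assert (H2 : Rabs (g x - g y) < 1).
      { apply Hg; try lra; unfold y in *; rewrite Rabs_right; lra. }
      replace (g x - g a) with ((g x - g y) + (g y - g a)) by ring.
      eapply Rle_trans; [apply Rabs_triang|]; lra.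
Qed.

(** A period times the time interval is compact. *)
Lemma periodic_bounded (g : R -> R -> R) T :
  0 < T -> (forall rho t, continuity_2d_pt g rho t) ->
  (forall rho t, g (rho + 1) t = g rho t) ->
  (forall rho t, g rho (clamp T t) = g rho t) ->
  exists M, 0 < M /\ forall rho t, Rabs (g rho t) <= M.
Proof.
  intros HT Hc Hp Ht.
  destruct (uniform_continuity_2d g 0 1 0 T (fun x y _ _ => Hc x y) (mkposreal 1 Rlt_0_1))
    as [d Hd]; simpl in Hd.
  assert (HN : forall y, 0 < y -> y <= INR (Z.to_nat (up (2 * y / d))) * (d / 2)).
  { intros y Hy; generalize (archimed (2 * y / d)); intros [Hup _].
    assert (Hq : 0 < 2 * y / d) by (apply Rdiv_lt_0_compat; [lra|apply cond_pos]).
    rewrite INR_IZR_INZ, Z2Nat.id by (apply le_IZR; lra).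
    apply Rle_trans with (2 * y / d * (d / 2)); [right; field; apply Rgt_not_eq, cond_pos|].
    apply Rmult_le_compat_r; [|lra]; generalize (cond_pos d); lra. }
  set (n1 := Z.to_nat (up (2 * 1 / d))); set (n2 := Z.to_nat (up (2 * T / d))).
  exists (Rabs (g 0 0) + INR n1 + INR n2 + 1); split.
  { generalize (Rabs_pos (g 0 0)) (pos_INR n1) (pos_INR n2); lra. }
  assert (Hmain : forall rho t, 0 <= rho <= 1 -> 0 <= t <= T ->
            Rabs (g rho t) <= Rabs (g 0 0) + INR n1 + INR n2).
  { intros rho t Hr Htt.
    assert (H1 : Rabs (g rho t - g 0 t) <= INR n1).
    { apply (bounded_oscillation (fun r => g r t) 0 d); [apply cond_pos| |lra|].
      - intros y z Hy Hz Hyz; apply Hd; try lra.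
        rewrite Rminus_diag, Rabs_R0; apply cond_pos.
      - generalize (HN 1 Rlt_0_1); fold n1; lra. }
    assert (H2 : Rabs (g 0 t - g 0 0) <= INR n2).
    { apply (bounded_oscillation (fun r => g 0 r) 0 d); [apply cond_pos| |lra|].
      - intros y z Hy Hz Hyz; apply Hd; try lra.
        rewrite Rminus_diag, Rabs_R0; apply cond_pos.
      - generalize (HN T HT); fold n2; lra. }
    replace (g rho t) with ((g rho t - g 0 t) + (g 0 t - g 0 0) + g 0 0) by ring.
    eapply Rle_trans; [apply Rabs_triang|].
    generalize (Rabs_triang (g rho t - g 0 t) (g 0 t - g 0 0)); lra. }
  assert (Hz : forall n rho t, g (rho + IZR n) t = g rho t).
  { intros n; induction n using Z.peano_ind; intros rho t.
    - now rewrite Rplus_0_r.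
    - rewrite succ_IZR, <- Rplus_assoc, Hp; apply IHn.
    - rewrite <- (Hp (rho + IZR (Z.pred n))), <- (IHn rho).
      f_equal; rewrite <- Z.sub_1_r, minus_IZR; ring. }
  intros rho t; rewrite <- Ht.
  rewrite <- (Hz (- (up rho - 1))%Z).
  assert (Hfr : 0 <= rho + IZR (- (up rho - 1)) <= 1).
  { rewrite opp_IZR, minus_IZR; generalize (archimed rho); lra. }
  generalize (Hmain _ _ Hfr (clamp_Icc T t (Rlt_le _ _ HT))); lra.
Qed.

(** Quantities attached to a curve with coordinates [f true], [f false], whose
    [j]-th derivative along the curve is [f k j] and whose velocity is [g]. *)
Definition speed (f : bool -> nat -> R -> R -> R) (rho t : R) : R :=
  sqrt (f true 1%nat rho t * f true 1%nat rho t +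
        f false 1%nat rho t * f false 1%nat rho t).

Definition normal_velocity (f : bool -> nat -> R -> R -> R) (g : bool -> R -> R -> R)
  (rho t : R) : R :=
  (g false rho t * f true 1%nat rho t - g true rho t * f false 1%nat rho t)
  / speed f rho t.

Definition turning (f : bool -> nat -> R -> R -> R) (rho t : R) : R :=
  f true 1%nat rho t * f false 2%nat rho t - f false 1%nat rho t * f true 2%nat rho t.

Set Implicit Arguments.
(** The form in which the exact solution enters the error analysis. The motion
    is normal, and the second order equation has become a first order system for
    the normal velocity and the length element. *)
Record smooth_flow (beta T M m : R) (f : bool -> nat -> R -> R -> R)
  (g : bool -> R -> R -> R) : Prop := {
  flow_rho : forall k j rho t, (j < 4)%nat ->
    is_derive (fun r => f k j r t) rho (f k (S j) rho t);
  flow_t : forall k rho t, 0 < t < T ->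
    is_derive (fun s => f k 0%nat rho s) t (g k rho t);
  flow_f_bound : forall k j rho t, (1 <= j <= 4)%nat -> Rabs (f k j rho t) <= M;
  flow_g_bound : forall k rho t, Rabs (g k rho t) <= M;
  flow_g_lip : forall k rho r t, Rabs (g k r t - g k rho t) <= M * Rabs (r - rho);
  flow_f_cont : forall k j rho t, (j <= 4)%nat -> continuous (fun s => f k j rho s) t;
  flow_g_cont : forall k rho t, continuous (fun s => g k rho s) t;
  flow_f_periodic : forall k j rho t, (j <= 4)%nat -> f k j (rho + 1) t = f k j rho t;
  flow_g_periodic : forall k rho t, g k (rho + 1) t = g k rho t;
  flow_speed : forall rho t, m <= speed f rho t;
  flow_normal : forall rho t, g true rho t * f true 1%nat rho t +
                              g false rho t * f false 1%nat rho t = 0;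
  flow_velocity_rate : forall rho t, 0 < t < T ->
    is_derive (fun s => normal_velocity f g rho s) t
      (- beta * normal_velocity f g rho t + turning f rho t / speed f rho t ^ 3);
  flow_speed_rate : forall rho t, 0 < t < T ->
    is_derive (fun s => speed f rho s) t
      (- (normal_velocity f g rho t * turning f rho t) / speed f rho t ^ 2)
}.
Unset Implicit Arguments.

Lemma normal_vector (y1 y2 g1 g2 p : R) :
  0 < p -> p * p = y1 * y1 + y2 * y2 -> g1 * y1 + g2 * y2 = 0 ->
  g1 = - ((g2 * y1 - g1 * y2) / p) * (y2 / p) /\ g2 = (g2 * y1 - g1 * y2) / p * (y1 / p).
Proof.
  intros Hp E N; assert (Hpp : p * p <> 0) by nra.
  split; apply Rmult_eq_reg_r with (p * p); trivial.
  - transitivity (g1 * (y1 * y1 + y2 * y2) - y1 * (g1 * y1 + g2 * y2));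
      [rewrite N, <- E; ring|field; lra].
  - transitivity (g2 * (y1 * y1 + y2 * y2) - y2 * (g1 * y1 + g2 * y2));
      [rewrite N, <- E; ring|field; lra].
Qed.

Definition coord (k : bool) (u : R * R) : R := if k then fst u else snd u.

Section Exact.
Variables (beta T : R) (x0 : R -> R * R) (V0 : R -> R)
  (x : R -> R -> R * R) (dx : nat -> nat -> R -> R -> R * R).
Hypotheses (hbeta : 0 <= beta) (hT : 0 < T)
  (hdx : parabolic_partials 4 T x dx)
  (hsol : continuous_solution beta T x0 V0 x
            (dx 0%nat 1%nat) (dx 1%nat 0%nat) (dx 2%nat 0%nat))
  (hreg : forall rho t, 0 <= t <= T -> 0 < norm (dx 0%nat 1%nat rho t)).

(* coordinates of the partial derivatives, frozen outside [0, T] *)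
Let D k i j rho t := coord k (dx i j rho (clamp T t)).

Let Hcl t : Icc 0 T (clamp T t).
Proof. apply clamp_Icc; lra. Qed.

Let Dclamp k i j rho t : D k i j rho (clamp T t) = D k i j rho t.
Proof. unfold D; now rewrite (clamp_id T (clamp T t)) by apply Hcl. Qed.

Let D_rho k j rho t : (j < 4)%nat ->
  is_derive (fun r => D k 0 j r t) rho (D k 0 (S j) rho t).
Proof.
  intros Hj.
  destruct (is_derive_components _ _ _ (partials_rho hdx j rho _ Hj (Hcl t)))
    as [H1 H2].
  destruct k; [exact H1|exact H2].
Qed.

Let D_t k i j rho t : (2 * S i + j <= 4)%nat -> 0 < t < T ->
  is_derive (fun s => D k i j rho s) t (D k (S i) j rho t).
Proof.
  intros Hij Ht.
  assert (Hi : Icc 0 T t) by (unfold Icc; lra).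
  destruct (is_derive_on_interior _ _ _ _ Ht (partials_t hdx i j rho t Hij Hi))
    as [H1 H2].
  apply (is_derive_near (fun s => coord k (dx i j rho s)) _ 0 T); trivial.
  - intros s Hs; unfold D; now rewrite clamp_id by lra.
  - unfold D; rewrite clamp_id by lra; destruct k; [exact H1|exact H2].
Qed.

Let D_cont2 k i j rho t : (2 * i + j <= 4)%nat -> continuity_2d_pt (D k i j) rho t.
Proof.
  intros Hij eps.
  generalize (partials_continuous hdx i j Hij (rho, clamp T t)); simpl.
  intros H; specialize (H (Hcl t)).
  destruct (proj1 (filterlim_locally _ _) H eps) as [d Hd].
  exists d; intros u v Hu Hv.
  assert (Hb : ball (rho, clamp T t) d (u, clamp T v)).
  { split; simpl; [exact Hu|].
    change (Rabs (clamp T v - clamp T t) < d).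
    apply Rle_lt_trans with (2 := Hv), clamp_lip. }
  destruct (Hd _ Hb (Hcl v)) as [H1 H2].
  unfold D; destruct k; [exact H1|exact H2].
Qed.

Let cont2_t (g : R -> R -> R) rho t :
  continuity_2d_pt g rho t -> continuous (fun s => g rho s) t.
Proof.
  intros H; apply continuous_eps; intros e He.
  destruct (H (mkposreal e He)) as [d Hd]; exists d; split; [apply cond_pos|].
  intros s Hs; apply Hd; trivial; rewrite Rminus_diag, Rabs_R0; apply cond_pos.
Qed.

Let D_cont_t k i j rho t : (2 * i + j <= 4)%nat -> continuous (fun s => D k i j rho s) t.
Proof. intros; now apply (cont2_t (D k i j)), D_cont2. Qed.

Let D0_periodic k j rho t : (j <= 4)%nat -> D k 0 j (rho + 1) t = D k 0 j rho t.
Proof.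
  revert rho; induction j as [|j IH]; intros rho Hj.
  - unfold D; rewrite !(partials_00 hdx) by apply Hcl.
    now rewrite (cont_periodic hsol).
  - generalize (D_rho k j (rho + 1) t Hj); intros H1.
    assert (H2 : is_derive (fun r => D k 0 j r t) rho (D k 0 (S j) (rho + 1) t)).
    { apply is_derive_Rext with (fun r => D k 0 j (r + 1) t).
      - intros r; apply IH; lia.
      - eapply is_derive_eq.
        + apply (is_derive_Rcomp (fun r => D k 0 j r t) (fun r => r + 1)); [exact H1|].
          apply is_derive_Rplus; [apply is_derive_Rid|apply is_derive_Rconst].
        + ring. }
    generalize (is_derive_unique _ _ _ H2) (is_derive_unique _ _ _ (D_rho k j rho t Hj)).
    now intros <- <-.
Qed.

Let D1_periodic k j rho t : (j <= 2)%nat -> D k 1 j (rho + 1) t = D k 1 j rho t.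
Proof.
  intros Hj; rewrite <- (Dclamp k 1 j (rho + 1) t), <- (Dclamp k 1 j rho t).
  apply (closed_extension_eq (D k 1 j (rho + 1)) (D k 1 j rho) T); trivial.
  - intros; apply D_cont_t; lia.
  - intros; apply D_cont_t; lia.
  - intros s Hs.
    generalize (D_t k 0 j (rho + 1) s ltac:(lia) Hs) (D_t k 0 j rho s ltac:(lia) Hs).
    intros H1 H2.
    apply (is_derive_Rext _ (fun s => D k 0 j rho s)) in H1;
      [|intros r; apply D0_periodic; lia].
    generalize (is_derive_unique _ _ _ H1) (is_derive_unique _ _ _ H2); now intros <- <-.
  - apply Hcl.
Qed.

Let Dbounded k i j : (i <= 1)%nat -> (2 * i + j <= 4)%nat ->
  exists M, 0 < M /\ forall rho t, Rabs (D k i j rho t) <= M.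
Proof.
  intros Hi Hij; apply periodic_bounded with T; trivial.
  - intros; now apply D_cont2.
  - intros; destruct i as [|[|i]]; [apply D0_periodic|apply D1_periodic|]; lia.
Qed.

(** Exchange of the derivatives: [dx 1 1] is given as the time derivative of
    the tangent vector and is needed as the space derivative of the velocity.
    The second increments of the solution are estimated by the mean value theorem
    in both variables. *)
Let D_mixed k rho t : 0 < t < T ->
  is_derive (fun r => D k 1 0 r t) rho (D k 1 1 rho t).
Proof.
  intros Ht; apply is_derive_eps; intros e He.
  destruct (D_cont2 k 1 1 rho t ltac:(lia) (mkposreal e He)) as [d Hd]; simpl in Hd.
  exists d; split; [apply cond_pos|]; intros r Hr.
  assert (Hm : 0 < Rmin d (Rmin t (T - t))).
  { repeat apply Rmin_case; try lra; apply cond_pos. }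
  generalize (Rmin_l d (Rmin t (T - t))) (Rmin_r d (Rmin t (T - t)))
    (Rmin_l t (T - t)) (Rmin_r t (T - t)); intros L1 L2 L3 L4.
  set (m := Rmin d (Rmin t (T - t))) in *.
  replace (D k 1 0 r t - D k 1 0 rho t - D k 1 1 rho t * (r - rho))
    with ((D k 1 0 r t - D k 1 0 rho t) - D k 1 1 rho t * (r - rho)) by ring.
  apply (derive_close (fun s => D k 0 0 r s - D k 0 0 rho s) t _ _ _ m); trivial.
  - apply is_derive_Rminus; apply D_t; trivial; lia.
  - intros s Hs.
    set (H0 := D k 1 1 rho t).
    replace (D k 0 0 r s - D k 0 0 rho s - (D k 0 0 r t - D k 0 0 rho t) -
             H0 * (r - rho) * (s - t)) with
      ((D k 0 0 r s - D k 0 0 r t - H0 * (s - t) * r) -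
       (D k 0 0 rho s - D k 0 0 rho t - H0 * (s - t) * rho)) by ring.
    replace (e * Rabs (r - rho) * Rabs (s - t)) with (e * Rabs (s - t) * Rabs (r - rho))
      by ring.
    apply (lipschitz_between (fun r => D k 0 0 r s - D k 0 0 r t - H0 * (s - t) * r)
             (fun r => D k 0 1 r s - D k 0 1 r t - H0 * (s - t))).
    + intros r' Hr'; eapply is_derive_eq.
      * apply is_derive_Rminus; [apply is_derive_Rminus; apply D_rho; lia|].
        apply is_derive_Rmult; [apply is_derive_Rconst|apply is_derive_Rid].
      * cbv beta; ring.
    + intros r' Hr'.
      replace (D k 0 1 r' s - D k 0 1 r' t - H0 * (s - t)) with
        ((D k 0 1 r' s - H0 * s) - (D k 0 1 r' t - H0 * t)) by ring.
      apply (lipschitz_between (fun s => D k 0 1 r' s - H0 * s)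
               (fun s => D k 1 1 r' s - H0)).
      * intros s' Hs'; generalize (Rle_lt_trans _ _ _ Hs' Hs); intros Hs2.
        apply Rabs_lt_between in Hs2; eapply is_derive_eq.
        -- apply is_derive_Rminus; [apply D_t; [lia|lra]|].
           apply is_derive_Rmult; [apply is_derive_Rconst|apply is_derive_Rid].
        -- cbv beta; ring.
      * intros s' Hs'; left; apply Hd; lra.
Qed.

Let f k j rho t := D k 0 j rho t.
Let g k rho t := D k 1 0 rho t.

Let speed_norm rho t : speed f rho t = norm (dx 0%nat 1%nat rho (clamp T t)).
Proof. rewrite norm_pair; reflexivity. Qed.

Let speed_pos rho t : 0 < speed f rho t.
Proof. rewrite speed_norm; apply hreg, Hcl. Qed.

Let speed_sqr rho t : speed f rho t ^ 2 = f true 1%nat rho t * f true 1%nat rho t +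
        f false 1%nat rho t * f false 1%nat rho t.
Proof. unfold speed; apply pow2_sqrt; nra. Qed.

Let speed_lower : exists m, 0 < m /\ forall rho t, m <= speed f rho t.
Proof.
  destruct (periodic_bounded (fun rho t => / speed f rho t) T) as [K [HK H]]; trivial.
  - intros rho t; apply continuity_2d_pt_inv; [|apply Rgt_not_eq, speed_pos].
    apply (continuity_1d_2d_pt_comp sqrt (fun rho t =>
        f true 1%nat rho t * f true 1%nat rho t +
        f false 1%nat rho t * f false 1%nat rho t)).
    + apply continuity_pt_filterlim, continuous_sqrt.
    + apply continuity_2d_pt_plus; apply continuity_2d_pt_mult; apply D_cont2; lia.
  - intros rho t; unfold speed, f; now rewrite !D0_periodic by lia.
  - intros rho t; unfold speed, f; now rewrite !Dclamp.
  - exists (/ K); split; [now apply Rinv_0_lt_compat|]; intros rho t.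
    specialize (H rho t); generalize (speed_pos rho t); intros Hs.
    rewrite Rabs_right in H by (left; now apply Rinv_0_lt_compat).
    rewrite <- (Rinv_inv (speed f rho t)); apply Rinv_le_contravar; trivial.
    now apply Rinv_0_lt_compat.
Qed.

Let tau k rho t := f k 1%nat rho t / speed f rho t.

Let tau_coord k rho t : tau k rho t = coord k (normalize (dx 0%nat 1%nat rho (clamp T t))).
Proof.
  unfold tau; rewrite speed_norm; unfold normalize; rewrite scal_pair.
  unfold f, D; destruct k; cbn [coord fst snd]; apply Rmult_comm.
Qed.

Let tau_unit rho t : tau true rho t * tau true rho t + tau false rho t * tau false rho t = 1.
Proof.
  unfold tau; generalize (speed_pos rho t); intros Hs.
  transitivity ((f true 1%nat rho t * f true 1%nat rho t +
        f false 1%nat rho t * f false 1%nat rho t) / speed f rho t ^ 2); [field; lra|].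
  rewrite <- speed_sqr; field; lra.
Qed.

Let tau_cont k rho t : continuous (fun s => tau k rho s) t.
Proof.
  unfold tau; apply continuous_Rdiv.
  - apply D_cont_t; lia.
  - unfold speed; apply continuous_Rsqrt, continuous_Rplus;
      apply continuous_Rmult; apply D_cont_t; lia.
  - apply Rgt_not_eq, speed_pos.
Qed.

(** The equation at an interior time, in coordinates, with the orthogonality
    relations between the unit tangent [tau] and its derivatives. *)
Let equation_facts rho t : 0 < t < T ->
  exists a1 a2 b1 b2 : R,
    is_derive (fun s => tau true rho s) t b1 /\ is_derive (fun s => tau false rho s) t b2 /\
    tau true rho t * a1 + tau false rho t * a2 = 0 /\
    tau true rho t * b1 + tau false rho t * b2 = 0 /\
    speed f rho t * (tau true rho t * a2 - tau false rho t * a1)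
      = turning f rho t / speed f rho t /\
    D true 2 0 rho t + beta * g true rho t = a1 / speed f rho t -
      (g true rho t * b1 + g false rho t * b2) * tau true rho t /\
    D false 2 0 rho t + beta * g false rho t = a2 / speed f rho t -
      (g true rho t * b1 + g false rho t * b2) * tau false rho t.
Proof.
  intros Ht.
  destruct (cont_equation hsol rho t ltac:(lra))
    as [[a1 a2] [[b1 b2] [Ha [Hb E]]]].
  exists a1, a2, b1, b2.
  destruct (is_derive_components _ _ _ Ha) as [Ha1 Ha2].
  destruct (is_derive_on_interior _ _ _ _ Ht Hb) as [Hb1 Hb2].
  assert (Hid : clamp T t = t) by (apply clamp_id; lra).
  cbn [fst snd] in *.
  assert (Da1 : is_derive (fun r => tau true r t) rho a1).
  { apply is_derive_Rext with (2 := Ha1); intros r; rewrite tau_coord, Hid; reflexivity. }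
  assert (Da2 : is_derive (fun r => tau false r t) rho a2).
  { apply is_derive_Rext with (2 := Ha2); intros r; rewrite tau_coord, Hid; reflexivity. }
  assert (Db1 : is_derive (fun s => tau true rho s) t b1).
  { apply is_derive_near with (3 := Hb1) (a := 0) (b := T); trivial.
    intros s Hs; rewrite tau_coord, clamp_id by lra; reflexivity. }
  assert (Db2 : is_derive (fun s => tau false rho s) t b2).
  { apply is_derive_near with (3 := Hb2) (a := 0) (b := T); trivial.
    intros s Hs; rewrite tau_coord, clamp_id by lra; reflexivity. }
  generalize (speed_pos rho t); intros Hs.
  split; [trivial|split; [trivial|]].
  split.
  { assert (H : is_derive (fun _ : R => 1) rho
       ((a1 * tau true rho t + tau true rho t * a1) +
        (a2 * tau false rho t + tau false rho t * a2))).
    { apply is_derive_Rext with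
        (fun r => tau true r t * tau true r t + tau false r t * tau false r t).
      - intros r; apply tau_unit.
      - eapply is_derive_eq;
          [apply is_derive_Rplus; apply is_derive_Rmult; eassumption|reflexivity]. }
    generalize (is_derive_unique _ _ _ H); rewrite Derive_const; lra. }
  split.
  { assert (H : is_derive (fun _ : R => 1) t
       ((b1 * tau true rho t + tau true rho t * b1) +
        (b2 * tau false rho t + tau false rho t * b2))).
    { apply is_derive_Rext with
        (fun r => tau true rho r * tau true rho r + tau false rho r * tau false rho r).
      - intros r; apply tau_unit.
      - eapply is_derive_eq;
          [apply is_derive_Rplus; apply is_derive_Rmult; eassumption|reflexivity]. }
    generalize (is_derive_unique _ _ _ H); rewrite Derive_const; lra. }
  split.
  { assert (H : is_derive (fun _ : R => 0) rho
       ((f true 2%nat rho t * tau false rho t + f true 1%nat rho t * a2) -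
        (f false 2%nat rho t * tau true rho t + f false 1%nat rho t * a1))).
    { apply is_derive_Rext with
        (fun r => f true 1%nat r t * tau false r t - f false 1%nat r t * tau true r t).
      - intros r; unfold tau; field; apply Rgt_not_eq, speed_pos.
      - eapply is_derive_eq; [apply is_derive_Rminus; apply is_derive_Rmult;
          first [eassumption | apply D_rho; lia]|reflexivity]. }
    generalize (is_derive_unique _ _ _ H); rewrite Derive_const; intros E0.
    replace (speed f rho t * (tau true rho t * a2 - tau false rho t * a1)) with
      (f true 1%nat rho t * a2 - f false 1%nat rho t * a1)
      by (unfold tau; field; lra).
    replace (f true 1%nat rho t * a2 - f false 1%nat rho t * a1) with
      (f false 2%nat rho t * tau true rho t - f true 2%nat rho t * tau false rho t) by lra.
    unfold tau, turning; field; lra. }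
  assert (E1 := f_equal fst E); assert (E2 := f_equal snd E).
  rewrite plus_pair, minus_pair, !scal_pair in E1, E2; cbn [fst snd] in E1, E2.
  unfold dot in E1, E2; cbn [fst snd] in E1, E2.
  unfold g, D; rewrite !tau_coord, speed_norm, Hid; cbn [coord].
  split.
  - rewrite E1; unfold Rdiv; ring.
  - rewrite E2; unfold Rdiv; ring.
Qed.

(** The tangential velocity satisfies [p' = - beta p] and vanishes initially: the
    last term of the equation compensates the rotation of the tangent. *)
Let normal rho t : g true rho t * f true 1%nat rho t +
                   g false rho t * f false 1%nat rho t = 0.
Proof.
  set (p := fun s => g true rho s * tau true rho s + g false rho s * tau false rho s).
  assert (Hpc : forall s, continuous p s).
  { intros s; apply continuous_Rplus; apply continuous_Rmult; trivial;
      apply D_cont_t; lia. }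
  assert (Hp : forall s, 0 < s < T -> is_derive p s (- beta * p s)).
  { intros s Hs; destruct (equation_facts rho s Hs)
      as [a1 [a2 [b1 [b2 [Db1 [Db2 [Ea [Eb [_ [E1 E2]]]]]]]]]].
    eapply is_derive_eq.
    - apply is_derive_Rplus; apply is_derive_Rmult; eauto; apply D_t; trivial; lia.
    - cbv beta; fold (g true rho s) (g false rho s).
      replace (D true 2 0 rho s) with
        (a1 / speed f rho s - (g true rho s * b1 + g false rho s * b2) * tau true rho s
         - beta * g true rho s) by lra.
      replace (D false 2 0 rho s) with
        (a2 / speed f rho s - (g true rho s * b1 + g false rho s * b2) * tau false rho s
         - beta * g false rho s) by lra.
      unfold p; generalize (tau_unit rho s); intros Eu.
      transitivity (- beta * p s + (tau true rho s * a1 + tau false rho s * a2) / speed f rho s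
         + (g true rho s * b1 + g false rho s * b2) *
           (1 - (tau true rho s * tau true rho s + tau false rho s * tau false rho s)));
        [unfold p; field; apply Rgt_not_eq, speed_pos|].
      rewrite Ea, Eu; unfold p; field; apply Rgt_not_eq, speed_pos. }
  assert (Hp0 : p 0 = 0).
  { assert (Hid : clamp T 0 = 0) by (apply clamp_id; lra).
    unfold p; rewrite !tau_coord; unfold g, D; rewrite Hid.
    rewrite (cont_init_vel hsol), scal_pair; unfold perp.
    cbn [coord fst snd]; ring. }
  assert (Hz : p (clamp T t) = 0).
  { assert (Hsq : p (clamp T t) * p (clamp T t) <= p 0 * p 0).
    { apply (decreasing_of_derive (fun s => p s * p s)
               (fun s => - beta * p s * p s + p s * (- beta * p s)) 0 (clamp T t)).
      - apply Hcl.
      - intros s _; now apply continuous_Rmult.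
      - intros s Hs; apply is_derive_Rmult; apply Hp; generalize (Hcl t);
          unfold Icc; lra.
      - intros s Hs; generalize (pow2_ge_0 (p s)); intros; nra. }
    rewrite Hp0 in Hsq; nra. }
  generalize (speed_pos rho t); intros Hs.
  assert (E : p (clamp T t) = (g true rho t * f true 1%nat rho t +
                   g false rho t * f false 1%nat rho t) / speed f rho t).
  { unfold p, g, tau, speed, f; rewrite !Dclamp; fold (f true 1%nat rho t)
      (f false 1%nat rho t); fold (speed f rho t); field; lra. }
  rewrite Hz in E.
  apply Rmult_eq_reg_r with (/ speed f rho t); [|apply Rinv_neq_0_compat; lra].
  unfold Rdiv in E; lra.
Qed.

Let nv := normal_velocity f g.

Let nv_tau rho t : nv rho t = g false rho t * tau true rho t - g true rho t * tau false rho t.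
Proof. unfold nv, normal_velocity, tau; field; apply Rgt_not_eq, speed_pos. Qed.

Let g_normal rho t :
  g true rho t = - nv rho t * tau false rho t /\ g false rho t = nv rho t * tau true rho t.
Proof.
  apply normal_vector; [apply speed_pos| |apply normal].
  rewrite <- speed_sqr; ring.
Qed.

(** The normal component of the equation, where its last term disappears. *)
Let nv_rate rho t : 0 < t < T ->
  is_derive (fun s => nv rho s) t (- beta * nv rho t + turning f rho t / speed f rho t ^ 3).
Proof.
  intros Ht; destruct (equation_facts rho t Ht)
      as [a1 [a2 [b1 [b2 [Db1 [Db2 [Ea [Eb [Ec [E1 E2]]]]]]]]]].
  apply is_derive_Rext with
    (fun s => g false rho s * tau true rho s - g true rho s * tau false rho s).
  { intros s; symmetry; apply nv_tau. }
  eapply is_derive_eq.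
  - apply is_derive_Rminus; apply is_derive_Rmult; eauto; apply D_t; trivial; lia.
  - cbv beta; fold (g true rho t) (g false rho t).
    generalize (speed_pos rho t); intros Hs.
    replace (D true 2 0 rho t) with
        (a1 / speed f rho t - (g true rho t * b1 + g false rho t * b2) * tau true rho t
         - beta * g true rho t) by lra.
    replace (D false 2 0 rho t) with
        (a2 / speed f rho t - (g true rho t * b1 + g false rho t * b2) * tau false rho t
         - beta * g false rho t) by lra.
    assert (E : tau true rho t * a2 - tau false rho t * a1
                = turning f rho t / speed f rho t ^ 2).
    { apply Rmult_eq_reg_l with (speed f rho t); [|lra]; rewrite Ec; field; lra. }
    destruct (g_normal rho t) as [G1 G2].
    assert (Z : g false rho t * b1 - g true rho t * b2 = 0).
    { rewrite G1, G2; transitivity (nv rho t * (tau true rho t * b1 + tau false rho t * b2));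
        [ring|rewrite Eb; ring]. }
    transitivity (- beta * (g false rho t * tau true rho t - g true rho t * tau false rho t)
      + (tau true rho t * a2 - tau false rho t * a1) / speed f rho t
      + (g false rho t * b1 - g true rho t * b2)); [field; lra|].
    rewrite <- nv_tau, E, Z; field; lra.
Qed.

(** The orthogonality of velocity and tangent is differentiated along the curve. *)
Let speed_rate rho t : 0 < t < T ->
  is_derive (fun s => speed f rho s) t
    (- (nv rho t * turning f rho t) / speed f rho t ^ 2).
Proof.
  intros Ht.
  assert (Hmix : D true 1 1 rho t * f true 1%nat rho t + g true rho t * f true 2%nat rho t +
    (D false 1 1 rho t * f false 1%nat rho t + g false rho t * f false 2%nat rho t) = 0).
  { assert (H : is_derive (fun _ : R => 0) rho
      (D true 1 1 rho t * f true 1%nat rho t + g true rho t * f true 2%nat rho t +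
      (D false 1 1 rho t * f false 1%nat rho t + g false rho t * f false 2%nat rho t))).
    { apply is_derive_Rext with (fun r => g true r t * f true 1%nat r t +
                   g false r t * f false 1%nat r t).
      - intros r; apply normal.
      - eapply is_derive_eq; [apply is_derive_Rplus; apply is_derive_Rmult|].
        + exact (D_mixed true rho t Ht).
        + apply (D_rho true 1%nat); lia.
        + exact (D_mixed false rho t Ht).
        + apply (D_rho false 1%nat); lia.
        + reflexivity. }
    generalize (is_derive_unique _ _ _ H); rewrite Derive_const; auto. }
  generalize (speed_pos rho t); intros Hs.
  eapply is_derive_eq.
  - unfold speed; apply is_derive_Rsqrt.
    + apply is_derive_Rplus; apply is_derive_Rmult; apply D_t; trivial; lia.
    + rewrite <- speed_sqr; apply pow_lt; lra.
  - cbv beta; fold (f true 1%nat rho t) (f false 1%nat rho t); fold (speed f rho t).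
    transitivity ((D true 1 1 rho t * f true 1%nat rho t +
                   D false 1 1 rho t * f false 1%nat rho t) / speed f rho t);
      [field; lra|].
    replace (D true 1 1 rho t * f true 1%nat rho t + D false 1 1 rho t * f false 1%nat rho t)
      with (- (g true rho t * f true 2%nat rho t + g false rho t * f false 2%nat rho t))
      by lra.
    destruct (g_normal rho t) as [-> ->].
    unfold tau, turning; field; lra.
Qed.

Lemma exact_smooth_flow :
  exists M m, 0 < M /\ 0 < m /\ smooth_flow beta T M m
    (fun k j rho t => coord k (dx 0%nat j rho (clamp T t)))
    (fun k rho t => coord k (dx 1%nat 0%nat rho (clamp T t))).
Proof.
  destruct speed_lower as [m [Hm Hspeed]].
  assert (Hall : exists M, 0 < M /\ forall k rho t,
            (forall j, (1 <= j <= 4)%nat -> Rabs (D k 0 j rho t) <= M) /\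
            Rabs (D k 1 0 rho t) <= M /\ Rabs (D k 1 1 rho t) <= M).
  { assert (Hk : forall k, exists M, 0 < M /\ forall rho t,
            (forall j, (1 <= j <= 4)%nat -> Rabs (D k 0 j rho t) <= M) /\
            Rabs (D k 1 0 rho t) <= M /\ Rabs (D k 1 1 rho t) <= M).
    { intros k.
      destruct (Dbounded k 0 1 ltac:(lia) ltac:(lia)) as [M1 [P1 H1]].
      destruct (Dbounded k 0 2 ltac:(lia) ltac:(lia)) as [M2 [P2 H2]].
      destruct (Dbounded k 0 3 ltac:(lia) ltac:(lia)) as [M3 [P3 H3]].
      destruct (Dbounded k 0 4 ltac:(lia) ltac:(lia)) as [M4 [P4 H4]].
      destruct (Dbounded k 1 0 ltac:(lia) ltac:(lia)) as [M5 [P5 H5]].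
      destruct (Dbounded k 1 1 ltac:(lia) ltac:(lia)) as [M6 [P6 H6]].
      exists (M1 + M2 + M3 + M4 + M5 + M6); split; [lra|]; intros rho t.
      specialize (H1 rho t); specialize (H2 rho t); specialize (H3 rho t);
      specialize (H4 rho t); specialize (H5 rho t); specialize (H6 rho t).
      split; [|split; lra].
      intros j Hj; assert (E : (j = 1 \/ j = 2 \/ j = 3 \/ j = 4)%nat) by lia.
      destruct E as [-> | [-> | [-> | ->]]]; lra. }
    destruct (Hk true) as [M1 [P1 H1]], (Hk false) as [M2 [P2 H2]].
    exists (M1 + M2); split; [lra|]; intros k rho t.
    destruct (H1 rho t) as [A1 [A2 A3]], (H2 rho t) as [B1 [B2 B3]].
    destruct k; (split; [|split; lra]); intros j Hj; specialize (A1 j Hj);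
      specialize (B1 j Hj); lra. }
  destruct Hall as [M [HM Hb]].
  exists M, m; split; [trivial|split; [trivial|]].
  change (smooth_flow beta T M m f g); split.
  - intros; now apply D_rho.
  - intros; apply D_t; trivial; lia.
  - intros; now apply Hb.
  - intros; now apply Hb.
  - intros k rho r t.
    unfold g; rewrite <- (Dclamp k 1 0 r t), <- (Dclamp k 1 0 rho t).
    assert (H : Rabs (D k 1 0 r (clamp T t) - D k 1 0 rho (clamp T t))
                - M * Rabs (r - rho) <= 0); [|lra].
    apply (closed_extension
      (fun s => Rabs (D k 1 0 r s - D k 1 0 rho s) - M * Rabs (r - rho)) T hT).
    + intros s; apply continuous_Rminus; [|apply continuous_Rconst].
      apply continuous_Rabs_comp, continuous_Rminus; apply D_cont_t; lia.
    + intros s Hs.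
      assert (H : Rabs (D k 1 0 r s - D k 1 0 rho s) <= M * Rabs (r - rho)); [|lra].
      apply (lipschitz_between (fun r => D k 1 0 r s) (fun r => D k 1 1 r s)).
      * intros; now apply D_mixed.
      * intros; apply Hb.
    + apply Hcl.
  - intros; apply D_cont_t; lia.
  - intros; apply D_cont_t; lia.
  - intros; apply D0_periodic; lia.
  - intros; apply D1_periodic; lia.
  - exact Hspeed.
  - exact normal.
  - exact nv_rate.
  - exact speed_rate.
Qed.

Lemma exact_initial_velocity rho :
  normal_velocity (fun k j rho t => coord k (dx 0%nat j rho (clamp T t)))
    (fun k rho t => coord k (dx 1%nat 0%nat rho (clamp T t))) rho 0 = V0 rho.
Proof.
  change (nv rho 0 = V0 rho).
  rewrite nv_tau.
  assert (Hid : clamp T 0 = 0) by (apply clamp_id; lra).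
  generalize (tau_unit rho 0); rewrite !tau_coord; unfold g, D; rewrite Hid.
  rewrite (cont_init_vel hsol), scal_pair; unfold perp.
  cbn [coord fst snd]; intros U.
  set (n := normalize (dx 0%nat 1%nat rho 0)) in *.
  transitivity (V0 rho * (fst n * fst n + snd n * snd n)); [ring|rewrite U; ring].
Qed.

End Exact.

(** * Consistency of the exact solution with the scheme *)

(** Taylor's formula with a crude constant, by integrating the bound on the
    last derivative once per order. *)
Section Taylor.
Variables (F : nat -> R -> R) (M rho r : R).
Hypotheses (HM : 0 <= M)
  (HF : forall j s, (j < 4)%nat -> is_derive (F j) s (F (S j) s))
  (HB : forall j s, (1 <= j <= 4)%nat -> Rabs (F j s) <= M).

Let step (w dw : R -> R) n q : Rabs q <= Rabs r -> w 0 = 0 ->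
  (forall s, Rabs s <= Rabs r -> is_derive w s (dw s)) ->
  (forall s, Rabs s <= Rabs r -> Rabs (dw s) <= M * Rabs s ^ n) ->
  Rabs (w q) <= M * Rabs q ^ (S n).
Proof.
  intros Hq H0 Hd Hb.
  replace (w q) with (w q - w 0) by (rewrite H0; ring).
  replace (M * Rabs q ^ S n) with (M * Rabs q ^ n * Rabs (q - 0))
    by (rewrite Rminus_0_r; simpl; ring).
  apply (lipschitz_between w dw); intros s; rewrite !Rminus_0_r; intros Hs.
  - apply Hd; lra.
  - apply Rle_trans with (1 := Hb s (Rle_trans _ _ _ Hs Hq)).
    apply Rmult_le_compat_l; trivial; apply pow_incr; split; [apply Rabs_pos|trivial].
Qed.

Let F_shift j s : (j < 4)%nat -> is_derive (fun s => F j (rho + s)) s (F (S j) (rho + s)).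
Proof.
  intros Hj; eapply is_derive_eq.
  - apply (is_derive_Rcomp (F j) (fun s => rho + s)); [now apply HF|].
    apply is_derive_Rplus; [apply is_derive_Rconst|apply is_derive_Rid].
  - ring.
Qed.

Lemma taylor0 j q : (j < 4)%nat -> Rabs q <= Rabs r ->
  Rabs (F j (rho + q) - F j rho) <= M * Rabs q ^ 1.
Proof.
  intros Hj Hq; apply (step (fun q => F j (rho + q) - F j rho) (fun s => F (S j) (rho + s))
    0); trivial.
  - rewrite Rplus_0_r; ring.
  - intros s _; eapply is_derive_eq;
      [apply is_derive_Rminus; [now apply F_shift|apply is_derive_Rconst]|ring].
  - intros s _; simpl; rewrite Rmult_1_r; apply HB; lia.
Qed.

Lemma taylor1 j q : (j < 3)%nat -> Rabs q <= Rabs r ->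
  Rabs (F j (rho + q) - F j rho - q * F (S j) rho) <= M * Rabs q ^ 2.
Proof.
  intros Hj Hq; apply (step (fun q => F j (rho + q) - F j rho - q * F (S j) rho)
    (fun s => F (S j) (rho + s) - F (S j) rho) 1); trivial.
  - rewrite Rplus_0_r; ring.
  - intros s _; eapply is_derive_eq.
    + apply is_derive_Rminus; [apply is_derive_Rminus; [apply F_shift; lia|
        apply is_derive_Rconst]|].
      apply is_derive_Rmult; [apply is_derive_Rid|apply is_derive_Rconst].
    + cbv beta; ring.
  - intros s Hs; apply taylor0; trivial; lia.
Qed.

Lemma taylor2 j q : (j < 2)%nat -> Rabs q <= Rabs r ->
  Rabs (F j (rho + q) - F j rho - q * F (S j) rho - q * q / 2 * F (S (S j)) rho)
  <= M * Rabs q ^ 3.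
Proof.
  intros Hj Hq; apply (step (fun q => F j (rho + q) - F j rho - q * F (S j) rho
      - q * q / 2 * F (S (S j)) rho)
    (fun s => F (S j) (rho + s) - F (S j) rho - s * F (S (S j)) rho) 2); trivial.
  - rewrite Rplus_0_r; field.
  - intros s _; eapply is_derive_eq.
    + generalize (F_shift j s ltac:(lia)); intros D0; repeat derive_step; lra.
    + cbv beta; field.
  - intros s Hs; apply taylor1; trivial; lia.
Qed.

Lemma taylor3 q : Rabs q <= Rabs r ->
  Rabs (F 0 (rho + q) - F 0 rho - q * F 1 rho - q * q / 2 * F 2 rho
        - q * q * q / 6 * F 3 rho) <= M * Rabs q ^ 4.
Proof.
  intros Hq; apply (step (fun q => F 0%nat (rho + q) - F 0%nat rho - q * F 1%nat rho
      - q * q / 2 * F 2%nat rho - q * q * q / 6 * F 3%nat rho)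
    (fun s => F 1%nat (rho + s) - F 1%nat rho - s * F 2%nat rho - s * s / 2 * F 3%nat rho)
    3); trivial.
  - rewrite Rplus_0_r; field.
  - intros s _; eapply is_derive_eq.
    + generalize (F_shift 0 s ltac:(lia)); intros D0; repeat derive_step; lra.
    + cbv beta; field.
  - intros s Hs; apply taylor2; trivial; lia.
Qed.

End Taylor.

(** Equality up to [O(h^2)] is compatible with sums, products, inverses and square
    roots; consistency can thus be computed instead of being estimated term by
    term. *)
Section Congruence.
Context {A : Type} (P : A -> Prop) (h : A -> R).
Hypothesis Hh : forall a, P a -> 0 < h a <= 1.

Definition congr (f g : A -> Z -> R) : Prop :=
  dom P (fun a _ => h a ^ 2) (fun a j => f a j - g a j).

Notation one := (fun (_ : A) (_ : Z) => 1).
Notation "f == g" := (congr f g) (at level 70).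

Lemma dom_h2_one f : dom P (fun a _ => h a ^ 2) f -> dom P one f.
Proof. intros H; apply dom_weaken with (1 := H); intros a j Ha; generalize (Hh a Ha); nra. Qed.

Lemma dom_h2_h f : dom P (fun a _ => h a ^ 2) f -> dom P (fun a _ => h a) f.
Proof. intros H; apply dom_weaken with (1 := H); intros a j Ha; generalize (Hh a Ha); nra. Qed.

Lemma dom_h_one f : dom P (fun a _ => h a) f -> dom P one f.
Proof. intros H; apply dom_weaken with (1 := H); intros a j Ha; generalize (Hh a Ha); nra. Qed.

Lemma congr_of_eq f g : (forall a j, P a -> f a j = g a j) -> f == g.
Proof.
  intros E; apply dom_le with 0; [lra|]; intros a j Ha; rewrite E by trivial.
  rewrite Rminus_diag, Rabs_R0; lra.
Qed.

Lemma congr_trans f g k : f == g -> g == k -> f == k.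
Proof.
  intros H1 H2; apply dom_ext with (fun a j => (f a j - g a j) + (g a j - k a j)).
  - now apply dom_plus.
  - intros; ring.
Qed.

Lemma congr_sym f g : f == g -> g == f.
Proof.
  intros H; apply dom_ext with (fun a j => - (f a j - g a j)); [now apply dom_opp|].
  intros; ring.
Qed.

Lemma congr_bounded f g : f == g -> dom P one g -> dom P one f.
Proof.
  intros H1 H2; apply dom_ext with (fun a j => (f a j - g a j) + g a j).
  - apply dom_plus; trivial; now apply dom_h2_one.
  - intros; ring.
Qed.

Lemma congr_plus f f' g g' : f == f' -> g == g' ->
  (fun a j => f a j + g a j) == (fun a j => f' a j + g' a j).
Proof.
  intros H1 H2; apply dom_ext with (fun a j => (f a j - f' a j) + (g a j - g' a j)).
  - now apply dom_plus.
  - intros; ring.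
Qed.

Lemma congr_mult f f' g g' : f == f' -> g == g' -> dom P one f' -> dom P one g' ->
  (fun a j => f a j * g a j) == (fun a j => f' a j * g' a j).
Proof.
  intros H1 H2 B1 B2.
  apply dom_ext with (fun a j => f a j * (g a j - g' a j) + g' a j * (f a j - f' a j)).
  - apply dom_plus; apply dom_mult1; trivial; now apply congr_bounded with f'.
  - intros; ring.
Qed.

Lemma congr_scal k f f' : f == f' -> (fun a j => k * f a j) == (fun a j => k * f' a j).
Proof.
  intros H; apply dom_ext with (fun a j => k * (f a j - f' a j)); [now apply dom_scal|].
  intros; ring.
Qed.

Lemma congr_inv c f f' : 0 < c -> (forall a j, P a -> c <= f a j) ->
  (forall a j, P a -> c <= f' a j) -> f == f' ->
  (fun a j => / f a j) == (fun a j => / f' a j).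
Proof.
  intros Hc H1 H2 H.
  apply dom_ext with (fun a j => / f a j * (/ f' a j * - (f a j - f' a j))).
  - apply dom_mult1; [now apply dom_inv with c|].
    apply dom_mult1; [now apply dom_inv with c|now apply dom_opp].
  - intros a j Ha; generalize (H1 a j Ha) (H2 a j Ha); intros; field; lra.
Qed.

Lemma congr_sqrt c f f' : 0 < c -> (forall a j, P a -> 0 <= f a j) ->
  (forall a j, P a -> c <= f' a j) -> f == f' ->
  (fun a j => sqrt (f a j)) == (fun a j => sqrt (f' a j)).
Proof.
  intros Hc H1 H2 H.
  apply dom_ext with (fun a j => (f a j - f' a j) / (sqrt (f a j) + sqrt (f' a j))).
  - apply dom_div with (sqrt c); [now apply sqrt_lt_R0| |trivial].
    intros a j Ha; generalize (sqrt_pos (f a j)) (sqrt_le_1_alt _ _ (H2 a j Ha)); lra.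
  - intros a j Ha; generalize (sqrt_pos (f a j)) (sqrt_lt_R0 (f' a j)); intros S1 S2.
    specialize (H1 a j Ha); specialize (H2 a j Ha); specialize (S2 ltac:(lra)).
    replace (f a j - f' a j) with
      ((sqrt (f a j) - sqrt (f' a j)) * (sqrt (f a j) + sqrt (f' a j))).
    + field; lra.
    + generalize (sqrt_sqrt (f a j) H1) (sqrt_sqrt (f' a j) ltac:(lra)); intros E1 E2.
      transitivity (sqrt (f a j) * sqrt (f a j) - sqrt (f' a j) * sqrt (f' a j));
        [ring|now rewrite E1, E2].
Qed.

Lemma dom_times_h f : dom P one f -> dom P (fun a _ => h a) (fun a j => h a * f a j).
Proof.
  intros H; apply dom_ext with (fun a j => (fun a _ => h a) a j * f a j); [|trivial].
  apply dom_mult with (fun a _ => h a) one; trivial.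
  - apply dom_le with 1; [lra|]; intros a j Ha; generalize (Hh a Ha); intros.
    rewrite Rabs_right; lra.
  - intros; lra.
Qed.

Lemma dom_times_h2 f : dom P one f -> dom P (fun a _ => h a ^ 2) (fun a j => h a ^ 2 * f a j).
Proof.
  intros H; apply dom_ext with (fun a j => h a * (h a * f a j)); [|intros; ring].
  apply dom_mult with (fun a _ => h a) (fun a _ => h a); trivial.
  - apply dom_le with 1; [lra|]; intros a j Ha; generalize (Hh a Ha); intros.
    rewrite Rabs_right; lra.
  - now apply dom_times_h.
  - intros; right; ring.
Qed.

(** Two vectors [u], [v] symmetric about [w] up to [O(h^2)], at a distance
    [O(h)]: the first order changes of their lengths cancel. *)
Section SymmetricPair.
Variables (u1 u2 v1 v2 w1 w2 e1 e2 : A -> Z -> R) (m : R).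
Hypotheses (Hm : 0 < m) (Bw1 : dom P one w1) (Bw2 : dom P one w2)
  (Be1 : dom P one e1) (Be2 : dom P one e2)
  (Hu1 : u1 == (fun a j => w1 a j - h a * e1 a j))
  (Hu2 : u2 == (fun a j => w2 a j - h a * e2 a j))
  (Hv1 : v1 == (fun a j => w1 a j + h a * e1 a j))
  (Hv2 : v2 == (fun a j => w2 a j + h a * e2 a j))
  (Hw : forall a j, P a -> m <= sqrt (w1 a j * w1 a j + w2 a j * w2 a j)).

Let N a j := w1 a j * w1 a j + w2 a j * w2 a j.
Let E a j := w1 a j * e1 a j + w2 a j * e2 a j.
Let U a j := u1 a j * u1 a j + u2 a j * u2 a j.
Let V a j := v1 a j * v1 a j + v2 a j * v2 a j.

Let N_low a j : P a -> m ^ 2 <= N a j.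
Proof.
  intros Ha; specialize (Hw a j Ha); fold (N a j) in Hw.
  assert (HN : 0 <= N a j) by (unfold N; nra).
  rewrite <- (sqrt_sqrt (N a j)) by trivial; nra.
Qed.

Let BN : dom P one N.
Proof. unfold N; apply dom_plus; now apply dom_mult1. Qed.

Let BE : dom P one E.
Proof. unfold E; apply dom_plus; now apply dom_mult1. Qed.

Let Bee : dom P one (fun a j => e1 a j * e1 a j + e2 a j * e2 a j).
Proof. apply dom_plus; now apply dom_mult1. Qed.

Let HU : U == (fun a j => N a j + h a * (-2 * E a j)).
Proof.
  apply congr_trans with (fun a j =>
     (w1 a j - h a * e1 a j) * (w1 a j - h a * e1 a j) +
     (w2 a j - h a * e2 a j) * (w2 a j - h a * e2 a j)).
  - unfold U; apply congr_plus; apply congr_mult; trivial;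
      (apply dom_minus; [trivial|]; apply dom_h_one, dom_times_h; trivial).
  - apply dom_ext with (fun a j => h a ^ 2 * (e1 a j * e1 a j + e2 a j * e2 a j)).
    + now apply dom_times_h2.
    + intros; unfold N, E; ring.
Qed.

Let HV : V == (fun a j => N a j + h a * (2 * E a j)).
Proof.
  apply congr_trans with (fun a j =>
     (w1 a j + h a * e1 a j) * (w1 a j + h a * e1 a j) +
     (w2 a j + h a * e2 a j) * (w2 a j + h a * e2 a j)).
  - unfold V; apply congr_plus; apply congr_mult; trivial;
      (apply dom_plus; [trivial|]; apply dom_h_one, dom_times_h; trivial).
  - apply dom_ext with (fun a j => h a ^ 2 * (e1 a j * e1 a j + e2 a j * e2 a j)).
    + now apply dom_times_h2.
    + intros; unfold N, E; ring.
Qed.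

Lemma pair_length_product :
  (fun a j => sqrt (u1 a j * u1 a j + u2 a j * u2 a j) *
              sqrt (v1 a j * v1 a j + v2 a j * v2 a j)) == N.
Proof.
  assert (Hm4 : 0 < m ^ 2 * m ^ 2) by (apply Rmult_lt_0_compat; apply pow_lt; lra).
  apply congr_trans with (fun a j => sqrt (U a j * V a j)).
  { apply congr_of_eq; intros; symmetry; apply sqrt_mult; unfold U, V; nra. }
  apply congr_trans with (fun a j => sqrt (N a j * N a j)).
  { apply (congr_sqrt (m ^ 2 * m ^ 2)); trivial.
    - intros; apply Rmult_le_pos; unfold U, V; nra.
    - intros a j Ha; generalize (N_low a j Ha) (pow2_ge_0 m); intros.
      apply Rmult_le_compat; lra.
    - apply congr_trans with (fun a j =>
        (N a j + h a * (-2 * E a j)) * (N a j + h a * (2 * E a j))).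
      + apply congr_mult; trivial; (apply dom_plus; [trivial|];
          apply dom_h_one, dom_times_h, dom_scal; trivial).
      + apply dom_ext with (fun a j => h a ^ 2 * (-4 * (E a j * E a j))).
        * apply dom_times_h2, dom_scal; now apply dom_mult1.
        * intros; ring. }
  apply congr_of_eq; intros a j Ha; apply sqrt_square.
  generalize (N_low a j Ha) (pow2_ge_0 m); lra.
Qed.

Lemma pair_length_sum :
  (fun a j => sqrt (u1 a j * u1 a j + u2 a j * u2 a j) +
              sqrt (v1 a j * v1 a j + v2 a j * v2 a j)) == (fun a j => 2 * sqrt (N a j)).
Proof.
  assert (Hm2 : 0 < m ^ 2) by (apply pow_lt; lra).
  apply congr_trans with (fun a j =>
    sqrt ((U a j + V a j) + 2 * (sqrt (U a j) * sqrt (V a j)))).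
  { apply congr_of_eq; intros a j Ha; fold (U a j) (V a j).
    assert (HU0 : 0 <= U a j) by (unfold U; nra).
    assert (HV0 : 0 <= V a j) by (unfold V; nra).
    generalize (sqrt_pos (U a j)) (sqrt_pos (V a j)); intros.
    rewrite <- (sqrt_square (sqrt (U a j) + sqrt (V a j))) by lra.
    f_equal; rewrite <- (sqrt_sqrt (U a j)) at 3 by trivial.
    rewrite <- (sqrt_sqrt (V a j)) at 3 by trivial; ring. }
  apply congr_trans with (fun a j => sqrt (4 * N a j)).
  { apply (congr_sqrt (m ^ 2)); trivial.
    - intros a j Ha.
      assert (HU0 : 0 <= U a j) by (unfold U; nra).
      assert (HV0 : 0 <= V a j) by (unfold V; nra).
      generalize (Rmult_le_pos _ _ (sqrt_pos (U a j)) (sqrt_pos (V a j))); lra.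
    - intros a j Ha; generalize (N_low a j Ha); lra.
    - apply congr_trans with (fun a j =>
        ((N a j + h a * (-2 * E a j)) + (N a j + h a * (2 * E a j))) + 2 * N a j).
      + apply congr_plus; [now apply congr_plus|].
        apply congr_scal; exact pair_length_product.
      + apply congr_of_eq; intros; ring. }
  apply congr_of_eq; intros a j Ha; rewrite sqrt_mult by
    (generalize (N_low a j Ha); lra).
  replace 4 with (2 * 2) by ring; rewrite sqrt_square by lra; reflexivity.
Qed.

End SymmetricPair.
End Congruence.

Section Consistency.
Variables (beta T M m : R) (f : bool -> nat -> R -> R -> R) (g : bool -> R -> R -> R).
Hypotheses (HM : 0 < M) (Hm : 0 < m) (Hflow : smooth_flow beta T M m f g).

(** Quantities are indexed by the number of grid points and the time, so that the
    constants in [dom] and [congr] are uniform in both. *)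
Let A := (nat * R)%type.
Let h (a : A) : R := mesh (fst a).
Let nd (a : A) (j : Z) : R := node (fst a) j.

Variable P : A -> Prop.
Hypothesis HP : forall a, P a -> (2 <= fst a)%nat.

Notation one := (fun (_ : A) (_ : Z) => 1).
Notation "p == q" := (congr P h p q) (at level 70).
Notation "p << w" := (dom P w p) (at level 70).

Let Hh a : P a -> 0 < h a <= 1.
Proof.
  intros Ha; generalize (HP a Ha); intros HJ; unfold h, mesh.
  assert (H1 : 1 <= INR (fst a)) by (apply (le_INR 1); lia).
  split; [apply Rinv_0_lt_compat; lra|].
  rewrite <- Rinv_1; apply Rinv_le_contravar; lra.
Qed.

Let nd_succ a j : nd a (j + 1)%Z = nd a j + h a.
Proof. unfold nd, node, h; rewrite plus_IZR; ring. Qed.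

Let nd_pred a j : nd a (j - 1)%Z = nd a j + - h a.
Proof. unfold nd, node, h; rewrite minus_IZR; ring. Qed.

(* First and second derivatives at the nodes, and the secants ending and starting
   there. *)
Let y k (a : A) j := f k 1%nat (nd a j) (snd a).
Let z k (a : A) j := f k 2%nat (nd a j) (snd a).
Let da k (a : A) j := / h a * (f k 0%nat (nd a j) (snd a) - f k 0%nat (nd a (j - 1)%Z) (snd a)).
Let db k (a : A) j := da k a (j + 1)%Z.

Let F k t j rho := f k j rho t.
Let HF k t j s : (j < 4)%nat -> is_derive (F k t j) s (F k t (S j) s).
Proof. intros; now apply (flow_rho Hflow). Qed.
Let HB k t j s : (1 <= j <= 4)%nat -> Rabs (F k t j s) <= M.
Proof. intros; now apply (flow_f_bound Hflow). Qed.
Let HM0 : 0 <= M.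
Proof. lra. Qed.

Let y1 k : y k << one.
Proof. apply dom_le with M; trivial; intros; rewrite Rmult_1_r; apply HB; lia. Qed.
Let z1 k : z k << one.
Proof. apply dom_le with M; trivial; intros; rewrite Rmult_1_r; apply HB; lia. Qed.
Let hz1 k : (fun a j => / 2 * z k a j) << one.
Proof. now apply dom_scal. Qed.

Let db_def k a j : db k a j = / h a * (f k 0%nat (nd a j + h a) (snd a) -
                                       f k 0%nat (nd a j) (snd a)).
Proof.
  unfold db, da; rewrite nd_succ; replace (j + 1 - 1)%Z with j by lia; reflexivity.
Qed.

Let da_def k a j : da k a j = / h a * (f k 0%nat (nd a j) (snd a) -
                                       f k 0%nat (nd a j + - h a) (snd a)).
Proof. unfold da; now rewrite nd_pred. Qed.

(* division of a Taylor remainder by a power of the mesh size *)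
Let divide_h (n : nat) (p : A -> Z -> R) K : 0 <= K ->
  (forall a j, P a -> Rabs (h a ^ n * p a j) <= K * h a ^ (n + 2)) ->
  p << (fun a _ => h a ^ 2).
Proof.
  intros HK H; apply dom_le with K; trivial; intros a j Ha.
  specialize (H a j Ha); generalize (Hh a Ha); intros Hha.
  assert (Hn : 0 < h a ^ n) by (apply pow_lt; lra).
  rewrite Rabs_mult, (Rabs_right (h a ^ n)), pow_add in H by lra.
  apply Rmult_le_reg_l with (h a ^ n); trivial; lra.
Qed.

Let abs_h a : P a -> Rabs (h a) = h a /\ Rabs (- h a) = h a.
Proof. intros Ha; generalize (Hh a Ha); intros; rewrite Rabs_Ropp, Rabs_right; lra. Qed.

Let Hda k : da k == (fun a j => y k a j - h a * (/ 2 * z k a j)).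
Proof.
  apply (divide_h 1) with M; trivial; intros a j Ha.
  generalize (Hh a Ha) (abs_h a Ha); intros H1 [H2 H3].
  generalize (taylor2 (F k (snd a)) M (nd a j) (- h a) HM0 (HF k (snd a)) (HB k (snd a))
    0 (- h a) ltac:(lia) (Rle_refl _)); rewrite H3; unfold F; intros H.
  rewrite da_def; rewrite <- Rabs_Ropp in H.
  match type of H with Rabs ?u <= _ => match goal with |- Rabs ?v <= _ =>
    replace v with u; [exact H|] end end.
  unfold y, z; field; lra.
Qed.

Let Hdb k : db k == (fun a j => y k a j + h a * (/ 2 * z k a j)).
Proof.
  apply (divide_h 1) with M; trivial; intros a j Ha.
  generalize (Hh a Ha) (abs_h a Ha); intros H1 [H2 H3].
  generalize (taylor2 (F k (snd a)) M (nd a j) (h a) HM0 (HF k (snd a)) (HB k (snd a))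
    0 (h a) ltac:(lia) (Rle_refl _)); rewrite H2; unfold F; intros H.
  rewrite db_def.
  match type of H with Rabs ?u <= _ => match goal with |- Rabs ?v <= _ =>
    replace v with u; [exact H|] end end.
  unfold y, z; field; lra.
Qed.

(* central first and second difference quotients *)
Let md k a j := / 2 * (da k a j + db k a j).
Let kd k a j := / h a * (db k a j - da k a j).

Let Hmd k : md k == y k.
Proof.
  apply congr_trans with (fun a j => / 2 * ((y k a j - h a * (/ 2 * z k a j)) +
                                            (y k a j + h a * (/ 2 * z k a j)))).
  - apply congr_scal; now apply congr_plus.
  - apply congr_of_eq; intros; field.
Qed.

Let Hkd k : kd k == z k.
Proof.
  apply (divide_h 2) with (2 * M); [lra|]; intros a j Ha.
  generalize (Hh a Ha) (abs_h a Ha); intros H1 [H2 H3].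
  generalize (taylor3 (F k (snd a)) M (nd a j) (h a) HM0 (HF k (snd a)) (HB k (snd a))
    (h a) (Rle_refl _)) (taylor3 (F k (snd a)) M (nd a j) (- h a) HM0 (HF k (snd a))
    (HB k (snd a)) (- h a) (Rle_refl _)); rewrite H2, H3; unfold F; intros T1 T2.
  unfold kd; rewrite da_def, db_def.
  match type of T1 with Rabs ?u <= _ => match type of T2 with Rabs ?v <= _ =>
    match goal with |- Rabs ?w <= _ => replace w with (u + v) end end end.
  - eapply Rle_trans; [apply Rabs_triang|]; simpl in *; lra.
  - unfold z; field; lra.
Qed.

Let Hy_pred k : (fun a j => y k a (j + -1)%Z) == (fun a j => y k a j - h a * z k a j).
Proof.
  apply (divide_h 0) with M; trivial; intros a j Ha.
  generalize (Hh a Ha) (abs_h a Ha); intros H1 [H2 H3].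
  generalize (taylor1 (F k (snd a)) M (nd a j) (- h a) HM0 (HF k (snd a)) (HB k (snd a))
    1 (- h a) ltac:(lia) (Rle_refl _)); rewrite H3; unfold F; intros H.
  change (j + -1)%Z with (j - 1)%Z; unfold y at 1; rewrite nd_pred.
  match type of H with Rabs ?u <= _ => match goal with |- Rabs ?v <= _ =>
    replace v with u; [exact H|] end end.
  unfold y, z; ring.
Qed.

Let Hy_succ k : (fun a j => y k a (j + 1)%Z) == (fun a j => y k a j + h a * z k a j).
Proof.
  apply (divide_h 0) with M; trivial; intros a j Ha.
  generalize (Hh a Ha) (abs_h a Ha); intros H1 [H2 H3].
  generalize (taylor1 (F k (snd a)) M (nd a j) (h a) HM0 (HF k (snd a)) (HB k (snd a))
    1 (h a) ltac:(lia) (Rle_refl _)); rewrite H2; unfold F; intros H.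
  unfold y at 1; rewrite nd_succ.
  match type of H with Rabs ?u <= _ => match goal with |- Rabs ?v <= _ =>
    replace v with u; [exact H|] end end.
  unfold y, z; ring.
Qed.

Let da1 k : da k << one.
Proof.
  apply congr_bounded with h (fun a j => y k a j - h a * (/ 2 * z k a j)); trivial.
  apply dom_minus; trivial; apply (dom_h_one P h Hh), dom_times_h; trivial.
Qed.

Let db1 k : db k << one.
Proof. exact (dom_shift P 1 one (da k) (da1 k)). Qed.

Let md1 k : md k << one.
Proof. apply dom_scal, dom_plus; trivial. Qed.

Let kd1 k : kd k << one.
Proof. apply congr_bounded with h (z k); trivial. Qed.

Let dot2 (p q : bool -> A -> Z -> R) a j := p true a j * q true a j + p false a j * q false a j.
Let cross2 (p q : bool -> A -> Z -> R) a j := p true a j * q false a j - p false a j * q true a j.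

Let dom_dot p q w : (forall k, p k << one) -> (forall k, q k << w) -> dot2 p q << w.
Proof. intros Hp Hq; unfold dot2; apply dom_plus; now apply dom_mult1. Qed.

Let NA := dot2 da da.
Let NB := dot2 db db.
Let AB := dot2 da db.
Let NY := dot2 y y.

Let da_y_h k : (fun a j => da k a j - y k a j) << (fun a _ => h a).
Proof.
  apply dom_ext with (fun a j => (da k a j - (y k a j - h a * (/ 2 * z k a j)))
                                 - h a * (/ 2 * z k a j)); [|intros; ring].
  apply dom_minus; [apply (dom_h2_h P h Hh), Hda|]; now apply dom_times_h.
Qed.

Let db_y_h k : (fun a j => db k a j - y k a j) << (fun a _ => h a).
Proof.
  apply dom_ext with (fun a j => (db k a j - (y k a j + h a * (/ 2 * z k a j)))
                                 + h a * (/ 2 * z k a j)); [|intros; ring].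
  apply dom_plus; [apply (dom_h2_h P h Hh), Hdb|]; now apply dom_times_h.
Qed.

Lemma secants_near_tangent :
  (fun a j => NA a j - NY a j) << (fun a _ => h a) /\
  (fun a j => AB a j - NY a j) << (fun a _ => h a).
Proof.
  split.
  - apply dom_ext with (fun a j =>
      dot2 (fun k a j => da k a j + y k a j) (fun k a j => da k a j - y k a j) a j).
    + apply dom_dot; trivial; intros; now apply dom_plus.
    + intros; unfold NA, NY, dot2; ring.
  - apply dom_ext with (fun a j => dot2 db (fun k a j => da k a j - y k a j) a j +
                         dot2 y (fun k a j => db k a j - y k a j) a j).
    + apply dom_plus; now apply dom_dot.
    + intros; unfold AB, NY, dot2; ring.
Qed.

(* The secants are nondegenerate and make an angle of less than a right angle
   as soon as the mesh size is small; see [secants_near_tangent]. *)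
Hypothesis Hsmall : forall a j, P a -> m ^ 2 / 4 <= NA a j /\ 0 <= AB a j.

Let sp a j := sqrt (NY a j).
Let na a j := sqrt (NA a j).
Let nb a j := na a (j + 1)%Z.

Let sp_speed a j : sp a j = speed f (nd a j) (snd a).
Proof. reflexivity. Qed.

Let sp_low a j : m <= sp a j.
Proof. apply (flow_speed Hflow). Qed.

Let sp_sqr a j : sp a j * sp a j = NY a j.
Proof. apply sqrt_sqrt; unfold NY, dot2; nra. Qed.

Let sp1 : sp << one.
Proof.
  apply dom_le with (2 * M); [lra|]; intros a j _; rewrite Rmult_1_r.
  rewrite Rabs_right by (generalize (sp_low a j); lra).
  assert (Hk : forall k, Rabs (y k a j) <= M) by (intros; apply HB; lia).
  apply Rsqr_incr_0_var; [|lra]; unfold Rsqr; rewrite sp_sqr; unfold NY, dot2.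
  assert (Hs : forall k, y k a j * y k a j <= M * M).
  { intros k; specialize (Hk k); apply Rabs_le_between in Hk; nra. }
  generalize (Hs true) (Hs false); nra.
Qed.

Let na_low a j : P a -> m / 2 <= na a j.
Proof.
  intros Ha; destruct (Hsmall a j Ha) as [H _].
  unfold na; rewrite <- (sqrt_square (m / 2)) by lra.
  apply sqrt_le_1_alt; lra.
Qed.

Let nb_low a j : P a -> m / 2 <= nb a j.
Proof. apply na_low. Qed.

Let na_sqr a j : na a j * na a j = NA a j.
Proof. apply sqrt_sqrt; unfold NA, dot2; nra. Qed.

Let nb_sqr a j : nb a j * nb a j = NB a j.
Proof. apply (na_sqr a (j + 1)%Z). Qed.

Let na_congr_product : (fun a j => na a j * nb a j) == NY.
Proof.
  exact (pair_length_product P h Hh (da true) (da false) (db true) (db false)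
    (y true) (y false) (fun a j => / 2 * z true a j) (fun a j => / 2 * z false a j)
    m Hm (y1 true) (y1 false) (hz1 true) (hz1 false) (Hda true) (Hda false)
    (Hdb true) (Hdb false) (fun a j _ => sp_low a j)).
Qed.

Let na_congr_sum : (fun a j => na a j + nb a j) == (fun a j => 2 * sp a j).
Proof.
  exact (pair_length_sum P h Hh (da true) (da false) (db true) (db false)
    (y true) (y false) (fun a j => / 2 * z true a j) (fun a j => / 2 * z false a j)
    m Hm (y1 true) (y1 false) (hz1 true) (hz1 false) (Hda true) (Hda false)
    (Hdb true) (Hdb false) (fun a j _ => sp_low a j)).
Qed.

(** The tangents at the ends of a cell are symmetric about its secant. *)
Let cell_speed : (fun a j => (sp a (j + -1)%Z + sp a j) / 2) == na.
Proof.
  assert (H : (fun a j => sp a (j + -1)%Z + sp a j) == (fun a j => 2 * na a j)).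
  { refine (pair_length_sum P h Hh (fun a j => y true a (j + -1)%Z)
      (fun a j => y false a (j + -1)%Z) (y true) (y false)
      (da true) (da false) (fun a j => / 2 * z true a j) (fun a j => / 2 * z false a j)
      (m / 2) ltac:(lra) (da1 true) (da1 false) (hz1 true) (hz1 false) _ _ _ _ na_low);
    match goal with |- congr _ _ _ (fun a j => da ?k a j - _) =>
      apply congr_trans with (1 := Hy_pred k);
      apply congr_trans with (fun a j => (y k a j - h a * (/ 2 * z k a j))
                                         + -1 * (h a * (/ 2 * z k a j)));
      [apply congr_of_eq; intros; field
      |apply congr_trans with (fun a j => da k a j + -1 * (h a * (/ 2 * z k a j)));
       [apply congr_plus; [apply congr_sym, Hda|now apply congr_of_eq]
       |apply congr_of_eq; intros; ring]]
    | |- congr _ _ (y ?k) _ =>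
      apply congr_trans with (fun a j => (y k a j - h a * (/ 2 * z k a j))
                                         + h a * (/ 2 * z k a j));
      [apply congr_of_eq; intros; field
      |apply congr_plus; [apply congr_sym, Hda|now apply congr_of_eq]]
    end. }
  apply congr_trans with (fun a j => / 2 * (sp a (j + -1)%Z + sp a j)).
  { apply congr_of_eq; intros; field. }
  apply congr_trans with (fun a j => / 2 * (2 * na a j)); [now apply congr_scal|].
  apply congr_of_eq; intros; field.
Qed.

(** The tangents at the neighbours of a node are symmetric about its tangent. *)
Let node_speed :
  (fun a j => (sp a (j + -1)%Z + 2 * sp a j + sp a (j + 1)%Z) / 4) == sp.
Proof.
  assert (H : (fun a j => sp a (j + -1)%Z + sp a (j + 1)%Z) == (fun a j => 2 * sp a j)).
  { exact (pair_length_sum P h Hh (fun a j => y true a (j + -1)%Z)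
      (fun a j => y false a (j + -1)%Z) (fun a j => y true a (j + 1)%Z)
      (fun a j => y false a (j + 1)%Z)
      (y true) (y false) (z true) (z false)
      m Hm (y1 true) (y1 false) (z1 true) (z1 false) (Hy_pred true) (Hy_pred false)
      (Hy_succ true) (Hy_succ false) (fun a j _ => sp_low a j)). }
  apply congr_trans with
    (fun a j => / 4 * ((sp a (j + -1)%Z + sp a (j + 1)%Z) + 2 * sp a j)).
  { apply congr_of_eq; intros; field. }
  apply congr_trans with (fun a j => / 4 * (2 * sp a j + 2 * sp a j)).
  - apply congr_scal, congr_plus; [exact H|now apply congr_of_eq].
  - apply congr_of_eq; intros; field.
Qed.

Let tan k a j := / na a j * da k a j.
Let tan' k a j := tan k a (j + 1)%Z.
Let nsum a j := sqrt ((tan true a j + tan' true a j) * (tan true a j + tan' true a j) +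
                      (tan false a j + tan' false a j) * (tan false a j + tan' false a j)).
Let co a j := nsum a j / 2.
Let si a j := cross2 tan tan' a j / nsum a j.

Let tan_unit a j : P a -> dot2 tan tan a j = 1.
Proof.
  intros Ha; generalize (na_low a j Ha) (na_sqr a j); intros H1 H2.
  unfold dot2, tan.
  transitivity (NA a j / (na a j * na a j)); [unfold NA, dot2; field; lra|].
  rewrite H2; field; rewrite <- H2; nra.
Qed.

Let tan'_unit a j : P a -> dot2 tan' tan' a j = 1.
Proof. apply (tan_unit a (j + 1)%Z). Qed.

Let tan_dot a j : P a -> 0 <= dot2 tan tan' a j.
Proof.
  intros Ha; generalize (na_low a j Ha) (nb_low a j Ha); intros H1 H2.
  destruct (Hsmall a j Ha) as [_ H].
  replace (dot2 tan tan' a j) with (AB a j * / (na a j * nb a j)).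
  - apply Rmult_le_pos; trivial; left; apply Rinv_0_lt_compat, Rmult_lt_0_compat; lra.
  - unfold AB, dot2, tan', tan, db, nb; field.
    unfold nb in H2; lra.
Qed.

Let nsum_sqr a j : P a -> nsum a j * nsum a j = 2 + 2 * dot2 tan tan' a j.
Proof.
  intros Ha; unfold nsum; rewrite sqrt_sqrt by
    (apply Rplus_le_le_0_compat; apply Rle_0_sqr).
  generalize (tan_unit a j Ha) (tan'_unit a j Ha); unfold dot2; lra.
Qed.

Let nsum_low a j : P a -> 1 <= nsum a j.
Proof.
  intros Ha; generalize (nsum_sqr a j Ha) (tan_dot a j Ha); intros H1 H2.
  assert (0 <= nsum a j) by apply sqrt_pos; nra.
Qed.

Let turn_unit a j : P a -> co a j ^ 2 + si a j ^ 2 = 1.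
Proof.
  intros Ha; generalize (nsum_sqr a j Ha) (nsum_low a j Ha); intros H1 H2.
  generalize (tan_unit a j Ha) (tan'_unit a j Ha); intros U1 U2.
  assert (L : dot2 tan tan' a j ^ 2 + cross2 tan tan' a j ^ 2 =
              dot2 tan tan a j * dot2 tan' tan' a j) by (unfold dot2, cross2; ring).
  rewrite U1, U2 in L; unfold co, si.
  transitivity (((nsum a j * nsum a j) ^ 2 + 4 * cross2 tan tan' a j ^ 2) /
                (4 * (nsum a j * nsum a j))); [field; lra|].
  assert (E : (nsum a j * nsum a j) ^ 2 + 4 * cross2 tan tan' a j ^ 2 =
              4 * (nsum a j * nsum a j)) by (rewrite H1; lra).
  rewrite E; field; lra.
Qed.

Let crs := cross2 y z.

Let crs1 : crs << one.
Proof. unfold crs, cross2; apply dom_minus; now apply dom_mult1. Qed.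

Let cross_congr : cross2 md kd == crs.
Proof.
  assert (H : forall k k', (fun a j => md k a j * kd k' a j) ==
                           (fun a j => y k a j * z k' a j)).
  { intros; apply congr_mult; trivial. }
  unfold crs, cross2; apply congr_trans with (fun a j =>
    y true a j * z false a j + -1 * (y false a j * z true a j)).
  - apply congr_trans with (fun a j =>
      md true a j * kd false a j + -1 * (md false a j * kd true a j)).
    + apply congr_of_eq; intros; ring.
    + apply congr_plus; [apply H|now apply congr_scal].
  - apply congr_of_eq; intros; ring.
Qed.

Let cross_md1 : cross2 md kd << one.
Proof. apply congr_bounded with h crs; trivial. Qed.

Let prod_low a j : P a -> m * m / 4 <= na a j * nb a j.
Proof. intros Ha; generalize (na_low a j Ha) (nb_low a j Ha); nra. Qed.

Let si_formula a j : P a ->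
  si a j = h a * (cross2 md kd a j * / (na a j * nb a j) * / nsum a j).
Proof.
  intros Ha; generalize (na_low a j Ha) (nb_low a j Ha) (nsum_low a j Ha) (Hh a Ha).
  intros H1 H2 H3 H4; unfold si, cross2, tan', tan, md, kd.
  change (na a (j + 1)%Z) with (nb a j); fold (db true a j) (db false a j).
  field; lra.
Qed.

Let inv_prod1 : (fun a j => / (na a j * nb a j)) << one.
Proof. apply dom_inv with (m * m / 4); [nra|exact prod_low]. Qed.

Let inv_nsum1 : (fun a j => / nsum a j) << one.
Proof. apply dom_inv with 1; [lra|exact nsum_low]. Qed.

Let si_h : si << (fun a _ => h a).
Proof.
  apply dom_ext with
    (fun a j => h a * (cross2 md kd a j * / (na a j * nb a j) * / nsum a j)).
  - apply dom_times_h; trivial; apply dom_mult1; trivial; now apply dom_mult1.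
  - exact si_formula.
Qed.

Let nsum_congr : nsum == (fun _ _ => 2).
Proof.
  apply congr_trans with (fun a j => sqrt (4 - 4 * (si a j * si a j))).
  { apply congr_of_eq; intros a j Ha.
    rewrite <- (sqrt_square (nsum a j)) by apply sqrt_pos; f_equal.
    generalize (turn_unit a j Ha); unfold co; intros; lra. }
  apply congr_trans with (fun _ _ => sqrt 4).
  - apply (congr_sqrt P h 4 (fun a j => 4 - 4 * (si a j * si a j)) (fun _ _ => 4)); try lra.
    + intros a j Ha; generalize (turn_unit a j Ha) (pow2_ge_0 (co a j)); lra.
    + intros; lra.
    + apply dom_ext with (fun a j => -4 * (si a j * si a j)); [|intros; ring].
      apply dom_scal, dom_mult with (fun a _ => h a) (fun a _ => h a); trivial.
      intros; right; ring.
  - apply congr_of_eq; intros; replace 4 with (2 * 2) by ring; apply sqrt_square; lra.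
Qed.

Let NY_low a j : m * m <= NY a j.
Proof. rewrite <- sp_sqr; generalize (sp_low a j); nra. Qed.

Let inv_NY1 : (fun a j => / NY a j) << one.
Proof. apply dom_inv with (m * m); [nra|]; intros; apply NY_low. Qed.

Let inv_prod_congr : (fun a j => / (na a j * nb a j)) == (fun a j => / NY a j).
Proof.
  apply congr_inv with (m * m / 4); trivial; [nra|].
  intros; generalize (NY_low a j); nra.
Qed.

Let inv_nsum_congr : (fun a j => / nsum a j) == (fun _ _ => / 2).
Proof. apply congr_inv with 1; trivial; intros; lra. Qed.

(** By [si_formula] the left-hand side is built from the central difference
    quotients and from quantities symmetric in the two secants at a node, which
    are all known up to [O(h^2)]. *)
Let turn_congr : (fun a j => 2 * (/ h a * si a j)) == (fun a j => crs a j * / NY a j).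
Proof.
  apply congr_trans with
    (fun a j => 2 * (cross2 md kd a j * / (na a j * nb a j) * / nsum a j)).
  { apply congr_of_eq; intros a j Ha; rewrite si_formula by trivial.
    generalize (na_low a j Ha) (nb_low a j Ha) (nsum_low a j Ha) (Hh a Ha); intros.
    field; lra. }
  apply congr_trans with (fun a j => 2 * (crs a j * / NY a j * / 2)).
  - apply congr_scal, congr_mult; trivial.
    + apply congr_mult; trivial.
    + now apply dom_mult1.
    + apply dom_const.
  - apply congr_of_eq; intros a j _; generalize (NY_low a j); intros; field; nra.
Qed.

Let theta k a j := (tan k a j + tan' k a j) * / nsum a j.
Let tg k a j := y k a j * / sp a j.

Let inv_sp1 : (fun a j => / sp a j) << one.
Proof. apply dom_inv with m; trivial; intros; apply sp_low. Qed.

Let na_diff_h : (fun a j => na a j - nb a j) << (fun a _ => h a).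
Proof.
  apply dom_ext with (fun a j => h a * (-2 * dot2 kd md a j) / (na a j + nb a j)).
  - apply dom_div with m; trivial.
    + intros a j Ha; generalize (na_low a j Ha) (nb_low a j Ha); lra.
    + apply dom_times_h; trivial; apply dom_scal; now apply dom_dot.
  - intros a j Ha; generalize (na_low a j Ha) (nb_low a j Ha) (Hh a Ha); intros.
    assert (E : h a * (-2 * dot2 kd md a j) = (na a j - nb a j) * (na a j + nb a j)).
    { transitivity (NA a j - NB a j).
      - unfold NA, NB, dot2, kd, md; field; lra.
      - rewrite <- na_sqr, <- nb_sqr; ring. }
    rewrite E; field; lra.
Qed.

(** The secants at a node are symmetric about the tangent, and their lengths
    differ by [O(h)] only: the first order terms cancel. *)
Let theta_congr k : theta k == tg k.
Proof.
  apply congr_trans with (fun a j =>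
    ((na a j + nb a j) * md k a j + / 2 * (h a * ((na a j - nb a j) * kd k a j)))
    * / (na a j * nb a j) * / nsum a j).
  { apply congr_of_eq; intros a j Ha.
    generalize (na_low a j Ha) (nb_low a j Ha) (nsum_low a j Ha) (Hh a Ha); intros.
    unfold theta, tan', tan, md, kd.
    change (na a (j + 1)%Z) with (nb a j); fold (db k a j); field; lra. }
  apply congr_trans with (fun a j => (2 * sp a j * y k a j) * / NY a j * / 2).
  - assert (B : (fun a j => 2 * sp a j * y k a j) << one).
    { apply dom_mult1; trivial; now apply dom_scal. }
    apply congr_mult; trivial; [|now apply dom_mult1|apply dom_const].
    apply congr_mult; trivial.
    apply congr_trans with (fun a j => 2 * sp a j * y k a j + / 2 * 0);
      [|apply congr_of_eq; intros; ring].
    apply congr_plus.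
    + apply congr_mult; trivial; now apply dom_scal.
    + apply congr_scal, dom_ext with
        (fun a j => (na a j - nb a j) * (h a * kd k a j)); [|intros; ring].
      apply dom_mult with (fun a _ => h a) (fun a _ => h a); trivial.
      * now apply dom_times_h.
      * intros; right; ring.
  - apply congr_of_eq; intros a j _; unfold tg; rewrite <- sp_sqr.
    generalize (sp_low a j); intros; field; lra.
Qed.

Let theta_unit a j : P a -> dot2 theta theta a j = 1.
Proof.
  intros Ha; generalize (nsum_low a j Ha) (nsum_sqr a j Ha) (tan_unit a j Ha)
    (tan'_unit a j Ha); intros H1 H2 U1 U2.
  transitivity ((dot2 tan tan a j + dot2 tan' tan' a j + 2 * dot2 tan tan' a j) *
                / (nsum a j * nsum a j)).
  - unfold dot2, theta; field; lra.
  - rewrite U1, U2, H2; field; rewrite <- H2; nra.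
Qed.

Let tg_unit a j : dot2 tg tg a j = 1.
Proof.
  generalize (sp_low a j) (sp_sqr a j); intros H1 H2; unfold dot2, tg.
  transitivity (NY a j * / (sp a j * sp a j)); [unfold NY, dot2; field; lra|].
  rewrite H2; field; rewrite <- H2; nra.
Qed.

Let theta1 k : theta k << one.
Proof.
  apply dom_le with 1; [lra|]; intros a j Ha; rewrite Rmult_1_r.
  generalize (theta_unit a j Ha); unfold dot2; intros E.
  apply Rabs_le_between; destruct k; split; nra.
Qed.

Let tan1 k : tan k << one.
Proof.
  apply dom_le with 1; [lra|]; intros a j Ha; rewrite Rmult_1_r.
  generalize (tan_unit a j Ha); unfold dot2; intros E.
  apply Rabs_le_between; destruct k; split; nra.
Qed.

Let co1 : co << one.
Proof.
  apply dom_le with 1; [lra|]; intros a j Ha; rewrite Rmult_1_r.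
  generalize (turn_unit a j Ha) (pow2_ge_0 (si a j)); intros E1 E2.
  apply Rabs_le_between; split; nra.
Qed.

(* Projections of the secant directions on the bisector: elementary identities
   between unit vectors, from the values of [tan . tan'] and [tan x tan']. *)
Let tan_theta a j : P a ->
  dot2 tan theta a j = co a j /\ cross2 theta tan a j = - si a j /\
  dot2 tan' theta a j = co a j /\ cross2 theta tan' a j = si a j.
Proof.
  intros Ha; generalize (nsum_low a j Ha) (nsum_sqr a j Ha) (tan_unit a j Ha)
    (tan'_unit a j Ha); intros H1 H2 U1 U2.
  assert (E : co a j = (1 + dot2 tan tan' a j) * / nsum a j).
  { unfold co; transitivity (nsum a j * nsum a j * / 2 * / nsum a j); [field; lra|].
    rewrite H2; field; lra. }
  rewrite E; repeat split.
  - rewrite <- U1; unfold dot2, theta; ring.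
  - unfold si, cross2, theta; field; lra.
  - rewrite <- U2; unfold dot2, theta; ring.
  - unfold si, cross2, theta; field; lra.
Qed.

Let h3 (a : A) (j : Z) := h a ^ 3.

Let h2_mul_h : forall a (j : Z), P a -> h a * h a ^ 2 <= h3 a j.
Proof. intros; unfold h3; right; ring. Qed.

(** For a unit vector at an angle of order [h] with the bisecting direction, an
    error [O(h^2)] of that direction changes the cosine by [O(h^3)] only. The
    additional order survives the division by [h] in the angle equation. *)
Let projection_defect (v : bool -> A -> Z -> R) (sg : R) :
  (forall k, v k << one) ->
  (forall a j, P a -> dot2 v theta a j = co a j /\ cross2 theta v a j = sg * si a j) ->
  (fun a j => dot2 v tg a j - co a j) << h3.
Proof.
  intros Hv Hd.
  assert (Hdiff : forall k, (fun a j => tg k a j - theta k a j) << (fun a _ => h a ^ 2)).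
  { intros k; apply congr_sym, theta_congr. }
  assert (Hgap : dot2 (fun k a j => tg k a j - theta k a j)
                  (fun k a j => tg k a j - theta k a j) << h3).
  { unfold dot2; apply dom_plus;
    (apply dom_mult with (fun a _ => h a ^ 2) (fun a _ => h a ^ 2); trivial;
     intros a j Ha; unfold h3; generalize (Hh a Ha); intros;
     assert (0 <= h a ^ 3) by (apply pow_le; lra);
     replace (h a ^ 2 * h a ^ 2) with (h a * h a ^ 3) by ring; nra). }
  apply dom_ext with (fun a j =>
    co a j * (- / 2 * dot2 (fun k a j => tg k a j - theta k a j)
                  (fun k a j => tg k a j - theta k a j) a j) +
    sg * (si a j * cross2 theta (fun k a j => tg k a j - theta k a j) a j)).
  - apply dom_plus.
    + apply dom_mult1; trivial; now apply dom_scal.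
    + apply dom_scal, dom_mult with (fun a _ => h a) (fun a _ => h a ^ 2); trivial.
      unfold cross2; apply dom_minus; apply dom_mult1; trivial.
  - intros a j Ha; destruct (Hd a j Ha) as [D1 D2].
    assert (Edec : dot2 v tg a j = dot2 v theta a j * dot2 theta tg a j +
                                   cross2 theta v a j * cross2 theta tg a j).
    { transitivity (dot2 v tg a j * dot2 theta theta a j);
        [rewrite theta_unit by trivial; ring|unfold dot2, cross2; ring]. }
    assert (Egap : dot2 (fun k a j => tg k a j - theta k a j)
                  (fun k a j => tg k a j - theta k a j) a j = 2 - 2 * dot2 theta tg a j).
    { generalize (theta_unit a j Ha) (tg_unit a j); unfold dot2; intros; lra. }
    assert (Ecross : cross2 theta (fun k a j => tg k a j - theta k a j) a j
                     = cross2 theta tg a j) by (unfold cross2; ring).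
    rewrite Edec, Egap, Ecross, D1, D2; field.
Qed.

Let tan_tg : (fun a j => dot2 tan tg a j - co a j) << h3.
Proof.
  apply (projection_defect tan (-1)); trivial; intros a j Ha.
  destruct (tan_theta a j Ha) as [E1 [E2 _]]; split; trivial; rewrite E2; ring.
Qed.

Let tan'_tg : (fun a j => dot2 tan' tg a j - co a j) << h3.
Proof.
  apply (projection_defect tan' 1).
  - intros k; exact (dom_shift P 1 one (tan k) (tan1 k)).
  - intros a j Ha; destruct (tan_theta a j Ha) as [_ [_ [E1 E2]]].
    split; trivial; rewrite E2; ring.
Qed.

Let V a j := normal_velocity f g (nd a j) (snd a).
Let gv k (a : A) j := g k (nd a j) (snd a).
Let dg k a j := / h a * (gv k a j - gv k a (j + -1)%Z).

Let gv_normal a j : gv true a j = - V a j * tg false a j /\ gv false a j = V a j * tg true a j.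
Proof.
  apply (normal_vector (y true a j) (y false a j) (gv true a j) (gv false a j) (sp a j)).
  - generalize (sp_low a j); lra.
  - exact (sp_sqr a j).
  - apply (flow_normal Hflow).
Qed.

Let gv1 k : gv k << one.
Proof.
  apply dom_le with M; trivial; intros; rewrite Rmult_1_r.
  apply (flow_g_bound Hflow).
Qed.

Let V1 : V << one.
Proof.
  apply dom_ext with (fun a j => cross2 y gv a j * / sp a j).
  - apply dom_mult1; trivial; unfold cross2; apply dom_minus; now apply dom_mult1.
  - intros; unfold V, normal_velocity; rewrite <- sp_speed; unfold cross2, y, gv, Rdiv; ring.
Qed.

Let dg1 k : dg k << one.
Proof.
  apply dom_le with M; trivial; intros a j Ha; generalize (Hh a Ha); intros Hha.
  generalize (flow_g_lip Hflow k (nd a (j + -1)%Z) (nd a j) (snd a)).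
  change (j + -1)%Z with (j - 1)%Z; rewrite nd_pred.
  replace (nd a j - (nd a j + - h a)) with (h a) by ring.
  rewrite (Rabs_right (h a)) by lra; intros H.
  unfold dg; rewrite Rabs_mult, Rabs_right by (left; apply Rinv_0_lt_compat; lra).
  apply Rmult_le_reg_l with (h a); [lra|].
  unfold gv; change (j + -1)%Z with (j - 1)%Z; rewrite nd_pred.
  rewrite <- Rmult_assoc, Rinv_r, Rmult_1_l by lra; lra.
Qed.

Let om a j := (dg false a j * tan true a j - dg true a j * tan false a j) * / na a j.
Let qb a j := (sp a (j + -1)%Z + sp a j) / 2.

Let om1 : om << one.
Proof.
  unfold om; apply dom_ext with (fun a j => / na a j * cross2 tan dg a j);
    [|intros; unfold cross2; ring].
  apply dom_mult1; [apply dom_inv with (m / 2); trivial; lra|].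
  unfold cross2; apply dom_minus; now apply dom_mult1.
Qed.

Let qb_low a j : m <= qb a j.
Proof. unfold qb; generalize (sp_low a j) (sp_low a (j + -1)%Z); lra. Qed.

Let qb1 : qb << one.
Proof.
  apply dom_ext with (fun a j => / 2 * (sp a (j + -1)%Z + sp a j));
    [|intros; unfold qb; field].
  apply dom_scal, dom_plus; trivial; exact (dom_shift P (-1) one sp sp1).
Qed.

Let psi_consistent :
  (fun a j => qb a j * om a j - (V a j * co a j - V a (j + -1)%Z * co a (j + -1)%Z) / h a)
  << (fun a _ => h a ^ 2).
Proof.
  apply dom_ext with (fun a j => om a j * (qb a j - na a j) +
    (V a j * (dot2 tan tg a j - co a j) / h a -
     V a (j + -1)%Z * (dot2 tan' tg a (j + -1)%Z - co a (j + -1)%Z) / h a)).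
  - assert (Hdiv : forall p, p << h3 ->
        (fun a j => V a j * p a j / h a) << (fun a _ => h a ^ 2)).
    { intros p [K [HK H]]; apply dom_ext with (fun a j => V a j * (p a j / h a));
        [|intros a j Ha; generalize (Hh a Ha); intros; field; lra].
      apply dom_mult1; trivial; apply dom_le with K; trivial; intros a j Ha.
      specialize (H a j Ha); generalize (Hh a Ha); intros Hha; unfold h3 in H.
      unfold Rdiv; rewrite Rabs_mult, (Rabs_right (/ h a))
        by (left; apply Rinv_0_lt_compat; lra).
      apply Rmult_le_reg_r with (h a); [lra|].
      rewrite Rmult_assoc, Rinv_l by lra; simpl in *; lra. }
    apply dom_plus; [apply dom_mult1; trivial; exact cell_speed|].
    apply dom_minus; [now apply Hdiv|].
    exact (dom_shift P (-1) (fun a _ => h a ^ 2) _ (Hdiv _ tan'_tg)).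
  - intros a j Ha; generalize (Hh a Ha) (na_low a j Ha); intros.
    assert (E : na a j * om a j = (V a j * dot2 tan tg a j -
               V a (j + -1)%Z * dot2 tan' tg a (j + -1)%Z) / h a).
    { unfold om, dg.
      destruct (gv_normal a j) as [-> ->], (gv_normal a (j + -1)%Z) as [-> ->].
      unfold dot2, tan'; replace (j + -1 + 1)%Z with j by lia; field; lra. }
    transitivity (om a j * (qb a j - na a j) + (na a j * om a j -
      (V a j * co a j - V a (j + -1)%Z * co a (j + -1)%Z) / h a)); [ring|].
    rewrite E; field; lra.
Qed.

Let vel_consistent :
  (fun a j => crs a j / sp a j ^ 3 - 4 / (qb a j + qb a (j + 1)%Z) * (si a j / h a))
  << (fun a _ => h a ^ 2).
Proof.
  apply (congr_sym P h).
  apply congr_trans with (fun a j => / ((qb a j + qb a (j + 1)%Z) / 2) *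
                                     (2 * (/ h a * si a j))).
  { apply congr_of_eq; intros a j Ha.
    generalize (qb_low a j) (qb_low a (j + 1)%Z) (Hh a Ha); intros; field; lra. }
  apply congr_trans with (fun a j => / sp a j * (crs a j * / NY a j)).
  - apply congr_mult; trivial.
    + apply congr_inv with m; trivial.
      * intros; generalize (qb_low a j) (qb_low a (j + 1)%Z); lra.
      * apply congr_trans with (2 := node_speed); apply congr_of_eq; intros a j _.
        unfold qb; replace (j + 1 + -1)%Z with j by lia; field.
    + now apply dom_mult1.
  - apply congr_of_eq; intros a j _; rewrite <- sp_sqr.
    generalize (sp_low a j); intros; field; lra.
Qed.

Let len_consistent :
  (fun a j => (- (V a (j + -1)%Z * crs a (j + -1)%Z) / sp a (j + -1)%Z ^ 2 +
               - (V a j * crs a j) / sp a j ^ 2) / 2 +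
     (V a j * si a j + V a (j + -1)%Z * si a (j + -1)%Z) / h a)
  << (fun a _ => h a ^ 2).
Proof.
  set (p := fun a j => / 2 * (V a j * (2 * (/ h a * si a j) - crs a j * / NY a j))).
  assert (Hp : p << (fun a _ => h a ^ 2)).
  { unfold p; apply dom_scal, dom_mult1; trivial; exact turn_congr. }
  apply dom_ext with (fun a j => p a j + p a (j + -1)%Z).
  - apply dom_plus; trivial; exact (dom_shift P (-1) _ _ Hp).
  - intros a j Ha; unfold p; rewrite <- !sp_sqr.
    generalize (sp_low a j) (sp_low a (j + -1)%Z) (Hh a Ha); intros; field; lra.
Qed.

Lemma consistency_bounds :
  exists K, 0 < K /\ forall a j, P a ->
    Rabs (V a j) <= K /\ m <= qb a j <= K /\ Rabs (om a j) <= K /\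
    Rabs (si a j) <= K * h a /\ co a j ^ 2 + si a j ^ 2 = 1 /\
    Rabs (qb a j * om a j - (V a j * co a j - V a (j + -1)%Z * co a (j + -1)%Z) / h a)
      <= K * h a ^ 2 /\
    Rabs (crs a j / sp a j ^ 3 - 4 / (qb a j + qb a (j + 1)%Z) * (si a j / h a))
      <= K * h a ^ 2 /\
    Rabs ((- (V a (j + -1)%Z * crs a (j + -1)%Z) / sp a (j + -1)%Z ^ 2 +
               - (V a j * crs a j) / sp a j ^ 2) / 2 +
     (V a j * si a j + V a (j + -1)%Z * si a (j + -1)%Z) / h a) <= K * h a ^ 2 /\
    (forall k, Rabs (theta k a j - tg k a j) <= K * h a ^ 2) /\
    Rabs (qb a j - na a j) <= K * h a ^ 2 /\
    m / 2 <= na a j /\ 1 <= nsum a j.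
Proof.
  destruct V1 as [K1 [P1 H1]], qb1 as [K2 [P2 H2]], om1 as [K3 [P3 H3]],
    si_h as [K4 [P4 H4]], psi_consistent as [K5 [P5 H5]],
    vel_consistent as [K6 [P6 H6]], len_consistent as [K7 [P7 H7]],
    (theta_congr true) as [K8 [P8 H8]], (theta_congr false) as [K9 [P9 H9]],
    cell_speed as [K10 [P10 H10]].
  exists (1 + K1 + K2 + K3 + K4 + K5 + K6 + K7 + K8 + K9 + K10); split; [lra|].
  intros a j Ha.
  specialize (H1 a j Ha); specialize (H2 a j Ha); specialize (H3 a j Ha);
  specialize (H4 a j Ha); specialize (H5 a j Ha); specialize (H6 a j Ha);
  specialize (H7 a j Ha); specialize (H8 a j Ha); specialize (H9 a j Ha);
  specialize (H10 a j Ha).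
  generalize (Hh a Ha); intros Hha.
  assert (Hh2 : 0 <= h a ^ 2) by (apply pow_le; lra).
  set (K := 1 + K1 + K2 + K3 + K4 + K5 + K6 + K7 + K8 + K9 + K10).
  assert (Hup : forall x q K', 0 <= q -> K' <= K -> x <= K' * q -> x <= K * q).
  { intros x q K' Hq HK' Hx; apply Rle_trans with (1 := Hx).
    now apply Rmult_le_compat_r. }
  assert (Hup1 : forall x K', K' <= K -> x <= K' * 1 -> x <= K).
  { intros x K' HK' Hx; lra. }
  split; [apply (Hup1 _ K1); trivial; unfold K; lra|].
  split; [split; [apply qb_low|]|].
  { apply Rle_trans with (1 := Rle_abs _); apply (Hup1 _ K2); trivial; unfold K; lra. }
  split; [apply (Hup1 _ K3); trivial; unfold K; lra|].
  split; [apply (Hup _ _ K4); trivial; unfold K; lra|].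
  split; [now apply turn_unit|].
  split; [apply (Hup _ _ K5); trivial; unfold K; lra|].
  split; [apply (Hup _ _ K6); trivial; unfold K; lra|].
  split; [apply (Hup _ _ K7); trivial; unfold K; lra|].
  split.
  { intros [|]; [apply (Hup _ _ K8)|apply (Hup _ _ K9)]; trivial; unfold K; lra. }
  split; [apply (Hup _ _ K10); trivial; unfold K; lra|].
  split; [now apply na_low|now apply nsum_low].
Qed.

End Consistency.

Definition exact_grid (f : bool -> nat -> R -> R -> R) (J : nat) (t : R) (j : Z) : R * R :=
  (f true 0%nat (node J j) t, f false 0%nat (node J j) t).

Definition exact_grid_velocity (g : bool -> R -> R -> R) (J : nat) (t : R) (j : Z) : R * R :=
  (g true (node J j) t, g false (node J j) t).

Definition exact_tangent (f : bool -> nat -> R -> R -> R) (J : nat) (t : R) (j : Z) : R * R :=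
  (f true 1%nat (node J j) t * / speed f (node J j) t,
   f false 1%nat (node J j) t * / speed f (node J j) t).

(** The angular velocities and the turning angles are those of the exact polygon,
    because [psi] is measured from its edges. The lengths, however, are means of
    the speed at the nodes and not edge lengths: the rate of an edge length
    involves the sine of the angle between tangent and edge, which approximates
    that of half the turning angle up to [O(h^2)] only, and is divided by [h]. *)
Definition exact_reference (f : bool -> nat -> R -> R -> R) (g : bool -> R -> R -> R)
  (J : nat) (t : R) : reference :=
  let X := exact_grid f J t in
  Reference
    (fun j => normal_velocity f g (node J j) t)
    (fun j => (speed f (node J (j - 1)) t + speed f (node J j) t) / 2)
    (fun j => dot (delta J (exact_grid_velocity g J t) j) (perp (tauh J X j)) / qh J X j)
    (fun j => half_cos (tauh J X j) (tauh J X (j + 1)%Z))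
    (fun j => half_sin (tauh J X j) (tauh J X (j + 1)%Z)).

Definition exact_dV (beta : R) (f : bool -> nat -> R -> R -> R) (g : bool -> R -> R -> R)
  (J : nat) (t : R) (j : Z) : R :=
  - beta * normal_velocity f g (node J j) t +
  turning f (node J j) t / speed f (node J j) t ^ 3.

Definition exact_speed_rate (f : bool -> nat -> R -> R -> R) (g : bool -> R -> R -> R)
  (rho t : R) : R :=
  - (normal_velocity f g rho t * turning f rho t) / speed f rho t ^ 2.

Definition exact_dQ (f : bool -> nat -> R -> R -> R) (g : bool -> R -> R -> R)
  (J : nat) (t : R) (j : Z) : R :=
  (exact_speed_rate f g (node J (j - 1)) t + exact_speed_rate f g (node J j) t) / 2.

Lemma qh_pair J v j : qh J v j =
  sqrt (/ mesh J * (fst (v j) - fst (v (j - 1)%Z)) * (/ mesh J * (fst (v j) - fst (v (j - 1)%Z))) +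
        / mesh J * (snd (v j) - snd (v (j - 1)%Z)) * (/ mesh J * (snd (v j) - snd (v (j - 1)%Z)))).
Proof. unfold qh; rewrite norm_pair; reflexivity. Qed.

Lemma node_periodic J j : (0 < J)%nat -> node J (j + Z.of_nat J) = node J j + 1.
Proof.
  intros HJ; unfold node; rewrite plus_IZR, <- INR_IZR_INZ, Rmult_plus_distr_r.
  now rewrite INR_mesh.
Qed.

(** The scheme only involves the grid function through differences, so that
    periodicity is inherited. *)
Lemma delta_periodic J v : grid_periodic J v -> forall j, delta J v (j + Z.of_nat J)%Z = delta J v j.
Proof.
  intros Hv j; unfold delta; rewrite Hv.
  replace (j + Z.of_nat J - 1)%Z with (j - 1 + Z.of_nat J)%Z by lia; now rewrite Hv.
Qed.

Lemma tauh_periodic J v : grid_periodic J v -> forall j, tauh J v (j + Z.of_nat J)%Z = tauh J v j.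
Proof. intros Hv j; unfold tauh, qh; now rewrite delta_periodic. Qed.

Section ExactReference.
Variables (beta T M m : R) (f : bool -> nat -> R -> R -> R) (g : bool -> R -> R -> R).
Hypotheses (HM : 0 < M) (Hm : 0 < m) (Hflow : smooth_flow beta T M m f g).

Let r J t := exact_reference f g J t.

(** The bound on [h1] makes the secants nondegenerate, after which all the
    estimates are those of [consistency_bounds]. *)
Lemma exact_estimates : exists K h1, 0 < K /\ 0 < h1 <= 1 /\
  forall J t, (2 <= J)%nat -> mesh J <= h1 ->
  bounded_reference K m (mesh J) (r J t) /\
  consistent beta K (mesh J) (r J t) (exact_dV beta f g J t) (exact_dQ f g J t) /\
  forall j,
    norm (minus (thetah J (exact_grid f J t) j) (exact_tangent f J t j)) <= K * mesh J ^ 2 /\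
    Rabs (ref_len (r J t) j - qh J (exact_grid f J t) j) <= K * mesh J ^ 2 /\
    m / 2 <= qh J (exact_grid f J t) j /\
    1 <= norm (plus (tauh J (exact_grid f J t) j) (tauh J (exact_grid f J t) (j + 1)%Z)).
Proof.
  destruct (secants_near_tangent beta T M m f g HM Hflow
    (fun a => (2 <= fst a)%nat) (fun a H => H)) as [[C1 [HC1 H1]] [C2 [HC2 H2]]].
  cbv zeta in H1, H2.
  assert (Hm2 : 0 < m ^ 2) by (apply pow_lt; lra).
  set (h1 := Rmin 1 (m ^ 2 / (4 * (C1 + C2 + 1)))).
  assert (Hd : 0 < m ^ 2 / (4 * (C1 + C2 + 1))) by (apply Rdiv_lt_0_compat; lra).
  assert (Hh1 : 0 < h1 <= 1) by (unfold h1; split; [apply Rmin_case; lra|apply Rmin_l]).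
  set (P := fun a : nat * R => (2 <= fst a)%nat /\ mesh (fst a) <= h1).
  assert (HP : forall a, P a -> (2 <= fst a)%nat) by (intros a [H _]; exact H).
  assert (Hy : forall J j t, m ^ 2 <=
            f true 1%nat (node J j) t * f true 1%nat (node J j) t +
            f false 1%nat (node J j) t * f false 1%nat (node J j) t).
  { intros J j t; generalize (flow_speed Hflow (node J j) t).
    unfold speed; set (x := _ + _); intros H.
    assert (Hx : 0 <= x) by (unfold x; nra).
    rewrite <- (sqrt_sqrt x Hx); nra. }
  assert (Hdrop : forall a, P a -> (C1 + C2 + 1) * mesh (fst a) <= m ^ 2 / 4).
  { intros a [_ Ha].
    apply Rle_trans with ((C1 + C2 + 1) * (m ^ 2 / (4 * (C1 + C2 + 1)))).
    - apply Rmult_le_compat_l; [lra|]; apply Rle_trans with (1 := Ha), Rmin_r.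
    - right; field; lra. }
  assert (Hpos : forall a, P a -> 0 < mesh (fst a)).
  { intros a [Ha _]; apply mesh_pos; lia. }
  destruct (consistency_bounds beta T M m f g HM Hm Hflow P HP) as [K0 [HK0 HK]].
  { intros a j Ha; specialize (Hdrop a Ha); specialize (Hpos a Ha).
    specialize (H1 a j (HP a Ha)); specialize (H2 a j (HP a Ha)).
    specialize (Hy (fst a) j (snd a)).
    apply Rabs_le_between in H1, H2.
    assert (C1 * mesh (fst a) <= (C1 + C2 + 1) * mesh (fst a)) by nra.
    assert (C2 * mesh (fst a) <= (C1 + C2 + 1) * mesh (fst a)) by nra.
    cbv zeta in *; split; lra. }
  cbv zeta in HK.
  exists (2 * K0), h1; split; [lra|split; [trivial|]].
  intros J t HJ HhJ.
  assert (Hh2 : 0 <= mesh J ^ 2) by apply pow2_ge_0.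
  assert (Hmesh : 0 < mesh J) by (apply mesh_pos; lia).
  assert (HPa : P (J, t)) by (split; trivial).
  assert (Hqh : forall j, qh J (exact_grid f J t) j = _) by (intros j; apply qh_pair).
  assert (Hns : forall j, norm (plus (tauh J (exact_grid f J t) j)
                     (tauh J (exact_grid f J t) (j + 1)%Z)) = _)
    by (intros j; apply norm_pair).
  assert (Hrel : forall x, x <= K0 * mesh J ^ 2 -> x <= 2 * K0 * mesh J ^ 2).
  { intros x Hx; assert (0 <= K0 * mesh J ^ 2) by (apply Rmult_le_pos; lra); lra. }
  assert (Hom : forall j, ref_om (r J t) j =
    (/ mesh J * (g false (node J j) t - g false (node J (j + -1)) t) *
       (/ qh J (exact_grid f J t) j * (/ mesh J * (f true 0%nat (node J j) t -
          f true 0%nat (node J (j - 1)) t))) -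
     / mesh J * (g true (node J j) t - g true (node J (j + -1)) t) *
       (/ qh J (exact_grid f J t) j * (/ mesh J * (f false 0%nat (node J j) t -
          f false 0%nat (node J (j - 1)) t)))) * / qh J (exact_grid f J t) j).
  { intros j; unfold r, exact_reference, delta, tauh, delta; cbn [ref_om].
    rewrite !scal_pair, !minus_pair; unfold dot, perp, exact_grid_velocity, exact_grid.
    cbn [fst snd]; change (j + -1)%Z with (j - 1)%Z; unfold Rdiv; ring. }
  assert (Hco : forall j, ref_cos (r J t) j = norm (plus (tauh J (exact_grid f J t) j)
                     (tauh J (exact_grid f J t) (j + 1)%Z)) / 2) by reflexivity.
  assert (Hsi : forall j, ref_sin (r J t) j =
     (fst (tauh J (exact_grid f J t) j) * snd (tauh J (exact_grid f J t) (j + 1)%Z) -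
      snd (tauh J (exact_grid f J t) j) * fst (tauh J (exact_grid f J t) (j + 1)%Z)) /
      norm (plus (tauh J (exact_grid f J t) j)
                     (tauh J (exact_grid f J t) (j + 1)%Z))) by reflexivity.
  split; [|split].
  - split; intros j; destruct (HK (J, t) j HPa)
      as [E1 [E2 [E3 [E4 [E5 _]]]]]; cbn [fst snd] in *.
    + apply Rle_trans with K0; [exact E1|lra].
    + assert (E : m <= ref_len (r J t) j <= K0) by exact E2; lra.
    + apply Rle_trans with K0; [|lra]; rewrite Hom, Hqh; exact E3.
    + apply Rle_trans with (K0 * mesh J).
      * rewrite Hsi, Hns; unfold tauh; rewrite !Hqh; exact E4.
      * apply Rmult_le_compat_r; lra.
    + rewrite Hco, Hsi, Hns; unfold tauh; rewrite !Hqh; exact E5.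
  - split; intros j; destruct (HK (J, t) j HPa)
      as [E1 [E2 [E3 [E4 [E5 [E6 [E7 [E8 _]]]]]]]]; cbn [fst snd] in *; apply Hrel.
    + rewrite Hom, !Hco, !Hns; unfold tauh; rewrite !Hqh; exact E6.
    + rewrite Hsi, Hns; unfold tauh; rewrite !Hqh; unfold exact_dV.
      match goal with |- Rabs (?u + ?v + ?w - ?x) <= _ =>
        replace (u + v + w - x) with (v - x)
          by (unfold r, exact_reference; cbn [ref_vel]; ring) end.
      exact E7.
    + rewrite !Hsi, !Hns; unfold tauh; rewrite !Hqh; exact E8.
  - intros j; destruct (HK (J, t) j HPa)
      as [_ [_ [_ [_ [_ [_ [_ [_ [E9 [E10 [E11 E12]]]]]]]]]]]; cbn [fst snd] in *.
    split; [|split; [|split]].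
    + eapply Rle_trans; [apply norm_le_sum|].
      rewrite minus_pair; cbn [fst snd].
      generalize (E9 true) (E9 false); clear E9; intros E9 E9'.
      replace (2 * K0 * mesh J ^ 2) with (K0 * mesh J ^ 2 + K0 * mesh J ^ 2) by ring.
      unfold thetah, normalize; rewrite scal_pair, Hns, Rmult_comm, (Rmult_comm (/ _)).
      unfold tauh; rewrite !Hqh; cbn [fst snd].
      apply Rplus_le_compat; [exact E9|exact E9'].
    + apply Hrel; rewrite Hqh; exact E10.
    + rewrite Hqh; exact E11.
    + rewrite Hns; unfold tauh; rewrite !Hqh; exact E12.
Qed.

End ExactReference.

(** * Grid functions moving in time *)

Definition vcont (u : R -> R * R) (t : R) : Prop :=
  continuous (fun s => fst (u s)) t /\ continuous (fun s => snd (u s)) t.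

Definition vderive (u : R -> R * R) (t : R) (l : R * R) : Prop :=
  is_derive (fun s => fst (u s)) t (fst l) /\ is_derive (fun s => snd (u s)) t (snd l).

Lemma is_derive_on_of_vderive T (f u : R -> R * R) t l :
  0 <= t <= T -> (forall s, 0 <= s <= T -> f s = u s) -> vderive u t l ->
  is_derive_on (Icc 0 T) f t l.
Proof.
  destruct l as [a b]; intros Ht E [H1 H2].
  exact (is_derive_on_of_components T f u t a b Ht E H1 H2).
Qed.

Lemma interior_vderive T (F : R -> R * R) t l :
  0 < t < T -> is_derive_on (Icc 0 T) F t l -> vderive (fun s => F (clamp T s)) t l.
Proof.
  intros Ht HF; destruct (is_derive_on_interior T F t l Ht HF) as [D1 D2]; split.
  - apply (is_derive_near (fun s => fst (F s)) _ 0 T); trivial.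
    intros s Hs; now rewrite clamp_id by lra.
  - apply (is_derive_near (fun s => snd (F s)) _ 0 T); trivial.
    intros s Hs; now rewrite clamp_id by lra.
Qed.

Lemma vderive_vcont u t l : vderive u t l -> vcont u t.
Proof. intros [H1 H2]; split; eapply is_derive_cont; eauto. Qed.

Lemma vderive_eq u t l l' : vderive u t l -> l = l' -> vderive u t l'.
Proof. now intros H <-. Qed.

Lemma constant_of_vderive (u : R -> R * R) T t :
  0 <= t <= T -> (forall s, vcont u s) -> (forall s, 0 < s < T -> vderive u s (0, 0)) ->
  u t = u 0.
Proof.
  intros Ht Hc Hd; apply injective_projections.
  - apply (constant_of_derive (fun s => fst (u s)) 0 t);
      [lra|intros s _; exact (proj1 (Hc s))|].
    intros s Hs; exact (proj1 (Hd s ltac:(lra))).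
  - apply (constant_of_derive (fun s => snd (u s)) 0 t);
      [lra|intros s _; exact (proj2 (Hc s))|].
    intros s Hs; exact (proj2 (Hd s ltac:(lra))).
Qed.

Lemma minus_zero_eq (u v : R * R) : minus u v = (0, 0) -> u = v.
Proof.
  rewrite minus_pair; intros E; injection E; intros.
  apply injective_projections; lra.
Qed.

Lemma vcont_dot u v t : vcont u t -> vcont v t -> continuous (fun s => dot (u s) (v s)) t.
Proof.
  intros [H1 H2] [H3 H4]; unfold dot; apply continuous_Rplus; now apply continuous_Rmult.
Qed.

Lemma vcont_perp u t : vcont u t -> vcont (fun s => perp (u s)) t.
Proof. intros [H1 H2]; split; simpl; trivial; now apply continuous_Ropp. Qed.

Lemma vcont_plus (u v : R -> R * R) t :
  vcont u t -> vcont v t -> vcont (fun s => plus (u s) (v s)) t.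
Proof.
  intros [H1 H2] [H3 H4]; split; simpl; apply continuous_Rplus; trivial.
Qed.

Lemma vcont_minus (u v : R -> R * R) t :
  vcont u t -> vcont v t -> vcont (fun s => minus (u s) (v s)) t.
Proof.
  intros [H1 H2] [H3 H4]; split; [exact (continuous_Rminus _ _ _ H1 H3)|
    exact (continuous_Rminus _ _ _ H2 H4)].
Qed.

Lemma vcont_scal (k : R -> R) (u : R -> R * R) t :
  continuous k t -> vcont u t -> vcont (fun s => scal (k s) (u s)) t.
Proof.
  intros H [H1 H2]; split; apply (continuous_Rmult k); trivial.
Qed.

Lemma norm_cont (u : R -> R * R) t : vcont u t -> continuous (fun s => norm (u s)) t.
Proof.
  intros [H1 H2].
  apply continuous_ext with (fun s => sqrt (fst (u s) * fst (u s) + snd (u s) * snd (u s))).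
  - intros s; now rewrite norm_pair.
  - apply continuous_Rsqrt, continuous_Rplus; now apply continuous_Rmult.
Qed.

Lemma vcont_normalize (u : R -> R * R) t :
  vcont u t -> 0 < norm (u t) -> vcont (fun s => normalize (u s)) t.
Proof.
  intros H Hp; unfold normalize; apply (vcont_scal (fun s => / norm (u s))); trivial.
  apply continuous_Rinv_comp; [now apply norm_cont|lra].
Qed.

Lemma vcont_delta J (v : R -> Z -> R * R) j t :
  (forall i, vcont (fun s => v s i) t) -> vcont (fun s => delta J (v s) j) t.
Proof.
  intros H; destruct (H j) as [H1 H2], (H (j - 1)%Z) as [H3 H4]; split;
    apply (continuous_Rmult (fun _ => / mesh J));
    try apply continuous_Rconst; now apply continuous_Rminus.
Qed.

Lemma qh_cont J (v : R -> Z -> R * R) j t :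
  (forall i, vcont (fun s => v s i) t) -> continuous (fun s => qh J (v s) j) t.
Proof.
  intros H; apply (norm_cont (fun s => delta J (v s) j)).
  now apply (vcont_delta J v).
Qed.

Lemma tauh_normalize J v j : tauh J v j = normalize (delta J v j).
Proof. reflexivity. Qed.

Lemma vcont_tauh J (v : R -> Z -> R * R) j t :
  (forall i, vcont (fun s => v s i) t) -> 0 < qh J (v t) j ->
  vcont (fun s => tauh J (v s) j) t.
Proof.
  intros H Hq; apply (vcont_normalize (fun s => delta J (v s) j)); trivial.
  now apply (vcont_delta J v).
Qed.

Lemma vcont_thetah J (v : R -> Z -> R * R) j t :
  (forall i, vcont (fun s => v s i) t) -> (forall i, 0 < qh J (v t) i) ->
  0 < norm (plus (tauh J (v t) j) (tauh J (v t) (j + 1)%Z)) ->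
  vcont (fun s => thetah J (v s) j) t.
Proof.
  intros H Hq Hn.
  apply (vcont_normalize (fun s => plus (tauh J (v s) j) (tauh J (v s) (j + 1)%Z)));
    trivial.
  apply (vcont_plus (fun s => tauh J (v s) j) (fun s => tauh J (v s) (j + 1)%Z));
    now apply vcont_tauh.
Qed.

Lemma vderive_plus (u v : R -> R * R) t (a b : R * R) :
  vderive u t a -> vderive v t b -> vderive (fun s => plus (u s) (v s)) t (plus a b).
Proof.
  intros [H1 H2] [H3 H4]; split.
  - exact (is_derive_Rplus _ _ _ _ _ H1 H3).
  - exact (is_derive_Rplus _ _ _ _ _ H2 H4).
Qed.

Lemma vderive_minus (u v : R -> R * R) t (a b : R * R) :
  vderive u t a -> vderive v t b -> vderive (fun s => minus (u s) (v s)) t (minus a b).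
Proof.
  intros [H1 H2] [H3 H4]; split.
  - exact (is_derive_Rminus _ _ _ _ _ H1 H3).
  - exact (is_derive_Rminus _ _ _ _ _ H2 H4).
Qed.

Lemma vderive_scal (k : R -> R) (u : R -> R * R) t (a : R) (b : R * R) :
  is_derive k t a -> vderive u t b ->
  vderive (fun s => scal (k s) (u s)) t (plus (scal a (u t)) (scal (k t) b)).
Proof.
  intros H [H1 H2]; split.
  - exact (is_derive_Rmult _ _ _ _ _ H H1).
  - exact (is_derive_Rmult _ _ _ _ _ H H2).
Qed.

Lemma vderive_perp u t a : vderive u t a -> vderive (fun s => perp (u s)) t (perp a).
Proof.
  intros [H1 H2]; split; [exact (is_derive_Ropp _ _ _ H2)|exact H1].
Qed.

Lemma vderive_dot u v t a b :
  vderive u t a -> vderive v t b ->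
  is_derive (fun s => dot (u s) (v s)) t (dot a (v t) + dot (u t) b).
Proof.
  intros [H1 H2] [H3 H4]; unfold dot; eapply is_derive_eq.
  - apply is_derive_Rplus; apply is_derive_Rmult; eassumption.
  - cbv beta; ring.
Qed.

Lemma vderive_delta J (v : R -> Z -> R * R) dv j t :
  (forall i, vderive (fun s => v s i) t (dv i)) ->
  vderive (fun s => delta J (v s) j) t (delta J dv j).
Proof.
  intros H; unfold delta.
  eapply vderive_eq.
  - apply (vderive_scal (fun _ => / mesh J) (fun s => minus (v s j) (v s (j - 1)%Z))).
    + apply is_derive_Rconst.
    + apply vderive_minus; apply H.
  - cbv beta; rewrite plus_pair, !scal_pair; cbn [fst snd]; f_equal; ring.
Qed.

Lemma norm_derive (u : R -> R * R) t (a : R * R) :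
  vderive u t a -> 0 < norm (u t) ->
  is_derive (fun s => norm (u s)) t (dot a (normalize (u t))).
Proof.
  intros [H1 H2] Hp.
  apply is_derive_Rext with (fun s => sqrt (fst (u s) * fst (u s) + snd (u s) * snd (u s))).
  { intros s; now rewrite norm_pair. }
  assert (Hpos : 0 < fst (u t) * fst (u t) + snd (u t) * snd (u t)).
  { rewrite norm_pair in Hp; apply sqrt_lt_0_alt; now rewrite sqrt_0. }
  eapply is_derive_eq.
  - apply is_derive_Rsqrt; [|exact Hpos].
    apply is_derive_Rplus; apply is_derive_Rmult; eassumption.
  - unfold normalize; rewrite scal_pair; unfold dot; cbn [fst snd].
    rewrite <- norm_pair; field; lra.
Qed.

(** A unit vector rotates: only the normal component of the derivative counts. *)
Lemma vderive_normalize (u : R -> R * R) t (a : R * R) :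
  vderive u t a -> 0 < norm (u t) ->
  vderive (fun s => normalize (u s)) t
    (scal (dot a (perp (normalize (u t))) / norm (u t)) (perp (normalize (u t)))).
Proof.
  intros H Hp; unfold normalize at 1; eapply vderive_eq.
  - apply (vderive_scal (fun s => / norm (u s)) u); [|exact H].
    apply (is_derive_inv (fun s => norm (u s))); [apply norm_derive; [exact H|exact Hp]|lra].
  - generalize (norm_sqr (u t)); unfold normalize.
    rewrite plus_pair, !scal_pair; unfold perp, dot; cbn [fst snd].
    set (n := norm (u t)) in *; intros E.
    change (@opp R_AbelianGroup) with Ropp.
    assert (E' : n * n = fst (u t) * fst (u t) + snd (u t) * snd (u t))
      by (rewrite <- E; ring).
    f_equal.
    + transitivity ((fst a * (n * n) - (fst a * fst (u t) + snd a * snd (u t)) * fst (u t))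
                    / n ^ 3); [field; lra|rewrite E'; field; lra].
    + transitivity ((snd a * (n * n) - (fst a * fst (u t) + snd a * snd (u t)) * snd (u t))
                    / n ^ 3); [field; lra|rewrite E'; field; lra].
Qed.

Lemma vderive_tauh J (v : R -> Z -> R * R) dv j t :
  (forall i, vderive (fun s => v s i) t (dv i)) -> 0 < qh J (v t) j ->
  vderive (fun s => tauh J (v s) j) t
    (scal (dot (delta J dv j) (perp (tauh J (v t) j)) / qh J (v t) j)
          (perp (tauh J (v t) j))).
Proof.
  intros H Hq; apply (vderive_normalize (fun s => delta J (v s) j)); trivial.
  now apply (vderive_delta J v).
Qed.

Lemma qh_derive J (v : R -> Z -> R * R) dv j t :
  (forall i, vderive (fun s => v s i) t (dv i)) -> 0 < qh J (v t) j ->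
  is_derive (fun s => qh J (v s) j) t (dot (delta J dv j) (tauh J (v t) j)).
Proof.
  intros H Hq; apply (norm_derive (fun s => delta J (v s) j)); trivial.
  now apply (vderive_delta J v).
Qed.

(** The angular velocity [mu] stays implicit because it will cancel from the
    equation: the tangential acceleration is exactly its last term. *)
Lemma vderive_thetah J (v : R -> Z -> R * R) dv j t :
  (forall i, vderive (fun s => v s i) t (dv i)) -> (forall i, 0 < qh J (v t) i) ->
  0 < norm (plus (tauh J (v t) j) (tauh J (v t) (j + 1)%Z)) ->
  exists mu, vderive (fun s => thetah J (v s) j) t (scal mu (perp (thetah J (v t) j))).
Proof.
  intros H Hq Hn; eexists.
  apply (vderive_normalize (fun s => plus (tauh J (v s) j) (tauh J (v s) (j + 1)%Z)));
    trivial.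
  apply (vderive_plus (fun s => tauh J (v s) j) (fun s => tauh J (v s) (j + 1)%Z));
    now apply vderive_tauh.
Qed.

Lemma tauh_unit J v j : 0 < qh J v j -> dot (tauh J v j) (tauh J v j) = 1.
Proof. intros H; rewrite tauh_normalize; now apply normalize_unit. Qed.

Lemma delta_polar J v j : 0 < qh J v j -> delta J v j = scal (qh J v j) (tauh J v j).
Proof.
  intros H; unfold tauh; rewrite !scal_pair; cbn [fst snd].
  rewrite (surjective_pairing (delta J v j)) at 1; f_equal; field; lra.
Qed.

(** * The exact solution as a reference for the scheme *)

Section ExactPath.
Variables (beta T M m : R) (f : bool -> nat -> R -> R -> R) (g : bool -> R -> R -> R).
Hypotheses (HM : 0 < M) (Hm : 0 < m) (Hflow : smooth_flow beta T M m f g).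

Lemma speed_pos rho t : 0 < speed f rho t.
Proof. generalize (flow_speed Hflow rho t); lra. Qed.

Lemma speed_cont rho t : continuous (fun s => speed f rho s) t.
Proof.
  unfold speed; apply continuous_Rsqrt, continuous_Rplus; apply continuous_Rmult;
    apply (flow_f_cont Hflow); lia.
Qed.

Lemma exact_grid_cont J j t : vcont (fun s => exact_grid f J s j) t.
Proof. split; apply (flow_f_cont Hflow); lia. Qed.

Lemma exact_grid_velocity_cont J j t : vcont (fun s => exact_grid_velocity g J s j) t.
Proof. split; apply (flow_g_cont Hflow). Qed.

Lemma exact_grid_derive J j t : 0 < t < T ->
  vderive (fun s => exact_grid f J s j) t (exact_grid_velocity g J t j).
Proof. intros Ht; split; now apply (flow_t Hflow). Qed.

Lemma exact_grid_periodic J t : (0 < J)%nat -> grid_periodic J (exact_grid f J t).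
Proof.
  intros HJ j; unfold exact_grid; rewrite node_periodic by trivial.
  now rewrite !(flow_f_periodic Hflow) by lia.
Qed.

Lemma exact_grid_velocity_periodic J t : (0 < J)%nat ->
  grid_periodic J (exact_grid_velocity g J t).
Proof.
  intros HJ j; unfold exact_grid_velocity; rewrite node_periodic by trivial.
  now rewrite !(flow_g_periodic Hflow).
Qed.

Lemma exact_velocity_normal J t j :
  exact_grid_velocity g J t j =
  scal (ref_vel (exact_reference f g J t) j) (perp (exact_tangent f J t j)).
Proof.
  unfold exact_grid_velocity, exact_tangent; rewrite scal_pair; unfold perp; cbn [fst snd].
  destruct (normal_vector (f true 1%nat (node J j) t) (f false 1%nat (node J j) t)
    (g true (node J j) t) (g false (node J j) t) (speed f (node J j) t)) as [E1 E2].
  - apply speed_pos.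
  - apply sqrt_sqrt; nra.
  - apply (flow_normal Hflow).
  - f_equal; [rewrite E1 at 1|rewrite E2 at 1];
      unfold exact_reference, normal_velocity; cbn [ref_vel]; unfold Rdiv; ring.
Qed.

Lemma exact_reference_path : exists K h1, 0 < K /\ 0 < h1 <= 1 /\
  forall J, (2 <= J)%nat -> mesh J <= h1 ->
  reference_path beta K m T J (exact_reference f g J) (exact_dV beta f g J)
    (exact_dQ f g J) /\
  forall t j,
    norm (minus (thetah J (exact_grid f J t) j) (exact_tangent f J t j)) <= K * mesh J ^ 2 /\
    Rabs (ref_len (exact_reference f g J t) j - qh J (exact_grid f J t) j)
      <= K * mesh J ^ 2 /\
    m / 2 <= qh J (exact_grid f J t) j /\
    1 <= norm (plus (tauh J (exact_grid f J t) j) (tauh J (exact_grid f J t) (j + 1)%Z)).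
Proof.
  destruct (exact_estimates beta T M m f g HM Hm Hflow) as [K [h1 [HK [Hh1 H]]]].
  exists K, h1; split; [trivial|split; [trivial|]]; intros J HJ HhJ.
  assert (Hq : forall t j, 0 < qh J (exact_grid f J t) j).
  { intros t j; destruct (H J t HJ HhJ) as [_ [_ Hj]]; destruct (Hj j) as [_ [_ [Hq _]]];
      lra. }
  assert (Hn : forall t j, 0 < norm (plus (tauh J (exact_grid f J t) j)
                                    (tauh J (exact_grid f J t) (j + 1)%Z))).
  { intros t j; destruct (H J t HJ HhJ) as [_ [_ Hj]]; destruct (Hj j) as [_ [_ [_ Hn]]];
      lra. }
  assert (Ht : forall t j, vcont (fun s => tauh J (exact_grid f J s) j) t).
  { intros t j; apply vcont_tauh; trivial; intros; apply exact_grid_cont. }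
  assert (Hsum : forall t j, vcont (fun s => plus (tauh J (exact_grid f J s) j)
                                    (tauh J (exact_grid f J s) (j + 1)%Z)) t).
  { intros t j; now apply (vcont_plus (fun s => tauh J (exact_grid f J s) j)). }
  split; [split|].
  - intros t; now apply H.
  - intros t _; now apply H.
  - intros j t Ht'; apply (flow_velocity_rate Hflow); trivial.
  - intros j t Ht'; unfold exact_reference, exact_dQ; cbn [ref_len].
    generalize (flow_speed_rate Hflow (node J (j - 1)) Ht')
      (flow_speed_rate Hflow (node J j) Ht'); intros D1 D2.
    eapply is_derive_eq; [repeat derive_step; lra|].
    unfold exact_speed_rate; field.
    generalize (speed_pos (node J (j - 1)) t) (speed_pos (node J j) t); lra.
  - intros j t; unfold exact_reference, normal_velocity; cbn [ref_vel].
    apply continuous_Rdiv.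
    + apply continuous_Rminus; apply continuous_Rmult;
        first [apply (flow_g_cont Hflow)
              |apply (flow_f_cont Hflow); lia].
    + apply speed_cont.
    + apply Rgt_not_eq, speed_pos.
  - intros j t; unfold exact_reference; cbn [ref_len].
    apply continuous_Rdiv; [|apply continuous_Rconst|lra].
    apply continuous_Rplus; apply speed_cont.
  - intros j t; unfold exact_reference; cbn [ref_om].
    apply continuous_Rdiv.
    + apply (vcont_dot (fun s => delta J (exact_grid_velocity g J s) j)
               (fun s => perp (tauh J (exact_grid f J s) j))).
      * apply (vcont_delta J (exact_grid_velocity g J)).
        intros; apply exact_grid_velocity_cont.
      * apply (vcont_perp (fun s => tauh J (exact_grid f J s) j)), Ht.
    + apply qh_cont; intros; apply exact_grid_cont.
    + apply Rgt_not_eq, Hq.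
  - intros j t; unfold exact_reference, half_cos; cbn [ref_cos].
    apply continuous_Rdiv; [|apply continuous_Rconst|lra].
    now apply (norm_cont (fun s => plus (tauh J (exact_grid f J s) j)
                            (tauh J (exact_grid f J s) (j + 1)%Z))).
  - intros j t; unfold exact_reference, half_sin; cbn [ref_sin].
    apply continuous_Rdiv.
    + destruct (Ht t j) as [T1 T2], (Ht t (j + 1)%Z) as [T3 T4].
      unfold cross; apply continuous_Rminus; now apply continuous_Rmult.
    + now apply (norm_cont (fun s => plus (tauh J (exact_grid f J s) j)
                            (tauh J (exact_grid f J s) (j + 1)%Z))).
    + apply Rgt_not_eq, Hn.
  - intros t.
    assert (Pt : forall j, tauh J (exact_grid f J t) (j + Z.of_nat J)%Z
                           = tauh J (exact_grid f J t) j).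
    { apply tauh_periodic, exact_grid_periodic; lia. }
    assert (Pt1 : forall j, tauh J (exact_grid f J t) (j + Z.of_nat J + 1)%Z
                           = tauh J (exact_grid f J t) (j + 1)%Z).
    { intros j; rewrite <- (Pt (j + 1)%Z); f_equal; lia. }
    assert (Ps : forall j, speed f (node J (j + Z.of_nat J)) t = speed f (node J j) t).
    { intros j; rewrite node_periodic by lia; unfold speed.
      now rewrite !(flow_f_periodic Hflow) by lia. }
    repeat split; intros j; unfold exact_reference; cbn [ref_vel ref_len ref_om ref_cos ref_sin].
    + unfold normal_velocity; rewrite Ps, node_periodic by lia.
      now rewrite !(flow_f_periodic Hflow),
        !(flow_g_periodic Hflow) by lia.
    + replace (j + Z.of_nat J - 1)%Z with (j - 1 + Z.of_nat J)%Z by lia; now rewrite !Ps.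
    + unfold qh; rewrite !delta_periodic, Pt;
        trivial; try (apply exact_grid_periodic; lia).
      apply exact_grid_velocity_periodic; lia.
    + now rewrite Pt, Pt1.
    + now rewrite Pt, Pt1.
  - intros t j; now apply H.
Qed.

End ExactPath.

(** * The polar form of the semidiscrete problem *)

Definition rot (a : R) (v : R * R) : R * R :=
  (cos a * fst v - sin a * snd v, sin a * fst v + cos a * snd v).

Lemma rot_0 v : rot 0 v = v.
Proof.
  unfold rot; rewrite cos_0, sin_0, (surjective_pairing v); cbn [fst snd]; f_equal; ring.
Qed.

Lemma rot_dot a u v : dot (rot a u) (rot a v) = dot u v.
Proof.
  unfold rot, dot; cbn [fst snd].
  generalize (sin2_cos2 a); unfold Rsqr; intros E.
  transitivity ((fst u * fst v + snd u * snd v) * (sin a * sin a + cos a * cos a));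
    [ring|rewrite E; ring].
Qed.

Lemma perp_dot u v : dot (perp u) (perp v) = dot u v.
Proof. unfold perp, dot; cbn [fst snd]; ring. Qed.

Lemma vcont_rot (p : R -> R) (u : R -> R * R) t :
  continuous p t -> vcont u t -> vcont (fun s => rot (p s) (u s)) t.
Proof.
  intros Hp [H1 H2]; split; unfold rot; cbn [fst snd].
  - apply continuous_Rminus; apply continuous_Rmult; trivial;
      [now apply continuous_Rcos|now apply continuous_Rsin].
  - apply continuous_Rplus; apply continuous_Rmult; trivial;
      [now apply continuous_Rsin|now apply continuous_Rcos].
Qed.

Lemma vderive_rot (p : R -> R) (u : R -> R * R) t (dp : R) (du : R * R) :
  is_derive p t dp -> vderive u t du ->
  vderive (fun s => rot (p s) (u s)) t
    (plus (scal dp (perp (rot (p t) (u t)))) (rot (p t) du)).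
Proof.
  intros Hp [H1 H2].
  assert (Hc := is_derive_Rcos p t dp Hp); assert (Hs := is_derive_Rsin p t dp Hp).
  split; unfold rot; cbn [fst snd].
  - eapply is_derive_eq; [apply is_derive_Rminus; apply is_derive_Rmult; eassumption|].
    rewrite plus_pair, !scal_pair; unfold perp; cbn [fst snd]; ring.
  - eapply is_derive_eq; [apply is_derive_Rplus; apply is_derive_Rmult; eassumption|].
    rewrite plus_pair, !scal_pair; unfold perp; cbn [fst snd]; ring.
Qed.

(** The sum is [2 C theta]; the sign of [C] excludes the opposite direction. *)
Lemma normalize_symmetric theta u v (C S : R) :
  dot theta theta = 1 -> 0 < C ->
  u = plus (scal C theta) (scal (- S) (perp theta)) ->
  v = plus (scal C theta) (scal S (perp theta)) ->
  norm (plus u v) = 2 * C /\ normalize (plus u v) = theta.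
Proof.
  intros Ht HC -> ->.
  assert (E : plus (plus (scal C theta) (scal (- S) (perp theta)))
                   (plus (scal C theta) (scal S (perp theta))) = scal (2 * C) theta).
  { rewrite !plus_pair, !scal_pair; unfold perp; cbn [fst snd]; f_equal; ring. }
  assert (N : norm (scal (2 * C) theta) = 2 * C).
  { rewrite norm_pair, scal_pair; cbn [fst snd].
    replace (2 * C * fst theta * (2 * C * fst theta) + 2 * C * snd theta * (2 * C * snd theta))
      with (2 * C * (2 * C) * dot theta theta) by (unfold dot; ring).
    rewrite Ht, Rmult_1_r; apply sqrt_square; lra. }
  rewrite E; split; [exact N|]; unfold normalize; rewrite N, !scal_pair; cbn [fst snd].
  rewrite (surjective_pairing theta) at 3; f_equal; field; lra.
Qed.

(** Tangents, bisecting directions and velocities of the discrete curve that a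
    state describes relative to the grid function [X]. *)
Definition disc_tau (J : nat) (X : Z -> R * R) (u : state) (j : Z) : R * R :=
  rot (- psi u j) (tauh J X j).

Definition disc_theta (J : nat) (X : Z -> R * R) (u : state) (j : Z) : R * R :=
  rot (- ((psi u j + psi u (j + 1)%Z) / 2)) (thetah J X j).

Definition disc_vel (J : nat) (X : Z -> R * R) (u : state) (j : Z) : R * R :=
  scal (vel u j) (perp (disc_theta J X u j)).

Section Frame.
Variables (J : nat) (X : Z -> R * R) (r : reference) (u : state).
Hypotheses (HJ : (0 < J)%nat) (Hq : forall j, 0 < qh J X j)
  (Hn : forall j, 0 < norm (plus (tauh J X j) (tauh J X (j + 1)%Z)))
  (Hcos : forall j, ref_cos r j = half_cos (tauh J X j) (tauh J X (j + 1)%Z))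
  (Hsin : forall j, ref_sin r j = half_sin (tauh J X j) (tauh J X (j + 1)%Z)).

Lemma thetah_unit j : dot (thetah J X j) (thetah J X j) = 1.
Proof. now apply normalize_unit. Qed.

Lemma disc_tau_unit j : dot (disc_tau J X u j) (disc_tau J X u j) = 1.
Proof. unfold disc_tau; rewrite rot_dot; now apply tauh_unit. Qed.

Lemma disc_theta_unit j : dot (disc_theta J X u j) (disc_theta J X u j) = 1.
Proof. unfold disc_theta; rewrite rot_dot; apply thetah_unit. Qed.

(** Both edges at a vertex make half the turning angle with the bisecting
    direction. Turning them by [- psi] turns that direction by the mean of the two
    angles and changes half the turning angle by [half_jump]. *)
Lemma disc_frame j :
  disc_tau J X u j = plus (scal (turn_cos r u j) (disc_theta J X u j))
                          (scal (- turn_sin r u j) (perp (disc_theta J X u j))) /\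
  disc_tau J X u (j + 1)%Z = plus (scal (turn_cos r u j) (disc_theta J X u j))
                          (scal (turn_sin r u j) (perp (disc_theta J X u j))).
Proof.
  generalize (tauh_unit J X j (Hq j)) (tauh_unit J X (j + 1)%Z (Hq _)); intros U1 U2.
  destruct (bisector_left _ _ U1 U2 (Hn j)) as [L1 L2].
  destruct (bisector_right _ _ U1 U2 (Hn j)) as [R1 R2].
  fold (thetah J X j) in L1, L2, R1, R2.
  rewrite <- Hcos in L1, R1; rewrite <- Hsin in L2, R2.
  generalize (frame_decomposition (thetah J X j) (tauh J X j) (thetah_unit j))
    (frame_decomposition (thetah J X j) (tauh J X (j + 1)%Z) (thetah_unit j)).
  rewrite L1, L2, R1, R2; intros E1 E2.
  unfold disc_tau, disc_theta, turn_cos, turn_sin, half_jump.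
  set (a := (psi u j + psi u (j + 1)%Z) / 2); set (x := (psi u (j + 1)%Z - psi u j) / 2).
  replace (- psi u j) with (- a + x) by (unfold a, x; field).
  replace (- psi u (j + 1)%Z) with (- a - x) by (unfold a, x; field).
  rewrite E1, E2; unfold rot; rewrite cos_plus, sin_plus, cos_minus, sin_minus.
  rewrite !plus_pair, !scal_pair; unfold perp; cbn [fst snd].
  split; f_equal; ring.
Qed.

Let project j :
  dot (perp (disc_theta J X u j)) (disc_tau J X u j) = - turn_sin r u j /\
  dot (perp (disc_theta J X u j)) (perp (disc_tau J X u j)) = turn_cos r u j /\
  dot (perp (disc_theta J X u j)) (disc_tau J X u (j + 1)%Z) = turn_sin r u j /\
  dot (perp (disc_theta J X u j)) (perp (disc_tau J X u (j + 1)%Z)) = turn_cos r u j.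
Proof.
  destruct (disc_frame j) as [E1 E2]; generalize (disc_theta_unit j).
  rewrite E1, E2, !plus_pair, !scal_pair; unfold dot, perp; cbn [fst snd].
  set (t1 := fst (disc_theta J X u j)); set (t2 := snd (disc_theta J X u j)).
  set (C := turn_cos r u j); set (S := turn_sin r u j); intros U.
  repeat split.
  - transitivity (- S * (t1 * t1 + t2 * t2)); [ring|rewrite U; ring].
  - transitivity (C * (t1 * t1 + t2 * t2)); [ring|rewrite U; ring].
  - transitivity (S * (t1 * t1 + t2 * t2)); [ring|rewrite U; ring].
  - transitivity (C * (t1 * t1 + t2 * t2)); [ring|rewrite U; ring].
Qed.

(** The computation behind [psi_rate] and [len_rate]. *)
Lemma disc_vel_differences (w : Z -> R * R) j :
  (forall i, w i = disc_vel J X u i) ->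
  dot (delta J w j) (disc_tau J X u j) = len_rate (mesh J) r u j /\
  dot (delta J w j) (perp (disc_tau J X u j)) =
    (vel u j * turn_cos r u j - vel u (j - 1)%Z * turn_cos r u (j - 1)%Z) / mesh J.
Proof.
  intros Hw.
  destruct (project j) as [A1 [A2 _]], (project (j - 1)%Z) as [_ [_ [A3 A4]]].
  replace (j - 1 + 1)%Z with j in A3, A4 by lia.
  generalize (mesh_pos J HJ); intros Hm.
  unfold delta; rewrite !Hw; unfold disc_vel, len_rate.
  rewrite <- A2, <- A4.
  replace (turn_sin r u j) with (- dot (perp (disc_theta J X u j)) (disc_tau J X u j)) by lra.
  rewrite <- A3, scal_pair, minus_pair, !scal_pair; unfold dot; cbn [fst snd].
  split; field; lra.
Qed.

Lemma disc_theta_eq j : 0 < turn_cos r u j ->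
  norm (plus (disc_tau J X u j) (disc_tau J X u (j + 1)%Z)) = 2 * turn_cos r u j /\
  normalize (plus (disc_tau J X u j) (disc_tau J X u (j + 1)%Z)) = disc_theta J X u j.
Proof.
  intros HC; destruct (disc_frame j) as [E1 E2].
  exact (normalize_symmetric _ _ _ _ _ (disc_theta_unit j) HC E1 E2).
Qed.

End Frame.

(** Neighbouring edges of the discrete curve are not opposite, so that its
    bisecting directions are defined. *)
Lemma turn_cos_pos K m h r u j :
  0 < h <= 1 -> 0 < K -> h * (4 * K + 4) <= 1 -> bounded_reference K m h r ->
  near_reference m h r u -> 1 / 2 <= ref_cos r j -> 0 < turn_cos r u j.
Proof.
  intros Hh HK Hs Hb Hn Hc; unfold turn_cos.
  assert (Hx : Rabs (half_jump u j) <= h).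
  { unfold half_jump.
    generalize (close_psi Hn j) (close_psi Hn (j + 1)%Z); intros H1 H2.
    apply Rabs_le_between in H1, H2; apply Rabs_le_between; lra. }
  generalize (cos_defect (half_jump u j)) (bounded_sin Hb j)
    (SIN_bound (half_jump u j)) (unit_turn Hb j); intros H1 H2 H3 H4.
  set (x := half_jump u j) in *.
  assert (Hx2 : x ^ 2 <= 1).
  { rewrite <- Rabs_sqr; generalize (Rabs_pos x); intros; simpl; nra. }
  apply Rabs_le_between in H1.
  assert (H5 : Rabs (ref_sin r j * sin x) <= K * h).
  { rewrite Rabs_mult; rewrite <- (Rmult_1_r (K * h)).
    apply Rmult_le_compat; try apply Rabs_pos; trivial.
    apply Rabs_le_between; lra. }
  apply Rabs_le_between in H5.
  nra.
Qed.

Section Equivalence.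
Variables (beta K m T : R) (J : nat) (X G : R -> Z -> R * R) (r : R -> reference)
  (dV dQ : R -> Z -> R) (x0 : R -> R * R) (V0 : R -> R).
Hypotheses (HK : 0 < K) (Hm : 0 < m) (HT : 0 < T) (HJ : (2 <= J)%nat)
  (Hr : reference_path beta K m T J r dV dQ)
  (HXc : forall j t, vcont (fun s => X s j) t)
  (HGc : forall j t, vcont (fun s => G s j) t)
  (HXd : forall j t, 0 < t < T -> vderive (fun s => X s j) t (G t j))
  (HXp : forall t, grid_periodic J (X t)) (HGp : forall t, grid_periodic J (G t))
  (Hq : forall t j, 0 < qh J (X t) j)
  (Hn : forall t j, 1 <= norm (plus (tauh J (X t) j) (tauh J (X t) (j + 1)%Z)))
  (Hom : forall t j, ref_om (r t) j =
     dot (delta J (G t) j) (perp (tauh J (X t) j)) / qh J (X t) j)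
  (Hcos : forall t j, ref_cos (r t) j = half_cos (tauh J (X t) j) (tauh J (X t) (j + 1)%Z))
  (Hsin : forall t j, ref_sin (r t) j = half_sin (tauh J (X t) j) (tauh J (X t) (j + 1)%Z))
  (Hh : mesh J * (4 * K + 4) <= 1)
  (HX0 : forall j, X 0 j = x0 (node J j))
  (HV0 : forall j, ref_vel (r 0) j = V0 (node J j))
  (Hlen0 : forall j, Rabs (ref_len (r 0) j - qh J (X 0) j) <= K * mesh J ^ 2).

Let HJ0 : (0 < J)%nat.
Proof. lia. Qed.

Let Hmesh : 0 < mesh J <= 1.
Proof.
  generalize (mesh_pos J HJ0); intros H; split; trivial; nra.
Qed.

Let Hn0 t j : 0 < norm (plus (tauh J (X t) j) (tauh J (X t) (j + 1)%Z)).
Proof. generalize (Hn t j); lra. Qed.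

Let tau_cont j t : vcont (fun s => tauh J (X s) j) t.
Proof. now apply vcont_tauh. Qed.

Let theta_cont j t : vcont (fun s => thetah J (X s) j) t.
Proof. now apply vcont_thetah. Qed.

Let tau_derive j t : 0 < t < T ->
  vderive (fun s => tauh J (X s) j) t (scal (ref_om (r t) j) (perp (tauh J (X t) j))).
Proof. intros Ht; rewrite Hom; apply (vderive_tauh J X (G t)); auto. Qed.

Let turn_pos t u j : near_reference m (mesh J) (r t) u -> 0 < turn_cos (r t) u j.
Proof.
  intros Hu; apply (turn_cos_pos K m (mesh J)); trivial.
  - apply (path_bounded Hr).
  - rewrite Hcos; unfold half_cos; generalize (Hn t j); lra.
Qed.

(** ** From a solution in polar variables to a discrete curve *)

Section Forward.
Variable u : R -> state.
Hypotheses (Hu : state_path beta K m T J r u)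
  (Hnear : forall t, 0 <= t <= T -> near_reference m (mesh J) (r t) (u t))
  (Hlen : forall j, len (u 0) j = qh J (X 0) j).

Let w j t := disc_vel J (X t) (u t) j.

Let disc_theta_cont j t : vcont (fun s => disc_theta J (X s) (u s) j) t.
Proof.
  unfold disc_theta.
  apply (vcont_rot (fun s => - ((psi (u s) j + psi (u s) (j + 1)%Z) / 2)));
    [|apply theta_cont].
  apply continuous_Ropp, continuous_Rdiv; [|apply continuous_Rconst|lra].
  apply continuous_Rplus; apply (state_psi_cont Hu).
Qed.

Let w_cont j t : vcont (w j) t.
Proof.
  unfold w, disc_vel.
  apply (vcont_scal (fun s => vel (u s) j) (fun s => perp (disc_theta J (X s) (u s) j))).
  - apply (state_vel_cont Hu).
  - apply (vcont_perp (fun s => disc_theta J (X s) (u s) j)), disc_theta_cont.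
Qed.

Definition built_curve (j : Z) (t : R) : R * R :=
  (fst (X 0 j) + RInt (fun s => fst (disc_vel J (X s) (u s) j)) 0 t,
   snd (X 0 j) + RInt (fun s => snd (disc_vel J (X s) (u s) j)) 0 t).

Let xh := built_curve.

Lemma built_curve_derive j t : vderive (xh j) t (disc_vel J (X t) (u t) j).
Proof.
  split; unfold xh, built_curve; cbn [fst snd].
  - exact (is_derive_primitive (fun s => fst (w j s)) (fst (X 0 j)) t
             (fun s => proj1 (w_cont j s))).
  - exact (is_derive_primitive (fun s => snd (w j s)) (snd (X 0 j)) t
             (fun s => proj2 (w_cont j s))).
Qed.

Lemma built_curve_0 j : xh j 0 = X 0 j.
Proof.
  unfold xh, built_curve; rewrite !(RInt_point (V := R_CompleteNormedModule)).
  rewrite (surjective_pairing (X 0 j)) at 3; f_equal; unfold zero; simpl; ring.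
Qed.

Let disc_tau_cont j t : vcont (fun s => disc_tau J (X s) (u s) j) t.
Proof.
  apply (vcont_rot (fun s => - psi (u s) j)); [|apply tau_cont].
  apply continuous_Ropp, (state_psi_cont Hu).
Qed.

Let delta_cont j t : vcont (fun s => delta J (at_time xh s) j) t.
Proof.
  apply (vcont_delta J (fun s => at_time xh s)); intros i.
  eapply vderive_vcont, built_curve_derive.
Qed.

Let len_pos t j : 0 <= t <= T -> 0 < len (u t) j.
Proof.
  intros Ht; generalize (len_bounds _ _ _ _ _ j (path_bounded Hr t)
    (Hnear t Ht)); lra.
Qed.

(** Both sides have the same derivative, by the choice of the polar equations. *)
Lemma built_curve_delta j t : 0 <= t <= T ->
  delta J (at_time xh t) j = scal (len (u t) j) (disc_tau J (X t) (u t) j).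
Proof.
  intros Ht.
  set (D := fun s => minus (delta J (at_time xh s) j)
                           (scal (len (u s) j) (disc_tau J (X s) (u s) j))).
  assert (Hscal : forall s, vcont (fun s => scal (len (u s) j) (disc_tau J (X s) (u s) j)) s).
  { intros s; apply (vcont_scal (fun s => len (u s) j)
      (fun s => disc_tau J (X s) (u s) j)); [|apply disc_tau_cont].
    apply (state_len_cont Hu). }
  assert (HDd : forall s, 0 < s < T -> vderive D s (0, 0)).
  { intros s Hs.
    assert (Hs' : 0 <= s <= T) by lra.
    destruct (state_evolves Hu Hs (Hnear s Hs') j) as [E1 [_ E3]].
    destruct (disc_vel_differences J (X s) (r s) (u s) HJ0 (Hq s) (Hn0 s) (Hcos s) (Hsin s)
      (fun i => w i s) j (fun i => eq_refl)) as [D1 D2].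
    generalize (len_pos s j Hs'); intros Hl.
    eapply vderive_eq.
    - unfold D; apply vderive_minus.
      + apply (vderive_delta J (fun s => at_time xh s) (fun i => w i s)); intros i.
        apply built_curve_derive.
      + apply (vderive_scal (fun s => len (u s) j) (fun s => disc_tau J (X s) (u s) j));
          [exact E3|].
        apply (vderive_rot (fun s => - psi (u s) j) (fun s => tauh J (X s) j));
          [apply is_derive_Ropp; exact E1|now apply tau_derive].
    - rewrite (frame_decomposition (disc_tau J (X s) (u s) j) (delta J (fun i => w i s) j))
        by now apply disc_tau_unit.
      rewrite D1, D2; cbv beta.
      unfold psi_rate; rewrite minus_pair, !plus_pair, !scal_pair.
      unfold disc_tau, rot, perp; cbn [fst snd].
      f_equal; field; lra. }
  assert (HD0 : D 0 = (0, 0)).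
  { unfold D, disc_tau; rewrite Hlen, (state_psi_init Hu), Ropp_0, rot_0.
    rewrite <- delta_polar by apply Hq.
    assert (E : delta J (at_time xh 0) j = delta J (X 0) j).
    { unfold delta, at_time; now rewrite !built_curve_0. }
    rewrite E, minus_pair; f_equal; ring. }
  assert (HDc : forall s, vcont D s).
  { intros s; unfold D; apply (vcont_minus (fun s => delta J (at_time xh s) j)); auto. }
  generalize (constant_of_vderive D T t Ht HDc HDd); rewrite HD0; apply minus_zero_eq.
Qed.

Lemma built_curve_polar j t : 0 <= t <= T ->
  qh J (at_time xh t) j = len (u t) j /\ tauh J (at_time xh t) j = disc_tau J (X t) (u t) j.
Proof.
  intros Ht; generalize (len_pos t j Ht); intros Hl.
  assert (E : qh J (at_time xh t) j = len (u t) j).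
  { unfold qh; rewrite built_curve_delta by trivial; rewrite norm_pair, scal_pair.
    cbn [fst snd].
    generalize (disc_tau_unit J (X t) (u t) (Hq t) j); unfold dot; intros U.
    match goal with |- sqrt ?x = _ =>
      replace x with (len (u t) j * len (u t) j) end; [apply sqrt_square; lra|].
    transitivity (len (u t) j * len (u t) j *
      (fst (disc_tau J (X t) (u t) j) * fst (disc_tau J (X t) (u t) j) +
       snd (disc_tau J (X t) (u t) j) * snd (disc_tau J (X t) (u t) j)));
      [rewrite U; ring|ring]. }
  split; trivial.
  unfold tauh; rewrite E, built_curve_delta, !scal_pair by trivial; cbn [fst snd].
  rewrite (surjective_pairing (disc_tau J (X t) (u t) j)) at 3; f_equal; field; lra.
Qed.

Lemma built_curve_theta j t : 0 <= t <= T ->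
  norm (plus (tauh J (at_time xh t) j) (tauh J (at_time xh t) (j + 1)%Z)) =
    2 * turn_cos (r t) (u t) j /\
  thetah J (at_time xh t) j = disc_theta J (X t) (u t) j.
Proof.
  intros Ht; unfold thetah.
  destruct (built_curve_polar j t Ht) as [_ ->],
    (built_curve_polar (j + 1)%Z t Ht) as [_ ->].
  apply disc_theta_eq; auto.
Qed.

Let rate_cont j s : 0 <= s <= T ->
  continuous (fun s => vel_rate beta (mesh J) (r s) (u s) j) s.
Proof.
  intros Hs; unfold vel_rate, turn_sin, half_jump; path_cont Hr Hu; try lra.
  generalize (len_pos s j Hs) (len_pos s (j + 1)%Z Hs); lra.
Qed.

(* The velocity is the integral of its rate, which is continuous up to the end
   points: this is where its one-sided differentiability comes from. *)
Let vel_integral j s : 0 <= s <= T ->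
  vel (u s) j = vel (u 0) j +
    RInt (fun s => vel_rate beta (mesh J) (r (clamp T s)) (u (clamp T s)) j) 0 s.
Proof.
  intros Hs.
  set (rt := fun s => vel_rate beta (mesh J) (r (clamp T s)) (u (clamp T s)) j).
  assert (Hc : forall s, continuous rt s).
  { intros t; apply (continuous_Rcomp (fun s => vel_rate beta (mesh J) (r s) (u s) j)
      (clamp T)); [apply rate_cont, clamp_Icc; lra|apply continuous_clamp]. }
  set (D := fun s => vel (u s) j - (vel (u 0) j + RInt rt 0 s)).
  assert (E : D s = D 0).
  { apply (constant_of_derive D 0 s); [lra| |].
    - intros t _; unfold D; apply continuous_Rminus.
      + apply (state_vel_cont Hu).
      + eapply is_derive_cont, (is_derive_primitive rt); trivial.
    - intros t Ht; assert (Ht' : 0 < t < T) by lra.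
      destruct (state_evolves Hu Ht' (Hnear t ltac:(lra)) j)
        as [_ [E2 _]].
      eapply is_derive_eq; [apply is_derive_Rminus;
        [exact E2|apply (is_derive_primitive rt); trivial]|].
      unfold rt; rewrite clamp_id by lra; ring. }
  unfold D in E; rewrite (RInt_point (V := R_CompleteNormedModule)) in E.
  change (@zero R_CompleteNormedModule) with 0 in E; lra.
Qed.

Lemma built_curve_solution :
  semidiscrete_solution beta T x0 V0 J xh (fun j t => disc_vel J (X t) (u t) j).
Proof.
  assert (Hpt : forall t, periodic_state J (u t)) by apply (state_periodic Hu).
  assert (Hthp : forall t j, thetah J (X t) (j + Z.of_nat J)%Z = thetah J (X t) j).
  { intros t j; unfold thetah.
    replace (j + Z.of_nat J + 1)%Z with (j + 1 + Z.of_nat J)%Z by lia.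
    now rewrite !(tauh_periodic J (X t) (HXp t)). }
  assert (Hwp : forall t j, disc_vel J (X t) (u t) (j + Z.of_nat J)%Z
                            = disc_vel J (X t) (u t) j).
  { intros t j; destruct (Hpt t) as [P1 [P2 _]].
    unfold disc_vel, disc_theta; rewrite Hthp, P2, (zperiodic_shift J _ 1 j P1).
    now rewrite P1. }
  split.
  - intros t Ht j; unfold at_time, xh, built_curve; rewrite HXp; f_equal; f_equal;
      apply (RInt_ext (V := R_CompleteNormedModule)); intros; now rewrite Hwp.
  - intros j t Ht; apply (is_derive_on_of_vderive T (xh j) (xh j)); trivial.
    apply built_curve_derive.
  - intros j t Ht; destruct (built_curve_polar j t Ht) as [-> _]; now apply len_pos.
  - intros j t Ht; destruct (built_curve_theta j t Ht) as [E _]; intros Hz.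
    assert (E0 : norm (@zero (prod_AbelianGroup R_AbelianGroup R_AbelianGroup)) = 0).
    { exact (@norm_zero R_AbsRing
        (prod_NormedModule R_AbsRing R_NormedModule R_NormedModule)). }
    rewrite Hz in E; generalize (eq_trans (eq_sym E0) E); clear E; intros E.
    generalize (turn_pos t (u t) j (Hnear t Ht)); lra.
  - intros j t Ht q tau theta.
    assert (Hqt : forall i, 0 < qh J (at_time xh t) i).
    { intros i; destruct (built_curve_polar i t Ht) as [-> _]; now apply len_pos. }
    assert (Hnt : 0 < norm (plus (tauh J (at_time xh t) j) (tauh J (at_time xh t) (j + 1)%Z))).
    { destruct (built_curve_theta j t Ht) as [-> _].
      generalize (turn_pos t (u t) j (Hnear t Ht)); lra. }
    destruct (vderive_thetah J (fun s => at_time xh s) (fun i => w i t) j t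
      (fun i => built_curve_derive i t) Hqt Hnt) as [mu Hmu].
    set (rt := fun s => vel_rate beta (mesh J) (r (clamp T s)) (u (clamp T s)) j).
    assert (Hc : forall s, continuous rt s).
    { intros s; apply (continuous_Rcomp (fun s => vel_rate beta (mesh J) (r s) (u s) j)
        (clamp T)); [apply rate_cont, clamp_Icc; lra|apply continuous_clamp]. }
    set (Vt := fun s => vel (u 0) j + RInt rt 0 s).
    assert (HVt : is_derive Vt t (rt t)) by now apply (is_derive_primitive rt).
    set (th := thetah J (at_time xh t) j) in *.
    assert (Hacc : vderive (fun s => scal (Vt s) (perp (thetah J (at_time xh s) j))) t
       (plus (scal (rt t) (perp th)) (scal (Vt t) (perp (scal mu (perp th)))))).
    { apply (vderive_scal Vt (fun s => perp (thetah J (at_time xh s) j))); trivial.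
      now apply vderive_perp. }
    exists (plus (scal (rt t) (perp th)) (scal (Vt t) (perp (scal mu (perp th))))),
      (scal mu (perp th)).
    split; [|split].
    + apply (is_derive_on_of_vderive T _
        (fun s => scal (Vt s) (perp (thetah J (at_time xh s) j)))); trivial.
      intros s Hs; destruct (built_curve_theta j s Hs) as [_ ->].
      unfold disc_vel, Vt; now rewrite <- vel_integral.
    + now apply (is_derive_on_of_vderive T _ theta).
    + destruct (built_curve_theta j t Ht) as [_ Eth]; fold th in Eth.
      destruct (built_curve_polar j t Ht) as [Eq1 Et1],
        (built_curve_polar (j + 1)%Z t Ht) as [Eq2 Et2].
      unfold q, tau, theta; fold th; rewrite Eq1, Eq2, Et1, Et2.
      destruct (disc_frame J (X t) (r t) (u t) (Hq t) (Hn0 t) (Hcos t) (Hsin t) j)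
        as [-> ->].
      rewrite <- Eth.
      assert (Ew : disc_vel J (X t) (u t) j = scal (vel (u t) j) (perp th))
        by (rewrite Eth; reflexivity).
      rewrite Ew.
      assert (EV : Vt t = vel (u t) j) by (unfold Vt; now rewrite <- vel_integral).
      rewrite EV; unfold rt, vel_rate; rewrite !clamp_id by trivial.
      generalize (disc_theta_unit J (X t) (u t) (Hn0 t) j); rewrite <- Eth; intros U.
      generalize (len_pos t j Ht) (len_pos t (j + 1)%Z Ht); intros L1 L2.
      assert (Edot : dot (scal (vel (u t) j) (perp th)) (scal mu (perp th))
                     = vel (u t) j * mu).
      { rewrite !scal_pair; unfold dot, perp in *; cbn [fst snd].
        transitivity (vel (u t) j * mu * (fst th * fst th + snd th * snd th));
          [ring|rewrite U; ring]. }
      rewrite Edot; repeat first [rewrite plus_pair | rewrite minus_pair | rewrite scal_pair].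
      unfold perp; cbn [fst snd]; f_equal; field; lra.
  - intros j; rewrite <- HX0; apply built_curve_0.
  - intros j; assert (H0 : 0 <= 0 <= T) by lra.
    destruct (built_curve_theta j 0 H0) as [_ ->].
    unfold disc_vel; now rewrite (state_vel_init Hu), HV0.
Qed.

End Forward.

(** ** From a discrete curve to polar variables *)

Section Backward.
Variables (yh wh : Z -> R -> R * R).
Hypothesis Hy : semidiscrete_solution beta T x0 V0 J yh wh.

Let Y (t : R) : Z -> R * R := at_time yh (clamp T t).
Let W (t : R) : Z -> R * R := at_time wh (clamp T t).

Let Hcl t : Icc 0 T (clamp T t).
Proof. apply clamp_Icc; lra. Qed.

Let Y_cont j t : vcont (fun s => Y s j) t.
Proof.
  destruct (is_derive_on_continuous T (yh j) ltac:(lra)) as [C1 C2].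
  - intros s Hs; exists (wh j s); now apply (semi_velocity Hy).
  - split; [apply C1|apply C2].
Qed.

Let W_cont j t : vcont (fun s => W s j) t.
Proof.
  destruct (is_derive_on_continuous T (wh j) ltac:(lra)) as [C1 C2].
  - intros s Hs; destruct (semi_equation Hy j s Hs) as [acc [td [A _]]].
    now exists acc.
  - split; [apply C1|apply C2].
Qed.

Let Y_derive j t : 0 < t < T -> vderive (fun s => Y s j) t (W t j).
Proof.
  intros Ht; apply (interior_vderive T (yh j)); trivial.
  unfold W, at_time; rewrite clamp_id by lra.
  apply (semi_velocity Hy); unfold Icc; lra.
Qed.

Let qY t j : 0 < qh J (Y t) j.
Proof. apply (semi_q_pos Hy), Hcl. Qed.

Let nY t j : 0 < norm (plus (tauh J (Y t) j) (tauh J (Y t) (j + 1)%Z)).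
Proof.
  apply norm_pos_of_neq; exact (semi_theta_def Hy j _ (Hcl t)).
Qed.

Let th t j := thetah J (Y t) j.

Let th_unit t j : dot (th t j) (th t j) = 1.
Proof. apply normalize_unit, nY. Qed.

Let th_cont j t : vcont (fun s => th s j) t.
Proof. apply (vcont_thetah J Y); auto. Qed.

Let bisect t j : dot (minus (tauh J (Y t) (j + 1)%Z) (tauh J (Y t) j)) (th t j) = 0.
Proof.
  generalize (tauh_unit J (Y t) j (qY t j)) (tauh_unit J (Y t) (j + 1)%Z (qY t _)).
  intros U1 U2.
  destruct (bisector_left _ _ U1 U2 (nY t j)) as [L1 _].
  destruct (bisector_right _ _ U1 U2 (nY t j)) as [R1 _].
  fold (thetah J (Y t) j) in L1, R1; fold (th t j) in L1, R1.
  rewrite minus_pair; unfold dot in *; cbn [fst snd]; lra.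
Qed.

Let kappa t j : R := 2 / (qh J (Y t) j + qh J (Y t) (j + 1)%Z) * / mesh J.

Let equation j t : 0 < t < T -> exists acc td,
  vderive (fun s => W s j) t acc /\ vderive (fun s => th s j) t td /\
  dot (th t j) td = 0 /\
  forall v, dot acc v + beta * dot (W t j) v =
    kappa t j * dot (minus (tauh J (Y t) (j + 1)%Z) (tauh J (Y t) j)) v -
    dot (W t j) td * dot (th t j) v.
Proof.
  intros Ht; assert (Hi : Icc 0 T t) by (unfold Icc; lra).
  destruct (semi_equation Hy j t Hi) as [acc [td [A [B E]]]].
  exists acc, td.
  assert (Htd : vderive (fun s => th s j) t td).
  { exact (interior_vderive T (fun s => thetah J (at_time yh s) j) t td Ht B). }
  split; [now apply (interior_vderive T (wh j))|split; [trivial|split]].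
  - assert (H1 := vderive_dot _ _ _ _ _ Htd Htd); cbv beta in H1.
    apply (is_derive_Rext _ (fun _ => 1)) in H1; [|intros; apply th_unit].
    apply is_derive_unique in H1; rewrite Derive_const in H1.
    unfold dot in *; lra.
  - intros v; unfold kappa, W, th, Y, at_time; rewrite (clamp_id T t) by lra.
    fold (at_time yh t).
    assert (E1 := f_equal fst E); assert (E2 := f_equal snd E).
    repeat first [rewrite plus_pair in E1, E2 | rewrite minus_pair in E1, E2
                 |rewrite scal_pair in E1, E2]; cbn [fst snd] in E1, E2.
    rewrite minus_pair; unfold dot in *; cbn [fst snd].
    fold (thetah J (at_time yh t) j) in E1, E2.
    change (thetah J (fun j0 : Z => yh j0 t) j) with (thetah J (at_time yh t) j).
    set (a1 := fst acc) in *; set (a2 := snd acc) in *.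
    transitivity ((a1 + beta * fst (wh j t)) * fst v + (a2 + beta * snd (wh j t)) * snd v);
      [ring|rewrite E1, E2; ring].
Qed.

(** As for the exact solution the tangential velocity solves a linear homogeneous
    equation; by [bisect] the discrete curvature vector does not contribute. *)
Let normal t j : dot (W t j) (th t j) = 0.
Proof.
  set (p := fun s => dot (W s j) (th s j)).
  assert (Hpc : forall s, continuous p s).
  { intros s; apply (vcont_dot (fun s => W s j) (fun s => th s j));
      [apply W_cont|apply th_cont]. }
  assert (Hp : forall s, 0 < s < T -> is_derive p s (- beta * p s)).
  { intros s Hs; destruct (equation j s Hs) as [acc [td [A [B [_ E]]]]].
    eapply is_derive_eq; [exact (vderive_dot _ _ _ _ _ A B)|].
    specialize (E (th s j)); rewrite bisect, th_unit in E; unfold p; lra. }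
  assert (Hcst : forall s, p (clamp T s) = p s).
  { intros s; unfold p, W, th, Y; now rewrite (clamp_id T (clamp T s)) by apply Hcl. }
  assert (Hexp : exp (beta * clamp T t) * p (clamp T t) = exp (beta * 0) * p 0).
  { apply (constant_of_derive (fun s => exp (beta * s) * p s) 0 (clamp T t)).
    - apply Hcl.
    - intros s _; apply continuous_Rmult; [|trivial].
      eapply is_derive_cont, is_derive_exp_scal.
    - intros s Hs; generalize (Hcl t); unfold Icc; intros Ht.
      eapply is_derive_eq.
      + apply is_derive_Rmult; [apply is_derive_exp_scal|apply Hp; lra].
      + cbv beta; ring. }
  assert (Hp0 : p 0 = 0).
  { unfold p, th, Y, W, at_time; rewrite clamp_id by lra.
    rewrite (semi_init_vel Hy), scal_pair.
    change (thetah J (fun j0 : Z => yh j0 0) j) with (thetah J (at_time yh 0) j).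
    unfold dot, perp; cbn [fst snd]; ring. }
  rewrite Hp0, Rmult_0_r in Hexp; fold (p t); rewrite <- Hcst.
  generalize (exp_pos (beta * clamp T t)); intros He.
  apply Rmult_eq_reg_l with (exp (beta * clamp T t)); lra.
Qed.

Let nvel t j : R := dot (W t j) (perp (th t j)).

Let W_normal t j : W t j = scal (nvel t j) (perp (th t j)).
Proof.
  rewrite (frame_decomposition (th t j) (W t j) (th_unit t j)) at 1.
  rewrite normal; fold (nvel t j); rewrite scal_pair; unfold perp; cbn [fst snd].
  f_equal; ring.
Qed.

Let omY t j : R := dot (delta J (W t) j) (perp (tauh J (Y t) j)) / qh J (Y t) j.

Let tauY_cont j t : vcont (fun s => tauh J (Y s) j) t.
Proof. now apply (vcont_tauh J Y). Qed.

Let omY_cont j t : continuous (fun s => omY s j) t.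
Proof.
  unfold omY; apply continuous_Rdiv.
  - apply (vcont_dot (fun s => delta J (W s) j) (fun s => perp (tauh J (Y s) j))).
    + now apply (vcont_delta J W).
    + apply (vcont_perp (fun s => tauh J (Y s) j)), tauY_cont.
  - now apply (qh_cont J Y).
  - apply Rgt_not_eq, qY.
Qed.

Let jump_rate_cont j t : continuous (fun s => ref_om (r s) j - omY s j) t.
Proof.
  apply continuous_Rminus; [apply (path_om_cont Hr)|apply omY_cont].
Qed.

Definition polar_state (t : R) : state :=
  State (fun j => 0 + RInt (fun s => ref_om (r s) j - omY s j) 0 t)
        (fun j => nvel t j) (fun j => qh J (Y t) j).

Let psi_derive j t : is_derive (fun s => psi (polar_state s) j) t (ref_om (r t) j - omY t j).
Proof. apply (is_derive_primitive (fun s => ref_om (r s) j - omY s j)); auto. Qed.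

Let psi_0 j : psi (polar_state 0) j = 0.
Proof.
  simpl; rewrite (RInt_point (V := R_CompleteNormedModule)); unfold zero; simpl; ring.
Qed.

Let Y_0 j : Y 0 j = X 0 j.
Proof.
  unfold Y, at_time; rewrite clamp_id by lra.
  now rewrite (semi_init_pos Hy), HX0.
Qed.

Let delta_0 j : delta J (Y 0) j = delta J (X 0) j.
Proof. unfold delta; now rewrite !Y_0. Qed.

Let tau_0 j : tauh J (Y 0) j = tauh J (X 0) j.
Proof. unfold tauh, qh; now rewrite delta_0. Qed.

(* The exact tangent turned by [- psi] rotates with the same angular velocity as
   the discrete tangent and coincides with it initially. *)
Let tau_polar t j : 0 <= t <= T ->
  tauh J (Y t) j = disc_tau J (X t) (polar_state t) j.
Proof.
  intros Ht.
  set (D := fun s => dot (tauh J (Y s) j) (disc_tau J (X s) (polar_state s) j)).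
  assert (Hdc : forall s, vcont (fun s => disc_tau J (X s) (polar_state s) j) s).
  { intros s; apply (vcont_rot (fun s => - psi (polar_state s) j)); [|apply tau_cont].
    apply continuous_Ropp; eapply is_derive_cont, psi_derive. }
  assert (E : D t = D 0).
  { apply (constant_of_derive D 0 t); [lra| |].
    - intros s _; apply (vcont_dot (fun s => tauh J (Y s) j)
        (fun s => disc_tau J (X s) (polar_state s) j)); trivial.
    - intros s Hs; assert (Hs' : 0 < s < T) by lra.
      eapply is_derive_eq.
      + apply (vderive_dot (fun s => tauh J (Y s) j)
          (fun s => disc_tau J (X s) (polar_state s) j)).
        * apply (vderive_tauh J Y (W s)); auto.
        * apply (vderive_rot (fun s => - psi (polar_state s) j) (fun s => tauh J (X s) j));
            [apply is_derive_Ropp; apply psi_derive|now apply tau_derive].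
      + fold (omY s j); unfold disc_tau; cbv beta.
        set (q := psi (polar_state s) j); set (o := omY s j).
        rewrite plus_pair, !scal_pair; unfold rot, perp, dot; cbn [fst snd]; ring. }
  assert (U1 := tauh_unit J (Y t) j (qY t j)).
  assert (U2 := disc_tau_unit J (X t) (polar_state t) (Hq t) j).
  assert (E1 : dot (tauh J (Y t) j) (disc_tau J (X t) (polar_state t) j) = 1).
  { change (D t = 1); rewrite E; unfold D, disc_tau.
    rewrite psi_0, Ropp_0, rot_0, tau_0; now apply tauh_unit. }
  unfold dot in U1, U2, E1.
  set (a := tauh J (Y t) j) in *; set (b := disc_tau J (X t) (polar_state t) j) in *.
  assert (Hsq : (fst a - fst b) * (fst a - fst b) + (snd a - snd b) * (snd a - snd b) = 0)
    by lra.
  destruct (Rplus_sqr_eq_0 _ _ Hsq) as [Z1 Z2].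
  apply injective_projections; apply Rminus_diag_uniq; trivial.
Qed.

Let theta_polar t j : 0 <= t <= T -> near_reference m (mesh J) (r t) (polar_state t) ->
  th t j = disc_theta J (X t) (polar_state t) j.
Proof.
  intros Ht Hnr; unfold th, thetah; rewrite !tau_polar by trivial.
  apply (disc_theta_eq J (X t) (r t)); auto.
Qed.

Let W_polar t j : 0 <= t <= T -> near_reference m (mesh J) (r t) (polar_state t) ->
  W t j = disc_vel J (X t) (polar_state t) j.
Proof. intros Ht Hnr; unfold disc_vel; rewrite <- theta_polar; trivial; apply W_normal. Qed.

Let Y_periodic t : grid_periodic J (Y t).
Proof. apply (semi_periodic Hy), Hcl. Qed.

Let W_periodic t : grid_periodic J (W t).
Proof.
  assert (Hint : forall s j, 0 < s < T -> W s (j + Z.of_nat J)%Z = W s j).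
  { intros s j Hs.
    destruct (Y_derive (j + Z.of_nat J) s Hs) as [D1 D2], (Y_derive j s Hs) as [D3 D4].
    apply (is_derive_Rext _ (fun s => fst (Y s j))) in D1;
      [|intros s'; now rewrite Y_periodic].
    apply (is_derive_Rext _ (fun s => snd (Y s j))) in D2;
      [|intros s'; now rewrite Y_periodic].
    apply is_derive_unique in D1, D2, D3, D4.
    apply injective_projections;
      [exact (eq_trans (eq_sym D1) D3)|exact (eq_trans (eq_sym D2) D4)]. }
  assert (Hcc : forall s j, W (clamp T s) j = W s j).
  { intros; unfold W; now rewrite (clamp_id T (clamp T s)) by apply Hcl. }
  intros j; rewrite <- (Hcc t (j + Z.of_nat J)%Z), <- (Hcc t j).
  apply injective_projections.
  - apply (closed_extension_eq (fun s => fst (W s (j + Z.of_nat J)%Z))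
      (fun s => fst (W s j)) T HT).
    + intros s; exact (proj1 (W_cont _ s)).
    + intros s; exact (proj1 (W_cont _ s)).
    + intros s Hs; now rewrite Hint.
    + apply Hcl.
  - apply (closed_extension_eq (fun s => snd (W s (j + Z.of_nat J)%Z))
      (fun s => snd (W s j)) T HT).
    + intros s; exact (proj2 (W_cont _ s)).
    + intros s; exact (proj2 (W_cont _ s)).
    + intros s Hs; now rewrite Hint.
    + apply Hcl.
Qed.

Lemma polar_state_len_0 j : len (polar_state 0) j = qh J (X 0) j.
Proof. simpl; unfold qh; now rewrite delta_0. Qed.

Lemma polar_state_path : state_path beta K m T J r polar_state.
Proof.
  assert (Htp : forall t j, tauh J (Y t) (j + Z.of_nat J)%Z = tauh J (Y t) j).
  { intros t; apply tauh_periodic, Y_periodic. }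
  assert (Hthp : forall t j, th t (j + Z.of_nat J)%Z = th t j).
  { intros t j; unfold th, thetah.
    replace (j + Z.of_nat J + 1)%Z with (j + 1 + Z.of_nat J)%Z by lia; now rewrite !Htp. }
  split.
  - intros j t; eapply is_derive_cont, psi_derive.
  - intros j t; apply (vcont_dot (fun s => W s j) (fun s => perp (th s j)));
      [apply W_cont|apply (vcont_perp (fun s => th s j)), th_cont].
  - intros j t; now apply (qh_cont J Y).
  - intros t; split; [|split]; intros j; simpl.
    + f_equal; apply (RInt_ext (V := R_CompleteNormedModule)); intros s _.
      destruct (path_periodic Hr s) as [_ [_ [Po _]]].
      rewrite Po; unfold omY, qh.
      now rewrite (delta_periodic J (W s) (W_periodic s)),
        (delta_periodic J (Y s) (Y_periodic s)), Htp.
    + unfold nvel; now rewrite W_periodic, Hthp.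
    + unfold qh; now rewrite (delta_periodic J (Y t) (Y_periodic t)).
  - exact psi_0.
  - intros j; simpl; unfold nvel.
    assert (E : W 0 j = scal (V0 (node J j)) (perp (th 0 j))).
    { unfold W, th, Y, at_time; rewrite clamp_id by lra.
      exact (semi_init_vel Hy j). }
    rewrite E, HV0, scal_pair; generalize (th_unit 0 j); unfold dot, perp; cbn [fst snd].
    intros U; transitivity (V0 (node J j) * (fst (th 0 j) * fst (th 0 j) +
      snd (th 0 j) * snd (th 0 j))); [ring|rewrite U; ring].
  - intros j; rewrite polar_state_len_0; apply Hlen0.
  - intros t Ht Hnr j; assert (Ht' : 0 <= t <= T) by lra.
    destruct (disc_vel_differences J (X t) (r t) (polar_state t) HJ0 (Hq t) (Hn0 t) (Hcos t)
      (Hsin t) (W t) j (fun i => W_polar t i Ht' Hnr)) as [D1 D2].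
    rewrite <- tau_polar in D1, D2 by trivial.
    split; [|split].
    + eapply is_derive_eq; [apply psi_derive|].
      unfold omY, psi_rate; rewrite D2; simpl; field.
      generalize (qY t j); lra.
    + destruct (equation j t Ht) as [acc [td [A [B [U E]]]]].
      eapply is_derive_eq;
        [exact (vderive_dot _ _ _ _ _ A (vderive_perp (fun s => th s j) t td B))|].
      specialize (E (perp (th t j))).
      assert (Z1 : dot (th t j) (perp (th t j)) = 0) by (unfold dot, perp; cbn [fst snd]; ring).
      assert (Z2 : dot (W t j) (perp td) = 0).
      { rewrite W_normal, scal_pair; unfold dot, perp in *; cbn [fst snd].
        transitivity (nvel t j * (fst (th t j) * fst td + snd (th t j) * snd td));
          [ring|rewrite U; ring]. }
      assert (Z3 : dot (minus (tauh J (Y t) (j + 1)%Z) (tauh J (Y t) j)) (perp (th t j))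
                   = 2 * turn_sin (r t) (polar_state t) j).
      { rewrite !tau_polar, theta_polar by trivial.
        destruct (disc_frame J (X t) (r t) (polar_state t) (Hq t) (Hn0 t) (Hcos t) (Hsin t) j)
          as [-> ->].
        generalize (disc_theta_unit J (X t) (polar_state t) (Hn0 t) j).
        rewrite minus_pair, !plus_pair, !scal_pair; unfold dot, perp; cbn [fst snd].
        set (t1 := fst _); set (t2 := snd _); intros U1.
        transitivity (2 * turn_sin (r t) (polar_state t) j * (t1 * t1 + t2 * t2));
          [ring|rewrite U1; ring]. }
      rewrite Z1, Z3 in E; cbv beta; rewrite Z2.
      unfold vel_rate; change (vel (polar_state t) j) with (dot (W t j) (perp (th t j))).
      transitivity (- beta * dot (W t j) (perp (th t j)) +
        kappa t j * (2 * turn_sin (r t) (polar_state t) j)); [lra|].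
      unfold kappa; simpl; field.
      generalize (qY t j) (qY t (j + 1)%Z); lra.
    + eapply is_derive_eq; [apply (qh_derive J Y (W t)); auto|].
      exact D1.
Qed.

Lemma polar_state_velocity t j : 0 <= t <= T ->
  near_reference m (mesh J) (r t) (polar_state t) ->
  wh j t = disc_vel J (X t) (polar_state t) j.
Proof.
  intros Ht Hnr; rewrite <- W_polar by trivial.
  unfold W, at_time; now rewrite clamp_id.
Qed.

End Backward.
End Equivalence.

(** * The error estimate *)

Lemma dot_triangle (u v w : R * R) :
  norm (minus u w) ^ 2 <= 2 * norm (minus u v) ^ 2 + 2 * norm (minus v w) ^ 2.
Proof.
  rewrite !norm_sqr, !minus_pair; unfold dot; cbn [fst snd].
  generalize (pow2_ge_0 (fst u - fst v - (fst v - fst w)))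
    (pow2_ge_0 (snd u - snd v - (snd v - snd w))); nra.
Qed.

Lemma scal_difference (a b : R) (u v : R * R) : dot v v = 1 ->
  norm (minus (scal a u) (scal b v)) ^ 2 <= 2 * (a - b) ^ 2 + 2 * a ^ 2 * norm (minus u v) ^ 2.
Proof.
  intros U; rewrite !norm_sqr, !minus_pair, !scal_pair; unfold dot in *; cbn [fst snd].
  assert (H : forall x y, (a * x - b * y) * (a * x - b * y) <=
             2 * (a - b) ^ 2 * (y * y) + 2 * a ^ 2 * ((x - y) * (x - y))).
  { intros x y; generalize (pow2_ge_0 ((a - b) * y - a * (x - y))); nra. }
  generalize (H (fst u) (fst v)) (H (snd u) (snd v)); intros H1 H2.
  replace (2 * (a - b) ^ 2) with (2 * (a - b) ^ 2 * (fst v * fst v + snd v * snd v))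
    by (rewrite U; ring).
  lra.
Qed.

Lemma perp_difference u v : norm (minus (perp u) (perp v)) = norm (minus u v).
Proof.
  rewrite !norm_pair, !minus_pair; unfold perp; cbn [fst snd]; f_equal; ring.
Qed.

Lemma rot_difference a v : dot v v = 1 -> norm (minus v (rot a v)) ^ 2 <= a ^ 2.
Proof.
  intros U; rewrite norm_sqr, minus_pair; unfold rot, dot in *; cbn [fst snd].
  generalize (cos_defect a) (sin2_cos2 a); unfold Rsqr; intros H E.
  apply Rabs_le_between in H.
  match goal with |- ?x <= _ => replace x with (2 - 2 * cos a) end; [lra|].
  transitivity ((1 + (sin a * sin a + cos a * cos a) - 2 * cos a) *
                (fst v * fst v + snd v * snd v)); [rewrite E, U; ring|ring].
Qed.

Lemma norm_1h_ext J v w : (forall j, v j = w j) -> norm_1h J v = norm_1h J w.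
Proof.
  intros H; unfold norm_1h, delta; do 2 f_equal; apply sum_n_m_ext; intros; now rewrite !H.
Qed.

Lemma norm_0h_ext J v w : (forall j, v j = w j) -> norm_0h J v = norm_0h J w.
Proof.
  intros H; unfold norm_0h; do 2 f_equal; apply sum_n_m_ext; intros; now rewrite !H.
Qed.

Section ErrorBound.
Variables (beta T M m K Ks : R) (f : bool -> nat -> R -> R -> R)
  (g : bool -> R -> R -> R) (J : nat) (u : R -> state).
Let X := exact_grid f J.
Let G := exact_grid_velocity g J.
Let r := exact_reference f g J.
Let h := mesh J.
Hypotheses (HK : 0 < K) (Hm : 0 < m) (HT : 0 < T) (HJ : (2 <= J)%nat) (HKs : 0 <= Ks)
  (Hflow : smooth_flow beta T M m f g)
  (Hr : reference_path beta K m T J r (exact_dV beta f g J) (exact_dQ f g J))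
  (Hest : forall t j,
    norm (minus (thetah J (X t) j) (exact_tangent f J t j)) <= K * h ^ 2 /\
    Rabs (ref_len (r t) j - qh J (X t) j) <= K * h ^ 2 /\
    m / 2 <= qh J (X t) j /\
    1 <= norm (plus (tauh J (X t) j) (tauh J (X t) (j + 1)%Z)))
  (Hh : h * (4 * K + 4) <= 1)
  (Hu : state_path beta K m T J r u)
  (Hlen : forall j, len (u 0) j = qh J (X 0) j)
  (Hnear : forall t, 0 <= t <= T -> near_reference m h (r t) (u t))
  (Hstab : forall t, 0 <= t <= T -> gsum J (square_error (r t) (u t)) <= Ks * h ^ 3).

Let HJ0 : (0 < J)%nat.
Proof. lia. Qed.

Let Hmesh : 0 < h.
Proof. now apply mesh_pos. Qed.

Let Hq t j : 0 < qh J (X t) j.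
Proof. destruct (Hest t j) as [_ [_ [H _]]]; lra. Qed.

Let Hn0 t j : 0 < norm (plus (tauh J (X t) j) (tauh J (X t) (j + 1)%Z)).
Proof. destruct (Hest t j) as [_ [_ [_ H]]]; lra. Qed.

Let Hn1 t j : 1 <= norm (plus (tauh J (X t) j) (tauh J (X t) (j + 1)%Z)).
Proof. now destruct (Hest t j) as [_ [_ [_ H]]]. Qed.

Let J_h4 : INR J * h ^ 4 = h ^ 3.
Proof.
  replace (INR J * h ^ 4) with (INR J * h * h ^ 3) by ring.
  unfold h at 1; rewrite INR_mesh by trivial; ring.
Qed.

Definition velocity_constant : R := (2 + 4 * K ^ 2) * Ks + 4 * K ^ 4.
Definition secant_constant : R := (4 + 2 * (K + m) ^ 2) * Ks + 4 * K ^ 2.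

Let psi_periodic t : zperiodic J (fun j => psi (u t) j ^ 2).
Proof. intros j; now rewrite (proj1 (state_periodic Hu t)). Qed.

Let error_sums t : 0 <= t <= T ->
  0 <= gsum J (fun j => vel_error (r t) (u t) j ^ 2) /\
  0 <= gsum J (fun j => psi (u t) j ^ 2) /\
  0 <= gsum J (fun j => len_error (r t) (u t) j ^ 2) /\
  gsum J (fun j => vel_error (r t) (u t) j ^ 2) + gsum J (fun j => psi (u t) j ^ 2) +
  gsum J (fun j => len_error (r t) (u t) j ^ 2) <= Ks * h ^ 3.
Proof.
  intros Ht; repeat split; try (apply gsum_nonneg; intros; apply pow2_ge_0).
  rewrite <- !gsum_plus; now apply Hstab.
Qed.

(** Three contributions: the error of [vel], the difference [O(h^2)] between the
    tangent and the bisecting direction of the exact polygon, and the rotation of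
    the latter by the mean of two angles [psi]. *)
Lemma velocity_error t : 0 <= t <= T ->
  gsum J (fun j => norm (minus (G t j) (disc_vel J (X t) (u t) j)) ^ 2)
  <= velocity_constant * h ^ 3.
Proof.
  intros Ht.
  assert (Hj : forall j, norm (minus (G t j) (disc_vel J (X t) (u t) j)) ^ 2 <=
    2 * vel_error (r t) (u t) j ^ 2 + 4 * K ^ 4 * h ^ 4 +
    2 * K ^ 2 * psi (u t) j ^ 2 + 2 * K ^ 2 * psi (u t) (j + 1)%Z ^ 2).
  { intros j; unfold G; rewrite (exact_velocity_normal beta T M m f g Hm Hflow).
    unfold disc_vel; fold (r t).
    assert (U := disc_theta_unit J (X t) (u t) (Hn0 t) j).
    eapply Rle_trans; [apply scal_difference; now rewrite perp_dot|].
    rewrite perp_difference; fold (vel_error (r t) (u t) j).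
    assert (HV : ref_vel (r t) j ^ 2 <= K ^ 2).
    { rewrite <- Rabs_sqr; apply pow_incr; split; [apply Rabs_pos|].
      apply (bounded_vel (path_bounded Hr t)). }
    assert (Hd : norm (minus (exact_tangent f J t j) (disc_theta J (X t) (u t) j)) ^ 2
                 <= 2 * K ^ 2 * h ^ 4 + psi (u t) j ^ 2 + psi (u t) (j + 1)%Z ^ 2).
    { eapply Rle_trans; [apply (dot_triangle _ (thetah J (X t) j))|].
      assert (H1 : norm (minus (exact_tangent f J t j) (thetah J (X t) j)) ^ 2
                   <= K ^ 2 * h ^ 4).
      { replace (K ^ 2 * h ^ 4) with ((K * h ^ 2) ^ 2) by ring.
        destruct (Hest t j) as [H1 _].
        apply pow_incr; split; [apply norm_nonneg|].
        apply Rle_trans with (2 := H1); right.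
        rewrite !norm_pair, !minus_pair; cbn [fst snd]; f_equal; ring. }
      assert (H2 := rot_difference (- ((psi (u t) j + psi (u t) (j + 1)%Z) / 2))
        (thetah J (X t) j) (thetah_unit J (X t) (Hn0 t) j)).
      fold (disc_theta J (X t) (u t) j) in H2.
      generalize (pow2_ge_0 (psi (u t) j - psi (u t) (j + 1)%Z)); intros; nra. }
    set (d := norm _ ^ 2) in *.
    assert (Hmul : ref_vel (r t) j ^ 2 * d <= K ^ 2 *
      (2 * K ^ 2 * h ^ 4 + psi (u t) j ^ 2 + psi (u t) (j + 1)%Z ^ 2)).
    { apply Rmult_le_compat; trivial; apply pow2_ge_0. }
    lra. }
  apply Rle_trans with (1 := gsum_le J _ _ Hj).
  rewrite !gsum_plus, !gsum_scal, gsum_const, J_h4.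
  rewrite (gsum_shift J (fun j => psi (u t) j ^ 2)) by apply psi_periodic.
  destruct (error_sums t Ht) as [P1 [P2 [P3 Hsum]]].
  set (a := gsum J (fun j => vel_error (r t) (u t) j ^ 2)) in *.
  set (b := gsum J (fun j => psi (u t) j ^ 2)) in *.
  set (c := gsum J (fun j => len_error (r t) (u t) j ^ 2)) in *.
  unfold velocity_constant; generalize (pow2_ge_0 K); intros HK2.
  assert (Q1 : K ^ 2 * b <= K ^ 2 * (Ks * h ^ 3)) by (apply Rmult_le_compat_l; lra).
  lra.
Qed.

Let xh := built_curve J X u.

Let error_derive j t : 0 < t < T ->
  vderive (fun s => minus (X s j) (xh j s)) t (minus (G t j) (disc_vel J (X t) (u t) j)).
Proof.
  intros Ht; apply vderive_minus.
  - now apply (exact_grid_derive beta T M m f g Hflow).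
  - apply (built_curve_derive beta K m T J X r); auto.
    intros i s; apply (exact_grid_cont beta T M m f g Hflow).
Qed.

Let error_cont j t : vcont (fun s => minus (X s j) (xh j s)) t.
Proof.
  apply (vcont_minus (fun s => X s j) (xh j)).
  - apply (exact_grid_cont beta T M m f g Hflow).
  - eapply vderive_vcont, (built_curve_derive beta K m T J X r); auto.
    intros i s; apply (exact_grid_cont beta T M m f g Hflow).
Qed.

Lemma velocity_constant_pos : 0 <= velocity_constant.
Proof.
  unfold velocity_constant; generalize (pow2_ge_0 K) (pow_le K 4 ltac:(lra)); intros.
  assert (0 <= K ^ 2 * Ks) by (now apply Rmult_le_pos); lra.
Qed.

(** The position error is the integral of the velocity error. *)
Lemma position_error t : 0 <= t <= T ->
  gsum J (fun j => norm (minus (X t j) (xh j t)) ^ 2)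
  <= velocity_constant * T * exp T * h ^ 3.
Proof.
  intros Ht; generalize velocity_constant_pos; intros HA.
  assert (Hh3 : 0 <= h ^ 3) by (apply pow_le; lra).
  set (e := fun s j => minus (X s j) (xh j s)).
  set (de := fun s j => minus (G s j) (disc_vel J (X s) (u s) j)).
  apply Rle_trans with (gsum J (fun j => dot (e t j) (e t j))).
  { right; apply gsum_ext; intros; apply norm_sqr. }
  assert (H : gsum J (fun j => dot (e t j) (e t j)) <=
    (gsum J (fun j => dot (e 0 j) (e 0 j)) + velocity_constant * h ^ 3 * t) * exp (1 * t)).
  { apply (gronwall (fun s => gsum J (fun j => dot (e s j) (e s j)))
      (fun s => gsum J (fun j => dot (de s j) (e s j) + dot (e s j) (de s j)))); try lra.
    - apply Rmult_le_pos; trivial.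
    - intros s _; apply gsum_continuous; intros j.
      apply (vcont_dot (fun s => e s j) (fun s => e s j)); apply error_cont.
    - intros s Hs; apply (gsum_derive J (fun j s => dot (e s j) (e s j))
        (fun j s => dot (de s j) (e s j) + dot (e s j) (de s j))); intros j.
      apply (vderive_dot (fun s => e s j) (fun s => e s j)); apply error_derive; lra.
    - intros s Hs; rewrite Rmult_1_l.
      apply Rle_trans with (gsum J (fun j => dot (e s j) (e s j)) +
        gsum J (fun j => norm (de s j) ^ 2)).
      + rewrite <- gsum_plus; apply gsum_le; intros j; rewrite norm_sqr; unfold dot.
        clearbody e de; destruct (e s j) as [a1 a2], (de s j) as [b1 b2]; cbn [fst snd].
        generalize (pow2_ge_0 (a1 - b1)) (pow2_ge_0 (a2 - b2)); lra.
      + apply Rplus_le_compat_l, velocity_error; lra. }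
  apply Rle_trans with (1 := H).
  assert (H0 : gsum J (fun j => dot (e 0 j) (e 0 j)) = 0).
  { transitivity (gsum J (fun _ => 0)); [|rewrite gsum_const; ring].
    apply gsum_ext; intros j; unfold e, xh; cbv beta; rewrite built_curve_0, minus_pair.
     unfold dot; cbn [fst snd]; ring. }
  rewrite H0, Rplus_0_l, Rmult_1_l.
  replace (velocity_constant * T * exp T * h ^ 3) with
    ((velocity_constant * h ^ 3 * T) * exp T) by ring.
  assert (Hvh : 0 <= velocity_constant * h ^ 3) by now apply Rmult_le_pos.
  apply Rmult_le_compat.
  - apply Rmult_le_pos; lra.
  - left; apply exp_pos.
  - apply Rmult_le_compat_l; lra.
  - destruct (Req_dec t T) as [->|]; [lra|left; apply exp_increasing; lra].
Qed.

(** The edges differ by the rotation of angle [psi] and by their lengths; the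
    length of the exact edge is [ref_len] up to [O(h^2)]. *)
Lemma secant_error t : 0 <= t <= T ->
  gsum J (fun j => norm (delta J (fun i => minus (X t i) (xh i t)) j) ^ 2)
  <= secant_constant * h ^ 3.
Proof.
  intros Ht.
  assert (Hb := path_bounded Hr t).
  assert (Hj : forall j, norm (delta J (fun i => minus (X t i) (xh i t)) j) ^ 2 <=
    4 * len_error (r t) (u t) j ^ 2 + 4 * K ^ 2 * h ^ 4 +
    2 * (K + m) ^ 2 * psi (u t) j ^ 2).
  { intros j.
    assert (E : delta J (fun i => minus (X t i) (xh i t)) j =
      minus (delta J (X t) j) (delta J (at_time xh t) j)).
    { unfold delta, at_time; rewrite !minus_pair, !scal_pair; cbn [fst snd].
      cbn [fst snd]; f_equal; ring. }
    assert (Ed : delta J (at_time xh t) j = scal (len (u t) j) (disc_tau J (X t) (u t) j)).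
    { apply (built_curve_delta beta K m T J X G r (exact_dV beta f g J) (exact_dQ f g J));
        auto; try reflexivity.
      - intros i s; apply (exact_grid_cont beta T M m f g Hflow).
      - intros i s Hs; now apply (exact_grid_derive beta T M m f g Hflow). }
    rewrite E, Ed, (delta_polar J (X t) j) by apply Hq.
    assert (U := tauh_unit J (X t) j (Hq t j)).
    assert (Hsym : norm (minus (scal (qh J (X t) j) (tauh J (X t) j))
              (scal (len (u t) j) (disc_tau J (X t) (u t) j))) ^ 2 =
            norm (minus (scal (len (u t) j) (disc_tau J (X t) (u t) j))
              (scal (qh J (X t) j) (tauh J (X t) j))) ^ 2).
    { rewrite !norm_sqr, !minus_pair; unfold dot; cbn [fst snd]; ring. }
    apply (Rle_trans _ _ _ (Req_le _ _ Hsym)).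
    eapply Rle_trans; [apply scal_difference; trivial|].
    assert (H1 : (len (u t) j - qh J (X t) j) ^ 2 <=
              2 * len_error (r t) (u t) j ^ 2 + 2 * K ^ 2 * h ^ 4).
    { destruct (Hest t j) as [_ [H1 _]].
      assert (H2 : (ref_len (r t) j - qh J (X t) j) ^ 2 <= K ^ 2 * h ^ 4).
      { replace (K ^ 2 * h ^ 4) with ((K * h ^ 2) ^ 2) by ring.
        rewrite <- Rabs_sqr; apply pow_incr; split; [apply Rabs_pos|trivial]. }
      unfold len_error.
      generalize (pow2_ge_0 ((ref_len (r t) j - len (u t) j) +
                             (ref_len (r t) j - qh J (X t) j))); nra. }
    assert (H2 : norm (minus (disc_tau J (X t) (u t) j) (tauh J (X t) j)) ^ 2
                 <= psi (u t) j ^ 2).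
    { replace (psi (u t) j ^ 2) with ((- psi (u t) j) ^ 2) by ring.
      apply Rle_trans with (2 := rot_difference (- psi (u t) j) _ U); right.
      rewrite !norm_sqr, !minus_pair; unfold disc_tau, dot; cbn [fst snd]; ring. }
    assert (H3 : len (u t) j ^ 2 <= (K + m) ^ 2).
    { generalize (len_bounds _ _ _ _ _ j Hb (Hnear t Ht)); intros.
      apply pow_incr; lra. }
    assert (H4 : len (u t) j ^ 2 * norm (minus (disc_tau J (X t) (u t) j) (tauh J (X t) j)) ^ 2
                 <= (K + m) ^ 2 * psi (u t) j ^ 2).
    { apply Rmult_le_compat; trivial; apply pow2_ge_0. }
    lra. }
  apply Rle_trans with (1 := gsum_le J _ _ Hj).
  rewrite !gsum_plus, !gsum_scal, gsum_const, J_h4.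
  destruct (error_sums t Ht) as [P1 [P2 [P3 Hsum]]].
  set (a := gsum J (fun j => vel_error (r t) (u t) j ^ 2)) in *.
  set (b := gsum J (fun j => psi (u t) j ^ 2)) in *.
  set (c := gsum J (fun j => len_error (r t) (u t) j ^ 2)) in *.
  unfold secant_constant; generalize (pow2_ge_0 (K + m)); intros HK2.
  assert (Q1 : (K + m) ^ 2 * b <= (K + m) ^ 2 * (Ks * h ^ 3))
    by (apply Rmult_le_compat_l; lra).
  lra.
Qed.

Lemma discrete_norms t : 0 <= t <= T ->
  norm_1h J (fun j => minus (X t j) (xh j t)) +
  norm_0h J (fun j => minus (G t j) (disc_vel J (X t) (u t) j))
  <= (sqrt (velocity_constant * T * exp T + secant_constant) + sqrt velocity_constant)
     * h ^ 2.
Proof.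
  intros Ht; generalize velocity_constant_pos; intros HA.
  assert (HB : 0 <= secant_constant).
  { unfold secant_constant; generalize (pow2_ge_0 (K + m)) (pow2_ge_0 K); intros.
    assert (0 <= (K + m) ^ 2 * Ks) by (now apply Rmult_le_pos); lra. }
  assert (HAT : 0 <= velocity_constant * T * exp T).
  { apply Rmult_le_pos; [apply Rmult_le_pos; lra|left; apply exp_pos]. }
  assert (Hroot : forall s C, 0 <= C -> s <= C * h ^ 3 -> sqrt (h * s) <= sqrt C * h ^ 2).
  { intros s C HC Hs.
    rewrite <- (sqrt_pow2 (h ^ 2)) by apply pow2_ge_0.
    rewrite <- sqrt_mult by (trivial; apply pow2_ge_0).
    apply sqrt_le_1_alt.
    replace (C * (h ^ 2) ^ 2) with (h * (C * h ^ 3)) by ring.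
    apply Rmult_le_compat_l; lra. }
  rewrite Rmult_plus_distr_r; apply Rplus_le_compat.
  - change (sqrt (h * gsum J (fun j => norm (minus (X t j) (xh j t)) ^ 2 +
      norm (delta J (fun i => minus (X t i) (xh i t)) j) ^ 2)) <=
      sqrt (velocity_constant * T * exp T + secant_constant) * h ^ 2).
    apply Hroot; [lra|]; rewrite gsum_plus.
    generalize (position_error t Ht) (secant_error t Ht); lra.
  - apply (Hroot (gsum J (fun j => norm (minus (G t j) (disc_vel J (X t) (u t) j)) ^ 2)));
      trivial.
    now apply velocity_error.
Qed.

End ErrorBound.

Theorem theorem3p5 (beta T : R) (x0 : R -> R * R) (V0 : R -> R)
  (x : R -> R -> R * R) (dx : nat -> nat -> R -> R -> R * R)
  (hbeta : 0 <= beta) (hT : 0 < T)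
  (hx0 : periodic x0) (hV0 : periodic V0)
  (hdx : parabolic_partials 4 T x dx)
  (hsol : continuous_solution beta T x0 V0 x
            (dx 0%nat 1%nat) (dx 1%nat 0%nat) (dx 2%nat 0%nat))
  (hreg : forall rho t, 0 <= t <= T -> 0 < norm (dx 0%nat 1%nat rho t)) :
  exists h0 C : R, 0 < h0 /\ 0 < C /\
    forall J : nat, (2 <= J)%nat -> mesh J <= h0 ->
      exists xh vh : Z -> R -> R * R,
        semidiscrete_solution beta T x0 V0 J xh vh /\
        (forall yh wh : Z -> R -> R * R,
           semidiscrete_solution beta T x0 V0 J yh wh ->
           forall j t, 0 <= t <= T -> yh j t = xh j t) /\
        (forall t, 0 <= t <= T ->
           norm_1h J (nodal_error J x xh t) +
           norm_0h J (nodal_error J (dx 1%nat 0%nat) vh t)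
           <= C * mesh J ^ 2).
Proof.
  destruct (exact_smooth_flow beta T x0 V0 x dx hbeta hT hdx hsol hreg)
    as [M [m [HM [Hm Hflow]]]].
  set (f := fun k j rho t => coord k (dx 0%nat j rho (clamp T t))) in *.
  set (g := fun k rho t => coord k (dx 1%nat 0%nat rho (clamp T t))) in *.
  destruct (exact_reference_path beta T M m f g HM Hm Hflow)
    as [K [h1 [HK [Hh1 Href]]]].
  destruct (stability beta K m T (Rlt_le _ _ HK) Hm hT) as [Ks [h2 [HKs [Hh2 Hstab]]]].
  set (h0 := Rmin h1 (Rmin h2 (/ (4 * K + 4)))).
  assert (Hinv : 0 < / (4 * K + 4)) by (apply Rinv_0_lt_compat; lra).
  exists h0, (sqrt (velocity_constant K Ks * T * exp T + secant_constant m K Ks) +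
              sqrt (velocity_constant K Ks) + 1).
  split; [unfold h0; repeat apply Rmin_case; lra|split].
  { generalize (sqrt_pos (velocity_constant K Ks * T * exp T + secant_constant m K Ks))
      (sqrt_pos (velocity_constant K Ks)); lra. }
  intros J HJ HhJ.
  assert (HJ0 : (0 < J)%nat) by lia.
  assert (Hs1 : mesh J <= h1) by (apply Rle_trans with (1 := HhJ), Rmin_l).
  assert (Hs23 : mesh J <= Rmin h2 (/ (4 * K + 4)))
    by (apply Rle_trans with (1 := HhJ), Rmin_r).
  assert (Hs2 : mesh J <= h2) by (apply Rle_trans with (1 := Hs23), Rmin_l).
  assert (Hs3 : mesh J * (4 * K + 4) <= 1).
  { apply Rle_trans with (/ (4 * K + 4) * (4 * K + 4)).
    - apply Rmult_le_compat_r; [lra|]; apply Rle_trans with (1 := Hs23), Rmin_r.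
    - right; field; lra. }
  destruct (Href J HJ Hs1) as [Hr Hest].
  set (X := exact_grid f J) in *; set (G := exact_grid_velocity g J).
  set (r := exact_reference f g J) in *.
  assert (HXc : forall j t, vcont (fun s => X s j) t).
  { intros j t; apply (exact_grid_cont beta T M m f g Hflow). }
  assert (HXd : forall j t, 0 < t < T -> vderive (fun s => X s j) t (G t j)).
  { intros j t Ht; now apply (exact_grid_derive beta T M m f g Hflow). }
  assert (HXp : forall t, grid_periodic J (X t)).
  { intros t; now apply (exact_grid_periodic beta T M m f g Hflow). }
  assert (Hq : forall t j, 0 < qh J (X t) j).
  { intros t j; destruct (Hest t j) as [_ [_ [H _]]]; lra. }
  assert (Hn : forall t j, 1 <= norm (plus (tauh J (X t) j) (tauh J (X t) (j + 1)%Z))).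
  { intros t j; now destruct (Hest t j) as [_ [_ [_ H]]]. }
  assert (Hx : forall t j, 0 <= t <= T -> X t j = x (node J j) t).
  { intros t j Ht; unfold X, exact_grid, f, coord; rewrite clamp_id by trivial.
    rewrite (partials_00 hdx) by exact Ht; symmetry; apply surjective_pairing. }
  assert (Hxt : forall t j, 0 <= t <= T -> G t j = dx 1%nat 0%nat (node J j) t).
  { intros t j Ht; unfold G, exact_grid_velocity, g, coord; rewrite clamp_id by trivial.
    symmetry; apply surjective_pairing. }
  assert (HX0 : forall j, X 0 j = x0 (node J j)).
  { intros j; rewrite Hx by lra; apply (cont_init_pos hsol). }
  assert (HV : forall j, ref_vel (r 0) j = V0 (node J j)).
  { intros j; exact (exact_initial_velocity beta T x0 V0 x dx hT hsol hreg (node J j)). }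
  assert (Hlen0 : forall j, Rabs (ref_len (r 0) j - qh J (X 0) j) <= K * mesh J ^ 2).
  { intros j; now destruct (Hest 0 j) as [_ [H _]]. }
  destruct (state_path_exists beta K m T J r _ _ (Rlt_le _ _ HK) Hm hT HJ0 Hr
    (fun j => qh J (X 0) j)) as [u [Hu Hlen]]; trivial.
  { intros j; unfold qh; now rewrite (delta_periodic J (X 0) (HXp 0)). }
  assert (Hnear : forall t, 0 <= t <= T -> near_reference m (mesh J) (r t) (u t)).
  { intros t Ht; now apply (Hstab J r _ _ u HJ0 Hs2 Hr Hu). }
  exists (built_curve J X u), (fun j t => disc_vel J (X t) (u t) j).
  split; [|split].
  - apply (built_curve_solution beta K m T J X G r (exact_dV beta f g J)
      (exact_dQ f g J)); auto; reflexivity.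
  - (* Another solution has polar variables as well. By stability they remain near
       the reference, where the polar equations have only one solution; hence the
       two curves have the same velocities. *)
    intros yh wh Hy j t Ht.
    set (v := polar_state T J r yh wh).
    assert (Hv : state_path beta K m T J r v).
    { apply (polar_state_path beta K m T J X G r (exact_dV beta f g J)
        (exact_dQ f g J) x0 V0); auto; reflexivity. }
    assert (Hvn : forall t, 0 <= t <= T -> near_reference m (mesh J) (r t) (v t)).
    { intros s Hs; now apply (Hstab J r _ _ v HJ0 Hs2 Hr Hv). }
    assert (Heq := state_path_unique beta K m T J r _ _ (Rlt_le _ _ HK) Hm HJ0 Hr u v
      Hu Hv Hnear Hvn).
    assert (Hw : forall i s, 0 <= s <= T -> wh i s = disc_vel J (X s) (u s) i).
    { intros i s Hs.
      assert (E : wh i s = disc_vel J (X s) (v s) i).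
      { apply (polar_state_velocity beta K m T J X G r (exact_dV beta f g J)
          (exact_dQ f g J) x0 V0); auto; reflexivity. }
      rewrite E; unfold disc_vel, disc_theta.
      assert (Hl : forall j, len (u 0) j = len (v 0) j).
      { intros i'; rewrite Hlen; symmetry.
        apply (polar_state_len_0 beta T J X r x0 V0 hT HX0 yh wh Hy). }
      destruct (Heq Hl i s Hs) as [-> [-> _]], (Heq Hl (i + 1)%Z s Hs) as [-> _].
      reflexivity. }
    assert (Hyc : forall s, vcont (fun s => yh j (clamp T s)) s).
    { destruct (is_derive_on_continuous T (yh j) ltac:(lra)) as [C1 C2].
      - intros s Hs; exists (wh j s); now apply (semi_velocity Hy).
      - intros s; split; [apply C1|apply C2]. }
    assert (Hxd : forall s, vderive (built_curve J X u j) s (disc_vel J (X s) (u s) j)).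
    { intros s; apply (built_curve_derive beta K m T J X r); auto. }
    assert (Hyd : forall s, 0 < s < T ->
      vderive (fun s => yh j (clamp T s)) s (disc_vel J (X s) (u s) j)).
    { intros s Hs; rewrite <- Hw by lra.
      apply (interior_vderive T (yh j)); trivial.
      apply (semi_velocity Hy); unfold Icc; lra. }
    set (D := fun s => minus (yh j (clamp T s)) (built_curve J X u j s)).
    assert (HDc : forall s, vcont D s).
    { intros s; apply vcont_minus; [apply Hyc|exact (vderive_vcont _ _ _ (Hxd s))]. }
    assert (HDd : forall s, 0 < s < T -> vderive D s (0, 0)).
    { intros s Hs; eapply vderive_eq; [exact (vderive_minus _ _ _ _ _ (Hyd s Hs) (Hxd s))|].
      rewrite minus_pair; f_equal; ring. }
    assert (HD0 : D 0 = (0, 0)).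
    { unfold D; rewrite built_curve_0, HX0, clamp_id by lra.
      rewrite (semi_init_pos Hy), minus_pair; f_equal; ring. }
    generalize (constant_of_vderive D T t Ht HDc HDd); rewrite HD0; unfold D.
    rewrite clamp_id by trivial; apply minus_zero_eq.
  - intros t Ht.
    apply Rle_trans with ((sqrt (velocity_constant K Ks * T * exp T + secant_constant m K Ks)
      + sqrt (velocity_constant K Ks)) * mesh J ^ 2).
    + generalize (discrete_norms beta T M m K Ks f g J u HK Hm hT HJ HKs Hflow Hr Hest Hs3
        Hu Hlen Hnear (fun t Ht => proj2 (Hstab J r _ _ u HJ0 Hs2 Hr Hu t Ht)) t Ht).
      fold X G; intros H; apply Rle_trans with (2 := H); right.
      f_equal; [apply norm_1h_ext|apply norm_0h_ext]; intros j; unfold nodal_error.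
      * now rewrite Hx.
      * now rewrite <- Hxt.
    + apply Rmult_le_compat_r; [apply pow2_ge_0|lra].
Qed.
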